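(* (1) There holds $\boldsymbol V^h\subset\boldsymbol H_0(\mathrm{div};\Omega_h)=\{\boldsymbol v\in[L^2(\Omega_h)]^2:\nabla\cdot\boldsymbol v\in L^2(\Omega_h),\ \boldsymbol v\cdot\boldsymbol n|_{\partial\Omega_h}=0\}$. (2) A function $q$ belongs to $Q^h$ if and only if $q|_T\circ F_T\in\hat Q$ for all $T\in\mathcal T_h$ and $$\sum_{T\in\mathcal T_h}2|\tilde T|\int_T\frac{q}{\det(DF_T\circ F_T^{-1})}=0,$$ where $\tilde T=G_h^{-1}(T)$.
   Context: Mesh. $\Omega\subset\mathbb R^2$ is a sufficiently smooth domain (boundary given by finitely many local charts). $\tilde{\mathcal T}_h$ is a member of a shape-regular family of affine (straight-sided) triangulations with mesh size $h=\max_{\tilde T}\mathrm{diam}(\tilde T)$ sufficiently small, whose boundary vertices lie on $\partial\Omega$, each triangle having at most two boundary vertices; $\tilde\Omega_h=\mathrm{int}\big(\bigcup_{\tilde T\in\tilde{\mathcal T}_h}\overline{\tilde T}\big)$ is an $O(h^2)$ polygonal approximation of $\Omega$. $G:\tilde\Omega_h\to\Omega$ is a bijection with $\|G\|_{W^{1,\infty}(\tilde\Omega_h)}\le C$, $G(x)=x$ at all vertices, and $G$ the identity on every triangle with three interior vertices. $G_h$ is the piecewise quadratic nodal (vertices and edge midpoints) interpolant of $G$, with $\|DG_h\|_{W^{1,\infty}(\tilde T)}\le C$ and $\|DG_h^{-1}\|_{W^{1,\infty}(\tilde T)}\le C$ for all $\tilde T$. $\mathcal T_h=\{G_h(\tilde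 T):\tilde T\in\tilde{\mathcal T}_h\}$ is the isoparametric mesh and $\Omega_h=\mathrm{int}\big(\bigcup_{T\in\mathcal T_h}\overline T\big)$. $\hat T$ is the reference triangle with vertices $(1,0),(0,1),(0,0)$; for $T=G_h(\tilde T)$, $F_{\tilde T}:\hat T\to\tilde T$ is an affine bijection with $|F_{\tilde T}|_{W^{1,\infty}(\hat T)}\le Ch_T$, $|F_{\tilde T}^{-1}|_{W^{1,\infty}(\tilde T)}\le Ch_T^{-1}$, $F_T=G_h\circ F_{\tilde T}:\hat T\to T$, $h_T=\mathrm{diam}(\tilde T)$, and $|F_T|_{W^{m,\infty}(\hat T)}\le Ch_T^m$ ($0\le m\le2$), $|F_T^{-1}|_{W^{m,\infty}(T)}\le Ch_T^{-m}$ ($0\le m\le 3$), $c_1h_T^2\le\det(DF_T)\le c_2h_T^2$. Interior edges of $\mathcal T_h$ are straight and are edges of $\tilde{\mathcal T}_h$; if $e=F_T(\hat e)$ is a straight edge then $F_T|_{\hat e}$ is affine; if all edges of $T$ are straight then $F_T$ is affine and $T=\tilde T$. All constants are independent of the mesh size. Local spaces. $\hat T^{ct}$ is the Clough–Tocher split of $\hat T$ into three triangles obtained by joining the vertices to the barycenter; $\hat{\boldsymbol V}=\{\hat{\boldsymbol v}\in [H^1(\hat T)]^2:\hat{\boldsymbol v}|_{\hat K}\in[\mathcal P_2(\hat K)]^2\ \forall\hat K\in\hat T^{ct}\}$, $\hat Q=\{\hat q\in L^2(\hat T):\hat q|_{\hat K}\in\mathcal P_1(\hat K)\ \forall\hat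 K\in\hat T^{ct}\}$ ($\mathcal P_k$: polynomials of degree $\le k$). With $A_T=DF_T/\det(DF_T)$, $x=F_T(\hat x)$, $\tilde x=F_{\tilde T}(\hat x)$: $\tilde{\boldsymbol V}(\tilde T)=\{\tilde{\boldsymbol v}:\tilde{\boldsymbol v}(\tilde x)=\hat{\boldsymbol v}(\hat x),\ \hat{\boldsymbol v}\in\hat{\boldsymbol V}\}$, $\tilde Q(\tilde T)=\{\tilde q:\tilde q(\tilde x)=\hat q(\hat x),\ \hat q\in\hat Q\}$, $\boldsymbol V(T)=\{\boldsymbol v:\boldsymbol v(x)=A_T(\hat x)\hat{\boldsymbol v}(\hat x),\ \hat{\boldsymbol v}\in\hat{\boldsymbol V}\}$, $Q(T)=\{q: q(x)=\hat q(\hat x),\ \hat q\in\hat Q\}$. $\mathcal N_{\hat T}$ is the set of the 4 vertices and 6 edge midpoints of $\hat T^{ct}$, $\mathcal N_T=F_T(\mathcal N_{\hat T})$, $\mathcal N_{\tilde T}=F_{\tilde T}(\mathcal N_{\hat T})$. Global spaces. $\tilde{\boldsymbol V}^h=\{\tilde{\boldsymbol v}\in[H^1_0(\tilde\Omega_h)]^2:\tilde{\boldsymbol v}|_{\tilde T}\in\tilde{\boldsymbol V}(\tilde T)\ \forall\tilde T\}$, $\tilde Q^h=\{\tilde q\in L^2_0(\tilde\Omega_h):\tilde q|_{\tilde T}\in\tilde Q(\tilde T)\ \forall\tilde T\}$ ($L^2_0$: zero mean). $\Psi$ is defined elementwise by: $(\Psi\tilde{\boldsymbol v})|_T\in\boldsymbol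 V(T)$ is the unique function with $(\Psi\tilde{\boldsymbol v})|_T(a)=\tilde{\boldsymbol v}|_{\tilde T}(\tilde a)$ for all $\tilde a\in\mathcal N_{\tilde T}$, $a=G_h(\tilde a)$; $\Upsilon$ by $(\Upsilon\tilde q)|_T(F_T(\hat x))=\tilde q|_{\tilde T}(F_{\tilde T}(\hat x))$. $\boldsymbol V^h=\Psi(\tilde{\boldsymbol V}^h)$ and $Q^h=\Upsilon(\tilde Q^h)$. *)

(* Defs.v *)
From HB Require Import structures.
From mathcomp Require Import all_boot all_order all_algebra.
From mathcomp Require Import all_classical all_reals all_analysis.

Set Implicit Arguments.
Unset Strict Implicit.
Unset Printing Implicit Defensive.
Import Order.TTheory GRing.Theory Num.Theory numFieldNormedType.Exports.
Local Open Scope classical_set_scope.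
Local Open Scope ring_scope.

(* Two-dimensional Lebesgue measure, on the Borel sigma-algebra of R * R. *)
Notation mu2 R := (@lebesgue_measure R \x @lebesgue_measure R)%E.

Section Plane.
Variable R : realType.
Notation R2 := (R * R)%type.

(* The topology of R * R is that of the sup norm; [enorm] is the Euclidean
   norm, used for lengths. *)
Definition enorm (x : R2) : R := Num.sqrt (x.1 ^+ 2 + x.2 ^+ 2).

Definition diam (A : set R2) : R :=
  sup [set d | exists x y, [/\ A x, A y & d = enorm (x - y)]].

Definition bdry (A : set R2) : set R2 := closure A `\` A°.

Definition cmp (j : 'I_2) (x : R2) : R := if j == 0 then x.1 else x.2.

Definition basis2 (j : 'I_2) : R2 := if j == 0 then (1, 0) else (0, 1).

Definition segment (p q : R2) : set R2 :=
  [set x | exists t : R, 0 <= t <= 1 /\ x = (1 - t) *: p + t *: q].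

Definition straight (A : set R2) : Prop := exists p q, A = segment p q.

Definition polydeg_le (k : nat) (p : R2 -> R) : Prop :=
  exists c : nat -> nat -> R, forall x : R2,
    p x = \sum_(a < k.+1) \sum_(b < k.+1 | (a + b <= k)%N)
            c a b * x.1 ^+ a * x.2 ^+ b.

Definition affine_on (A : set R2) (f : R2 -> R2) : Prop :=
  exists p : R2 -> R2, (forall j, polydeg_le 1 (cmp j \o p)) /\
    forall x, A x -> f x = p x.

Definition partial (j : 'I_2) (f : R2 -> R) : R2 -> R :=
  fun x => 'D_(basis2 j) f x.

Definition iter_partial (s : seq 'I_2) (f : R2 -> R) : R2 -> R :=
  foldr partial f s.

Definition smooth (f : R2 -> R) : Prop :=
  forall s, continuous (iter_partial s f) /\
    forall j x, derivable (iter_partial s f) x (basis2 j).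

Definition jac (f : R2 -> R2) (x : R2) : 'M[R]_2 :=
  \matrix_(i, j) partial j (cmp i \o f) x.

Definition mulmv (M : 'M[R]_2) (v : R2) : R2 :=
  (\sum_j M 0 j * cmp j v, \sum_j M 1 j * cmp j v).

Definition test_fun (U : set R2) (phi : R2 -> R) : Prop :=
  smooth phi /\
  exists K, [/\ compact K, K `<=` U & forall x, ~ K x -> phi x = 0].

(* A function on U is represented by a total function, of which only the class
   modulo null sets of U matters. *)

Definition ae_on (U : set R2) (P : R2 -> Prop) : Prop :=
  {ae mu2 R, forall x, U x -> P x}.

(* Lebesgue measurable = almost everywhere equal to a Borel function. *)
Definition ae_measurable (U : set R2) (f : R2 -> R) : Prop :=
  exists2 g : R2 -> R,
    @measurable_fun _ _ (measurableTypeR R * measurableTypeR R)%type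
      (measurableTypeR R) U g
    & ae_on U (fun x => f x = g x).

Definition loc_integrable (U : set R2) (f : R2 -> R) : Prop :=
  ae_measurable U f /\
  forall K, compact K -> K `<=` U ->
    (\int[mu2 R]_(x in K) (`|f x|)%:E < +oo)%E.

Definition L2 (U : set R2) (f : R2 -> R) : Prop :=
  ae_measurable U f /\ (\int[mu2 R]_(x in U) (f x ^+ 2)%:E < +oo)%E.

Definition L20 (U : set R2) (f : R2 -> R) : Prop :=
  L2 U f /\ (\int[mu2 R]_(x in U) f x)%R = 0.

Definition weak_deriv (U : set R2) (s : seq 'I_2) (f g : R2 -> R) : Prop :=
  [/\ loc_integrable U f, loc_integrable U g &
      forall phi, test_fun U phi ->
        (\int[mu2 R]_(x in U) (f x * iter_partial s phi x))%R =
        (-1) ^+ size s * (\int[mu2 R]_(x in U) (g x * phi x))%R].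

Definition weak_grad (U : set R2) (f : R2 -> R) (g : 'I_2 -> R2 -> R) : Prop :=
  forall j, weak_deriv U [:: j] f (g j).

Definition H1_with_grad (U : set R2) (f : R2 -> R) (g : 'I_2 -> R2 -> R) :=
  [/\ L2 U f, (forall j, L2 U (g j)) & weak_grad U f g].

Definition H1 (U : set R2) (f : R2 -> R) : Prop :=
  exists g, H1_with_grad U f g.

(* Closure in H^1(U) of the smooth functions with compact support in U. *)
Definition H10 (U : set R2) (f : R2 -> R) : Prop :=
  exists2 g, H1_with_grad U f g &
    forall eps : R, 0 < eps -> exists2 phi, test_fun U phi &
      ((\int[mu2 R]_(x in U) ((f x - phi x) ^+ 2)%:E) +
       \sum_(j < 2)
         (\int[mu2 R]_(x in U) ((g j x - partial j phi x) ^+ 2)%:E)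
       < eps%:E)%E.

Definition Linf_le (U : set R2) (M : R) (g : R2 -> R) : Prop :=
  ae_measurable U g /\ ae_on U (fun x => `|g x| <= M).

(* |f|_{W^{m,oo}(U)} <= M *)
Definition Wsemi_le (U : set R2) (m : nat) (M : R) (f : R2 -> R) : Prop :=
  forall s, size s = m -> exists2 g, weak_deriv U s f g & Linf_le U M g.

Definition Wsemi_leV (U : set R2) (m : nat) (M : R) (f : R2 -> R2) : Prop :=
  forall j, Wsemi_le U m M (cmp j \o f).

Definition W1inf_le (U : set R2) (M : R) (f : R2 -> R) : Prop :=
  forall m, (m <= 1)%N -> Wsemi_le U m M f.

Definition weak_div (U : set R2) (v : R2 -> R2) (d : R2 -> R) : Prop :=
  forall phi, test_fun U phi ->
    (\int[mu2 R]_(x in U) (\sum_j cmp j (v x) * partial j phi x))%R =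
    - (\int[mu2 R]_(x in U) (d x * phi x))%R.

(* The normal trace v . n on the boundary of U, as the functional which
   Green's formula assigns to v in H(div; U), d = div v:
     <v . n, psi> = (v, grad psi) + (div v, psi)   for psi in H^1(U). *)
Definition normal_trace (U : set R2) (v : R2 -> R2) (d : R2 -> R)
    (psi : R2 -> R) (gpsi : 'I_2 -> R2 -> R) : R :=
  (\int[mu2 R]_(x in U) (\sum_j cmp j (v x) * gpsi j x))%R +
  (\int[mu2 R]_(x in U) (d x * psi x))%R.

Definition H0div (U : set R2) : set (R2 -> R2) :=
  [set v : R2 -> R2 | (forall j, L2 U (cmp j \o v)) /\
     exists d, [/\ L2 U d, weak_div U v d &
       forall psi gpsi, H1_with_grad U psi gpsi ->
         normal_trace U v d psi gpsi = 0]].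

Definition C2 (f : R -> R) : Prop :=
  [/\ forall x, derivable f x 1,
      forall x, derivable (derive1 f) x 1 & continuous (derive1n 2 f)].

Definition rot90 (u : R2) : R2 := (- u.2, u.1).

Definition chart_map (p u : R2) (s t : R) : R2 := p + s *: u + t *: rot90 u.

(* Bounded domain which, in each of finitely many rotated rectangles that
   cover the boundary, is the part above the graph of a C^2 function. *)
Definition smooth_domain (Om : set R2) : Prop :=
  [/\ open Om, connected Om, bounded_set Om, Om !=set0 &
    exists (n : nat) (p u : 'I_n -> R2) (a b : 'I_n -> R) (g : 'I_n -> R -> R),
      (forall i, [/\ 0 < a i, 0 < b i, enorm (u i) = 1 & C2 (g i)] /\
        forall s, `|s| < a i -> `|g i s| < b i /\
          forall t, `|t| < b i ->
            (Om (chart_map (p i) (u i) s t) <-> g i s < t)) /\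
      (forall x, bdry Om x -> exists i s t,
        [/\ `|s| < a i, `|t| < b i & x = chart_map (p i) (u i) s t])].

(* The face spanned by the vertices with index in S. *)
Definition simplex (v : 'I_3 -> R2) (S : {set 'I_3}) : set R2 :=
  [set x | exists l : 'I_3 -> R,
     [/\ forall k, 0 <= l k, \sum_k l k = 1, forall k, k \notin S -> l k = 0
       & x = \sum_k l k *: v k]].

Definition triangle (v : 'I_3 -> R2) : set R2 := simplex v [set: 'I_3]%SET.

(* The edge opposite to vertex k. *)
Definition edge (v : 'I_3 -> R2) (k : 'I_3) : set R2 := simplex v [set~ k]%SET.

(* The vertices (1,0), (0,1), (0,0) of the reference triangle. *)
Definition zhat (k : 'I_3) : R2 :=
  if k == 0 then (1, 0) else if k == 1 then (0, 1) else (0, 0).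

Definition That : set R2 := triangle zhat.

(* Barycentric coordinates with respect to [zhat]. *)
Definition lam (x : R2) (k : 'I_3) : R :=
  if k == 0 then x.1 else if k == 1 then x.2 else 1 - x.1 - x.2.

Definition bary : R2 := 3^-1 *: \sum_k zhat k.

(* The subtriangle of the Clough-Tocher split in which the barycenter
   replaces vertex k. *)
Definition ctK (k : 'I_3) : set R2 :=
  triangle (fun l => if l == k then bary else zhat l).

Definition ct_vertex : set R2 := [set z | z = bary \/ exists k, z = zhat k].

(* Taking p = q yields the 4 vertices of the split, and p <> q the midpoints
   of its 6 edges: any two of its vertices are joined by an edge. *)
Definition Nhat : set R2 :=
  [set a | exists p q, [/\ ct_vertex p, ct_vertex q & a = 2^-1 *: (p + q)]].

Definition Vhat : set (R2 -> R2) :=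
  [set v : R2 -> R2 | (forall j, H1 That° (cmp j \o v)) /\
     forall k, exists2 p : R2 -> R2, (forall j, polydeg_le 2 (cmp j \o p)) &
       ae_on (ctK k) (fun x => v x = p x)].

Definition Qhat : set (R2 -> R) :=
  [set q : R2 -> R | L2 That q /\
     forall k, exists2 p : R2 -> R, polydeg_le 1 p &
       ae_on (ctK k) (fun x => q x = p x)].

(* Value at a of the representative of f which is continuous on That. *)
Definition value_at (f : R2 -> R2) (a y : R2) : Prop :=
  exists g : R2 -> R2, [/\ {within That, continuous g},
    ae_on That (fun x => f x = g x) & g a = y].

(* The affine triangulation is given by its finite type I of triangles and by
   the vertices [vtx i] of each triangle i. *)

Section Mesh.
Variables (I : finType) (vtx : I -> 'I_3 -> R2) (G : R2 -> R2).

Definition Ttil (i : I) : set R2 := triangle (vtx i).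

Definition hT (i : I) : R := diam (Ttil i).

Definition mesh_size : R := \big[Num.max/0]_(i : I) hT i.

Definition Omega_til : set R2 := (\bigcup_i Ttil i)°.

Definition Ftil (i : I) (x : R2) : R2 := \sum_k lam x k *: vtx i k.

(* The inverse of the affine map [Ftil i], on the whole plane. *)
Definition Ftil_inv (i : I) : R2 -> R2 := pinv setT (Ftil i).

(* G_h on triangle i: the quadratic interpolant of G at the vertices and edge
   midpoints, in the Lagrange basis.  The formula is kept outside of the
   triangle, so that derivatives at its boundary are those of the polynomial. *)
Definition Gh (i : I) (x : R2) : R2 :=
  let l := lam (Ftil_inv i x) in
  \sum_k (l k * (2 * l k - 1)) *: G (vtx i k) +
  \sum_(k < 3) \sum_(m < 3 | (k < m)%N)
     (4 * l k * l m) *: G (2^-1 *: (vtx i k + vtx i m)).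

Definition FT (i : I) : R2 -> R2 := Gh i \o Ftil i.

Definition Tcur (i : I) : set R2 := Gh i @` Ttil i.

Definition Omega_h : set R2 := (\bigcup_i Tcur i)°.

Definition FT_inv (i : I) : R2 -> R2 := pinv That (FT i).

Definition AT (i : I) (x : R2) : 'M[R]_2 :=
  (\det (jac (FT i) x))^-1 *: jac (FT i) x.

Definition boundary_vertex (i : I) (k : 'I_3) : Prop :=
  bdry Omega_til (vtx i k).

Definition interior_edge (i : I) (k : 'I_3) : Prop :=
  exists j m, j <> i /\ edge (vtx j) m = edge (vtx i) k.

(* Indices of the vertices of triangle i which are vertices of triangle j. *)
Definition shared (i j : I) : {set 'I_3} :=
  [set k | [exists m, vtx j m == vtx i k]]%SET.

(* Standing assumptions on the mesh.  C is the generic constant of the upper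
   bounds, sigma the shape-regularity constant. *)
Record isoparametric_mesh (Om : set R2) (C sigma c1 c2 : R) : Prop :=
  IsoparametricMesh {
  mesh_nondegenerate : forall i, \det (jac (Ftil i) 0) != 0;
  mesh_conforming : forall i j, i != j ->
    Ttil i `&` Ttil j = simplex (vtx i) (shared i j) /\
    shared i j != [set: 'I_3]%SET;
  mesh_shape_regular : forall i, exists (c : R2) (r : R),
    [/\ 0 < r, [set x | enorm (x - c) <= r] `<=` Ttil i
      & hT i <= sigma * (2 * r)];
  mesh_boundary_vertex : forall i k,
    boundary_vertex i k -> bdry Om (vtx i k);
  mesh_two_boundary_vertices : forall i, exists k, ~ boundary_vertex i k;
  (* The O(h^2) approximation, as the Hausdorff distance of the boundaries. *)
  mesh_approximation :
    (forall x, bdry Omega_til x ->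
       exists2 y, bdry Om y & enorm (x - y) <= C * mesh_size ^+ 2) /\
    (forall y, bdry Om y ->
       exists2 x, bdry Omega_til x & enorm (x - y) <= C * mesh_size ^+ 2);
  (* G is used at boundary nodes, so it includes its continuous extension to
     the closure of Omega_til. *)
  mesh_G_bij : set_bij Omega_til Om G;
  mesh_G_cont : {within closure Omega_til, continuous G};
  mesh_G_W1inf : forall j, W1inf_le Omega_til C (cmp j \o G);
  mesh_G_vertex : forall i k, G (vtx i k) = vtx i k;
  mesh_G_interior : forall i, (forall k, ~ boundary_vertex i k) ->
    forall x, Ttil i x -> G x = x;
  (* Injectivity across triangles: G_h^-1 is defined and the curved triangles
     do not overlap. *)
  mesh_Gh_inj : forall i j x y, Ttil i x -> Ttil j y -> Gh i x = Gh j y ->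
    x = y;
  mesh_DGh_W1inf : forall i a b,
    W1inf_le (Ttil i)° C (fun x => jac (Gh i) x a b);
  mesh_DGh_inv_W1inf : forall i a b,
    W1inf_le (Ttil i)° C (fun x => invmx (jac (Gh i) x) a b);
  mesh_Ftil_W1inf : forall i, Wsemi_leV That° 1 (C * hT i) (Ftil i);
  mesh_Ftil_inv_W1inf : forall i,
    Wsemi_leV (Ttil i)° 1 (C / hT i) (Ftil_inv i);
  mesh_FT_Wminf : forall i m, (m <= 2)%N ->
    Wsemi_leV That° m (C * hT i ^+ m) (FT i);
  mesh_FT_inv_Wminf : forall i m, (m <= 3)%N ->
    Wsemi_leV (Tcur i)° m (C / hT i ^+ m) (FT_inv i);
  mesh_FT_det : forall i x, That x ->
    c1 * hT i ^+ 2 <= \det (jac (FT i) x) <= c2 * hT i ^+ 2;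
  mesh_interior_edge : forall i k, interior_edge i k ->
    FT i @` edge zhat k = edge (vtx i) k;
  mesh_straight_edge : forall i k, straight (FT i @` edge zhat k) ->
    affine_on (edge zhat k) (FT i);
  mesh_straight_triangle : forall i,
    (forall k, straight (FT i @` edge zhat k)) ->
    affine_on That (FT i) /\ Tcur i = Ttil i }.

Definition V_til (i : I) : set (R2 -> R2) :=
  [set v : R2 -> R2 | exists2 vh, Vhat vh &
     ae_on That (fun x => v (Ftil i x) = vh x)].

Definition Q_til (i : I) : set (R2 -> R) :=
  [set q : R2 -> R | exists2 qh, Qhat qh &
     ae_on That (fun x => q (Ftil i x) = qh x)].

Definition V_loc (i : I) : set (R2 -> R2) :=
  [set v : R2 -> R2 | exists2 vh, Vhat vh &
     ae_on That (fun x => v (FT i x) = mulmv (AT i x) (vh x))].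

Definition Vh_til : set (R2 -> R2) :=
  [set v : R2 -> R2 | (forall j, H10 Omega_til (cmp j \o v)) /\
     forall i, V_til i v].

Definition Qh_til : set (R2 -> R) :=
  [set q : R2 -> R | L20 Omega_til q /\ forall i, Q_til i q].

(* The maps Psi and Upsilon, as relations between functions up to null sets;
   the node a = FT i x of T corresponds to the node Ftil i x of its affine
   counterpart, for x in [Nhat]. *)
Definition Psi_rel (vt v : R2 -> R2) : Prop :=
  forall i, V_loc i v /\
    forall a, Nhat a ->
      exists2 y, value_at (vt \o Ftil i) a y & value_at (v \o FT i) a y.

Definition Upsilon_rel (qt q : R2 -> R) : Prop :=
  forall i, ae_on That (fun x => q (FT i x) = qt (Ftil i x)).

Definition Vh : set (R2 -> R2) :=
  [set v : R2 -> R2 | exists2 vt, Vh_til vt & Psi_rel vt v].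

Definition Qh : set (R2 -> R) :=
  [set q : R2 -> R | exists2 qt, Qh_til qt & Upsilon_rel qt q].

End Mesh.
End Plane.

(* Main.v *)
(* Let vt be in the affine space and v = Psi vt.  On an element T = F(That), v is
   the Piola transform DF vh / det DF of a piecewise quadratic vh, so adj(DF) v
   = vh has no derivatives of DF, and its divergence is that of vh because the
   columns of adj(DF) are divergence free.  Split v = (v - w) + w, where
   w = vt o G_h^-1.  As vt is a limit of test functions and G_h is continuous
   across edges, Green's formula for w has no boundary term.  For W = v - w it
   holds element by element without boundary term, since W.n = 0 on each edge:
   there, adj(DF) W . n is a quadratic polynomial (the tangential derivative of F
   is constant on a straight edge, and on the curved edge vt vanishes, by a
   Poincare inequality in thin strips along the edge), and it vanishes at both
   vertices and at the midpoint, where v = w.  To test with merely H^1 functions,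
   W is multiplied by cutoffs, and the resulting Lipschitz functions on Omega_h
   are approximated by Bernstein polynomials.

   The integral of Upsilon^-1 q is the sum over the elements of 2 |Ttil| times the
   integral of q o F over the reference triangle, which the change of variables
   x = F(p) turns into the weighted integral of q over T. *)

Require Import Defs.
From HB Require Import structures.
From mathcomp Require Import all_boot all_order all_algebra.
From mathcomp Require Import all_classical all_reals all_analysis measurable_realfun.
From mathcomp Require Import ring lra.
Set Implicit Arguments.
Unset Strict Implicit.
Unset Printing Implicit Defensive.
Import Order.TTheory GRing.Theory Num.Theory numFieldNormedType.Exports.
Local Open Scope classical_set_scope.
Local Open Scope ring_scope.

(** * Measurability and continuity in the plane *)

Section PlaneMeasure.
Variable R : realType.
Local Notation R2 := (R * R)%type.
Local Notation T2 := (measurableTypeR R * measurableTypeR R)%type.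

(** Each triangle has an interior vertex, and the two edges at such a vertex are interior, hence
    straight. So F is an affine map after a shift p + b(p) d, with one edge bubble b and one fixed
    vector d. All points move in the same direction, which reduces the change of variables to
    Tonelli and substitution on lines, and openness of F to the intermediate value theorem.

    No trace of psi in H^1 is available: psi enters only through its weak derivatives, tested by
    smooth functions with compact support in Omega_h. Every integration by parts is a limit of that
    one identity, under dominated convergence: test functions need only converge pointwise almost
    everywhere with their derivatives, under a uniform bound. Strict differentiability is the notion
    that survives inversion of F and yields convergence of the derivatives of Bernstein polynomials.

    Omega_h is only the interior of a union of curved pieces, so it takes an argument that G_h maps
    Omega_til into it and thus preserves compact supports.

    The weak divergence is assembled from the terms of v - w and of w; the weak gradient of vt is
    never compared with its elementwise gradient. *)

Definition dist1 (x y : R2) : R := `|x.1 - y.1| + `|x.2 - y.2|.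

Lemma dist1C x y : dist1 x y = dist1 y x.
Proof. by rewrite /dist1 distrC [X in _ + X]distrC. Qed.

Lemma dist1xx x : dist1 x x = 0.
Proof. by rewrite /dist1 !subrr normr0 addr0. Qed.

Lemma dist1_ge0 x y : 0 <= dist1 x y.
Proof. by rewrite /dist1 addr_ge0. Qed.

Lemma dist1_tri z x y : dist1 x y <= dist1 x z + dist1 z y.
Proof.
rewrite /dist1; have := ler_distD z.1 x.1 y.1; have := ler_distD z.2 x.2 y.2.
by lra.
Qed.

Lemma dist1_0_eq x y : dist1 x y <= 0 -> x = y.
Proof.
rewrite /dist1 => h.
have h1 := normr_ge0 (x.1 - y.1); have h2 := normr_ge0 (x.2 - y.2).
have /eqP : `|x.1 - y.1| = 0 by lra.
have /eqP : `|x.2 - y.2| = 0 by lra.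
rewrite !normr_eq0 !subr_eq0 => /eqP e2 /eqP e1.
by case: x y e1 e2 {h h1 h2} => ? ? [? ?] /= -> ->.
Qed.

Lemma nbhs_dist1P (x : R2) (U : set R2) :
  nbhs x U <-> exists2 r : R, 0 < r & forall y, dist1 x y < r -> U y.
Proof.
split.
- move=> /nbhs_ballP[r /= r0 h]; exists r => // y xy; apply: h.
  rewrite /dist1 in xy.
  have h1 := normr_ge0 (x.1 - y.1); have h2 := normr_ge0 (x.2 - y.2).
  by split; rewrite /ball /=; lra.
- move=> [r r0 h]; apply/nbhs_ballP; exists (r / 2) => /=; first by lra.
  by move=> y [] /=; rewrite /ball /= => h1 h2; apply: h; rewrite /dist1; lra.
Qed.

Lemma open_dist1P (U : set R2) :
  open U <-> forall x, U x -> exists2 r : R, 0 < r & forall y, dist1 x y < r -> U y.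
Proof.
rewrite openE; split => h x /h; first by move=> /nbhs_dist1P.
by move=> /nbhs_dist1P.
Qed.

(** The measurable sets of the product are generated by rectangles, not by open sets; the two agree
    because an open set is the countable union of the rational open boxes which it contains. *)
Lemma open_measurable2 (U : set R2) : open U -> measurable (U : set T2).
Proof.
move=> /open_dist1P oU.
have -> : U = \bigcup_a \bigcup_b \bigcup_c \bigcup_d
   (if `[< `]ratr a, ratr b[ `*` `]ratr c, ratr d[ `<=` U >]
    then `]ratr a, ratr b[ `*` `]ratr c, ratr d[ else set0).
  apply/seteqP; split => x.
  - move=> Ux; have [r r0 h] := oU _ Ux.
    have [|a /[!in_itv]/= /andP[a1 a2]] := @rat_in_itvoo _ (x.1 - r / 2) x.1.
      by lra.
    have [|b /[!in_itv]/= /andP[b1 b2]] := @rat_in_itvoo _ x.1 (x.1 + r / 2).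
      by lra.
    have [|c /[!in_itv]/= /andP[c1 c2]] := @rat_in_itvoo _ (x.2 - r / 2) x.2.
      by lra.
    have [|d /[!in_itv]/= /andP[d1 d2]] := @rat_in_itvoo _ x.2 (x.2 + r / 2).
      by lra.
    exists a => //; exists b => //; exists c => //; exists d => //.
    case: asboolP => [_|].
      by split; rewrite /= in_itv/=; apply/andP; split.
    case=> y [] /=; rewrite !in_itv/= => /andP[? ?] /andP[? ?].
    apply: h; rewrite /dist1.
    have [? ?] : `|x.1 - y.1| < r / 2 /\ `|x.2 - y.2| < r / 2.
      by rewrite !ltr_norml; split; lra.
    by lra.
  - move=> [a _ [b _ [c _ [d _]]]].
    by case: asboolP => // h; exact: h.
do 4 (apply: bigcupT_measurable_rat => ?).
case: ifP => _; last exact: measurable0.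
by apply: measurableX; exact: measurable_itv.
Qed.

Lemma closed_measurable2 (U : set R2) : closed U -> measurable (U : set T2).
Proof.
move=> cU; rewrite -(setCK U); apply: measurableC; apply: open_measurable2.
exact: closed_openC.
Qed.

Lemma continuous_measurable2 (f : R2 -> R) : continuous f ->
  measurable_fun (setT : set T2) (f : T2 -> R).
Proof.
move=> /continuousP cf; apply: (measurability _ (measurable_realfun.RGenOpens.measurableE R)).
move=> _ [_ [a [b ->] <-]]; rewrite setTI.
by apply: open_measurable2; apply: cf; exact: interval_open.
Qed.

Lemma within_continuous_measurable2 (D : set R2) (f : R2 -> R) : closed D ->
  {within D, continuous f} -> measurable_fun (D : set T2) (f : T2 -> R).
Proof.
move=> cD /continuousP cf; apply: (measurability _ (measurable_realfun.RGenOpens.measurableE R)).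
move=> _ [_ [a [b ->] <-]].
have h : open (`]a, b[%classic : set R) by exact: interval_open.
have {h}/open_subspaceP[V oV h] := cf _ h.
have -> : D `&` f @^-1` `]a, b[ = V `&` D by rewrite h setIC.
by apply: measurableI; [exact: open_measurable2|exact: closed_measurable2].
Qed.

Lemma continuous_cst2 (c : R) : continuous (fun _ : R2 => c).
Proof. by move=> x; exact: cvg_cst. Qed.

Lemma continuous_pair (T : topologicalType) (f g : T -> R) :
  continuous f -> continuous g -> continuous (fun p => (f p, g p)).
Proof. by move=> cf cg x; exact: (cvg_pair (cf x) (cg x)). Qed.

Lemma continuous_pairr (u : R) : continuous (fun x : R => (x, u)).
Proof. by apply: continuous_pair => x; [exact: cvg_id|exact: cst_continuous]. Qed.

Lemma continuous_pairl (u : R) : continuous (fun x : R => (u, x)).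
Proof. by apply: continuous_pair => x; [exact: cst_continuous|exact: cvg_id]. Qed.

Lemma compact_closed2 (D : set R2) : compact D -> closed D.
Proof. by apply: compact_closed; exact: norm_hausdorff. Qed.

Lemma compact_measurable2 (D : set R2) : compact D -> measurable (D : set T2).
Proof. by move=> cD; apply: closed_measurable2; exact: compact_closed2. Qed.

Lemma continuous_fst2 : continuous (fun p : R2 => p.1).
Proof. by move=> p; exact: cvg_fst. Qed.

Lemma continuous_snd2 : continuous (fun p : R2 => p.2).
Proof. by move=> p; exact: cvg_snd. Qed.

Lemma contD (T : topologicalType) (f g : T -> R) :
  continuous f -> continuous g -> continuous (fun p => f p + g p).
Proof. by move=> cf cg x; exact: cvgD (cf x) (cg x). Qed.

Lemma contM (T : topologicalType) (f g : T -> R) :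
  continuous f -> continuous g -> continuous (fun p => f p * g p).
Proof. by move=> cf cg x; exact: cvgM (cf x) (cg x). Qed.

Lemma contN (T : topologicalType) (f : T -> R) :
  continuous f -> continuous (fun p => - f p).
Proof. by move=> cf x; exact: cvgN (cf x). Qed.

Lemma contX (T : topologicalType) (f : T -> R) n :
  continuous f -> continuous (fun p => f p ^+ n).
Proof.
move=> cf; elim: n => [|n IH]; first by move=> x; exact: cvg_cst.
have -> : (fun p => f p ^+ n.+1) = (fun p => f p * f p ^+ n).
  by apply/funext => p; rewrite exprS.
exact: contM.
Qed.

Lemma eq_pair2 (p q : R2) : p.1 = q.1 -> p.2 = q.2 -> p = q.
Proof. by case: p q => [? ?] [? ?] /= -> ->. Qed.

Lemma closed_le2 (f : R2 -> R) (c : R) : continuous f -> closed [set x | f x <= c].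
Proof.
by move=> cf; apply: (@preimage_closed _ _ f [set y | y <= c]) => //; exact: closed_le.
Qed.

Lemma closed_ge2 (f : R2 -> R) (c : R) : continuous f -> closed [set x | c <= f x].
Proof.
by move=> cf; apply: (@preimage_closed _ _ f [set y | c <= y]) => //; exact: closed_ge.
Qed.


End PlaneMeasure.

(** * Integrals of functions that agree off a null set *)

Section IntegralAE.
Local Open Scope ereal_scope.
Context d (T : measurableType d) (R : realType).
Variable mu : {measure set T -> \bar R}.
Import HBNNSimple.

(** [f] and [g] are arbitrary, since the function spaces consist of arbitrary representatives. The
    comparison is therefore made on the supremum over simple functions, each multiplied by the
    indicator of the complement of [N]. *)
Let ge0_integral_le_off_null (N : set T) (f g : T -> \bar R) : measurable N ->
  mu N = 0 -> (forall x, 0 <= f x) -> (forall x, 0 <= g x) ->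
  (forall x, ~ N x -> f x <= g x) -> \int[mu]_x f x <= \int[mu]_x g x.
Proof.
move=> mN N0 f0 g0 fg; rewrite (ge0_integralTE mu f0) (ge0_integralTE mu g0) /=.
apply: ub_ereal_sup => _ [h hf <-]; apply: ereal_sup_ubound.
have hE x : proj_nnsfun h (measurableC mN) x = (h x * \1_(~` N) x)%R by [].
exists (proj_nnsfun h (measurableC mN)).
  apply/asboolP; rewrite asboolE => x; rewrite hE indicE in_setC.
  have [xN|xN] := boolP (x \in N); first by rewrite mulr0.
  rewrite mulr1 (le_trans (hf x))// fg// => Nx.
  by move: xN; rewrite mem_set.
rewrite -!integralT_nnsfun; apply: ge0_ae_eq_integral => //.
- by apply/measurable_EFinP; exact: measurable_funP.
- by apply/measurable_EFinP; exact: measurable_funP.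
- by move=> x _; rewrite lee_fin; exact: fun_ge0.
- by move=> x _; rewrite lee_fin; exact: fun_ge0.
exists N; split => // x /= /not_implyP[_ h1]; apply: contrapT => xN; apply: h1.
have := hE x; rewrite /proj_nnsfun /= => ->; congr EFin.
by rewrite indicE in_setC (_ : x \in N = false) ?mulr1//; apply/negP; rewrite inE.
Qed.

Lemma integral_eq_off_null (U N : set T) (f g : T -> \bar R) : measurable N ->
  mu N = 0 -> (forall x, U x -> ~ N x -> f x = g x) ->
  \int[mu]_(x in U) f x = \int[mu]_(x in U) g x.
Proof.
move=> mN N0 fg; rewrite integral_mkcond [RHS]integral_mkcond.
rewrite integralE [RHS]integralE.
have fg' x : ~ N x -> (f \_ U) x = (g \_ U) x.
  by move=> xN; rewrite !patchE; case: ifPn => //; rewrite inE => Ux; rewrite fg.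
by congr (_ - _); apply/eqP; rewrite eq_le; apply/andP; split;
  apply: (ge0_integral_le_off_null mN N0) => // x xN;
  rewrite ?funeposE ?funenegE fg'.
Qed.

Lemma integral_eq_ae (U : set T) (f g : T -> \bar R) :
  {ae mu, forall x, U x -> f x = g x} ->
  \int[mu]_(x in U) f x = \int[mu]_(x in U) g x.
Proof.
move=> [N [mN N0 h]]; apply: (integral_eq_off_null mN N0) => x Ux xN.
by apply: contrapT => fg; apply: xN; apply: h => /=; apply/not_implyP.
Qed.

End IntegralAE.

(** * Change of variables *)

Section IntegralTransfer.
Local Open Scope ereal_scope.
Context d1 d2 (T1 : measurableType d1) (T2 : measurableType d2) (R : realType).
Variables (m1 : {measure set T1 -> \bar R}) (m2 : {measure set T2 -> \bar R}).
Import HBNNSimple.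

(** The usual climb from indicators to simple functions to monotone limits, for the image under
    [phi] of the measure with density [w]. *)
Lemma ge0_integral_transfer (D1 : set T1) (D2 : set T2) (phi : T1 -> T2)
    (w : T1 -> R) : measurable D1 -> measurable D2 ->
  measurable_fun setT phi -> measurable_fun setT w ->
  (forall x, D1 x -> (0 <= w x)%R) ->
  (forall A, measurable A ->
     \int[m1]_(x in D1) (\1_A (phi x) * w x)%:E = m2 (A `&` D2)) ->
  forall f : T2 -> \bar R, measurable_fun setT f -> (forall y, 0 <= f y) ->
  \int[m1]_(x in D1) (f (phi x) * (w x)%:E) = \int[m2]_(y in D2) f y.
Proof.
move=> mD1 mD2 mphi mw w0 hA f mf f0.
pose g := nnsfun_approx measurableT mf.
have gf y : (EFin \o (g ^~ y)) n @[n --> \oo] --> f y.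
  exact: (cvg_nnsfun_approx measurableT mf (fun y _ => f0 y)).
have ndg y n m : (n <= m)%N -> (g n y <= g m y)%R.
  by move=> nm; exact/lefP/nd_nnsfun_approx.
have mwD : measurable_fun D1 w by exact: measurable_funS mw.
have mg n : measurable_fun D1 (fun x => (g n (phi x) * w x)%:E).
  apply/measurable_EFinP; apply: measurable_funM => //.
  by apply: measurable_funTS; apply: measurableT_comp.
have hn n : \int[m1]_(x in D1) (g n (phi x) * w x)%:E =
            \int[m2]_(y in D2) (g n y)%:E.
  have E2 y : (g n y)%:E = \sum_(k \in range (g n)) k%:E * (\1_(g n @^-1` [set k]) y)%:E.
    by rewrite fsumEFin //= fimfunE.
  have E1 x : (g n (phi x) * w x)%:E =
      \sum_(k \in range (g n)) k%:E * (\1_(g n @^-1` [set k]) (phi x) * w x)%:E.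
    rewrite EFinM E2 muleC ge0_mule_fsumr; last first.
      by move=> r; exact: nnfun_muleindic_ge0.
    apply: eq_fsbigr => k _.
    by rewrite EFinM muleCA; congr (_ * _); rewrite muleC.
  have mA k : measurable (g n @^-1` [set k]) by exact: measurable_sfunP.
  have m1A k : measurable_fun D1 (fun x => (\1_(g n @^-1` [set k]) (phi x) * w x)%:E).
    apply/measurable_EFinP; apply: measurable_funM => //.
    apply: measurable_funTS; apply: (measurableT_comp (f := (\1_(g n @^-1` [set k]) : T2 -> R))) => //.
  under eq_integral do rewrite E1.
  under [RHS]eq_integral do rewrite E2.
  rewrite ge0_integral_fsum//; last 2 first.
  - by move=> k; apply: measurable_funeM.
  - move=> k x Dx; have [k0|k0] := leP 0%R k.
      by rewrite mule_ge0// lee_fin// mulr_ge0// w0.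
    by rewrite preimage_nnfun0// indicE in_set0 mul0r mule0.
  rewrite ge0_integral_fsum//; last 2 first.
  - move=> k; apply: measurable_funeM; apply/measurable_EFinP.
    by apply: measurable_funTS.
  - by move=> k y _; exact: nnfun_muleindic_ge0.
  apply: eq_fsbigr => k; rewrite inE => -[z _ <-].
  rewrite ge0_integralZl//; last 2 first.
  - by move=> x Dx; rewrite lee_fin mulr_ge0// w0.
  - by rewrite lee_fin.
  rewrite ge0_integralZl//; last 2 first.
  - by apply/measurable_EFinP; apply: measurable_funTS.
  - by rewrite lee_fin.
  by rewrite hA// integral_indic// setIC.
transitivity (limn (fun n => \int[m1]_(x in D1) (g n (phi x) * w x)%:E)).
  apply/esym/cvg_lim => //.
  rewrite (_ : \int[m1]_(x in D1) (f (phi x) * (w x)%:E) =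
    \int[m1]_(x in D1) limn (fun n => (g n (phi x) * w x)%:E)); last first.
    apply: eq_integral => x; rewrite inE => Dx; apply/esym/cvg_lim => //.
    under eq_fun do rewrite EFinM muleC.
    rewrite muleC; apply: cvgeZl => //; exact: gf.
  apply: cvg_monotone_convergence => //.
  - by move=> n x Dx; rewrite lee_fin mulr_ge0// w0.
  - by move=> x Dx n m nm; rewrite lee_fin ler_wpM2r// ?w0// ndg.
apply/cvg_lim => //; under eq_fun do rewrite hn.
rewrite (_ : \int[m2]_(y in D2) f y =
    \int[m2]_(y in D2) limn (fun n => (g n y)%:E)); last first.
  by apply: eq_integral => y _; apply/esym/cvg_lim => //; exact: gf.
apply: cvg_monotone_convergence => //.
- by move=> n; apply/measurable_EFinP; apply: measurable_funTS.
- by move=> n y _; rewrite lee_fin.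
- by move=> y _ n m nm; rewrite lee_fin ndg.
Qed.


(** Both sides of the identity for indicators are measures of [A], so uniqueness of measures reduces
    it to a generating family that is stable under intersection. *)
Lemma ge0_integral_transfer_gen (G : set (set T2)) (g : (set T2)^nat)
    (D1 : set T1) (D2 : set T2) (phi : T1 -> T2) (w : T1 -> R) :
  measurable = <<s G >> -> setI_closed G -> (forall i, G (g i)) ->
  \bigcup_k (g k) = setT ->
  measurable D1 -> measurable D2 ->
  measurable_fun setT phi -> measurable_fun setT w ->
  (forall x, D1 x -> (0 <= w x)%R) ->
  (forall A, G A ->
     \int[m1]_(x in D1) (\1_A (phi x) * w x)%:E = m2 (A `&` D2)) ->
  (forall k, m2 (g k `&` D2) < +oo) ->
  forall f : T2 -> \bar R, measurable_fun setT f -> (forall y, 0 <= f y) ->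
  \int[m1]_(x in D1) (f (phi x) * (w x)%:E) = \int[m2]_(y in D2) f y.
Proof.
move=> mG IG Gg gT mD1 mD2 mphi mw w0 hA goo f mf f0.
apply: ge0_integral_transfer => // A mA.
have mwD : measurable_fun D1 w by exact: measurable_funS mw.
have mI B : measurable B ->
    measurable_fun D1 (fun x => (\1_B (phi x) * w x)%:E).
  move=> mB; apply/measurable_EFinP; apply: measurable_funM => //.
  by apply: measurable_funTS; apply: (measurableT_comp (f := (\1_B : T2 -> R))) => //; exact: measurable_indic.
pose m0 B := \int[m1]_(x in D1) (\1_B (phi x) * w x)%:E.
have m00 : m0 set0 = 0.
  by apply: integral0_eq => x _; rewrite indicE in_set0 mul0r.
have m0ge0 B : 0 <= m0 B.
  by apply: integral_ge0 => x Dx; rewrite lee_fin mulr_ge0// w0.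
have m0add : semi_sigma_additive m0.
  move=> F mF tF mUF.
  have -> : m0 (\bigcup_n F n) = \sum_(0 <= n <oo) m0 (F n).
    rewrite /m0 -integral_nneseries//; last 2 first.
    - by move=> n; exact: mI.
    - by move=> n x Dx; rewrite lee_fin mulr_ge0// w0.
    apply: eq_integral => x; rewrite inE => Dx.
    under eq_eseriesr do rewrite mulrC EFinM.
    by rewrite nneseriesZl// mulrC EFinM indic_bigcup.
  by apply: is_cvg_nneseries => n _ _; exact: m0ge0.
pose m : {measure set T2 -> \bar R} :=
  HB.pack m0 (isMeasure.Build _ _ _ m0 m00 m0ge0 m0add).
rewrite -[LHS]/(m A) -[RHS]/(mrestr m2 mD2 A).
apply: (measure_unique G g) => //.
by move=> k; rewrite [X in X < _](hA _ (Gg k)).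
Qed.

End IntegralTransfer.

Lemma is_derive_quad1 (R : realType) (A B C s : R) :
  is_derive (s : R) (1 : R) (fun s => A * s ^+ 2 + B * s + C) (2 * A * s + B).
Proof.
have -> : (fun s => A * s ^+ 2 + B * s + C) =
    (A \*: ((@id R) ^+ 2)%R + B \*: (@id R) + cst C).
  by apply/funext => t; rewrite /= !fctE.
by apply: is_derive_eq; rewrite /GRing.scale /=; ring.
Qed.

Section Substitution1D.
Variable R : realType.
Local Notation lam1 := (@lebesgue_measure R).
Local Open Scope ereal_scope.

Let G : set (set R) := [set A | exists x, A = `]-oo, x[%classic].

Let mG : (@measurable _ (measurableTypeR R)) = <<s G >>.
Proof. exact: (measurable_realfun.RGenInftyO.measurableE R). Qed.

Let IG : setI_closed G.
Proof.
move=> _ _ [x ->] [y ->]; exists (Num.min x y).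
by apply/seteqP; split => z /=; rewrite !in_itv/= lt_min => /andP.
Qed.

Let Gcov : \bigcup_k [set` `]-oo, (k%:R : R)[] = setT.
Proof.
apply/seteqP; split => // x _; exists (Num.Def.archi_bound `|x|%R) => //=.
by rewrite in_itv/= (le_lt_trans (ler_norm x) (archi_boundP (normr_ge0 x))).
Qed.

Lemma continuous_FTC2_le (f F : R -> R) (a b : R) : (a <= b)%R -> continuous f ->
  (forall x, is_derive (x : R) (1%R : R) F (f x)) ->
  \int[lam1]_(x in `[a, b]) (f x)%:E = (F b - F a)%:E.
Proof.
rewrite le_eqVlt => /predU1P[->|ab] cf dF.
  by rewrite set_itv1 integral_set1 subrr.
have cF : continuous F by move=> x; apply/differentiable_continuous/derivable1_diffP; exact: (@ex_derive _ _ _ _ _ _ _ (dF x)).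
rewrite (@continuous_FTC2 _ f F)//.
- exact: continuous_subspaceT.
- split=> [x _||]; first exact: (@ex_derive _ _ _ _ _ _ _ (dF x)).
  + exact/cvg_at_right_filter/cF.
  + exact/cvg_at_left_filter/cF.
- by move=> x _; rewrite derive1E; exact: (@derive_val _ _ _ _ _ _ _ (dF x)).
Qed.

Lemma ge0_integral_affine1 (a b : R) (f : R -> \bar R) : (a != 0)%R ->
  measurable_fun setT f -> (forall x, 0 <= f x) ->
  \int[lam1]_x (f (a * x + b)%R * `|a|%:E) = \int[lam1]_x f x.
Proof.
move=> a0 mf f0.
pose phi (x : R) := (a * x + b)%R.
have mphi : measurable_fun (setT : set R) phi.
  by apply: measurable_funD => //; apply: measurable_funM.
apply: (@ge0_integral_transfer_gen _ _ _ _ _ lam1 lam1 (@ocitv R)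
  (fun k => `](- k%:R)%R, k%:R]%classic) setT setT phi (cst `|a|%R)) => //.
- exact: ocitvI.
- by move=> i; exact: is_ocitv.
- apply/seteqP; split => // x _; exists (Num.Def.archi_bound `|x|%R) => //=.
  have := archi_boundP (normr_ge0 x); rewrite in_itv/= ltr_norml => /andP[h1 h2].
  by rewrite h1 ltW.
- move=> _ [[c d] _ <-]; rewrite setIT.
  have mpre : measurable (phi @^-1` `]c, d]).
    by rewrite -[X in measurable X]setTI; apply: mphi => //; exact: measurable_itv.
  transitivity (\int[lam1]_x (`|a|%:E * (\1_(phi @^-1` `]c, d]) x)%:E)).
    by apply: eq_integral => x _; rewrite /= mulrC EFinM.
  rewrite ge0_integralZl//; last first.
    by apply/measurable_EFinP; exact: measurable_indic.
  rewrite (_ : \int[_]_(_ in _) _ = lam1 (phi @^-1` `]c, d])); last first.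
    by rewrite -[in RHS](setIT (phi @^-1` _)) -integral_indic//.
  have [a_lt0|a_gt0|/eqP] := ltgtP a 0%R; last by rewrite (negbTE a0).
  - have -> : phi @^-1` `]c, d] = `[((d - b) / a)%R, ((c - b) / a)%R[%classic.
      apply/seteqP; split => x /=; rewrite /phi !in_itv/=;
        by rewrite ler_ndivrMr// ltr_ndivlMr// [(x * a)%R]mulrC; lra.
    rewrite !lebesgue_measure_itv/= !lte_fin ltr0_norm//.
    rewrite [RHS](lebesgue_measure_itv `]c, d])/= lte_fin.
    rewrite ltr_nM2r ?invr_lt0// ltrD2r; case: ifPn => _; last by rewrite mule0.
    by rewrite -!EFinB -EFinM; congr EFin; field.
  - have -> : phi @^-1` `]c, d] = `]((c - b) / a)%R, ((d - b) / a)%R]%classic.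
      apply/seteqP; split => x /=; rewrite /phi !in_itv/=;
        by rewrite ltr_pdivrMr// ler_pdivlMr// [(x * a)%R]mulrC; lra.
    rewrite !lebesgue_measure_itv/= !lte_fin gtr0_norm//.
    rewrite [RHS](lebesgue_measure_itv `]c, d])/= lte_fin.
    rewrite ltr_pM2r ?invr_gt0// ltrD2r; case: ifPn => _; last by rewrite mule0.
    by rewrite -!EFinB -EFinM; congr EFin; field.
- move=> k; rewrite setIT [X in X < _](lebesgue_measure_itv `](- k%:R)%R, k%:R])/=.
  case: ifP => _ //.
  by rewrite -EFinB ltry.
Qed.

(** It suffices to test half-lines []-oo, x[]. As [phi] is increasing, the preimage in [a, b] is
    empty, everything, or [a, c[ with phi c = x by the intermediate value theorem, and the integral
    of [phi'] over it is phi c - phi a. *)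
Lemma ge0_integral_subst1 (phi phi' : R -> R) (a b : R) (f : R -> \bar R) :
  (a <= b)%R -> continuous phi' -> (forall x, is_derive (x : R) (1%R : R) phi (phi' x)) ->
  {in `[a, b], forall x, 0 < phi' x}%R ->
  measurable_fun setT f -> (forall x, 0 <= f x) ->
  \int[lam1]_(x in `[a, b]) (f (phi x) * (phi' x)%:E) =
  \int[lam1]_(x in `[phi a, phi b]) f x.
Proof.
move=> ab cphi' dphi phi'0 mf f0.
have cphi : continuous phi by move=> x; apply/differentiable_continuous/derivable1_diffP; exact: (@ex_derive _ _ _ _ _ _ _ (dphi x)).
have incr x y : (a <= x -> y <= b -> x < y -> phi x < phi y)%R.
  move=> ax yb xy; have [|c] := @MVT _ phi phi' x y xy (fun z _ => dphi z).
  - exact: continuous_subspaceT.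
  rewrite in_itv/= => /andP[xc cy] h.
  suff : (0 < phi y - phi x)%R by rewrite subr_gt0.
  rewrite h mulr_gt0 ?subr_gt0//; apply: phi'0; rewrite in_itv/=.
  by rewrite (le_trans ax (ltW xc)) (le_trans (ltW cy) yb).
have incrW x y : (a <= x -> y <= b -> x <= y -> phi x <= phi y)%R.
  move=> ax yb; rewrite le_eqVlt => /predU1P[->//|xy]; apply: ltW; exact: incr.
have mphi' : measurable_fun setT phi' by exact: continuous_measurable_fun.
apply: (@ge0_integral_transfer_gen _ _ _ _ _ lam1 lam1 G
  (fun k => [set` `]-oo, (k%:R : R)[]) `[a, b]%classic `[phi a, phi b]%classic phi phi') => //.
- by move=> i; exists i%:R.
- exact: continuous_measurable_fun.
- by move=> x /= /phi'0/ltW.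
- move=> _ [x ->].
  rewrite (_ : \int[_]_(_ in _) _ =
      \int[lam1]_(t in `[a, b] `&` phi @^-1` `]-oo, x[) (phi' t)%:E); last first.
    rewrite [RHS]integral_mkcondr; apply: eq_integral => t _.
    rewrite patchE indicE (_ : (phi t \in _) = (t \in phi @^-1` `]-oo, x[))//.
    by case: ifP => _; rewrite ?mul1r ?mul0r.
  have [xa|xa] := leP x (phi a).
    rewrite (_ : _ `&` _ = set0) ?integral_set0; last first.
      apply/seteqP; split => // t [] /=; rewrite !in_itv/= => /andP[at_ tb] tx.
      by have := incrW a t (lexx _) tb at_; lra.
    rewrite (_ : _ `&` _ = set0) ?measure0//.
    by apply/seteqP; split => // t [] /=; rewrite !in_itv/= => h1 /andP[]; lra.
  have [xb|xb] := ltP (phi b) x.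
    rewrite (_ : _ `&` _ = `[a, b]%classic); last first.
      apply/seteqP; split => [t []//|t tab]; split => //=; move: tab.
      rewrite /= !in_itv/= => /andP[at_ tb].
      by have := incrW t b at_ (lexx _) tb; lra.
    rewrite continuous_FTC2_le//.
    rewrite (_ : _ `&` _ = `[phi a, phi b]%classic); last first.
      apply/seteqP; split => [t []//|t tab]; split => //=; move: tab.
      by rewrite /= !in_itv/= => /andP[]; lra.
    rewrite [RHS](lebesgue_measure_itv `[phi a, phi b])/= lte_fin -EFinB; case: ifPn => //.
    rewrite -leNgt => h; congr EFin; apply/eqP; rewrite subr_eq0 eq_le h/=.
    exact: incrW.
  have [||c] := @IVT _ phi a b x ab.
  - exact: continuous_subspaceT.
  - by rewrite ge_min (ltW xa)/= le_max xb orbT.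
  rewrite in_itv/= => /andP[ac cb] cx.
  rewrite (_ : _ `&` _ = `[a, c[%classic); last first.
    apply/seteqP; split => t /=; rewrite !in_itv/=.
      move=> [/andP[at_ tb]] tx; rewrite at_ /= ltNge; apply/negP => ct.
      by have := incrW c t ac tb ct; lra.
    move=> /andP[at_ tc]; have := incr t c at_ cb tc.
    by rewrite cx at_ (ltW (lt_le_trans tc cb)).
  rewrite integral_itv_bndo_bndc; last first.
    by apply/measurable_EFinP; exact: measurable_funTS.
  rewrite continuous_FTC2_le//.
  rewrite (_ : _ `&` _ = `[phi a, x[%classic); last first.
    apply/seteqP; split => t /=; rewrite !in_itv/=.
      by move=> [tx /andP[-> _]].
    by move=> /andP[h1 h2]; rewrite h2 h1; split => //; lra.
  by rewrite [RHS](lebesgue_measure_itv `[phi a, x[)/= lte_fin cx xa -EFinB.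
- move=> k; apply: (@le_lt_trans _ _ (lam1 `[phi a, phi b]%classic)).
    by apply: le_measure; rewrite ?inE//; apply: measurableI.
  by rewrite [X in X < _](lebesgue_measure_itv `[phi a, phi b])/=; case: ifP => _ //; rewrite -EFinB ltry.
Qed.

End Substitution1D.

Section PlaneChangeOfVariables.
Variable R : realType.
Local Notation R2 := (R * R)%type.
Local Notation T2 := (measurableTypeR R * measurableTypeR R)%type.
Local Notation lam1 := (@lebesgue_measure R).
Local Notation mu := (mu2 R).
Local Open Scope ereal_scope.

Lemma ge0_integral_fiber_affine (a : R) (b : R -> R) (f : T2 -> \bar R) :
  (a != 0)%R -> measurable_fun setT b -> measurable_fun setT f ->
  (forall p, 0 <= f p) ->
  \int[mu]_p (f ((a * p.1 + b p.2)%R, p.2) * `|a|%:E) = \int[mu]_p f p.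
Proof.
move=> a0 mb mf f0.
have mS : measurable_fun (setT : set T2) (fun p : T2 => ((a * p.1 + b p.2)%R, p.2) : T2).
  apply: measurable_fun_pair => //; apply: measurable_funD.
    by apply: measurable_funM.
  exact: measurableT_comp.
rewrite (fubini_tonelli2 (fun p : T2 => f ((a * p.1 + b p.2)%R, p.2) * `|a|%:E)); first last.
- by move=> p; rewrite mule_ge0.
- apply: emeasurable_funM => //.
  exact: (measurableT_comp (f := f) mf mS).
rewrite (fubini_tonelli2 f mf f0); apply: eq_integral => y _.
apply: (@ge0_integral_affine1 _ a (b y) (fun x => f (x, y))) => //.
exact: (measurableT_comp (f := f)).
Qed.

Lemma ge0_integral_swap (f : T2 -> \bar R) :
  measurable_fun setT f -> (forall p, 0 <= f p) ->
  \int[mu]_p f (p.2, p.1) = \int[mu]_p f p.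
Proof.
move=> mf f0.
rewrite (fubini_tonelli2 f mf f0) (fubini_tonelli1 (fun p : T2 => f (p.2, p.1))).
- by [].
- apply: (measurableT_comp (f := f)) => //; exact: measurable_fun_pair.
- by move=> p; exact: f0.
Qed.

Definition affine2 (a b c d e g : R) (p : R2) : R2 :=
  (a * p.1 + b * p.2 + e, c * p.1 + d * p.2 + g)%R.

Lemma measurable_affine2 a b c d e g :
  measurable_fun (setT : set T2) (affine2 a b c d e g : T2 -> T2).
Proof.
apply: measurable_fun_pair; apply: measurable_funD => //;
  by apply: measurable_funD => //; apply: measurable_funM.
Qed.

(** If a is nonzero, the map is a change of the first coordinate alone followed by a change of the
    second alone, with factors a and D / a; each is affine on the lines of one direction. If a = 0
    the two columns are exchanged first. *)
Lemma ge0_integral_affine2 (a b c d e g : R) (f : T2 -> \bar R) :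
  (a * d - b * c != 0)%R -> measurable_fun setT f -> (forall p, 0 <= f p) ->
  \int[mu]_p (f (affine2 a b c d e g p) * `|a * d - b * c|%:E) = \int[mu]_p f p.
Proof.
wlog : a b c d f / (a != 0)%R.
  move=> H dn0; have [a0|a0] := eqVneq a 0%R; last exact: H.
  have b0 : (b != 0)%R.
    by apply: contra dn0 => /eqP ->; rewrite a0 !mul0r subrr.
  move=> mf f0.
  have dn1 : (b * c - a * d != 0)%R.
    by apply: contra dn0 => /eqP h; apply/eqP; lra.
  have <- := H b a d c f b0 dn1 mf f0.
  rewrite -ge0_integral_swap; first last.
  - by move=> p; rewrite mule_ge0.
  - apply: emeasurable_funM => //.
    exact: (measurableT_comp (f := f) mf (measurable_affine2 _ _ _ _ _ _)).
  apply: eq_integral => -[x y] _; rewrite /affine2/=.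
  by congr (f (_, _) * _); rewrite ?(addrC (_ * y)%R)// distrC.
move=> a0 dn0 mf f0.
pose D := (a * d - b * c)%R.
(* With X = a x + b y + e, the second coordinate c x + d y + g equals (D / a) y + k X. *)
pose k := (fun X => c * (X - e) / a + g)%R.
pose h (p : T2) := f (p.1, (D / a * p.2 + k p.1)%R).
have mk : measurable_fun setT k.
  by apply: measurable_funD => //; apply: measurable_funM => //; apply: measurable_funM => //; apply: measurable_funB.
have mh : measurable_fun setT h.
  apply: (measurableT_comp (f := f)) => //; apply: measurable_fun_pair => //.
  apply: measurable_funD; last exact: measurableT_comp.
  by apply: measurable_funM.
have h0 p : 0 <= h p by exact: f0.
transitivity (\int[mu]_p (h p * `|D / a|%:E)).
  rewrite -(@ge0_integral_fiber_affine a (fun y => b * y + e)%R (fun p => h p * `|D / a|%:E) a0); first last.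
  - by move=> p; rewrite mule_ge0.
  - by apply: emeasurable_funM.
  - by apply: measurable_funD => //; apply: measurable_funM.
  apply: eq_integral => -[x y] _; rewrite -muleA -EFinM -normrM divfK// /h /affine2 /=.
  congr (f (_, _) * _); first by rewrite addrA.
  by rewrite /k /D; field.
rewrite -ge0_integral_swap; first last.
- by move=> p; rewrite mule_ge0.
- by apply: emeasurable_funM.
rewrite -[RHS]ge0_integral_swap//.
pose f' (p : T2) := f (p.2, p.1).
rewrite -(@ge0_integral_fiber_affine (D / a) k f')//.
- by rewrite mulf_neq0// invr_neq0.
- by apply: (measurableT_comp (f := f)) => //; exact: measurable_fun_pair.
- by move=> p; exact: f0.
Qed.

Lemma closed_convex_itv (E : set R) (l u : R) : closed E ->
  (forall x, E x -> (l <= x <= u)%R) ->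
  (forall x y z : R, E x -> E y -> (x <= z <= y)%R -> E z) ->
  exists a b : R, E = `[a, b]%classic.
Proof.
move=> cE bE iE; have [->|/set0P[x0 Ex0]] := eqVneq E set0.
  by exists 1%R, 0%R; rewrite set_itv_ge// bnd_simp; lra.
have hs : has_sup E.
  by split; [exists x0|exists u => x /bE /andP[]].
pose E' := -%R @^-1` E.
have hs' : has_sup E'.
  split; first by exists (- x0)%R; rewrite /E' /= opprK.
  by exists (- l)%R => x; rewrite /E' /= => /bE /andP[]; lra.
have cE' : closed E' by apply: preimage_closed => // x _; exact: opp_continuous.
have Esup : E (sup E).
  by rewrite {1}((closure_id E).1 cE); apply: closure_sup; case: hs.
have Einf : E (- sup E')%R.
  rewrite -[E _]/(E' (sup E')).
  by rewrite {1}((closure_id E').1 cE'); apply: closure_sup; case: hs'.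
exists (- sup E')%R, (sup E); apply/seteqP; split => x /=; rewrite in_itv/=.
  move=> Ex; apply/andP; split; last exact: (sup_upper_bound hs).
  by rewrite lerNl; apply: (sup_upper_bound hs'); rewrite /E' /= opprK.
exact: iE.
Qed.

Definition convex2 (D : set R2) := forall p q (t : R), D p -> D q ->
  (0 <= t <= 1)%R -> D ((1 - t) *: p + t *: q)%R.

Lemma convex_fiber_itv (D : set R2) (u : R) : compact D -> convex2 D ->
  exists a b : R, [set x | D (x, u)] = `[a, b]%classic.
Proof.
move=> cD xD.
have [M [Mr hM]] := compact_bounded cD.
have hM' : forall p, D p -> (`|p| <= M + 1)%R by apply: hM; lra.
apply: (@closed_convex_itv _ (- (M + 1))%R (M + 1)%R).
- apply: (@preimage_closed _ _ (fun x : R => (x, u)) D).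
    by move=> x _; exact: continuous_pairr.
  exact: compact_closed2.
- move=> x /hM'; rewrite -ler_norml; apply: le_trans.
  by rewrite prod_normE /= le_max lexx.
- move=> x y z Dx Dy /andP[xz zy].
  have [xy|xy] := eqVneq x y.
    by rewrite (_ : z = x)//; lra.
  have := xD _ _ ((z - x) / (y - x))%R Dx Dy.
  have yx0 : (0 < y - x)%R by rewrite subr_gt0 lt_neqAle xy (le_trans xz zy).
  rewrite divr_ge0 ?subr_ge0 ?(le_trans xz zy)//= ler_pdivrMr// mul1r lerB//.
  move=> /(_ isT); congr (D (_, _)) => /=.
    rewrite /GRing.scale /=; field; lra.
  by rewrite /GRing.scale /=; ring.
Qed.

(** The map moves points horizontally only. By Tonelli it is treated line by line, and on each line
    the section of the compact convex set [D] is a segment, to which one-dimensional substitution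
    applies. *)
Lemma ge0_integral_fiber (phi phi' : R2 -> R) (D : set R2) (f : T2 -> \bar R) :
  compact D -> convex2 D -> continuous phi -> continuous phi' ->
  (forall x y, is_derive (x : R) (1%R : R) (fun x => phi (x, y)) (phi' (x, y))) ->
  (forall p, D p -> 0 < phi' p)%R ->
  measurable_fun setT f -> (forall p, 0 <= f p) ->
  \int[mu]_(p in D) (f (phi p, p.2) * (phi' p)%:E) =
  \int[mu]_(p in (fun p => (phi p, p.2)) @` D) f p.
Proof.
move=> cD xD cphi cphi' dphi phi'0 mf f0.
pose S (p : R2) : R2 := (phi p, p.2).
have cS : continuous S.
  by apply: (continuous_pair cphi); exact: continuous_snd2.
have mD : measurable (D : set T2).
  exact: compact_measurable2.
have mSD : measurable (S @` D : set T2).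
  apply: compact_measurable2.
  by apply: continuous_compact => //; exact: continuous_subspaceT.
have mS : measurable_fun (setT : set T2) (S : T2 -> T2).
  apply: measurable_fun_pair => //; exact: (continuous_measurable2 cphi).
have mphi' := continuous_measurable2 cphi'.
rewrite [LHS]integral_mkcond; set g1 := (X in integral _ _ X).
rewrite [RHS]integral_mkcond; set g2 := (X in _ = integral _ _ X).
rewrite (fubini_tonelli2 g1); first last.
- move=> p; rewrite /g1 patchE; case: ifPn => // /set_mem Dp.
  by rewrite mule_ge0// lee_fin ltW// phi'0.
- apply/(measurable_restrictT _ mD); apply: measurable_funTS.
  apply: emeasurable_funM; last by apply/measurable_EFinP.
  exact: (measurableT_comp (f := f) mf mS).
rewrite (fubini_tonelli2 g2); first last.
- by move=> p; rewrite /g2 patchE; case: ifPn.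
- by apply/(measurable_restrictT _ mSD); apply: measurable_funTS.
rewrite /g1 /g2.
apply: eq_integral => u _; rewrite /fubini_G.
have [a [b Eab]] := convex_fiber_itv u cD xD.
have DE x : D (x, u) = (x \in `[a, b]) :> Prop.
  by rewrite -[D (x, u)]/([set x | D (x, u)] x) Eab.
have [ab|ba] := leP a b; last first.
  transitivity (\int[lam1]_(x in set0) (0 : \bar R)).
    rewrite [RHS]integral_mkcond; apply: eq_integral => x _.
    rewrite !patchE in_set0; case: ifPn => // /set_mem.
    by rewrite DE in_itv/= => /andP[ax xb]; move: (le_trans ax xb); rewrite leNgt ba.
  rewrite [LHS]integral_mkcond; apply: eq_integral => x _.
  rewrite !patchE in_set0; case: ifPn => // /set_mem [[y v] Dyv [_ vu]].
  by move: Dyv; rewrite /= in vu; rewrite vu DE in_itv/= => /andP[ay yb];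
    move: (le_trans ay yb); rewrite leNgt ba.
have mfu : measurable_fun setT (fun x => f (x, u)).
  exact: (measurableT_comp (f := f)).
have cpu : continuous (fun x : R => (x, u)).
  exact: continuous_pairr.
have cphiu : continuous (fun x => phi (x, u)).
  by move=> x; apply: (continuous_comp (cpu x)); exact: cphi.
have cphi'u : continuous (fun x => phi' (x, u)).
  by move=> x; apply: (continuous_comp (cpu x)); exact: cphi'.
transitivity (\int[lam1]_(x in `[a, b]) (f (phi (x, u), u) * (phi' (x, u))%:E)).
  rewrite [RHS]integral_mkcond; apply: eq_integral => x _; rewrite !patchE.
  rewrite (_ : ((x, u) \in D) = (x \in `[a, b]%classic))//.
  by apply/idP/idP; rewrite !inE DE.
have phi'u0 : {in `[a, b], forall x, 0 < phi' (x, u)}%R.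
  by move=> x xab; apply: phi'0; rewrite DE.
rewrite (@ge0_integral_subst1 _ (fun x => phi (x, u)) (fun x => phi' (x, u)) a b
  (fun x => f (x, u)))//.
rewrite [LHS]integral_mkcond; apply: eq_integral => x _; rewrite !patchE.
congr (if _ then _ else _); apply/idP/idP; rewrite !inE/=.
  rewrite in_itv/= => /andP[h1 h2].
  have [||c cab cx] := @IVT _ (fun x => phi (x, u)) a b x ab.
  - exact: continuous_subspaceT.
  - by rewrite ge_min h1/= le_max h2 orbT.
  by exists (c, u); rewrite ?DE// /S cx.
move=> [[y v] Dyv [<- /= vu]]; move: Dyv; rewrite vu DE => yab.
have mono s t : (a <= s -> t <= b -> s <= t -> phi (s, u) <= phi (t, u))%R.
  move=> as_ tb; rewrite le_eqVlt => /predU1P[->//|st].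
  have [|c] := @MVT _ (fun x => phi (x, u)) (fun x => phi' (x, u)) s t st (fun z _ => dphi z u).
    exact: continuous_subspaceT.
  rewrite in_itv/= => /andP[sc ct] h.
  rewrite -subr_ge0 h mulr_ge0 ?subr_ge0 ?(ltW st)//; apply: ltW; apply: phi'u0.
  by rewrite in_itv/= (le_trans as_ (ltW sc)) (le_trans (ltW ct) tb).
move: yab; rewrite !in_itv/= => /andP[ay yb].
by rewrite !mono.
Qed.

(** The change of variables formula as a property of the triple, so that it can be composed along a
    factorization of the map. *)
Definition cov (D : set R2) (F : R2 -> R2) (J : R2 -> R) :=
  forall f : T2 -> \bar R, measurable_fun setT f -> (forall p, 0 <= f p) ->
  \int[mu]_(p in D) (f (F p) * (J p)%:E) = \int[mu]_(p in F @` D) f p.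

Lemma cov_comp (D : set R2) (F H : R2 -> R2) (J K : R2 -> R) :
  cov D F J -> cov (F @` D) H K ->
  measurable_fun (setT : set T2) (H : T2 -> T2) ->
  measurable_fun (setT : set T2) (K : T2 -> R) ->
  (forall p, D p -> 0 <= K (F p))%R ->
  cov D (H \o F) (fun p => K (F p) * J p)%R.
Proof.
move=> covF covH mH mK K0 f mf f0.
rewrite -image_comp -(covH f mf f0).
(* [K] is known to be nonnegative on the image of [F] only, whereas [covF] takes integrands that are
   nonnegative on the whole plane. *)
transitivity (\int[mu]_(p in F @` D) (f (H p) * `|K p|%:E)); last first.
  by apply: eq_integral => _ /set_mem[p Dp <-]; rewrite ger0_norm// K0.
rewrite -(covF (fun p => f (H p) * `|K p|%:E)); first last.
- by move=> p; rewrite mule_ge0.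
- apply: emeasurable_funM; first exact: (measurableT_comp (f := f)).
  by apply/measurable_EFinP; apply: (measurableT_comp (f := fun x : R => `|x|%R)) => //; exact: normr_measurable.
apply: eq_integral => p /set_mem Dp.
by rewrite /= -muleA -EFinM ger0_norm// K0.
Qed.

Lemma cov_ext (D : set R2) (F F' : R2 -> R2) (J J' : R2 -> R) :
  (forall p, D p -> F p = F' p) -> (forall p, D p -> J p = J' p) ->
  cov D F J -> cov D F' J'.
Proof.
move=> FF JJ covF f mf f0.
have -> : F' @` D = F @` D.
  by apply/seteqP; split => _ [p Dp <-]; exists p => //; rewrite FF.
rewrite -(covF f mf f0); apply: eq_integral => p /set_mem Dp.
by rewrite FF// JJ.
Qed.

Lemma continuous_affine2 a b c d e g : continuous (affine2 a b c d e g).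
Proof.
have h (u v w : R) : continuous (fun p : R2 => (u * p.1 + v * p.2 + w)%R).
  exact: (contD (contD (contM (@continuous_cst2 R _) (@continuous_fst2 R)) (contM (@continuous_cst2 R _) (@continuous_snd2 R))) (@continuous_cst2 R _)).
by apply: continuous_pair; exact: h.
Qed.

Lemma affine2_inj (a b c d e g : R) : (a * d - b * c != 0)%R ->
  injective (affine2 a b c d e g).
Proof.
move=> dn0 [x y] [x' y'] [/= h1 h2].
have e1 : ((a * d - b * c) * (x - x') = 0)%R.
  rewrite (_ : _ * _ = d * ((a * x + b * y + e) - (a * x' + b * y' + e))
    - b * ((c * x + d * y + g) - (c * x' + d * y' + g)))%R; last by ring.
  by rewrite h1 h2 !subrr !mulr0 subrr.
have e2 : ((a * d - b * c) * (y - y') = 0)%R.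
  rewrite (_ : _ * _ = a * ((c * x + d * y + g) - (c * x' + d * y' + g))
    - c * ((a * x + b * y + e) - (a * x' + b * y' + e)))%R; last by ring.
  by rewrite h1 h2 !subrr !mulr0 subrr.
move: e1 e2 => /eqP; rewrite mulf_eq0 (negbTE dn0)/= subr_eq0 => /eqP ->.
by move=> /eqP; rewrite mulf_eq0 (negbTE dn0)/= subr_eq0 => /eqP ->.
Qed.

Lemma continuous_image_compact (D : set R2) (F : R2 -> R2) :
  compact D -> continuous F -> compact (F @` D).
Proof.
by move=> cD cF; apply: continuous_compact => //; exact: continuous_subspaceT.
Qed.

Lemma cov_affine2 (D : set R2) (a b c d e g : R) : (a * d - b * c != 0)%R ->
  compact D -> cov D (affine2 a b c d e g) (cst `|a * d - b * c|%R).
Proof.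
move=> dn0 cD f mf f0; set A := affine2 a b c d e g.
have mAD : measurable (A @` D : set T2).
  apply: compact_measurable2; apply: continuous_image_compact => //.
  exact: continuous_affine2.
rewrite integral_mkcond [RHS]integral_mkcond.
rewrite -[RHS](ge0_integral_affine2 e g dn0); first last.
- by move=> p; rewrite patchE; case: ifPn.
- by apply/(measurable_restrictT _ mAD); apply: measurable_funTS.
apply: eq_integral => p _; rewrite !patchE.
rewrite (_ : (affine2 a b c d e g p \in A @` D) = (p \in D)).
  by case: ifPn => //; rewrite mul0e.
apply/idP/idP; rewrite !inE; last by move=> Dp; exists p.
by move=> [q Dq /(affine2_inj dn0) <-].
Qed.

(** Quadratic polynomials are kept as coefficient vectors; [quadx] and [quady] are their formal
    partial derivatives, so that identities among Jacobians are left to [ring] and [field]. *)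
Record quadc := Quadc {k0 : R; k1 : R; k2 : R; k3 : R; k4 : R; k5 : R}.

Definition quad (c : quadc) (p : R2) : R :=
  (k0 c + k1 c * p.1 + k2 c * p.2 + k3 c * p.1 ^+ 2 + k4 c * (p.1 * p.2)
   + k5 c * p.2 ^+ 2)%R.

Definition quadx (c : quadc) (p : R2) : R :=
  (k1 c + 2 * k3 c * p.1 + k4 c * p.2)%R.

Definition quady (c : quadc) (p : R2) : R :=
  (k2 c + k4 c * p.1 + 2 * k5 c * p.2)%R.

Lemma continuous_quad c : continuous (quad c).
Proof.
have cc r := @continuous_cst2 R r.
have fx := @continuous_fst2 R; have fy := @continuous_snd2 R.
exact: (contD (contD (contD (contD (contD (cc _) (contM (cc _) fx))
  (contM (cc _) fy)) (contM (cc _) (contX (n := 2) fx)))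
  (contM (cc _) (contM fx fy))) (contM (cc _) (contX (n := 2) fy))).
Qed.

Lemma continuous_quadx c : continuous (quadx c).
Proof.
have cc r := @continuous_cst2 R r.
exact: (contD (contD (cc _) (contM (cc _) (@continuous_fst2 R)))
  (contM (cc _) (@continuous_snd2 R))).
Qed.

Lemma continuous_quady c : continuous (quady c).
Proof.
have cc r := @continuous_cst2 R r.
exact: (contD (contD (cc _) (contM (cc _) (@continuous_fst2 R)))
  (contM (cc _) (@continuous_snd2 R))).
Qed.

Lemma convex2_affine2 (D : set R2) a b c d e g : convex2 D ->
  convex2 (affine2 a b c d e g @` D).
Proof.
move=> xD _ _ t [p Dp <-] [q Dq <-] t01.
exists ((1 - t) *: p + t *: q)%R; first exact: xD.
by apply: eq_pair2; rewrite /affine2 /= /GRing.scale /=; ring.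
Qed.

(** Every point moves in the direction (d1, d2). A linear map [L] that makes this vector horizontal
    conjugates the shift into a map (phi p, p.2), which [ge0_integral_fiber] covers; the
    determinants of [L] and of its inverse cancel. *)
Lemma cov_quad_shift (D : set R2) (q : quadc) (d1 d2 : R) :
  compact D -> convex2 D ->
  (forall p, D p -> 0 < 1 + quadx q p * d1 + quady q p * d2)%R ->
  cov D (fun p => (p.1 + quad q p * d1, p.2 + quad q p * d2)%R)
    (fun p => 1 + quadx q p * d1 + quady q p * d2)%R.
Proof.
move=> cD xD J0.
have [/andP[/eqP d10 /eqP d20]|dn0] := boolP ((d1 == 0) && (d2 == 0))%R.
  apply: (@cov_ext _ id _ (cst 1%R)).
  - by move=> [x y] _; rewrite d10 d20 !mulr0 !addr0.
  - by move=> p _; rewrite d10 d20 !mulr0 !addr0.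
  by move=> f mf f0; rewrite image_id; apply: eq_integral => p _; rewrite mule1.
have [a [b [c [d [Dn0 Lc]]]]] : exists a b c d : R,
    (a * d - b * c != 0 /\ c * d1 + d * d2 = 0)%R.
  have [d10|d1n0] := eqVneq d1 0%R.
    exists 0%R, 1%R, 1%R, 0%R; split; last by rewrite d10; ring.
    by apply/eqP; lra.
  exists 1%R, 0%R, d2, (- d1)%R; split; last by ring.
  by apply: contra d1n0 => /eqP h; apply/eqP; lra.
set Dt := (a * d - b * c)%R in Dn0.
pose k := (a * d1 + b * d2)%R.
(* [L] sends (d1, d2) to (k, 0), and its inverse [L'] sends (k, 0) back. *)
have e1 : (d1 = d / Dt * k)%R.
  apply: (mulfI Dn0); rewrite mulrA mulrCA divff// mulr1 /Dt /k.
  apply/eqP; rewrite -subr_eq0; apply/eqP.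
  by transitivity (- b * (c * d1 + d * d2))%R; [ring|rewrite Lc mulr0].
have e2 : (d2 = - c / Dt * k)%R.
  apply: (mulfI Dn0); rewrite mulrA mulrCA divff// mulr1 /Dt /k.
  apply/eqP; rewrite -subr_eq0; apply/eqP.
  by transitivity (a * (c * d1 + d * d2))%R; [ring|rewrite Lc mulr0].
pose L := affine2 a b c d 0 0.
pose L' := affine2 (d / Dt) (- b / Dt) (- c / Dt) (a / Dt) 0 0.
have L'K p : L' (L p) = p.
  case: p => x y; rewrite /L' /L /affine2 /=; congr (_, _);
    rewrite /Dt; field; exact: Dn0.
have D'n0 : (d / Dt * (a / Dt) - (- b / Dt) * (- c / Dt) != 0)%R.
  rewrite (_ : _ - _ = Dt^-1)%R ?invr_neq0//.
  by rewrite /Dt; field; exact: Dn0.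
pose phi p := (p.1 + k * quad q (L' p))%R.
pose phi' p := (1 + k * (quadx q (L' p) * (d / Dt) + quady q (L' p) * (- c / Dt)))%R.
have cL' : continuous L' by exact: continuous_affine2.
have cphi : continuous phi.
  move=> p; apply: cvgD; first exact: cvg_fst.
  apply: cvgM; first exact: cvg_cst.
  by apply: (continuous_comp (cL' p)); exact: continuous_quad.
have cphi' : continuous phi'.
  move=> p; apply: cvgD; first exact: cvg_cst.
  apply: cvgM; first exact: cvg_cst.
  apply: cvgD; apply: cvgM; try exact: cvg_cst.
  - by apply: (continuous_comp (cL' p)); exact: continuous_quadx.
  - by apply: (continuous_comp (cL' p)); exact: continuous_quady.
have dphi x y : is_derive (x : R) (1%R : R) (fun x => phi (x, y)) (phi' (x, y)).
  pose al := (d / Dt)%R; pose be := (- c / Dt)%R.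
  pose u := (- b / Dt * y)%R; pose w := (a / Dt * y)%R.
  have := is_derive_quad1 (k * (k3 q * al ^+ 2 + k4 q * al * be + k5 q * be ^+ 2))%R
    (1 + k * (k1 q * al + k2 q * be + 2 * k3 q * al * u
      + k4 q * (al * w + u * be) + 2 * k5 q * be * w))%R
    (k * (k0 q + k1 q * u + k2 q * w + k3 q * u ^+ 2 + k4 q * u * w + k5 q * w ^+ 2))%R x.
  congr (is_derive _ _ _ _).
    apply/funext => s; rewrite /phi /quad /L' /affine2 /= -/al -/be -/u -/w.
    by ring.
  rewrite /phi' /quadx /quady /L' /affine2 /= -/al -/be -/u -/w.
  by ring.
have phi'E p : phi' (L p) = (1 + quadx q p * d1 + quady q p * d2)%R.
  by rewrite /phi' L'K [in RHS]e1 [in RHS]e2; ring.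
have cLD : compact (L @` D).
  by apply: continuous_image_compact => //; exact: continuous_affine2.
have covS : cov (L @` D) (fun p => (phi p, p.2)) phi'.
  move=> f mf f0; apply: ge0_integral_fiber => //.
    exact: convex2_affine2.
  by move=> _ [p Dp <-]; rewrite phi'E; exact: J0.
have cS : continuous (fun p => (phi p, p.2)).
  by apply: (continuous_pair cphi); exact: continuous_snd2.
have mS : measurable_fun (setT : set T2) ((fun p => (phi p, p.2)) : T2 -> T2).
  by apply: measurable_fun_pair => //; exact: (continuous_measurable2 cphi).
have h1 := cov_comp (cov_affine2 0 0 Dn0 cD) covS mS (continuous_measurable2 cphi')
  (fun p Dp => ltW (eq_ind_r (fun z => 0 < z)%R (J0 p Dp) (phi'E p))).
have cSLD : compact (((fun p => (phi p, p.2)) \o L) @` D).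
  by rewrite -image_comp; exact: continuous_image_compact.
have h2 := cov_comp h1 (cov_affine2 0 0 D'n0 cSLD) (measurable_affine2 _ _ _ _ _ _)
  (measurable_cst _) (fun p _ => normr_ge0 _).
apply: cov_ext h2 => -[x y] Dp /=.
- rewrite /phi -/(L (x, y)) -/L' L'K /L' /affine2 /=.
  rewrite [in RHS]e1 [in RHS]e2.
  by congr (_, _); rewrite /Dt; field; exact: Dn0.
- rewrite -/(L (x, y)) phi'E.
  rewrite (_ : _ - _ = Dt^-1)%R; last by rewrite /Dt; field; exact: Dn0.
  rewrite -[(a * d - b * c)%R]/Dt normfV mulrCA mulVf ?mulr1//.
  by rewrite normr_eq0.
Qed.

End PlaneChangeOfVariables.

(** * Strictly differentiable and Lipschitz functions *)

Section StrictDifferentiability.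
Variable R : realType.
Local Notation R2 := (R * R)%type.

Definition dot (a b : R2) : R := a.1 * b.1 + a.2 * b.2.

(** Strict differentiability with gradient [a]: the increment is taken between two points that both
    tend to [x]. This two-point form controls the difference quotients between neighbouring nodes,
    of which the derivatives of Bernstein polynomials are averages. *)
Definition sdiff (f : R2 -> R) (x a : R2) := forall eps : R, 0 < eps ->
  exists2 del : R, 0 < del & forall y z, dist1 x y < del -> dist1 x z < del ->
    `|f y - f z - dot a (y - z)| <= eps * dist1 y z.

Lemma dot_le a y z : `|dot a (y - z)| <= (`|a.1| + `|a.2|) * dist1 y z.
Proof.
rewrite /dot /dist1 /= (le_trans (ler_normD _ _))// !normrM.
have h1 := normr_ge0 a.1; have h2 := normr_ge0 a.2.
have h3 := normr_ge0 (y.1 - z.1); have h4 := normr_ge0 (y.2 - z.2).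
by nra.
Qed.

Lemma sdiff_loc (f g : R2 -> R) x a (r : R) : 0 < r ->
  (forall y, dist1 x y < r -> f y = g y) -> sdiff f x a -> sdiff g x a.
Proof.
move=> r0 fg df eps /df[del del0 h]; exists (Num.min del r).
  by rewrite lt_min del0.
by move=> y z; rewrite !lt_min => /andP[? ?] /andP[? ?]; rewrite -!fg//; exact: h.
Qed.

Lemma sdiff_lip f x a : sdiff f x a -> exists del L : R, [/\ 0 < del, 0 <= L &
  forall y z, dist1 x y < del -> dist1 x z < del ->
    `|f y - f z| <= L * dist1 y z].
Proof.
move=> /(_ 1 ltr01)[del del0 h]; exists del, (1 + (`|a.1| + `|a.2|)); split => //.
move=> y z xy xz; have := h _ _ xy xz; have := dot_le a y z.
have := ler_normD (f y - f z - dot a (y - z)) (dot a (y - z)).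
by rewrite subrK; lra.
Qed.

Lemma sdiff_cont f x a : sdiff f x a -> forall eps : R, 0 < eps ->
  exists2 del : R, 0 < del & forall y, dist1 x y < del -> `|f y - f x| <= eps.
Proof.
move=> /sdiff_lip[del [L [del0 L0 h]]] eps e0.
exists (Num.min del (eps / (L + 1))).
  by rewrite lt_min del0 divr_gt0//; lra.
move=> y; rewrite lt_min => /andP[xy1]; rewrite ltr_pdivlMr; last by lra.
have xx : dist1 x x < del by rewrite dist1xx.
move: (h _ _ xy1 xx); rewrite (dist1C y).
by have := dist1_ge0 x y; nra.
Qed.

Lemma sdiff_cst (c : R) x : sdiff (fun=> c) x (0, 0).
Proof.
move=> eps e0; exists 1 => // y z _ _.
by rewrite /dot /= !mul0r addr0 !subrr normr0 mulr_ge0 ?dist1_ge0// ltW.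
Qed.

Lemma sdiff_quad c x : sdiff (quad c) x (quadx c x, quady c x).
Proof.
move=> eps e0.
pose M := `|2 * k3 c| + `|k4 c| + `|2 * k5 c| + 1.
have M0 : 0 < M by rewrite /M; have := normr_ge0 (2 * k3 c);
  have := normr_ge0 (k4 c); have := normr_ge0 (2 * k5 c); lra.
exists (eps / M) => [|y z]; first exact: divr_gt0.
rewrite !ltr_pdivlMr// => xy xz.
(* The increment of a quadratic is its gradient at the midpoint [m] times y - z; (e1, e2) is the
   difference of the gradients at [m] and at [x]. *)
pose m := ((y.1 + z.1) / 2, (y.2 + z.2) / 2) : R2.
pose e1 := 2 * k3 c * (m.1 - x.1) + k4 c * (m.2 - x.2).
pose e2 := k4 c * (m.1 - x.1) + 2 * k5 c * (m.2 - x.2).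
have -> : quad c y - quad c z - dot (quadx c x, quady c x) (y - z) =
    e1 * (y.1 - z.1) + e2 * (y.2 - z.2).
  by rewrite /e1 /e2 /m /quad /quadx /quady /dot /=; field.
have hm : dist1 x m * M <= eps.
  have : dist1 x m <= (dist1 x y + dist1 x z) / 2.
    rewrite /dist1 /m /=.
    have -> : x.1 - (y.1 + z.1) / 2 = ((x.1 - y.1) + (x.1 - z.1)) / 2 by field.
    have -> : x.2 - (y.2 + z.2) / 2 = ((x.2 - y.2) + (x.2 - z.2)) / 2 by field.
    rewrite !normrM !(@ger0_norm _ 2^-1) ?invr_ge0//.
    have := ler_normD (x.1 - y.1) (x.1 - z.1).
    by have := ler_normD (x.2 - y.2) (x.2 - z.2); lra.
  by nra.
have h1 : `|e1| <= dist1 x m * M.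
  rewrite /e1 (le_trans (ler_normD _ _))// !(normrM _ (m.1 - _)) !(normrM _ (m.2 - _)).
  rewrite /dist1 /M (distrC x.1) (distrC x.2).
  have := normr_ge0 (m.1 - x.1); have := normr_ge0 (m.2 - x.2).
  have := normr_ge0 (2 * k3 c); have := normr_ge0 (k4 c); have := normr_ge0 (2 * k5 c).
  by nra.
have h2 : `|e2| <= dist1 x m * M.
  rewrite /e2 (le_trans (ler_normD _ _))// !(normrM _ (m.1 - _)) !(normrM _ (m.2 - _)).
  rewrite /dist1 /M (distrC x.1) (distrC x.2).
  have := normr_ge0 (m.1 - x.1); have := normr_ge0 (m.2 - x.2).
  have := normr_ge0 (2 * k3 c); have := normr_ge0 (k4 c); have := normr_ge0 (2 * k5 c).
  by nra.
rewrite (le_trans (ler_normD _ _))// !normrM /dist1.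
have := normr_ge0 (y.1 - z.1); have := normr_ge0 (y.2 - z.2).
by nra.
Qed.

Lemma sdiffD f g x a b : sdiff f x a -> sdiff g x b ->
  sdiff (fun y => f y + g y) x (a + b).
Proof.
move=> df dg eps e0.
have e20 : 0 < eps / 2 by rewrite divr_gt0.
have [d1 d10 h1] := df _ e20; have [d2 d20 h2] := dg _ e20.
exists (Num.min d1 d2) => [|y z]; first by rewrite lt_min d10.
rewrite !lt_min => /andP[y1 y2] /andP[z1 z2].
have := h1 _ _ y1 z1; have := h2 _ _ y2 z2.
have := ler_normD (f y - f z - dot a (y - z)) (g y - g z - dot b (y - z)).
rewrite (_ : _ - _ - _ + (_ - _ - _) =
  f y + g y - (f z + g z) - dot (a + b) (y - z)); last by rewrite /dot /=; ring.
by lra.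
Qed.

Lemma sdiffM f g x a b : sdiff f x a -> sdiff g x b ->
  sdiff (fun y => f y * g y) x (f x *: b + g x *: a).
Proof.
move=> df dg eps e0.
pose A := `|a.1| + `|a.2|; pose B := `|b.1| + `|b.2|.
have A0 : 0 <= A by rewrite addr_ge0.
have B0 : 0 <= B by rewrite addr_ge0.
pose N := `|f x| + `|g x| + 2 + A + B.
have hf0 := normr_ge0 (f x); have hg0 := normr_ge0 (g x).
have N0 : 0 < N by rewrite /N; lra.
pose e := Num.min 1 (eps / N).
have e_gt0 : 0 < e by rewrite lt_min ltr01 divr_gt0.
have eN : e * N <= eps by rewrite -ler_pdivlMr// ge_min lexx orbT.
have e1 : e <= 1 by rewrite ge_min lexx.
have [d1 d10 h1] := df _ e_gt0; have [d2 d20 h2] := dg _ e_gt0.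
have [d3 d30 h3] := sdiff_cont df e_gt0.
have [d4 d40 h4] := sdiff_cont dg e_gt0.
exists (Num.min (Num.min d1 d2) (Num.min d3 d4)) => [|y z].
  by rewrite !lt_min d10 d20 d30.
rewrite !lt_min => /andP[/andP[y1 y2] /andP[y3 y4]] /andP[/andP[z1 z2] /andP[z3 z4]].
have {}h1 := h1 _ _ y1 z1; have {}h2 := h2 _ _ y2 z2.
have {}h3 := h3 _ y3; have {}h4 := h4 _ z4.
have k1 := dot_le a y z; have k2 := dot_le b y z; rewrite -/A in k1; rewrite -/B in k2.
have -> : f y * g y - f z * g z - dot (f x *: b + g x *: a) (y - z) =
   f y * (g y - g z - dot b (y - z)) + g z * (f y - f z - dot a (y - z))
   + ((f y - f x) * dot b (y - z) + (g z - g x) * dot a (y - z)).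
  by rewrite /dot /= /GRing.scale /=; ring.
have hfy : `|f y| <= `|f x| + 1.
  by have := ler_normD (f x) (f y - f x); rewrite subrKC; move: h3 e1; clear; lra.
have hgz : `|g z| <= `|g x| + 1.
  by have := ler_normD (g x) (g z - g x); rewrite subrKC; move: h4 e1; clear; lra.
rewrite (le_trans (ler_normD _ _))//.
have t1 := ler_normD (f y * (g y - g z - dot b (y - z))) (g z * (f y - f z - dot a (y - z))).
have t2 := ler_normD ((f y - f x) * dot b (y - z)) ((g z - g x) * dot a (y - z)).
rewrite !normrM in t1 t2.
have D0 := dist1_ge0 y z; set D := dist1 y z in D0 h1 h2 k1 k2 *.
have q1 : `|f y| * `|g y - g z - dot b (y - z)| <= (`|f x| + 1) * (e * D) by apply: ler_pM.
have q2 : `|g z| * `|f y - f z - dot a (y - z)| <= (`|g x| + 1) * (e * D) by apply: ler_pM.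
have q3 : `|f y - f x| * `|dot b (y - z)| <= e * (B * D) by apply: ler_pM.
have q4 : `|g z - g x| * `|dot a (y - z)| <= e * (A * D) by apply: ler_pM.
have : e * N * D <= eps * D by rewrite ler_wpM2r.
by rewrite /N; move: q1 q2 q3 q4 t1 t2; clear; lra.
Qed.

Lemma sdiffV f x a : f x != 0 -> sdiff f x a ->
  sdiff (fun y => (f y)^-1) x (- (f x ^- 2) *: a).
Proof.
move=> fx0 df eps e0.
pose A := `|a.1| + `|a.2|.
have A0 : 0 <= A by rewrite addr_ge0.
pose m := `|f x| / 2.
have m0 : 0 < m by rewrite divr_gt0 ?normr_gt0.
have mx : `|f x| = 2 * m by rewrite /m; lra.
pose N := m ^- 2 + A * (m ^- 2 * 4 * m^-1).
have im0 : 0 < m^-1 by rewrite invr_gt0.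
have im2 : 0 < m ^- 2 by rewrite invr_gt0 exprn_gt0.
have N0 : 0 < N by rewrite /N ltr_pwDl// mulr_ge0// ltW// !mulr_gt0.
pose e := Num.min m (eps / N).
have e_gt0 : 0 < e by rewrite lt_min m0 divr_gt0.
have eN : e * N <= eps by rewrite -ler_pdivlMr// ge_min lexx orbT.
have em : e <= m by rewrite ge_min lexx.
have [d1 d10 h1] := df _ e_gt0.
have [d3 d30 h3] := sdiff_cont df e_gt0.
exists (Num.min d1 d3) => [|y z].
  by rewrite !lt_min d10.
rewrite !lt_min => /andP[y1 y3] /andP[z1 z3].
have {}h1 := h1 _ _ y1 z1; have hy := h3 _ y3; have hz := h3 _ z3.
have k1 := dot_le a y z; rewrite -/A in k1.
have fy : m <= `|f y|.
  by have := ler_normD (f y) (f x - f y); rewrite subrKC distrC mx; move: hy em; clear; lra.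
have fz : m <= `|f z|.
  by have := ler_normD (f z) (f x - f z); rewrite subrKC distrC mx; move: hz em; clear; lra.
have fy0 : f y != 0 by rewrite -normr_gt0 (lt_le_trans m0 fy).
have fz0 : f z != 0 by rewrite -normr_gt0 (lt_le_trans m0 fz).
have D0 := dist1_ge0 y z; set D := dist1 y z in D0 h1 k1 *.
have -> : (f y)^-1 - (f z)^-1 - dot (- (f x ^- 2) *: a) (y - z) =
   - ((f y)^-1 * (f z)^-1 * (f y - f z - dot a (y - z)))
   + (f x ^- 2 - (f y)^-1 * (f z)^-1) * dot a (y - z).
  by rewrite /dot /= /GRing.scale /=; field; rewrite fy0 fz0.
have -> : f x ^- 2 - (f y)^-1 * (f z)^-1 =
  f x ^- 2 * ((f y)^-1 * (f z)^-1) * ((f y - f x) * f z + f x * (f z - f x)).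
  by field; rewrite fy0 fz0.
have iy : `|(f y)^-1| <= m^-1 by rewrite normfV lef_pV2// posrE (lt_le_trans m0 fy).
have iz : `|(f z)^-1| <= m^-1 by rewrite normfV lef_pV2// posrE (lt_le_trans m0 fz).
have iyz : `|(f y)^-1| * `|(f z)^-1| <= m ^- 2.
  by rewrite -exprVn expr2 ler_pM.
have fzle : `|f z| <= 4 * m.
  by have := ler_normD (f x) (f z - f x); rewrite subrKC mx; move: hz em m0; clear; lra.
have ix : `|f x ^- 2| <= m ^- 2 / 4.
  rewrite normfV normrX mx exprMn invfM mulrC.
  by rewrite (_ : 2 ^+ 2 = 4)//; rewrite -natrX.
rewrite (le_trans (ler_normD _ _))// normrN !normrM.
have q1 : `|(f y)^-1| * `|(f z)^-1| * `|f y - f z - dot a (y - z)| <= m ^- 2 * (e * D).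
  by apply: ler_pM => //; rewrite mulr_ge0.
have q3 : `|(f y - f x) * f z + f x * (f z - f x)| <= e * (6 * m).
  rewrite (le_trans (ler_normD _ _))// !normrM mx.
  have := ler_pM (normr_ge0 _) (normr_ge0 _) hy fzle.
  have : 2 * m * `|f z - f x| <= 2 * m * e.
    by apply: ler_wpM2l; [rewrite mulr_ge0// ltW|exact: hz].
  by clear; lra.
have q4 : `|f x ^- 2| * (`|(f y)^-1| * `|(f z)^-1|) *
    `|(f y - f x) * f z + f x * (f z - f x)| <= m ^- 2 / 4 * m ^- 2 * (e * (6 * m)).
  by apply: ler_pM => //; rewrite ?mulr_ge0//; apply: ler_pM => //; rewrite mulr_ge0.
have q5 : m ^- 2 / 4 * m ^- 2 * (e * (6 * m)) <= e * (m ^- 2 * 4 * m^-1).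
  have mn0 : m != 0 by rewrite gt_eqF.
  have -> : m ^- 2 / 4 * m ^- 2 * (e * (6 * m)) = e * (m ^- 2 * m^-1) * (6 / 4) by field.
  have q : 0 <= e * (m ^- 2 * m^-1) by rewrite ltW// !mulr_gt0.
  rewrite (_ : e * (m ^- 2 * 4 * m^-1) = e * (m ^- 2 * m^-1) * 4); last by ring.
  by move: q; clear; lra.
have q6 : `|f x ^- 2| * (`|(f y)^-1| * `|(f z)^-1|) *
    `|(f y - f x) * f z + f x * (f z - f x)| * `|dot a (y - z)|
    <= e * (m ^- 2 * 4 * m^-1) * (A * D).
  apply: ler_pM; [by rewrite !mulr_ge0|exact: normr_ge0|exact: le_trans q4 q5|exact: k1].
have : e * N * D <= eps * D by rewrite ler_wpM2r.
by rewrite /N; move: q1 q6; clear; lra.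
Qed.

Lemma sdiff_comp (f : R2 -> R) (F1 F2 : R2 -> R) x a b1 b2 :
  sdiff f (F1 x, F2 x) a -> sdiff F1 x b1 -> sdiff F2 x b2 ->
  sdiff (fun y => f (F1 y, F2 y)) x (a.1 *: b1 + a.2 *: b2).
Proof.
move=> df dF1 dF2 eps e0.
have [r1 [L1 [r10 L10 l1]]] := sdiff_lip dF1.
have [r2 [L2 [r20 L20 l2]]] := sdiff_lip dF2.
pose A := `|a.1| + `|a.2|.
have A0 : 0 <= A by rewrite addr_ge0.
pose N := L1 + L2 + A + 1.
have N0 : 0 < N by rewrite /N; lra.
pose e := eps / N.
have e_gt0 : 0 < e by rewrite divr_gt0.
have eN : e * N = eps by rewrite divfK// gt_eqF.
have [d0 d00 h0] := df _ e_gt0.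
have [d1 d10 h1] := dF1 _ e_gt0; have [d2 d20 h2] := dF2 _ e_gt0.
exists (Num.min (Num.min d1 d2) (Num.min (Num.min r1 r2) (d0 / N))) => [|y z].
  by rewrite !lt_min d10 d20 r10 r20 divr_gt0.
rewrite !lt_min => /andP[/andP[y1 y2] /andP[/andP[y3 y4] y5]].
move=> /andP[/andP[z1 z2] /andP[/andP[z3 z4] z5]].
rewrite !ltr_pdivlMr// in y5 z5.
have Fy w : dist1 x w < r1 -> dist1 x w < r2 -> dist1 x w * N < d0 ->
    dist1 (F1 x, F2 x) (F1 w, F2 w) < d0.
  move=> w3 w4 w5; rewrite /dist1 /=.
  have := l1 x w; rewrite dist1xx => /(_ r10 w3).
  have := l2 x w; rewrite dist1xx => /(_ r20 w4).
  by have := dist1_ge0 x w; move: w5; rewrite /N; nra.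
have {}h0 := h0 _ _ (Fy _ y3 y4 y5) (Fy _ z3 z4 z5).
have {}h1 := h1 _ _ y1 z1; have {}h2 := h2 _ _ y2 z2.
have {}l1 := l1 _ _ y3 z3; have {}l2 := l2 _ _ y4 z4.
have -> : f (F1 y, F2 y) - f (F1 z, F2 z) - dot (a.1 *: b1 + a.2 *: b2) (y - z) =
  f (F1 y, F2 y) - f (F1 z, F2 z) - dot a ((F1 y, F2 y) - (F1 z, F2 z)) +
  (a.1 * (F1 y - F1 z - dot b1 (y - z)) + a.2 * (F2 y - F2 z - dot b2 (y - z))).
  by rewrite /dot /= /GRing.scale /=; ring.
rewrite (le_trans (ler_normD _ _))//.
have t := ler_normD (a.1 * (F1 y - F1 z - dot b1 (y - z))) (a.2 * (F2 y - F2 z - dot b2 (y - z))).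
rewrite !normrM in t.
have D0 := dist1_ge0 y z; set D := dist1 y z in D0 h1 h2 l1 l2 *.
have q0 : e * dist1 (F1 y, F2 y) (F1 z, F2 z) <= e * ((L1 + L2) * D).
  by rewrite ler_pM2l// /dist1 /=; lra.
have q1 : `|a.1| * `|F1 y - F1 z - dot b1 (y - z)| <= `|a.1| * (e * D) by rewrite ler_wpM2l.
have q2 : `|a.2| * `|F2 y - F2 z - dot b2 (y - z)| <= `|a.2| * (e * D) by rewrite ler_wpM2l.
have : 0 <= e * D by rewrite mulr_ge0// ltW.
by rewrite -eN /N /A; move: h0 q0 q1 q2 t; clear; lra.
Qed.

(* Strict differentiability of [U] passes through a bi-Lipschitz local
   inverse [G] of [F]: c is the gradient with [a = DF^T c]. *)
Lemma sdiff_inv (u U F1 F2 : R2 -> R) (G : R2 -> R2) p a b1 b2 c (r K : R) :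
  0 < r -> G (F1 p, F2 p) = p ->
  (forall y, dist1 (F1 p, F2 p) y < r -> (F1 (G y), F2 (G y)) = y /\ u y = U (G y)) ->
  (forall y z, dist1 (F1 p, F2 p) y < r -> dist1 (F1 p, F2 p) z < r ->
     dist1 (G y) (G z) <= K * dist1 y z) ->
  a = c.1 *: b1 + c.2 *: b2 ->
  sdiff U p a -> sdiff F1 p b1 -> sdiff F2 p b2 -> sdiff u (F1 p, F2 p) c.
Proof.
move=> r0 Gp FG GK ->; set p' := (F1 p, F2 p) in Gp FG GK * => dU dF1 dF2 eps e0.
pose K' := `|K| + 1.
have K'0 : 0 < K' by rewrite /K'; have := normr_ge0 K; lra.
have KK' : K <= K' by rewrite /K'; have := ler_norm K; lra.
pose A := `|c.1| + `|c.2|.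
have A0 : 0 <= A by rewrite addr_ge0.
pose N := K' * (1 + A).
have N0 : 0 < N by rewrite /N mulr_gt0//; lra.
pose e := eps / N.
have e_gt0 : 0 < e by rewrite divr_gt0.
have eN : e * N = eps by rewrite divfK// gt_eqF.
have [d0 d00 h0] := dU _ e_gt0.
have [d1 d10 h1] := dF1 _ e_gt0; have [d2 d20 h2] := dF2 _ e_gt0.
pose d := Num.min d0 (Num.min d1 d2).
have d_gt0 : 0 < d by rewrite !lt_min d00 d10.
exists (Num.min r (d / K')) => [|y z]; first by rewrite lt_min r0 divr_gt0.
rewrite !lt_min !ltr_pdivlMr// => /andP[yr yd] /andP[zr zd].
have near w : dist1 p' w < r -> dist1 p' w * K' < d -> dist1 p (G w) < d.
  move=> wr wd; have := GK p' w; rewrite dist1xx Gp => /(_ r0 wr).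
  by have := dist1_ge0 p' w; nra.
have := near _ yr yd; rewrite !lt_min => /andP[y0 /andP[y1 y2]].
have := near _ zr zd; rewrite !lt_min => /andP[z0 /andP[z1 z2]].
have [Fy ->] := FG _ yr; have [Fz ->] := FG _ zr.
have {}h0 := h0 _ _ y0 z0; have {}h1 := h1 _ _ y1 z1; have {}h2 := h2 _ _ y2 z2.
have GK' : dist1 (G y) (G z) <= K' * dist1 y z.
  by have := GK _ _ yr zr; have := dist1_ge0 y z; nra.
set Y := G y in h0 h1 h2 Fy GK' *; set Z := G z in h0 h1 h2 Fz GK' *.
have -> : U Y - U Z - dot c (y - z) =
  U Y - U Z - dot (c.1 *: b1 + c.2 *: b2) (Y - Z) -
  (c.1 * (F1 Y - F1 Z - dot b1 (Y - Z)) + c.2 * (F2 Y - F2 Z - dot b2 (Y - Z))).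
  by rewrite -Fy -Fz /dot /= /GRing.scale /=; ring.
rewrite (le_trans (ler_normB _ _))//.
have t := ler_normD (c.1 * (F1 Y - F1 Z - dot b1 (Y - Z))) (c.2 * (F2 Y - F2 Z - dot b2 (Y - Z))).
rewrite !normrM in t.
have D0 := dist1_ge0 y z; have D0' := dist1_ge0 Y Z.
have q1 : `|c.1| * `|F1 Y - F1 Z - dot b1 (Y - Z)| <= `|c.1| * (e * dist1 Y Z) by rewrite ler_wpM2l.
have q2 : `|c.2| * `|F2 Y - F2 Z - dot b2 (Y - Z)| <= `|c.2| * (e * dist1 Y Z) by rewrite ler_wpM2l.
have q3 : e * (1 + A) * dist1 Y Z <= e * (1 + A) * (K' * dist1 y z).
  by apply: (ler_wpM2l _ GK'); apply: mulr_ge0; [exact: ltW|exact: addr_ge0].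
rewrite -eN /N; move: q1 q2 q3 t h0; rewrite /A; clear; lra.
Qed.

Lemma sdiff_is_derive (f : R2 -> R) x a j : sdiff f x a ->
  is_derive x (basis2 R j) f (cmp j a).
Proof.
move=> df; have cv : (fun h : R => h^-1 *: ((f \o shift x) (h *: basis2 R j) - f x))
    @ 0^' --> cmp j a.
  apply/cvgrPdist_le => eps e0; have [d d0 h] := df _ e0.
  near=> t.
  have t0 : t != 0 by near: t; exact: nbhs_dnbhs_neq.
  have td : `|t| < d by near: t; apply: dnbhs0_lt.
  have hD : dist1 x (t *: basis2 R j + x) = `|t|.
    rewrite /dist1 /basis2; case: ifP => _ /=; rewrite /GRing.scale /=.
      by rewrite mulr1 mulr0 add0r subrr normr0 addr0 distrC addrK.
    by rewrite mulr1 mulr0 add0r subrr normr0 add0r distrC addrK.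
  have := h (t *: basis2 R j + x) x; rewrite dist1xx hD => /(_ td d0).
  rewrite addrK dist1C hD.
  have -> : dot a (t *: basis2 R j) = t * cmp j a.
    by rewrite /dot /basis2 /cmp; case: ifP => _ /=; rewrite /GRing.scale /=; ring.
  rewrite /= => h1.
  rewrite distrC (_ : _ - _ = t^-1 * (f (t *: basis2 R j + x) - f x - t * cmp j a)); last first.
    by rewrite /GRing.scale /=; field.
  by rewrite normrM normfV ler_pdivrMl ?normr_gt0// [X in _ <= X]mulrC.
split; first by apply/cvg_ex; exists (cmp j a); exact: cv.
exact: cvg_lim cv.
Unshelve. all: by end_near.
Qed.

Lemma sdiff_partial f x a j : sdiff f x a -> partial j f x = cmp j a.
Proof. by move=> /(sdiff_is_derive j)/(@derive_val _ _ _ _ _ _ _). Qed.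

Lemma smooth_slice1 (f : R2 -> R) y (t : R) : smooth f ->
  is_derive (t : R) (1 : R) (fun t => f (t, y)) (partial 0 f (t, y)).
Proof.
move=> /(_ [::])[_ /(_ 0 (t, y))] /= df.
have E : (fun h : R => h^-1 *: (((fun t => f (t, y)) \o shift t) (h *: 1) - f (t, y))) =
         (fun h : R => h^-1 *: ((f \o shift (t, y)) (h *: basis2 R 0) - f (t, y))).
  apply/funext => h; rewrite /= /basis2 /=; congr (_ *: (f _ - _)).
  by apply: eq_pair2 => //=; rewrite /GRing.scale /= mulr0 add0r.
split; first by rewrite /derivable E.
by rewrite /derive E.
Qed.

Lemma smooth_slice2 (f : R2 -> R) x (t : R) : smooth f ->
  is_derive (t : R) (1 : R) (fun t => f (x, t)) (partial 1 f (x, t)).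
Proof.
move=> /(_ [::])[_ /(_ 1 (x, t))] /= df.
have E : (fun h : R => h^-1 *: (((fun t => f (x, t)) \o shift t) (h *: 1) - f (x, t))) =
         (fun h : R => h^-1 *: ((f \o shift (x, t)) (h *: basis2 R 1) - f (x, t))).
  apply/funext => h; rewrite /= /basis2 /=; congr (_ *: (f _ - _)).
  by apply: eq_pair2 => //=; rewrite /GRing.scale /= mulr0 add0r.
split; first by rewrite /derivable E.
by rewrite /derive E.
Qed.

Let MVT_le (f df : R -> R) (a b : R) : (forall t, is_derive (t : R) (1 : R) f (df t)) ->
  exists2 c, Num.min a b <= c <= Num.max a b & f b - f a = df c * (b - a).
Proof.
move=> h; have cf : continuous f by move=> x; apply/differentiable_continuous/derivable1_diffP; exact: (@ex_derive _ _ _ _ _ _ _ (h x)).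
case: (ltgtP a b) => [ab|ab|->].
- have [|c] := @MVT _ f df a b ab (fun t _ => h t); first exact: continuous_subspaceT.
  by rewrite in_itv/= => /andP[h1 h2] e; exists c => //; rewrite (ltW h1) (ltW h2).
- have [|c] := @MVT _ f df b a ab (fun t _ => h t); first exact: continuous_subspaceT.
  rewrite in_itv/= => /andP[h1 h2] e; exists c; last by lra.
  by rewrite (ltW h1) (ltW h2).
- by exists b; rewrite ?lexx// !subrr mulr0.
Qed.

(** [smooth] speaks of directional derivatives along the axes only, so the mean value theorem is
    applied on two sides of the rectangle spanned by [z] and [y]. *)
Lemma smooth_increment (f : R2 -> R) y z : smooth f -> exists c1 c2 : R,
  [/\ Num.min z.1 y.1 <= c1 <= Num.max z.1 y.1,
      Num.min z.2 y.2 <= c2 <= Num.max z.2 y.2 &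
      f y - f z = partial 0 f (c1, y.2) * (y.1 - z.1)
                + partial 1 f (z.1, c2) * (y.2 - z.2)].
Proof.
move=> sf.
have [c1 c1h e1] := MVT_le z.1 y.1 (fun t => smooth_slice1 y.2 t sf).
have [c2 c2h e2] := MVT_le z.2 y.2 (fun t => smooth_slice2 z.1 t sf).
exists c1, c2; split => //; rewrite -e1 -e2 -!surjective_pairing; lra.
Qed.

Lemma between_dist (x a b c : R) : Num.min a b <= c <= Num.max a b ->
  `|x - c| <= `|x - a| + `|x - b|.
Proof.
rewrite ge_min le_max ler_norml => h.
have := ler_norm (x - a); have := ler_norm (x - b).
have := ler_norm (- (x - a)); have := ler_norm (- (x - b)).
rewrite !normrN; have := normr_ge0 (x - a); have := normr_ge0 (x - b).
by case/andP: h => /orP[] ? /orP[] ?; lra.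
Qed.

Lemma smooth_sdiff (f : R2 -> R) x : smooth f ->
  sdiff f x (partial 0 f x, partial 1 f x).
Proof.
move=> sf eps e0.
have cp j : forall eps : R, 0 < eps -> exists2 d : R, 0 < d &
    forall y, dist1 x y < d -> `|partial j f x - partial j f y| < eps.
  move=> e e1; have [cj _] := sf [:: j].
  have /cvgrPdist_lt/(_ e e1) := cj x.
  by move=> /nbhs_dist1P[d d0 h]; exists d.
have [d0 d00 h0] := cp 0 _ e0; have [d1 d10 h1] := cp 1 _ e0.
exists (Num.min d0 d1 / 2) => [|y z]; first by rewrite divr_gt0// lt_min d00.
rewrite !ltr_pdivlMr// !lt_min => /andP[y0 y1] /andP[z0 z1].
have [c1 [c2 [c1h c2h ->]]] := smooth_increment y z sf.
have b1 : dist1 x (c1, y.2) < d0.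
  move: c1h y0 z0; rewrite /dist1 /= => h y0 z0.
  have := normr_ge0 (x.2 - z.2).
  by have := between_dist (x.1) h; move: y0 z0; clear; lra.
have b2 : dist1 x (z.1, c2) < d1.
  move: c2h y1 z1; rewrite /dist1 /= => h y1 z1.
  have := normr_ge0 (x.1 - y.1).
  by have := between_dist (x.2) h; move: y1 z1; clear; lra.
have {}b1 := h0 _ b1; have {}b2 := h1 _ b2.
set D1 := partial 0 f _; set D2 := partial 1 f _.
rewrite /dot /=; have -> : D1 * (y.1 - z.1) + D2 * (y.2 - z.2) -
    (partial 0 f x * (y.1 - z.1) + partial 1 f x * (y.2 - z.2)) =
    (D1 - partial 0 f x) * (y.1 - z.1) + (D2 - partial 1 f x) * (y.2 - z.2) by ring.
rewrite (le_trans (ler_normD _ _))// !normrM mulrDr.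
by apply: lerD; (apply: ler_wpM2r; first exact: normr_ge0); rewrite distrC; exact: ltW.
Qed.

End StrictDifferentiability.

Section Lipschitz.
Variable R : realType.
Local Notation R2 := (R * R)%type.

Definition Lip (L : R) (D : set R2) (f : R2 -> R) :=
  forall y z, D y -> D z -> `|f y - f z| <= L * dist1 y z.

Definition LipB (D : set R2) (f : R2 -> R) := exists L M : R,
  [/\ 0 <= L, 0 <= M, Lip L D f & forall y, D y -> `|f y| <= M].

Lemma LipB_ext D f g : (forall y, D y -> f y = g y) -> LipB D f -> LipB D g.
Proof.
move=> fg [L [M [L0 M0 lf bf]]]; exists L, M; split => //.
  by move=> y z Dy Dz; rewrite -!fg//; exact: lf.
by move=> y Dy; rewrite -fg//; exact: bf.
Qed.

Lemma LipB_cst D (c : R) : LipB D (fun=> c).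
Proof.
by exists 0, `|c|; split => // y z _ _; rewrite subrr normr0 mul0r.
Qed.

Lemma LipBD D f g : LipB D f -> LipB D g -> LipB D (fun y => f y + g y).
Proof.
move=> [L [M [L0 M0 lf bf]]] [L' [M' [L'0 M'0 lg bg]]].
exists (L + L'), (M + M'); split; try by rewrite addr_ge0.
  move=> y z Dy Dz; have := lf _ _ Dy Dz; have := lg _ _ Dy Dz.
  have := ler_normD (f y - f z) (g y - g z).
  by rewrite (_ : f y - f z + _ = f y + g y - (f z + g z)); [lra|ring].
by move=> y Dy; rewrite (le_trans (ler_normD _ _))// lerD ?bf ?bg.
Qed.

Lemma LipBM D f g : LipB D f -> LipB D g -> LipB D (fun y => f y * g y).
Proof.
move=> [L [M [L0 M0 lf bf]]] [L' [M' [L'0 M'0 lg bg]]].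
exists (M * L' + M' * L), (M * M'); split; try by rewrite ?addr_ge0 ?mulr_ge0.
  move=> y z Dy Dz; have hf := lf _ _ Dy Dz; have hg := lg _ _ Dy Dz.
  have := ler_normD (f y * (g y - g z)) (g z * (f y - f z)).
  rewrite (_ : f y * _ + _ = f y * g y - f z * g z); last by ring.
  rewrite !normrM => h; apply: (le_trans h); rewrite mulrDl -!mulrA.
  by apply: lerD; apply: ler_pM => //; [exact: bf|exact: bg].
by move=> y Dy; rewrite normrM ler_pM// ?bf ?bg.
Qed.

Lemma LipBN D f : LipB D f -> LipB D (fun y => - f y).
Proof.
move=> [L [M [L0 M0 lf bf]]]; exists L, M; split => //.
  by move=> y z Dy Dz; rewrite -opprD normrN; exact: lf.
by move=> y Dy; rewrite normrN; exact: bf.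
Qed.

Lemma LipBV D f (c : R) : 0 < c -> (forall y, D y -> c <= f y) ->
  LipB D f -> LipB D (fun y => (f y)^-1).
Proof.
move=> c0 fc [L [M [L0 M0 lf bf]]].
have fV y : D y -> 0 < f y by move=> /fc; lra.
have fVc y : D y -> `|(f y)^-1| <= c^-1.
  by move=> Dy; rewrite normfV gtr0_norm ?fV// lef_pV2 ?posrE ?fV// fc.
exists (c^-1 * (c^-1 * L)), c^-1; split => //.
- by rewrite !mulr_ge0// invr_ge0 ltW.
- by rewrite invr_ge0 ltW.
move=> y z Dy Dz; have fy0 := fV _ Dy; have fz0 := fV _ Dz.
rewrite (_ : _ - _ = (f y)^-1 * ((f z)^-1 * (f z - f y))); last first.
  by field; rewrite !gt_eqF.
rewrite !normrM -!mulrA; apply: ler_pM => //; first exact: fVc.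
by apply: ler_pM => //; [exact: fVc|rewrite dist1C; exact: lf].
Qed.

Lemma LipB_fst D (M : R) : (forall p, D p -> `|p.1| <= M /\ `|p.2| <= M) ->
  LipB D (fun p => p.1).
Proof.
move=> h; exists 1, `|M|; split => //.
  by move=> y z _ _; rewrite mul1r /dist1 lerDl.
by move=> y /h[h1 _]; rewrite (le_trans h1)// ler_norm.
Qed.

Lemma LipB_snd D (M : R) : (forall p, D p -> `|p.1| <= M /\ `|p.2| <= M) ->
  LipB D (fun p => p.2).
Proof.
move=> h; exists 1, `|M|; split => //.
  by move=> y z _ _; rewrite mul1r /dist1 lerDr.
by move=> y /h[_ h1]; rewrite (le_trans h1)// ler_norm.
Qed.

Lemma LipB_quad D c (M : R) : (forall p, D p -> `|p.1| <= M /\ `|p.2| <= M) ->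
  LipB D (quad c).
Proof.
move=> h; have h1 := LipB_fst h; have h2 := LipB_snd h.
by do ![apply: LipBD|exact: LipB_cst]; apply: LipBM; (try exact: LipB_cst) => //;
  exact: LipBM.
Qed.

Definition clamp01 (t : R) : R := Num.max 0 (Num.min t 1).

Lemma clamp01_ge0 t : 0 <= clamp01 t.
Proof. by rewrite /clamp01 le_max lexx. Qed.

Lemma clamp01_le1 t : clamp01 t <= 1.
Proof. by rewrite /clamp01 ge_max ler01 ge_min lexx orbT. Qed.

Lemma clamp01_lip s t : `|clamp01 s - clamp01 t| <= `|s - t|.
Proof.
rewrite ler_norml /clamp01; have := ler_norm (s - t); have := ler_norm (- (s - t)).
rewrite normrN !maxEle !minEle; case: ifP; case: ifP; case: ifP; case: ifP; lra.
Qed.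

Lemma LipB_clamp D f : LipB D f -> LipB D (clamp01 \o f).
Proof.
move=> [L [M [L0 M0 lf bf]]]; exists L, 1; split => //.
  move=> y z Dy Dz; rewrite (le_trans (clamp01_lip _ _))//; exact: lf.
by move=> y Dy; rewrite ger0_norm ?clamp01_ge0 ?clamp01_le1.
Qed.

(** Induction on the number of sets. If [C i] contains a, let s be its last point in [a, b]: the
    bound on [C i] serves between a and s, and the rest of the interval is covered by the other
    sets. The constant does not grow with their number. *)
Let Lip_cover1 (I : finType) (C : I -> set R) (L : R) (f : R -> R) (b : R) :
  (forall i, closed (C i)) ->
  (forall i s t, C i s -> C i t -> `|f s - f t| <= L * `|s - t|) ->
  forall n (A : {set I}) (a : R), (#|A| <= n)%N -> a <= b ->
  (forall t, a <= t <= b -> exists2 i, i \in A & C i t) ->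
  `|f a - f b| <= L * (b - a).
Proof.
move=> cC lC; elim=> [|n IH] A a An ab cov.
  have [|i iA] := cov a; first by rewrite lexx.
  by move: An; rewrite leqn0 cards_eq0 => /eqP A0; rewrite A0 inE in iA.
have [|i iA Cia] := cov a; first by rewrite lexx.
pose E := C i `&` `[a, b].
have Ea : E a by split => //=; rewrite in_itv/= lexx.
have hsE : has_sup E.
  by split; [exists a|exists b => t [_ /=]]; rewrite ?in_itv/= => // /andP[].
have cE : closed E by apply: closedI => //; exact: itv_closed.
have [Cis] : E (sup E).
  by rewrite {1}((closure_id E).1 cE); apply: closure_sup; case: hsE.
rewrite /= in_itv/= => /andP[as_ sb]; set s := sup E in Cis as_ sb.
have h1 : `|f a - f s| <= L * (s - a).
  by rewrite (le_trans (lC i _ _ Cia Cis))// ler0_norm ?subr_le0// opprB.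
have [sb'|sb'] := eqVneq s b; first by move: h1; rewrite sb'.
have {sb'}sb' : s < b by rewrite lt_neqAle sb'.
have cov' t : s < t <= b -> exists2 j, j \in A :\ i & C j t.
  move=> /andP[st tb]; have [|j jA Cjt] := cov t.
    by rewrite tb (le_trans as_ (ltW st)).
  exists j => //; rewrite !inE jA andbT; apply: contraTneq (st) => ji.
  rewrite -leNgt; apply: (sup_upper_bound hsE); split; first by rewrite -ji.
  by rewrite /= in_itv/= tb (le_trans as_ (ltW st)).
(* Points just after s lie in the other sets, whose finite union is closed and hence contains s
   itself. *)
have covs : exists2 j, j \in A :\ i & C j s.
  apply: contrapT => hs.
  have /open_nbhs_nbhs : open_nbhs s (~` \bigcup_(j in [set j | j \in A :\ i]) C j).
    split; last by move=> [j jA Cjs]; apply: hs; exists j.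
    by apply: closed_openC; apply: closed_bigcup.
  move=> /nbhs_ballP[e /= e0 h].
  pose t := Num.min (s + e / 2) b.
  have st : s < t by rewrite lt_min sb' andbT; lra.
  have tb : t <= b by rewrite ge_min lexx orbT.
  have [|j jA Cjt] := cov' t; first by rewrite st.
  apply: (h t); last by exists j.
  rewrite /ball /= distrC ger0_norm ?subr_ge0 ?ltW//.
  by have : t <= s + e / 2 by [rewrite ge_min lexx]; lra.
have : `|f s - f b| <= L * (b - s).
  apply: (IH (A :\ i)) => //.
    by move: An; rewrite (cardsD1 i) iA.
  move=> t /andP[st tb]; have [<-//|ts] := eqVneq s t.
  by apply: cov'; rewrite tb lt_neqAle ts st.
have := ler_normD (f a - f s) (f s - f b).
rewrite (_ : f a - f s + _ = f a - f b); last by ring.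
by lra.
Qed.

(** A Lipschitz bound on each piece passes to a convex union: along the segment between two points
    [dist1] is proportional to the parameter, and the one-dimensional covering argument applies. It
    serves both the pieces of the Clough-Tocher split and the elements of the mesh. *)
Lemma Lip_cover (I : finType) (C : I -> set R2) (D : set R2) (L : R) (f : R2 -> R) :
  convex2 D -> (forall i, closed (C i)) -> (forall y, D y -> exists i, C i y) ->
  (forall i, Lip L (C i `&` D) f) -> Lip L D f.
Proof.
move=> xD cC cov lC y z Dy Dz.
pose p (t : R) : R2 := ((1 - t) * y.1 + t * z.1, (1 - t) * y.2 + t * z.2).
have pE t : p t = (1 - t) *: y + t *: z by [].
have cp : continuous p.
  have ct : continuous (fun t : R => t) by move=> t; exact: cvg_id.
  have cc (r : R) : continuous (fun _ : R => r) by move=> t; exact: cvg_cst.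
  by apply: continuous_pair; apply: contD; apply: contM => //; apply: contD => //;
    exact: contN.
have dp s t : dist1 (p s) (p t) = dist1 y z * `|s - t|.
  rewrite /dist1 /p /= [in RHS]mulrDl; congr (_ + _); rewrite -normrM distrC;
    by congr `|_|; ring.
have := @Lip_cover1 I (fun i => (p @^-1` C i) `&` `[0, 1]) (L * dist1 y z) (f \o p) 1
  _ _ #|I| [set: I]%SET 0.
rewrite /p /= subr0 !mul1r !mul0r !addr0 subrr !mul0r !add0r -!surjective_pairing.
rewrite mulr1 cardsT; apply => //.
- move=> i; apply: closedI; last exact: itv_closed.
  by apply: preimage_closed => // t _; exact: cp.
- move=> i s t [Cs /= s01] [Ct /= t01]; rewrite -mulrA -dp; apply: (lC i); split => //.
    by rewrite -[(_, _)]/(p s) pE; apply: xD => //; rewrite in_itv/= in s01.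
  by rewrite -[(_, _)]/(p t) pE; apply: xD => //; rewrite in_itv/= in t01.
- move=> t t01; have [|i Ci] := cov (p t); first by rewrite pE; apply: xD.
  by exists i => //; split.
Qed.

End Lipschitz.

(** * Smooth functions *)

Lemma ord2P (i : 'I_2) : i != 0 -> i = 1.
Proof. by move=> i0; apply/val_inj; case: i i0 => [[|[|//]] ?]. Qed.

Section SmoothFunctions.
Variable R : realType.
Local Notation R2 := (R * R)%type.

(** Class C^n by recursion on the order, through which the product rule passes by induction;
    [smooth] quantifies over words of derivatives instead. *)
Fixpoint ck (n : nat) (f : R2 -> R) : Prop :=
  continuous f /\
  if n is m.+1 then forall j, (forall x, derivable f x (basis2 R j)) /\ ck m (partial j f)
  else True.

Lemma ck_smooth f : (forall n, ck n f) <-> smooth f.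
Proof.
split.
- move=> h s; have hs : forall n, ck n (iter_partial s f).
    elim: s => [//|j s IH] n /=; by have /= [_ /(_ j)[]] := IH n.+1.
  split; first by have /= [] := hs 0%N.
  by move=> j; have /= [_ /(_ j)[]] := hs 1%N.
- move=> sf n; elim: n f sf => [|n IH] f sf /=.
    by split => //; have [] := sf [::].
  split; first by have [] := sf [::].
  move=> j; split; first by have [_] := sf [::].
  apply: IH => s; have := sf (rcons s j).
  by rewrite /iter_partial foldr_rcons.
Qed.

Lemma ckW n f : ck n.+1 f -> ck n f.
Proof.
elim: n f => [|n IH] f; first by case.
by move=> [cf h]; split => // j; have [d c] := h j; split => //; exact: IH.
Qed.

Lemma partialD (f g : R2 -> R) j x : derivable f x (basis2 R j) -> derivable g x (basis2 R j) ->
  partial j (fun y => f y + g y) x = partial j f x + partial j g x.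
Proof. by move=> df dg; rewrite /partial -deriveD. Qed.

Lemma partialM (f g : R2 -> R) j x : derivable f x (basis2 R j) -> derivable g x (basis2 R j) ->
  partial j (fun y => f y * g y) x = f x * partial j g x + g x * partial j f x.
Proof. by move=> df dg; exact: (deriveM df dg). Qed.

Lemma ckD n (f g : R2 -> R) : ck n f -> ck n g -> ck n (fun y => f y + g y).
Proof.
elim: n f g => [|n IH] f g [cf hf] [cg hg]; split => //; try exact: contD.
move=> j; have [df cf'] := hf j; have [dg cg'] := hg j; split.
  by move=> x; exact: (@derivableD _ _ _ f g).
have -> : partial j (fun y => f y + g y) = (fun y => partial j f y + partial j g y).
  by apply/funext => y; rewrite partialD.
exact: IH.
Qed.

Lemma ckM n (f g : R2 -> R) : ck n f -> ck n g -> ck n (fun y => f y * g y).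
Proof.
elim: n f g => [|n IH] f g [cf hf] [cg hg]; split => //; try exact: contM.
move=> j; have [df cf'] := hf j; have [dg cg'] := hg j; split.
  by move=> x; exact: (@derivableM _ _ f g).
have -> : partial j (fun y => f y * g y) =
    (fun y => f y * partial j g y + g y * partial j f y).
  by apply/funext => y; rewrite partialM.
by apply: ckD; apply: IH => //; apply: ckW; split.
Qed.

Lemma ck_cst n (c : R) : ck n (fun=> c).
Proof.
elim: n c => [|n IH] c /=; split => //; try exact: cst_continuous.
move=> j; split; first by move=> x; exact: derivable_cst.
have -> : partial j (fun=> c) = (fun=> 0).
  by apply/funext => x; rewrite /partial derive_cst.
exact: IH.
Qed.

Lemma smooth_cst (c : R) : smooth (fun _ : R2 => c).
Proof. by apply/ck_smooth => n; exact: ck_cst. Qed.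

Lemma smoothD (f g : R2 -> R) : smooth f -> smooth g -> smooth (fun y => f y + g y).
Proof.
by move=> /ck_smooth hf /ck_smooth hg; apply/ck_smooth => n; exact: ckD.
Qed.

Lemma smoothM (f g : R2 -> R) : smooth f -> smooth g -> smooth (fun y => f y * g y).
Proof.
by move=> /ck_smooth hf /ck_smooth hg; apply/ck_smooth => n; exact: ckM.
Qed.

Lemma smooth_sum (I : Type) (r : seq I) (P : pred I) (F : I -> R2 -> R) :
  (forall i, P i -> smooth (F i)) -> smooth (fun y => \sum_(i <- r | P i) F i y).
Proof.
move=> h; elim: r => [|i r IH].
  rewrite (_ : (fun y => _) = (fun=> 0)); first exact: smooth_cst.
  by apply/funext => y; rewrite big_nil.
rewrite (_ : (fun y => _) = (fun y => (if P i then F i y else 0) + \sum_(i <- r | P i) F i y)).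
  apply: (smoothD _ IH).
  by case Pi : (P i); [exact: h|exact: smooth_cst].
by apply/funext => y; rewrite big_cons; case: ifP; rewrite ?add0r.
Qed.

Let slice (g dg : R -> R) (j : 'I_2) (x : R2) (i : 'I_2) :
  is_derive (cmp i x) (1 : R) g (dg (cmp i x)) ->
  is_derive x (basis2 R j) (fun y => g (cmp i y)) (if i == j then dg (cmp i x) else 0).
Proof.
move=> [dg1 dg2].
have [ij|ij] := eqVneq i j.
  have E : (fun h : R => h^-1 *: (((fun y => g (cmp i y)) \o shift x) (h *: basis2 R j) - g (cmp i x))) =
           (fun h : R => h^-1 *: ((g \o shift (cmp i x)) (h *: 1) - g (cmp i x))).
    apply/funext => h; rewrite /= -ij /basis2 /cmp; congr (_ *: (g _ - _)).
    by case: (i == 0).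
  by split; [rewrite /derivable E|rewrite /derive E].
have E : (fun h : R => h^-1 *: (((fun y => g (cmp i y)) \o shift x) (h *: basis2 R j) - g (cmp i x))) =
         (fun h : R => 0).
  apply/funext => h; rewrite /= /basis2 /cmp.
  suff -> : (if i == 0 then (h *: (if j == 0 then (1, 0) else (0, 1)) + x).1
      else (h *: (if j == 0 then (1, 0) else (0, 1)) + x).2) = cmp i x.
    by rewrite subrr scaler0.
  rewrite /cmp; move: ij; case: (i =P 0) => [->|/eqP i0].
    by rewrite eq_sym => /negbTE -> /=; rewrite /GRing.scale /= mulr0 add0r.
  case: (j =P 0) => [_ _|/eqP j0]; first by rewrite /= /GRing.scale /= mulr0 add0r.
  by rewrite (ord2P i0) (ord2P j0).
by split; [rewrite /derivable E; exact: is_cvg_cst|rewrite /derive E; exact: lim_cst].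
Qed.

(** [g k] plays the k-th derivative of [g 0]; giving the whole sequence at once makes every iterated
    partial derivative explicit. *)
Lemma smooth_slice (g : nat -> R -> R) (i : 'I_2) :
  (forall k t, is_derive (t : R) (1 : R) (g k) (g k.+1 t)) ->
  smooth (fun x => g 0%N (cmp i x)).
Proof.
move=> dg; apply/ck_smooth => n.
have cg k : continuous (fun x : R2 => g k (cmp i x)).
  move=> x; have cc : continuous (fun x : R2 => cmp i x).
    by rewrite /cmp; case: (i == 0); [exact: continuous_fst2|exact: continuous_snd2].
  apply: (continuous_comp (cc x)).
  by apply/differentiable_continuous/derivable1_diffP; exact: (@ex_derive _ _ _ _ _ _ _ (dg k _)).
elim: n 0%N => [|n IH] k /=; first by split.
split; first exact: cg.
move=> j; split; first by move=> x; exact: (@ex_derive _ _ _ _ _ _ _ (slice j (dg k (cmp i x)))).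
have -> : partial j (fun x => g k (cmp i x)) =
    fun x => if i == j then g k.+1 (cmp i x) else 0.
  by apply/funext => x; exact: (@derive_val _ _ _ _ _ _ _ (slice j (dg k (cmp i x)))).
by case: (i == j); [exact: IH|exact: ck_cst].
Qed.

Lemma smooth_cmp i : smooth (fun x : R2 => cmp i x).
Proof.
apply: (@smooth_slice (fun k t => if k is k'.+1 then (if k' is _.+1 then 0 else 1) else t)).
by case=> [|[|k]] t; exact: is_derive_cst || exact: is_derive_id.
Qed.

Lemma smooth_affine (a b c : R) : smooth (fun x : R2 => a * x.1 + b * x.2 + c).
Proof.
have s1 : smooth (fun x : R2 => x.1) := smooth_cmp 0.
have s2 : smooth (fun x : R2 => x.2) := smooth_cmp 1.
exact: (smoothD (smoothD (smoothM (smooth_cst a) s1) (smoothM (smooth_cst b) s2))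
  (smooth_cst c)).
Qed.

(* [E p] is the function which vanishes for t <= 0 and is p(1/t) exp(-1/t) for
   t > 0; its derivative is [E (X^2 (p - p'))]. *)
Definition flat (p : {poly R}) (t : R) : R :=
  if 0 < t then p.[t^-1] * expR (- t^-1) else 0.

(** The additional power [s ^+ n] absorbs the factor X when the induction passes from p to p X +
    c. *)
Lemma expR_dominates (p : {poly R}) n (eps : R) : 0 < eps ->
  exists2 A : R, 0 < A &
    forall s, A < s -> `|p.[s]| * s ^+ n * expR (- s) <= eps.
Proof.
have mono m (e : R) : 0 < e -> exists2 A : R, 0 < A &
    forall s, A < s -> s ^+ m * expR (- s) <= e.
  move=> e0; have f0 : 0 < ((m.+1)`!%:R : R) by rewrite ltr0n fact_gt0.
  exists ((m.+1)`!%:R / e) => [|s]; first exact: divr_gt0.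
  rewrite ltr_pdivrMr// => hs.
  have s0 : 0 < s by rewrite -(pmulr_lgt0 _ e0); lra.
  rewrite expRN ler_pdivrMr ?expR_gt0//.
  have h := expR_ge1Dxn m (ltW s0).
  have : s ^+ m <= e * (s ^+ m.+1 / m.+1`!%:R).
    rewrite mulrA ler_pdivlMr// exprS mulrA [X in _ <= X]mulrC ler_wpM2l//.
      by rewrite exprn_ge0// ltW.
    by rewrite mulrC ltW.
  have := ler_wpM2l (ltW e0) h; rewrite mulrDr mulr1; lra.
elim/poly_ind: p n eps => [|p c IH] n eps e0.
  by exists 1 => // s _; rewrite horner0 normr0 !mul0r ltW.
have e20 : 0 < eps / 2 by rewrite divr_gt0.
have c0 : 0 < eps / 2 / (`|c| + 1) by rewrite divr_gt0// ltr_wpDl.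
have [A A0 hA] := IH n.+1 _ e20; have [B B0 hB] := mono n _ c0.
exists (Num.max A B) => [|s]; first by rewrite lt_max A0.
rewrite gt_max => /andP[/hA h1 sB]; have {}hB := hB _ sB.
rewrite hornerMXaddC.
have s0 : 0 < s by exact: lt_trans sB.
have E0 := expR_gt0 (- s).
have h2 : `|c| * (s ^+ n * expR (- s)) <= eps / 2.
  rewrite ler_pdivlMr in hB; last by rewrite ltr_wpDl.
  have : 0 <= s ^+ n * expR (- s) by rewrite mulr_ge0 ?exprn_ge0// ltW.
  by have := normr_ge0 c; move: hB; nra.
have h3 : `|p.[s] * s + c| <= `|p.[s]| * s + `|c|.
  by rewrite (le_trans (ler_normD _ _))// normrM (gtr0_norm s0).
have h4 : `|p.[s] * s + c| * (s ^+ n * expR (- s)) <=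
   (`|p.[s]| * s + `|c|) * (s ^+ n * expR (- s)).
  by apply: ler_wpM2r => //; rewrite mulr_ge0 ?exprn_ge0// ltW.
rewrite -mulrA (le_trans h4)// mulrDl.
rewrite (_ : `|p.[s]| * s * _ = `|p.[s]| * s ^+ n.+1 * expR (- s)).
  by lra.
by rewrite exprS; ring.
Qed.

Definition flat_deriv (p : {poly R}) : {poly R} := 'X^2 * (p - p^`()).

Lemma flat_small (p : {poly R}) (eps : R) : 0 < eps -> exists2 d : R, 0 < d &
  forall t, `|t| < d -> `|flat p t| <= eps * `|t|.
Proof.
move=> e0; have [A A0 hA] := expR_dominates p 1 e0.
exists A^-1 => [|t td]; first by rewrite invr_gt0.
rewrite /flat; case: ifPn => t0; last by rewrite normr0 mulr_ge0// ltW.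
rewrite (gtr0_norm t0) in td *.
have ht : A < t^-1 by rewrite -[A]invrK ltf_pV2// posrE invr_gt0.
have := hA _ ht; rewrite expr1 normrM (gtr0_norm (expR_gt0 _)).
by rewrite mulrAC ler_pdivrMr.
Qed.

Let is_derive_near (f g : R -> R) (t d : R) : (\forall s \near t, f s = g s) ->
  is_derive (t : R) (1 : R) f d -> is_derive (t : R) (1 : R) g d.
Proof.
move=> fg [df1 df2]; split; first exact: near_eq_derivable df1.
by rewrite -(near_eq_derive (1 : R) fg).
Qed.

Let is_derive_flat_gt0 (p : {poly R}) (t : R) : 0 < t ->
  is_derive (t : R) (1 : R) (fun s => p.[s^-1] * expR (- s^-1))
    ((flat_deriv p).[t^-1] * expR (- t^-1)).
Proof.
move=> t0; have tn0 : t != 0 by rewrite gt_eqF.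
have hV : is_derive (t : R) (1 : R) (fun s : R => s^-1) (- (t ^- 2) *: (1 : R)).
  exact: (@is_deriveV _ id t 1 1 tn0 (is_derive_id _ _)).
have hp := is_derive1_comp (is_derive_poly p t^-1) hV.
have hE := @is_derive1_comp R expR (fun s => - s^-1) t _ _ (is_derive_expR _) (is_deriveN hV).
have h := is_deriveM hp hE.
apply: (is_derive_eq (h : is_derive (t : R) (1 : R) (fun s => p.[s^-1] * expR (- s^-1)) _)).
rewrite /flat_deriv hornerM hornerXn hornerD hornerN /GRing.scale /=.
by field.
Qed.

Lemma is_derive_flat (p : {poly R}) (t : R) :
  is_derive (t : R) (1 : R) (flat p) (flat (flat_deriv p) t).
Proof.
have [t0|t0|->] := ltgtP t 0.
- rewrite {2}/flat ltNge (ltW t0)/=.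
  apply: (@is_derive_near (cst 0)) => //.
  near=> s; rewrite /flat ifN// -leNgt ltW//.
  by near: s; exact: lt_nbhsl.
- rewrite {2}/flat t0.
  apply: is_derive_near (is_derive_flat_gt0 p t0).
  near=> s; rewrite /flat ifT//.
  by near: s; exact: lt_nbhsr.
- have cv : (fun h : R => h^-1 *: ((flat p \o shift 0) (h *: 1) - flat p 0))
      @ 0^' --> (0 : R).
    apply/cvgrPdist_le => eps e0; have [d d0 h] := flat_small p e0.
    near=> s; have s0 : s != 0 by near: s; exact: nbhs_dnbhs_neq.
    have sd : `|s| < d by near: s; apply: dnbhs0_lt.
    rewrite sub0r normrN /= addr0 {2}/flat ltxx subr0 /GRing.scale /= mulr1.
    by rewrite normrM normfV ler_pdivrMl ?normr_gt0// mulrC h.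
  rewrite [flat (flat_deriv p) 0]/flat ltxx.
  split; first by apply/cvg_ex; exists 0.
  exact: cvg_lim cv.
Unshelve. all: by end_near.
Qed.

Lemma smooth_flat (a c : R) (i : 'I_2) : smooth (fun x : R2 => flat 1 (a * cmp i x + c)).
Proof.
pose g k t := a ^+ k * flat (iter k flat_deriv 1) (a * t + c).
rewrite (_ : (fun _ => _) = fun x => g 0%N (cmp i x)); last first.
  by apply/funext => x; rewrite /g expr0 mul1r.
apply: smooth_slice => k t.
have hA : is_derive (t : R) (1 : R) (fun t => a * t + c) a.
  have := is_derive_quad1 0 a c t; rewrite mulr0 mul0r add0r.
  by congr (is_derive _ _ _ _); apply/funext => s; rewrite mul0r add0r.
have h := @is_derive1_comp R (flat (iter k flat_deriv 1)) (fun t => a * t + c) t _ _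
  (is_derive_flat _ _) hA.
have := @is_deriveZ _ _ _ _ (a ^+ k) _ _ _ h.
congr (is_derive _ _ _ _); rewrite /g /= exprS /GRing.scale /=; ring.
Qed.

Lemma flat_gt0 t : 0 < t -> 0 < flat 1 t.
Proof. by move=> t0; rewrite /flat t0 hornerC mul1r expR_gt0. Qed.

Lemma flat_le0 p t : t <= 0 -> flat p t = 0.
Proof. by move=> t0; rewrite /flat ltNge t0. Qed.

Lemma flat_ge0 t : 0 <= flat 1 t.
Proof. by have [/flat_gt0/ltW|/flat_le0 ->] := ltP 0 t. Qed.


Definition box_bump (c : R2) (r : R) (x : R2) : R :=
  flat 1 (1 * cmp 0 x + (r - c.1)) * flat 1 (-1 * cmp 0 x + (r + c.1)) *
  (flat 1 (1 * cmp 1 x + (r - c.2)) * flat 1 (-1 * cmp 1 x + (r + c.2))).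

Lemma smooth_box_bump c r : smooth (box_bump c r).
Proof.
have h := smooth_flat.
exact: (smoothM (smoothM (h _ _ _) (h _ _ _)) (smoothM (h _ _ _) (h _ _ _))).
Qed.

Lemma box_bump_ge0 c r x : 0 <= box_bump c r x.
Proof. by rewrite /box_bump !mulr_ge0// flat_ge0. Qed.

Lemma box_bump_gt0 c r x : `|x.1 - c.1| < r -> `|x.2 - c.2| < r -> 0 < box_bump c r x.
Proof.
rewrite !ltr_norml => /andP[h1 h2] /andP[h3 h4].
by rewrite /box_bump /cmp /= !mulr_gt0// flat_gt0//; lra.
Qed.

Definition box (c : R2) (r : R) : set R2 :=
  `[c.1 - r, c.1 + r]%classic `*` `[c.2 - r, c.2 + r]%classic.

Lemma box_bump_out c r x : ~ box c r x -> box_bump c r x = 0.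
Proof.
move=> nb; rewrite /box_bump /cmp /=.
have [h1|h1] := leP (1 * x.1 + (r - c.1)) 0; first by rewrite (flat_le0 _ h1) !mul0r.
have [h2|h2] := leP (-1 * x.1 + (r + c.1)) 0; first by rewrite (flat_le0 _ h2) mulr0 mul0r.
have [h3|h3] := leP (1 * x.2 + (r - c.2)) 0; first by rewrite (flat_le0 _ h3) mul0r mulr0.
have [h4|h4] := leP (-1 * x.2 + (r + c.2)) 0; first by rewrite (flat_le0 _ h4) !mulr0.
by exfalso; apply: nb; split; rewrite /= in_itv/=; apply/andP; split; lra.
Qed.

Lemma compact_box c r : compact (box c r).
Proof. by apply: compact_setX; exact: segment_compact. Qed.

Lemma compact_seq_cover (K : set R2) (O : R2 -> set R2) : compact K ->
  (forall x, K x -> nbhs x (O x)) ->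
  exists D : seq R2, (forall x, x \in D -> K x) /\
    forall y, K y -> exists2 x, x \in D & O x y.
Proof.
move=> /compact_near_coveringP cK hO.
(* The filter of the lists that contain a given finite list: near-covering compactness for it is the
   existence of a finite subcover. *)
pose F : set_system (seq R2) :=
  filter_from setT (fun D0 : seq R2 => [set D : seq R2 | {subset D0 <= D}]).
have FF : Filter F.
  apply: filter_from_filter; first by exists [::].
  move=> A B _ _; exists (A ++ B) => // D h; split => z zA; apply: h.
    by rewrite mem_cat zA.
  by rewrite mem_cat zA orbT.
have [|D0 _ h] := cK (seq R2) F
  (fun D y => exists2 x, x \in D & K x /\ O x y) FF.
  move=> x Kx; exists (O x, [set D : seq R2 | x \in D]).
    split; first exact: hO.
    by exists [:: x] => // D; apply; rewrite inE.
  by move=> [y D] [/= Oy xD]; exists x.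
have {}h := h D0 (fun _ h => h).
exists [seq x <- D0 | `[< K x >]]; split.
  by move=> x; rewrite mem_filter => /andP[/asboolP].
move=> y /h[x xD [Kx Oy]]; exists x => //.
by rewrite mem_filter xD andbT; apply/asboolP.
Qed.

(** A finite sum of box bumps. It is bounded below on [K] rather than normalized to 1, because
    [lip_approx] divides by it. *)
Lemma bump_exists (K U : set R2) : compact K -> open U -> K `<=` U ->
  exists S : R2 -> R, exists K' : set R2, exists m : R,
    [/\ smooth S, compact K' /\ K' `<=` U, (forall x, ~ K' x -> S x = 0),
        0 < m & forall x, K x -> m <= S x].
Proof.
move=> cK oU KU.
have /choice[r hr] : forall x, exists r : R, 0 < r /\ (K x -> box x r `<=` U).
  move=> x; have [Kx|nKx] := pselect (K x); last by exists 1.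
  have [d d0 hd] := (open_dist1P U).1 oU x (KU _ Kx).
  exists (d / 4); split; first exact: divr_gt0.
  move=> _ y [] /=; rewrite !in_itv/= => /andP[? ?] /andP[? ?]; apply: hd.
  have [? ?] : `|x.1 - y.1| <= d / 4 /\ `|x.2 - y.2| <= d / 4.
    by rewrite !ler_norml; split; lra.
  by rewrite /dist1; lra.
pose O (x : R2) : set R2 := [set y | `|y.1 - x.1| < r x /\ `|y.2 - x.2| < r x].
have oO x : open (O x).
  apply/open_dist1P => y [y1 y2].
  exists (Num.min (r x - `|y.1 - x.1|) (r x - `|y.2 - x.2|)).
    by rewrite lt_min !subr_gt0 y1.
  move=> z; rewrite lt_min /dist1 => /andP[z1 z2].
  have := ler_distD y.1 z.1 x.1; have := ler_distD y.2 z.2 x.2.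
  rewrite (distrC z.1 y.1) (distrC z.2 y.2).
  have := normr_ge0 (y.1 - z.1); have := normr_ge0 (y.2 - z.2) => ? ? ? ?.
  by split => /=; lra.
have [D [DK KO]] : exists D : seq R2, (forall x, x \in D -> K x) /\
    forall y, K y -> exists2 x, x \in D & O x y.
  apply: (compact_seq_cover cK) => x Kx; apply: open_nbhs_nbhs; split => //.
  by split; rewrite /= subrr normr0; exact: (hr x).1.
pose S y := \sum_(x <- D) box_bump x (r x) y.
have sS : smooth S by apply: smooth_sum => x _; exact: smooth_box_bump.
pose K' := \big[setU/set0]_(x <- D) box x (r x).
have K'E : K' = \bigcup_(x in [set` D]) box x (r x) by rewrite bigcup_seq.
have Spos y : K y -> 0 < S y.
  move=> /KO[x xD [h1 h2]]; rewrite /S (big_rem x)//= ltr_pwDl//.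
    exact: box_bump_gt0.
  by rewrite sumr_ge0// => z _; exact: box_bump_ge0.
have [m m0 hm] : exists2 m : R, 0 < m & forall y, K y -> m <= S y.
  have [K0|K0] := pselect (K !=set0); last first.
    by exists 1 => // y Ky; exfalso; apply: K0; exists y.
  have cS : {within K, continuous S}.
    by apply: continuous_subspaceT; have [] := sS [::].
  have [y /set_mem Ky hy] := compact_EVT_min K0 cK cS.
  by exists (S y); [exact: Spos|move=> z Kz; apply: hy; rewrite inE].
exists S, K', m; split => //.
- split; first by apply: bigsetU_compact => x _; exact: compact_box.
  rewrite K'E => y [x xD]; apply: (hr x).2.
  exact: DK.
- move=> x; rewrite K'E => nK; rewrite /S big_seq big1// => y yD.
  by apply: box_bump_out => xy; apply: nK; exists y.
Qed.

End SmoothFunctions.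

(** * Bernstein polynomials of two variables *)

Section Bernstein.
Variable R : realType.
Local Notation R2 := (R * R)%type.

(* The expectation of [f] under the binomial law of parameters n and t, that
   is the Bernstein polynomial of [f]. *)
Fixpoint bernE (n : nat) (f : nat -> R) (t : R) : R :=
  if n is m.+1 then t * bernE m (f \o succn) t + (1 - t) * bernE m f t else f 0%N.

Lemma bernE_eq n f g t : (forall k, (k <= n)%N -> f k = g k) -> bernE n f t = bernE n g t.
Proof.
elim: n f g => [|n IH] f g fg /=; first exact: fg.
congr (_ * _ + _ * _); apply: IH => k kn; apply: fg => //.
exact: leqW.
Qed.

Lemma bernE_cst n c t : bernE n (fun=> c) t = c.
Proof.
elim: n => [//|n IH] /=; rewrite -[(fun=> c) \o succn]/(fun=> c) IH; ring.
Qed.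

Lemma bernED n f g t : bernE n (fun k => f k + g k) t = bernE n f t + bernE n g t.
Proof.
elim: n f g => [//|n IH] f g /=.
rewrite -[(fun k => f k + g k) \o succn]/(fun k => (f \o succn) k + (g \o succn) k).
rewrite !IH; ring.
Qed.

Lemma bernEZ n c f t : bernE n (fun k => c * f k) t = c * bernE n f t.
Proof.
elim: n f => [//|n IH] f /=.
rewrite -[(fun k => c * f k) \o succn]/(fun k => c * (f \o succn) k).
rewrite !IH; ring.
Qed.

Lemma bernE_le n f g t : 0 <= t <= 1 -> (forall k, (k <= n)%N -> f k <= g k) ->
  bernE n f t <= bernE n g t.
Proof.
move=> /andP[t0 t1]; elim: n f g => [|n IH] f g fg /=; first exact: fg.
apply: lerD; apply: ler_wpM2l; rewrite ?subr_ge0//; apply: IH => k kn; apply: fg => //.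
exact: leqW.
Qed.

Lemma bernE_abs n f t : 0 <= t <= 1 -> `|bernE n f t| <= bernE n (fun k => `|f k|) t.
Proof.
move=> t01; rewrite ler_norml -mulN1r -bernEZ; apply/andP; split.
  by apply: bernE_le => // k _; rewrite mulN1r lerNl -normrN ler_norm.
by apply: bernE_le => // k _; exact: ler_norm.
Qed.

(** The second moment of the binomial law about an arbitrary centre: variance plus squared bias. The
    recursion shifts the centre by one, so it has to be arbitrary. *)
Lemma bernE_var n c t :
  bernE n (fun k => (k%:R - c) ^+ 2) t = n%:R * t * (1 - t) + (n%:R * t - c) ^+ 2.
Proof.
elim: n c => [|n IH] c /=; first by ring.
rewrite (bernE_eq (g := fun k => (k%:R - (c - 1)) ^+ 2)); last first.
  by move=> k _ /=; rewrite -natr1; congr (_ ^+ 2); ring.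
by rewrite !IH -natr1; ring.
Qed.

Lemma is_derive_bernE n f (t : R) : is_derive (t : R) (1 : R) (bernE n f)
  (n%:R * bernE n.-1 (fun k => f k.+1 - f k) t).
Proof.
elim: n f => [|n IH] f.
  rewrite mul0r; exact: (is_derive_cst (f 0%N)).
have h1 := is_deriveM (is_derive_id (t : R) (1 : R)) (IH (f \o succn)).
have h0 : is_derive (t : R) (1 : R) (fun t => 1 - t) (-1).
  have := is_derive_quad1 0 (-1) 1 t; rewrite mulr0 mul0r add0r.
  by congr (is_derive _ _ _ _); apply/funext => s; ring.
have h2 := is_deriveM h0 (IH f).
have := is_deriveD h1 h2.
move=> h; apply: (is_derive_eq (h : is_derive (t : R) (1 : R) (bernE n.+1 f) _)).
rewrite /GRing.scale /= -natr1.
case: n {IH h1 h2 h} => [|n] /=; first by ring.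
have -> : bernE n (fun k => (f \o succn) k.+1 - (f \o succn) k) t =
  bernE n ((fun k => f k.+1 - f k) \o succn) t by apply: bernE_eq.
have e1 := bernED n.+1 (f \o succn) (fun k => - f k) t.
have e2 := bernEZ n.+1 (-1) f t.
rewrite (bernE_eq (n := n.+1) (f := fun k => -1 * f k) (g := fun k => - f k)) in e2; last first.
  by move=> k _; rewrite mulN1r.
rewrite e2 /= in e1.
have -> : t * bernE n ((f \o succn) \o succn) t + (1 - t) * bernE n (f \o succn) t =
  (t * bernE n ((fun k => f k.+1 - f k) \o succn) t +
   (1 - t) * bernE n (fun k => f k.+1 - f k) t) +
  (t * bernE n (f \o succn) t + (1 - t) * bernE n f t).
  by move: e1; rewrite /comp /=; lra.
by rewrite -natr1; ring.
Qed.

Lemma smooth_bernE n (F : nat -> R2 -> R) (T : R2 -> R) : (forall k, smooth (F k)) ->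
  smooth T -> smooth (fun p => bernE n (F ^~ p) (T p)).
Proof.
move=> + sT; elim: n F => [|n IH] F sF; first exact: sF.
have s1 : smooth (fun p : R2 => 1 - T p).
  have := smoothD (smooth_cst 1) (smoothM (smooth_cst (-1)) sT).
  by congr smooth; apply/funext => p; rewrite mulN1r.
exact: (smoothD (smoothM sT (IH (F \o succn) (fun k => sF k.+1))) (smoothM s1 (IH F sF))).
Qed.

Lemma partial_slice1 (f : R2 -> R) p d :
  is_derive (p.1 : R) (1 : R) (fun t => f (t, p.2)) d -> partial 0 f p = d.
Proof.
move=> [_ <-]; rewrite /partial /derive.
set F := (X in lim (X @ _)); set G := (X in _ = lim (X @ _)); suff -> : F = G by [].
apply/funext => h; rewrite /F /G /= /basis2 /=; congr (_ *: (f _ - f _)).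
  by apply: eq_pair2 => //=; rewrite /GRing.scale /= mulr0 add0r.
exact: surjective_pairing.
Qed.

Lemma partial_slice2 (f : R2 -> R) p d :
  is_derive (p.2 : R) (1 : R) (fun t => f (p.1, t)) d -> partial 1 f p = d.
Proof.
move=> [_ <-]; rewrite /partial /derive.
set F := (X in lim (X @ _)); set G := (X in _ = lim (X @ _)); suff -> : F = G by [].
apply/funext => h; rewrite /F /G /= /basis2 /=; congr (_ *: (f _ - f _)).
  by apply: eq_pair2 => //=; rewrite /GRing.scale /= mulr0 add0r.
exact: surjective_pairing.
Qed.

Definition tob (M x : R) : R := (x + M) / (2 * M).

Definition bern2 (M : R) (n : nat) (f : nat -> nat -> R) (p : R2) : R :=
  bernE n (fun i => bernE n (f i) (tob M p.2)) (tob M p.1).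

Let is_derive_tob M (t : R) : is_derive (t : R) (1 : R) (tob M) (2 * M)^-1.
Proof.
have := is_derive_quad1 0 (2 * M)^-1 (M / (2 * M)) t; rewrite mulr0 mul0r add0r.
by congr (is_derive _ _ _ _); apply/funext => s; rewrite /tob; ring.
Qed.

Lemma smooth_bern2 M n f : smooth (bern2 M n f).
Proof.
have s1 : smooth (fun p : R2 => tob M p.1).
  have := smooth_affine (2 * M)^-1 0 (M / (2 * M)).
  by congr smooth; apply/funext => p; rewrite /tob; ring.
have s2 : smooth (fun p : R2 => tob M p.2).
  have := smooth_affine 0 (2 * M)^-1 (M / (2 * M)).
  by congr smooth; apply/funext => p; rewrite /tob; ring.
apply: (@smooth_bernE n (fun i p => bernE n (f i) (tob M p.2)) _ _ s1) => i.
by apply: (@smooth_bernE n (fun j p => f i j) _ _ s2) => j; exact: smooth_cst.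
Qed.

(** Fubini for the two binomial averages; it reduces the second partial derivative to the first one
    with the variables exchanged. *)
Lemma bernE_exchange n m (f : nat -> nat -> R) s t :
  bernE n (fun i => bernE m (f i) s) t = bernE m (fun j => bernE n (f ^~ j) t) s.
Proof.
elim: n f => [//|n IH] f.
rewrite /= (IH f) -[(fun i => _) \o succn]/(fun i => bernE m (f i.+1) s).
rewrite (IH (f \o succn)) -!bernEZ -bernED; exact: bernE_eq.
Qed.

Lemma partial0_bern2 M n f p : partial 0 (bern2 M n.+1 f) p =
  n.+1%:R / (2 * M) * bernE n (fun i => bernE n.+1 (fun j => f i.+1 j - f i j) (tob M p.2)) (tob M p.1).
Proof.
apply: partial_slice1.
have h := @is_derive1_comp R (bernE n.+1 (fun i => bernE n.+1 (f i) (tob M p.2))) (tob M) p.1 _ _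
  (is_derive_bernE _ _ _) (is_derive_tob M p.1).
apply: (is_derive_eq (h : is_derive (p.1 : R) (1 : R) (fun t => bern2 M n.+1 f (t, p.2)) _)).
rewrite mulrAC; congr (_ * _); apply: bernE_eq => k _.
have -> : bernE n.+1 (fun j => f k.+1 j - f k j) (tob M p.2) =
  bernE n.+1 (fun j => f k.+1 j + -1 * f k j) (tob M p.2).
  by apply: bernE_eq => j _; rewrite mulN1r.
by rewrite (bernED _ (f k.+1)) bernEZ mulN1r.
Qed.

Lemma partial1_bern2 M n f p : partial 1 (bern2 M n.+1 f) p =
  n.+1%:R / (2 * M) * bernE n (fun j => bernE n.+1 (fun i => f i j.+1 - f i j) (tob M p.1)) (tob M p.2).
Proof.
rewrite -(@partial0_bern2 M n (fun i j => f j i) (p.2, p.1)).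
apply: partial_slice2.
have h := @is_derive1_comp R (bernE n.+1 (fun i => bernE n.+1 (fun j => f j i) (tob M p.1))) (tob M) p.2 _ _
  (is_derive_bernE _ _ _) (is_derive_tob M p.2).
have E : (fun t => bern2 M n.+1 f (p.1, t)) = bernE n.+1 (fun i => bernE n.+1 (fun j => f j i) (tob M p.1)) \o tob M.
  by apply/funext => t; exact: bernE_exchange.
rewrite E; apply: (is_derive_eq h); apply/esym; exact: partial_slice1.
Qed.

(** Chebyshev's argument as a second moment bound. Differentiation lowers the order of one binomial
    law by one while the nodes keep the spacing 1 / N; the hypotheses on (n t - N t)^2 and (m s - N
    s)^2 absorb this shift of the means, and both moments stay below N. *)
Lemma bernE2_cheb n m (N : R) (g : nat -> nat -> R) (e C s t : R) :
  0 <= s <= 1 -> 0 <= t <= 1 -> 0 < N -> n%:R <= N -> m%:R <= N ->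
  (n%:R * t - N * t) ^+ 2 <= N - n%:R -> (m%:R * s - N * s) ^+ 2 <= N - m%:R ->
  0 <= C ->
  (forall i j, (i <= n)%N -> (j <= m)%N ->
    `|g i j| <= e + C * ((i%:R - N * t) ^+ 2 + (j%:R - N * s) ^+ 2)) ->
  `|bernE n (fun i => bernE m (g i) s) t| <= e + C * (2 * N).
Proof.
move=> s01 t01 N0 nN mN hn hm C0 hg.
have i2 (x : R) : 0 <= x <= 1 -> 0 <= x * (1 - x) <= 1.
  by move=> /andP[x0 x1]; apply/andP; split; nra.
have hi : bernE n (fun k => (k%:R - N * t) ^+ 2) t <= N.
  rewrite bernE_var; have /andP[? ?] := i2 _ t01.
  by have : 0 <= (n%:R : R) by []; rewrite -mulrA; nra.
have hj : bernE m (fun k => (k%:R - N * s) ^+ 2) s <= N.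
  rewrite bernE_var; have /andP[? ?] := i2 _ s01.
  by have : 0 <= (m%:R : R) by []; rewrite -mulrA; nra.
have hin i : (i <= n)%N -> `|bernE m (g i) s| <= (e + C * N) + C * (i%:R - N * t) ^+ 2.
  move=> ni; apply: (le_trans (bernE_abs _ _ s01)).
  pose h j := (e + C * (i%:R - N * t) ^+ 2) + C * (j%:R - N * s) ^+ 2.
  apply: (@le_trans _ _ (bernE m h s)); last first.
    rewrite /h bernED bernE_cst bernEZ.
    by have := ler_wpM2l C0 hj; lra.
  apply: bernE_le => // j jm; apply: le_trans (hg i j ni jm) _.
  by rewrite /h; lra.
apply: (le_trans (bernE_abs _ _ t01)).
apply: (@le_trans _ _ (bernE n (fun i => (e + C * N) + C * (i%:R - N * t) ^+ 2) t)).
  exact: bernE_le.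
rewrite bernED bernE_cst bernEZ.
by have := ler_wpM2l C0 hi; lra.
Qed.

(** Turns a Lipschitz bound, linear in the distance, into the form e plus a multiple of the squared
    distance that the second moment bound takes. *)
Lemma amgm (e A x : R) : 0 < e -> A * x <= e / 2 + A ^+ 2 / (2 * e) * x ^+ 2.
Proof.
move=> e0; rewrite -subr_ge0.
have -> : e / 2 + A ^+ 2 / (2 * e) * x ^+ 2 - A * x = (e - A * x) ^+ 2 / (2 * e).
  by field; rewrite gt_eqF.
by rewrite divr_ge0 ?sqr_ge0// mulr_ge0// ltW.
Qed.

Lemma bernE2_small n n1 n2 (g : nat -> nat -> R) (e K s t : R) :
  0 <= s <= 1 -> 0 <= t <= 1 -> 0 <= K ->
  (n <= n1 <= n.+1)%N -> (n <= n2 <= n.+1)%N ->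
  (forall i j, (i <= n1)%N -> (j <= n2)%N -> `|g i j| <=
    e + K * ((i%:R / n.+1%:R - t) ^+ 2 + (j%:R / n.+1%:R - s) ^+ 2)) ->
  `|bernE n1 (fun i => bernE n2 (g i) s) t| <= e + 2 * K / n.+1%:R.
Proof.
move=> s01 t01 K0 h1 h2 hg; set N : R := n.+1%:R.
have N0 : 0 < N by rewrite ltr0n.
have aux k (x : R) : (n <= k <= n.+1)%N -> 0 <= x <= 1 ->
    (k%:R <= N) * ((k%:R * x - N * x) ^+ 2 <= N - k%:R).
  move=> /andP[nk kn] /andP[x0 x1].
  have -> : N = k%:R + (n.+1 - k)%N%:R by rewrite -natrD subnKC.
  have : (n.+1 - k <= 1)%N by rewrite leq_subLR addn1.
  case: (n.+1 - k)%N => [|[|//]] _ /=; split; rewrite ?lerDl//.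
    by rewrite addr0 !subrr expr0n.
  rewrite mulrDl mul1r opprD addNKr sqrrN addrAC subrr add0r; nra.
have -> : e + 2 * K / N = e + K / N ^+ 2 * (2 * N) by field; rewrite gt_eqF.
have CN0 : 0 <= K / N ^+ 2 by rewrite divr_ge0// sqr_ge0.
apply: (@bernE2_cheb n1 n2 N g _ _ s t s01 t01 N0 (aux _ _ h1 t01).1 (aux _ _ h2 s01).1
  (aux _ _ h1 t01).2 (aux _ _ h2 s01).2 CN0).
move=> i j i1 j2; have := hg i j i1 j2.
suff -> : K * ((i%:R / N - t) ^+ 2 + (j%:R / N - s) ^+ 2) =
  K / N ^+ 2 * ((i%:R - N * t) ^+ 2 + (j%:R - N * s) ^+ 2) by [].
by field; rewrite gt_eqF.
Qed.

Lemma bernE2_sub n1 n2 (g : nat -> nat -> R) (c d s t : R) :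
  c * bernE n1 (fun i => bernE n2 (g i) s) t - d =
  bernE n1 (fun i => bernE n2 (fun j => c * g i j - d) s) t.
Proof.
have h n (f : nat -> R) x : bernE n (fun i => c * f i - d) x = c * bernE n f x - d.
  by rewrite (bernED n (fun i => c * f i) (fun=> - d)) bernEZ bernE_cst.
by rewrite -h; apply: bernE_eq => i _; rewrite h.
Qed.

Definition node (M : R) (n i : nat) : R := - M + 2 * M * (i%:R / n.+1%:R).

Definition samples (M : R) (w : R2 -> R) (n i j : nat) : R :=
  w (node M n i, node M n j).

Lemma cvg_near_inv (u : nat -> R) (l : R) :
  (forall e : R, 0 < e -> exists A B : R, forall n : nat,
    A <= n.+1%:R -> `|u n - l| <= e + B / n.+1%:R) -> u @ \oo --> l.
Proof.
move=> h; apply/cvgrPdist_le => e e0.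
have [A [B hAB]] := h (e / 2) (divr_gt0 e0 (ltr0n _ 2)).
near=> n; have nA : A <= n%:R by near: n; exact: nbhs_infty_ger.
have nB : 2 * B / e <= n%:R by near: n; exact: nbhs_infty_ger.
have N1 : (n%:R : R) + 1 = n.+1%:R by rewrite natr1.
have n0 : 0 <= (n%:R : R) by [].
rewrite distrC; apply: le_trans (hAB n _) _; first by lra.
rewrite [leRHS](splitr e) lerD2l.
rewrite ler_pdivrMr; last by lra.
by move: nB; rewrite ler_pdivrMr// -N1; lra.
Unshelve. all: by end_near.
Qed.

Section Approx.
Variables (M : R) (w : R2 -> R) (L B : R).
Hypotheses (M0 : 0 < M) (L0 : 0 <= L) (lw : Lip L setT w) (bw : forall x, `|w x| <= B).

Let sq (p : R2) := `|p.1| <= M /\ `|p.2| <= M.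

Let tob01 (x : R) : `|x| <= M -> 0 <= tob M x <= 1.
Proof.
move: (M0) (L0) => M0' L0'.
rewrite ler_norml => /andP[h1 h2]; rewrite /tob; apply/andP; split.
  by rewrite divr_ge0//; lra.
by rewrite ler_pdivrMr; lra.
Qed.

Lemma bern2_bound n (p : R2) : sq p -> `|bern2 M n.+1 (samples M w n) p| <= B.
Proof.
move: (M0) (L0) => M0' L0'.
move=> [/tob01 t /tob01 s]; rewrite -(bernE_cst n.+1 B (tob M p.1)).
apply: (le_trans (bernE_abs _ _ t)); apply: bernE_le => // i _.
rewrite -(bernE_cst n.+1 B (tob M p.2)).
by apply: (le_trans (bernE_abs _ _ s)); apply: bernE_le => // j _; exact: bw.
Qed.

Lemma sub_node n i (x : R) : node M n i - x = 2 * M * (i%:R / n.+1%:R - tob M x).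
Proof. by rewrite /node /tob; field; rewrite gt_eqF//= gt_eqF. Qed.

Lemma nodeS n i : node M n i.+1 - node M n i = 2 * M / n.+1%:R.
Proof. by rewrite /node -[i.+1%:R]natr1; field; rewrite addrC natr1 pnatr_eq0. Qed.

Lemma bern2_cvg (p : R2) : sq p -> (fun n => bern2 M n.+1 (samples M w n) p) @ \oo --> w p.
Proof.
move: (M0) (L0) => M0' L0'.
move=> [/tob01 t /tob01 s]; apply: cvg_near_inv => e e0.
pose K := (2 * M * L) ^+ 2 / (2 * e).
exists 0, (2 * K) => n _.
have K0 : 0 <= K by rewrite divr_ge0 ?sqr_ge0//; lra.
have := @bernE2_small n n.+1 n.+1 (fun i j => 1 * samples M w n i j - w p) e K _ _ s t K0.
rewrite leqnSn leqnn => /(_ isT isT).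
rewrite -(bernE2_sub n.+1 n.+1 (samples M w n)) mul1r; apply => i j _ _.
rewrite mul1r (le_trans (lw _ _))// /dist1 /= !sub_node.
set X := _ / _ - _; set Y := _ / _ - _.
have M20 : 0 <= 2 * M by lra.
rewrite !(normrM (2 * M)) (ger0_norm M20).
have := @amgm e (2 * M * L) `|X| e0; have := @amgm e (2 * M * L) `|Y| e0.
rewrite !real_normK ?num_real// -/K; lra.
Qed.

Let diff_bound n i j :
  `|n.+1%:R / (2 * M) * (samples M w n i.+1 j - samples M w n i j)| <= L.
Proof.
move: (M0) (L0) => M0' L0'.
have c0 : 0 < n.+1%:R / (2 * M) by rewrite divr_gt0//; lra.
rewrite normrM (gtr0_norm c0).
have := @lw (node M n i.+1, node M n j) (node M n i, node M n j) I I.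
have N0 : 0 < (n.+1%:R : R) by rewrite ltr0n.
have d0 : 0 <= 2 * M / n.+1%:R by rewrite divr_ge0//; lra.
rewrite /dist1 /= nodeS subrr normr0 addr0 (ger0_norm d0).
move=> h; apply: (le_trans (ler_wpM2l (ltW c0) h)).
suff -> : n.+1%:R / (2 * M) * (L * (2 * M / n.+1%:R)) = L by [].
by move: (n.+1%:R) N0 => N N0; field; rewrite !gt_eqF.
Qed.

Lemma bern_diff_bound n s t : 0 <= s <= 1 -> 0 <= t <= 1 ->
  `|n.+1%:R / (2 * M) * bernE n (fun i =>
      bernE n.+1 (fun j => samples M w n i.+1 j - samples M w n i j) s) t| <= L.
Proof.
move: (M0) (L0) => M0' L0'.
move=> s01 t01; rewrite -[X in `|X|]subr0.
rewrite (@bernE2_sub n n.+1 (fun i j => samples M w n i.+1 j - samples M w n i j)).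
rewrite -(bernE_cst n L t).
apply: (le_trans (bernE_abs _ _ t01)); apply: bernE_le => // i _.
rewrite -(bernE_cst n.+1 L s).
apply: (le_trans (bernE_abs _ _ s01)); apply: bernE_le => // j _.
by rewrite subr0; exact: diff_bound.
Qed.

(** The quotients between nodes near [p] are within [e] of [b.1] by strict differentiability. Those
    farther away are bounded by the Lipschitz constant, hence by a multiple [K] of the squared
    distance, which contributes only 2 K / n.+1. *)
Lemma bern_diff_cvg (p b : R2) : sq p -> sdiff w p b ->
  (fun n => n.+1%:R / (2 * M) * bernE n (fun i =>
      bernE n.+1 (fun j => samples M w n i.+1 j - samples M w n i j) (tob M p.2))
      (tob M p.1)) @ \oo --> b.1.
Proof.
move: (M0) (L0) => M0' L0'.
move=> [/tob01 t /tob01 s] dw; apply: cvg_near_inv => e e0.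
have [del del0 hd] := dw e e0.
(* If X^2 + Y^2 < r then |X| + |Y| < del / (4 M), so the node, at distance 2 M (|X| + |Y|), is
   within del / 2 of [p]. *)
pose r := del ^+ 2 / (32 * M ^+ 2).
have r0 : 0 < r by rewrite divr_gt0 ?exprn_gt0// mulr_gt0 ?exprn_gt0.
pose K := (L + `|b.1|) / r.
have K0 : 0 <= K by rewrite divr_ge0 ?addr_ge0// ltW.
(* From this bound on, the spacing 2 M / n.+1 is at most 2 del / 5, so the next node is within [del]
   of [p] as well. *)
exists (5 * M / del), (2 * K) => n nA.
have N0 : 0 < (n.+1%:R : R) by rewrite ltr0n.
have nd : 2 * M / n.+1%:R < del / 2.
  by rewrite ltr_pdivrMr//; move: nA; rewrite ler_pdivrMr//; lra.
have := @bernE2_small n n n.+1 (fun i j => n.+1%:R / (2 * M) *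
  (samples M w n i.+1 j - samples M w n i j) - b.1) e K _ _ s t K0.
rewrite leqnSn !leqnn => /(_ isT isT).
rewrite -(bernE2_sub n n.+1 (fun i j => samples M w n i.+1 j - samples M w n i j)).
apply => i j _ _.
set X := _ / _ - _; set Y := _ / _ - _.
have M20 : 0 <= 2 * M by lra.
have [XY|XY] := leP r (X ^+ 2 + Y ^+ 2).
  apply: (le_trans (ler_normB _ _)); have := diff_bound n i j => hdf.
  have : L + `|b.1| <= K * (X ^+ 2 + Y ^+ 2); last by lra.
  by rewrite /K mulrAC ler_pdivlMr// ler_wpM2l// addr_ge0.
have XYd : 2 * M * (`|X| + `|Y|) < del / 2.
  rewrite ltNge; apply/negP => h.
  have : (del / 2) ^+ 2 <= (2 * M * (`|X| + `|Y|)) ^+ 2.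
    by rewrite ler_sqr// nnegrE ?mulr_ge0 ?addr_ge0//; lra.
  have hxy : (`|X| + `|Y|) ^+ 2 <= 2 * (X ^+ 2 + Y ^+ 2).
    rewrite -(real_normK (num_real X)) -(real_normK (num_real Y)).
    have := sqr_ge0 (`|X| - `|Y|); rewrite sqrrB sqrrD; lra.
  move: XY; rewrite /r ltr_pdivlMr ?mulr_gt0 ?exprn_gt0// => XY.
  rewrite [(2 * M * _) ^+ 2]exprMn => h1.
  have := ler_wpM2l (sqr_ge0 (2 * M)) hxy.
  move: h1 XY; rewrite [(2 * M) ^+ 2]exprMn [(del / 2) ^+ 2]exprMn.
  by have : 0 < del ^+ 2 by [rewrite exprn_gt0]; lra.
have d2 : dist1 p (node M n i, node M n j) < del / 2.
  by rewrite dist1C /dist1 /= !sub_node !(normrM (2 * M)) (ger0_norm M20) -mulrDr.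
have d1 : dist1 p (node M n i.+1, node M n j) < del.
  apply: (le_lt_trans (dist1_tri (node M n i, node M n j) _ _)).
  rewrite [X in _ + X]dist1C {2}/dist1 /= nodeS subrr normr0 addr0 ger0_norm.
    by rewrite (splitr del) ltrD.
  by rewrite divr_ge0.
have d2' : dist1 p (node M n i, node M n j) < del by lra.
have := hd _ _ d1 d2'; rewrite /dot /dist1 /= nodeS subrr normr0 mulr0 !addr0.
rewrite (ger0_norm (divr_ge0 M20 (ltW N0))) => h.
have c0 : 0 < n.+1%:R / (2 * M) by rewrite divr_gt0//; lra.
have KX : 0 <= K * (X ^+ 2 + Y ^+ 2) by rewrite mulr_ge0// addr_ge0 ?sqr_ge0.
apply: (@le_trans _ _ e); last by lra.
have -> : n.+1%:R / (2 * M) * (samples M w n i.+1 j - samples M w n i j) - b.1 =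
  n.+1%:R / (2 * M) * (samples M w n i.+1 j - samples M w n i j - b.1 * (2 * M / n.+1%:R)).
  by move: (samples _ _ _ _ _) (samples _ _ _ _ _) (n.+1%:R) N0 => ? ? ? ?;
    field; rewrite !gt_eqF.
rewrite normrM (gtr0_norm c0); apply: (le_trans (ler_wpM2l (ltW c0) h)).
suff -> : n.+1%:R / (2 * M) * (e * (2 * M / n.+1%:R)) = e by [].
by move: (n.+1%:R) N0 => N N0; field; rewrite !gt_eqF.
Qed.

End Approx.

Let swap (w : R2 -> R) (p : R2) := w (p.2, p.1).

Lemma bern2_partial_bound (M : R) (w : R2 -> R) (L : R) n (p : R2) j :
  0 < M -> 0 <= L -> Lip L setT w -> `|p.1| <= M -> `|p.2| <= M ->
  `|partial j (bern2 M n.+1 (samples M w n)) p| <= L.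
Proof.
move=> M0 L0 lw p1 p2.
have h (x : R) : `|x| <= M -> 0 <= tob M x <= 1.
  rewrite ler_norml => /andP[h1 h2]; rewrite /tob; apply/andP; split.
    by rewrite divr_ge0//; lra.
  by rewrite ler_pdivrMr; lra.
have [->|/ord2P ->] := eqVneq j 0.
  by rewrite partial0_bern2; apply: (@bern_diff_bound M w) => //; exact: h.
rewrite partial1_bern2; apply: (@bern_diff_bound M (swap w)) => //; try exact: h.
by move=> y z _ _; apply: (le_trans (lw _ _ I I)); rewrite /dist1 /= addrC.
Qed.

Lemma bern2_partial_cvg (M : R) (w : R2 -> R) (L : R) (p b : R2) j :
  0 < M -> 0 <= L -> Lip L setT w -> `|p.1| <= M -> `|p.2| <= M -> sdiff w p b ->
  (fun n => partial j (bern2 M n.+1 (samples M w n)) p) @ \oo --> cmp j b.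
Proof.
move=> M0 L0 lw p1 p2 dw.
have [->|/ord2P ->] := eqVneq j 0.
  under eq_fun do rewrite partial0_bern2.
  exact: (@bern_diff_cvg M w L M0 L0 lw p b (conj p1 p2) dw).
under eq_fun do rewrite partial1_bern2.
apply: (@bern_diff_cvg M (swap w) L M0 L0 _ (p.2, p.1) (b.2, b.1) (conj p2 p1)).
  by move=> y z _ _; apply: (le_trans (lw _ _ I I)); rewrite /dist1 /= addrC.
move=> e e0; have [d d0 hd] := dw e e0; exists d => // y z py pz.
have e1 a c : dist1 (a : R2) (c : R2) = dist1 (a.2, a.1) (c.2, c.1) by rewrite /dist1 /= addrC.
rewrite (e1 y z); apply: le_trans (hd _ _ _ _); last 2 first.
- by move: py; rewrite e1; case: (p).
- by move: pz; rewrite e1; case: (p).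
by rewrite /dot /= [X in _ - X]addrC.
Qed.

End Bernstein.

(** * Test functions that approximate a Lipschitz function of compact support *)

Section LipschitzApproximation.
Variable R : realType.
Local Notation R2 := (R * R)%type.

Lemma continuous_bounded2 (f : R2 -> R) (K : set R2) : compact K -> continuous f ->
  exists2 B : R, 0 <= B & forall x, K x -> `|f x| <= B.
Proof.
move=> cK cf; have cfK : compact (f @` K).
  by apply: continuous_compact => //; exact: continuous_subspaceT.
have [M [Mr hM]] := compact_bounded cfK.
exists (`|M| + 1); first by rewrite addr_ge0.
move=> x Kx; apply: (hM (`|M| + 1)); last by exists x.
by rewrite (le_lt_trans (ler_norm _))// ltrDl.
Qed.

Lemma compact_in_square (K : set R2) : compact K -> exists2 M : R, 0 < M &
  forall p, K p -> `|p.1| <= M /\ `|p.2| <= M.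
Proof.
move=> cK.
have [B1 B10 h1] := continuous_bounded2 cK (@continuous_fst2 R).
have [B2 B20 h2] := continuous_bounded2 cK (@continuous_snd2 R).
exists (B1 + B2 + 1); first by lra.
by move=> p Kp; have := h1 p Kp; have := h2 p Kp; split; lra.
Qed.

Lemma smooth_LipB (f : R2 -> R) (M : R) : smooth f -> exists2 L : R, 0 <= L &
  Lip L (box (0, 0) M) f /\
  forall p, box (0, 0) M p -> `|f p| <= L /\ forall j, `|partial j f p| <= L.
Proof.
move=> sf; have cb := @compact_box R (0, 0) M.
have [B B0 hB] := continuous_bounded2 cb (sf [::]).1.
have [B1 B10 hB1] := continuous_bounded2 cb (sf [:: 0]).1.
have [B2 B20 hB2] := continuous_bounded2 cb (sf [:: 1]).1.
exists (B + B1 + B2); first by lra.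
split; last first.
  move=> p hp; split; first by have := hB p hp; rewrite /=; lra.
  move=> j; have [->|/ord2P ->] := eqVneq j 0.
    by have := hB1 p hp; rewrite /=; lra.
  by have := hB2 p hp; rewrite /=; lra.
move=> y z [/=]; rewrite !in_itv/= => /andP[y1 y1'] /andP[y2 y2'] [/=].
rewrite !in_itv/= => /andP[z1 z1'] /andP[z2 z2'].
have [c1 [c2 [/andP[h1 h1'] /andP[h2 h2'] ->]]] := smooth_increment y z sf.
move: h1 h1' h2 h2'; rewrite !ge_min !le_max => h1 h1' h2 h2'.
have e1 : `|partial 0 f (c1, y.2)| <= B1.
  apply: hB1; split; rewrite /= in_itv/=; apply/andP;
  by split; move: y1 y1' z1 z1' y2 y2' h1 h1'; clear; lra.
have e2 : `|partial 1 f (z.1, c2)| <= B2.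
  apply: hB2; split; rewrite /= in_itv/=; apply/andP;
  by split; move: y2 y2' z2 z2' z1 z1' h2 h2'; clear; lra.
rewrite /dist1 (mulrDr (B + B1 + B2)) (le_trans (ler_normD _ _))// !normrM.
by apply: lerD; apply: ler_wpM2r => //; move: e1 e2 B0 B10 B20; clear; lra.
Qed.

Lemma sdiff_zero_off (u : R2 -> R) (K : set R2) x : closed K -> (forall y, ~ K y -> u y = 0) ->
  ~ K x -> sdiff u x (0, 0).
Proof.
move=> cK u0 nKx.
have [r r0 hr] := (open_dist1P (~` K)).1 (closed_openC cK) x nKx.
apply: (@sdiff_loc _ (fun=> 0) u x _ r r0) (sdiff_cst 0 x) => y xy.
by rewrite u0//; exact: hr.
Qed.

(* The approximants are S B_n(u / S), with S a bump function which is positive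
   on K and B_n(w) the Bernstein polynomials of w on a square. *)
Lemma lip_approx (U K : set R2) (u : R2 -> R) (L : R) :
  open U -> compact K -> K `<=` U -> 0 <= L -> Lip L setT u -> (forall x, ~ K x -> u x = 0) ->
  exists (theta : nat -> R2 -> R) (C : R), [/\ 0 <= C,
    forall n, test_fun U (theta n),
    forall n x, `|theta n x| <= C /\ forall j, `|partial j (theta n) x| <= C,
    forall x, (theta n x) @[n --> \oo] --> u x &
    forall x a, sdiff u x a -> forall j, partial j (theta n) x @[n --> \oo] --> cmp j a].
Proof.
move=> oU cK KU L0 lu u0.
have [S [K' [m [sS [cK' K'U] S0 m0 mS]]]] := bump_exists cK oU KU.
have clK := compact_closed2 cK; have clK' := compact_closed2 cK'.
have [M M0 hM] := compact_in_square cK'.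
have [LS LS0 [lS bS]] := smooth_LipB M sS.
have KK' x : K x -> K' x.
  move=> Kx; apply: contrapT => /S0 Sx0; have := mS x Kx; rewrite Sx0; lra.
have K'b x : K' x -> box (0, 0) M x.
  move=> /hM[h1 h2]; split; rewrite /= in_itv/= sub0r add0r -ler_norml//.
pose w x := if `[< K x >] then u x / S x else 0.
have wK x : K x -> w x = u x / S x by move=> Kx; rewrite /w asboolT.
have wNK x : ~ K x -> w x = 0 by move=> Kx; rewrite /w asboolF.
have [Lw [Bw [Lw0 Bw0 lw bw]]] : LipB K w.
  apply: (@LipB_ext _ _ (fun x => u x * (S x)^-1)); first by move=> x /wK ->.
  apply: LipBM.
    exists L, (`|u (0, 0)| + L * (2 * M)); split => //; first 1 last.
    - by move=> y z _ _; exact: lu.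
    - move=> y /KK'/hM[h1 h2].
      have := lu y (0, 0) I I; rewrite /dist1 !subr0 => h.
      have := ler_normD (u y - u (0, 0)) (u (0, 0)); rewrite subrK => h'.
      have : L * (`|y.1| + `|y.2|) <= L * (2 * M) by rewrite ler_wpM2l//; lra.
      lra.
    - by rewrite addr_ge0// mulr_ge0// mulr_ge0// ltW.
  apply: (LipBV m0) => //; exists LS, LS; split => //.
    by move=> y z /KK'/K'b Ky /KK'/K'b Kz; exact: lS.
  by move=> y /KK'/K'b/bS[].
(* Across the boundary of [K] a lower bound on S at [y] is enough: as u z = 0, the difference is |u
   y - u z| / S y. *)
have hout y z : K y -> ~ K z -> `|w y - w z| <= L / m * dist1 y z.
  move=> Ky Kz; rewrite (wNK _ Kz) (wK _ Ky) subr0 normrM normfV mulrAC.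
  have my := mS y Ky; have Sy : 0 < S y by lra.
  rewrite (gtr0_norm Sy) ler_pdivrMr//.
  have := lu y z I I; rewrite (u0 _ Kz) subr0 => h; apply: (le_trans h).
  rewrite [leRHS](_ : _ = L * dist1 y z * S y / m); last by ring.
  rewrite ler_pdivlMr//; apply: ler_wpM2l => //.
  by rewrite mulr_ge0// dist1_ge0.
pose W := Lw + L / m.
have Lm0 : 0 <= L / m by rewrite divr_ge0// ltW.
have W0 : 0 <= W by rewrite addr_ge0.
have lwT : Lip W setT w.
  move=> y z _ _; have dyz := dist1_ge0 y z.
  have [Ky|Ky] := pselect (K y); have [Kz|Kz] := pselect (K z).
  - by apply: (le_trans (lw _ _ Ky Kz)); rewrite ler_wpM2r// lerDl.
  - by apply: (le_trans (hout _ _ Ky Kz)); rewrite ler_wpM2r// lerDr.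
  - rewrite distrC dist1C; apply: (le_trans (hout _ _ Kz Ky)).
    by rewrite ler_wpM2r ?dist1_ge0// lerDr.
  - by rewrite !wNK// subrr normr0 mulr_ge0.
have bwT x : `|w x| <= Bw.
  by have [/bw//|/wNK ->] := pselect (K x); rewrite normr0.
have uE x : u x = S x * w x.
  have [Kx|Kx] := pselect (K x); last by rewrite u0// wNK// mulr0.
  by rewrite (wK _ Kx) mulrC divfK// gt_eqF// (lt_le_trans m0)// mS.
pose b n := bern2 M n.+1 (samples M w n).
have sb n : smooth (b n) by exact: smooth_bern2.
have sSb n : smooth (fun x => S x * b n x) by exact: (smoothM sS (sb n)).
have dS j x : derivable S x (basis2 R j) by exact: (sS [::]).2.
have db n j x : derivable (b n) x (basis2 R j) by exact: (sb n [::]).2.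
have out n x : ~ K' x -> S x * b n x = 0 /\ forall j, partial j (fun x => S x * b n x) x = 0.
  move=> Kx; split; first by rewrite S0// mul0r.
  move=> j; have z0 y : ~ K' y -> S y * b n y = 0 by move=> /S0 ->; rewrite mul0r.
  have /sdiff_partial -> := @sdiff_zero_off (fun x => S x * b n x) K' x clK' z0 Kx.
  by rewrite /cmp; case: eqP.
exists (fun n x => S x * b n x), (LS * W + LS * Bw + LS * Bw).
have C0 : 0 <= LS * W + LS * Bw + LS * Bw by rewrite !addr_ge0// mulr_ge0.
split; first exact: C0.
- move=> n; split; first exact: sSb.
  by exists K'; split; [exact: cK'|exact: K'U|move=> x /(out n)[]].
- move=> n x; have [Kx|/out oKx] := pselect (K' x); last first.
    have [-> h] := oKx n; rewrite normr0; split => // j; by rewrite h normr0.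
  have [x1 x2] := hM _ Kx; have [S1 S2] := bS x (K'b _ Kx).
  have bb : `|b n x| <= Bw by exact: bern2_bound.
  have h1 : `|S x * b n x| <= LS * Bw by rewrite normrM ler_pM.
  have LW0 : 0 <= LS * W by rewrite mulr_ge0.
  have LB0 : 0 <= LS * Bw by rewrite mulr_ge0.
  split; first by apply: (le_trans h1); rewrite lerDr addr_ge0.
  move=> j; rewrite partialM//.
  have pb : `|partial j (b n) x| <= W by exact: (@bern2_partial_bound _ M w).
  apply: (le_trans (ler_normD _ _)); rewrite !normrM.
  have : `|S x| * `|partial j (b n) x| <= LS * W by exact: ler_pM.
  have : `|b n x| * `|partial j S x| <= Bw * LS by exact: ler_pM.
  lra.
- move=> x; have [Kx|nKx] := pselect (K' x); last first.
    rewrite (u0 x); last by move/KK'.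
    by under eq_fun do rewrite (out _ _ nKx).1; exact: cvg_cst.
  rewrite uE; apply: cvgM; first exact: cvg_cst.
  by have [x1 x2] := hM _ Kx; exact: (@bern2_cvg _ M w W).
- move=> x a da j; have [Kx|nKx] := pselect (K' x); last first.
    have nK : ~ K x by move/KK'.
    have := sdiff_partial j da; rewrite (sdiff_partial j (sdiff_zero_off clK u0 nK)) => <-.
    under eq_fun do rewrite (out _ _ nKx).2.
    rewrite (_ : cmp j (0, 0) = 0); first exact: cvg_cst.
    by rewrite /cmp; case: eqP.
  have [x1 x2] := hM _ Kx.
  (* Near a point of [K], [w] is the quotient u / S inside and outside of [K], because u vanishes
     outside; away from the closed set [K], [w] is locally zero. *)
  have [c dc] : exists c, sdiff w x c.
    have [xK|xK] := pselect (K x); last first.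
      by exists (0, 0); apply: (sdiff_zero_off clK) => // y; exact: wNK.
    have Sx : 0 < S x by rewrite (lt_le_trans m0)// mS.
    have hS := smooth_sdiff x sS.
    have [d d0 hd] := sdiff_cont hS (divr_gt0 Sx (ltr0n _ 2)).
    have hV := sdiffV (lt0r_neq0 Sx) hS.
    have := sdiffM da hV; set c := (X in sdiff _ _ X) => h; exists c.
    apply: sdiff_loc d0 _ h => y xy; rewrite /=.
    have [yK|yK] := pselect (K y); first by rewrite wK.
    by rewrite wNK// u0// mul0r.
  have hS := smooth_sdiff x sS.
  have h := sdiffM hS dc.
  rewrite -(sdiff_partial j da) (_ : u = fun y => S y * w y); last by apply/funext.
  rewrite (sdiff_partial j h).
  under eq_fun do rewrite partialM//.
  rewrite (_ : cmp j _ = S x * cmp j c + w x * partial j S x); last first.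
    by rewrite /cmp /= /GRing.scale /=; case: ifPn => [/eqP ->//|/ord2P ->].
  apply: cvgD.
    by apply: cvgM; [exact: cvg_cst|exact: (@bern2_partial_cvg _ M w W)].
  apply: cvgM; last exact: cvg_cst.
  exact: (@bern2_cvg _ M w W).
Qed.

End LipschitzApproximation.

(** * Curved elements *)

Lemma ord3P (k : 'I_3) : [\/ k = 0, k = 1 | k = 2].
Proof. by case: k => [[|[|[|//]]] i]; [constructor 1|constructor 2|constructor 3]; apply/val_inj. Qed.

Section Elements.
Variable R : realType.
Local Notation R2 := (R * R)%type.
Local Notation T2 := (measurableTypeR R * measurableTypeR R)%type.
Local Notation That := (@That R).

Lemma sum3 (V : nmodType) (f : 'I_3 -> V) : \sum_k f k = f 0 + f 1 + f 2.
Proof.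
by rewrite !big_ord_recl big_ord0 addr0 addrA; congr (f _ + f _ + f _); exact/val_inj.
Qed.

Lemma lam0 (p : R2) : lam p 0 = p.1. Proof. by []. Qed.
Lemma lam1 (p : R2) : lam p 1 = p.2. Proof. by []. Qed.
Lemma lam2 (p : R2) : lam p 2 = 1 - p.1 - p.2. Proof. by []. Qed.

Lemma simplexP (v : 'I_3 -> R2) (S : {set 'I_3}) x : simplex v S x <->
  exists p, [/\ forall k, 0 <= lam p k, forall k, k \notin S -> lam p k = 0 &
    x = \sum_k lam p k *: v k].
Proof.
split=> [[l [l0 l1 lS ->]]|[p [p0 pS ->]]].
  have lE k : lam (l 0, l 1) k = l k.
    move: l1; rewrite sum3; case: (ord3P k) => ->; rewrite ?lam0 ?lam1 ?lam2//=.
    by move=> <-; ring.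
  exists (l 0, l 1); split => [k|k kS|]; rewrite ?lE//; first exact: lS.
  by apply: eq_bigr => k _; rewrite lE.
exists (lam p); split => //; rewrite sum3 lam0 lam1 lam2; ring.
Qed.

Lemma ThatP (p : R2) : That p <-> forall k, 0 <= lam p k.
Proof.
have zE (q : R2) : q = \sum_k lam q k *: zhat R k.
  rewrite sum3 lam0 lam1 lam2 /zhat /=.
  by apply: eq_pair2; rewrite /= /GRing.scale /=; ring.
rewrite /Defs.That /triangle; split => [/simplexP[q [q0 _]]|h].
  by rewrite -zE => ->.
by apply/simplexP; exists p; split => // k; rewrite inE.
Qed.

Lemma ThatE (p : R2) : That p <-> [/\ 0 <= p.1, 0 <= p.2 & p.1 + p.2 <= 1].
Proof.
rewrite ThatP; split => [h|[h1 h2 h3] k].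
  by have := h 0; have := h 1; have := h 2; rewrite lam0 lam1 lam2; split => //; lra.
by case: (ord3P k) => ->; rewrite ?lam0 ?lam1 ?lam2//; lra.
Qed.

Lemma compact_That : compact That.
Proof.
apply: (@subclosed_compact _ _ (box (0, 0) 1)); last 2 first.
- exact: compact_box.
- move=> p /ThatE[h1 h2 h3]; split; rewrite /= in_itv/=; apply/andP; split; lra.
have -> : That = [set p : R2 | 0 <= p.1] `&` [set p : R2 | 0 <= p.2] `&`
    [set p : R2 | p.1 + p.2 <= 1].
  by apply/seteqP; split => [p /ThatE[]|p [[]] ? ? ?]//; apply/ThatE.
apply: closedI; last first.
  exact: (@closed_le2 R (fun p => p.1 + p.2) 1 (contD (@continuous_fst2 R) (@continuous_snd2 R))).
apply: closedI.
  exact: (@closed_ge2 R _ 0 (@continuous_fst2 R)).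
exact: (@closed_ge2 R _ 0 (@continuous_snd2 R)).
Qed.

Lemma measurable_That : measurable (That : set T2).
Proof. exact: (compact_measurable2 compact_That). Qed.

Lemma convex2_That : convex2 That.
Proof.
move=> p q t /ThatE[p1 p2 p3] /ThatE[q1 q2 q3] /andP[t0 t1].
have s0 : 0 <= 1 - t by rewrite subr_ge0.
apply/ThatE; rewrite /= /GRing.scale /=; split.
- by rewrite addr_ge0// mulr_ge0.
- by rewrite addr_ge0// mulr_ge0.
- have := ler_wpM2l s0 p3; have := ler_wpM2l t0 q3; lra.
Qed.

Lemma That_square (p : R2) : That p -> `|p.1| <= 1 /\ `|p.2| <= 1.
Proof. by move=> /ThatE[? ? ?]; rewrite !ler_norml; split; lra. Qed.

Lemma interior_That (p : R2) : That° p <-> forall k, 0 < lam p k.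
Proof.
split.
  move=> /nbhs_dist1P[r r0 h] k.
  have r40 : 0 < r / 4 by rewrite divr_gt0.
  have h1 (a b : R) : `|a| < r / 2 -> `|b| < r / 2 -> That (p.1 - a, p.2 - b).
    by move=> ha hb; apply: h; rewrite /dist1 /= !opprB ![p.1 + _]addrC ![p.2 + _]addrC !subrK; lra.
  have [/ThatE[/= p1 _ _] /ThatE[/= _ p2 _] /ThatE[/= _ _ p3]] :
      [/\ That (p.1 - r / 4, p.2 - 0), That (p.1 - 0, p.2 - r / 4) &
          That (p.1 - (- (r / 4)), p.2 - 0)].
    by split; apply: h1; rewrite ?normrN ?normr0 ?gtr0_norm//; lra.
  by case: (ord3P k) => ->; rewrite ?lam0 ?lam1 ?lam2; lra.
move=> h; have := h 0; have := h 1; have := h 2; rewrite lam0 lam1 lam2 => h2 h1 h0.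
apply/nbhs_dist1P; exists (Num.min (Num.min p.1 p.2) (1 - p.1 - p.2)).
  by rewrite !lt_min h0 h1 h2.
move=> y; rewrite !lt_min /dist1 => /andP[/andP[y1 y2] y3].
have := ler_norm (p.1 - y.1); have := ler_norm (p.2 - y.2).
have := ler_norm (- (p.1 - y.1)); have := ler_norm (- (p.2 - y.2)).
have := normr_ge0 (p.1 - y.1); have := normr_ge0 (p.2 - y.2); rewrite !normrN => *.
by apply/ThatE; split; lra.
Qed.

(** The midpoint rule is exact for quadratics, which makes it a mean value formula with the same
    intermediate point for both components of a quadratic map. *)
Lemma quad_increment (c : quadc R) (p q : R2) : quad c p - quad c q =
  quadx c (2^-1 *: (p + q)) * (p.1 - q.1) + quady c (2^-1 *: (p + q)) * (p.2 - q.2).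
Proof. by rewrite /quad /quadx /quady /= /GRing.scale /=; field. Qed.

Definition qcomb (a b e s : R) (q : quadc R) : quadc R :=
  Quadc (e + s * k0 q) (a + s * k1 q) (b + s * k2 q) (s * k3 q) (s * k4 q) (s * k5 q).

Lemma qcombE a b e s q p : quad (qcomb a b e s q) p = a * p.1 + b * p.2 + e + s * quad q p.
Proof. by rewrite /quad /=; ring. Qed.

Lemma qcombxE a b e s q p : quadx (qcomb a b e s q) p = a + s * quadx q p.
Proof. by rewrite /quadx /=; ring. Qed.

Lemma qcombyE a b e s q p : quady (qcomb a b e s q) p = b + s * quady q p.
Proof. by rewrite /quady /=; ring. Qed.

(* The bubble 4 lam_k lam_l of the edge kl opposite to n. *)
Definition qbub (n : 'I_3) : quadc R :=
  if n == 0 then Quadc 0 0 4 0 (-4) (-4)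
  else if n == 1 then Quadc 0 4 0 (-4) (-4) 0 else Quadc 0 0 0 0 4 0.

(* An affine map of the plane (a, b; c, d) p + (e, g) which is composed with
   the shift p + 4 lam_k lam_l (d1, d2), where kl is the edge opposite to n. *)
Record elem := Elem {ea : R; eb : R; ec : R; ed : R; ee : R; eg : R;
  en : 'I_3; e1 : R; e2 : R}.

Variable E : elem.

Definition elA : R2 -> R2 := affine2 (ea E) (eb E) (ec E) (ed E) (ee E) (eg E).

Definition elD : R := ea E * ed E - eb E * ec E.

Definition elq : quadc R := qbub (en E).

Definition elH (p : R2) : R2 := (p.1 + quad elq p * e1 E, p.2 + quad elq p * e2 E).

Definition elx : quadc R :=
  qcomb (ea E) (eb E) (ee E) (ea E * e1 E + eb E * e2 E) elq.

Definition ely : quadc R :=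
  qcomb (ec E) (ed E) (eg E) (ec E * e1 E + ed E * e2 E) elq.

Definition elF (p : R2) : R2 := (quad elx p, quad ely p).

Definition elK (p : R2) : R := 1 + quadx elq p * e1 E + quady elq p * e2 E.

Definition elJ (p : R2) : R := quadx elx p * quady ely p - quady elx p * quadx ely p.

Lemma elFE p : elF p = elA (elH p).
Proof. by rewrite /elF /elA /elH /affine2 !qcombE /=; apply: eq_pair2 => /=; ring. Qed.

Lemma elJE p : elJ p = elD * elK p.
Proof. by rewrite /elJ /elD /elK !qcombxE !qcombyE; ring. Qed.

Definition el_regular : Prop := 0 < elD /\ forall p, That p -> 0 < elJ p.

Lemma continuous_elF : continuous elF.
Proof. by apply: continuous_pair; exact: continuous_quad. Qed.

Lemma continuous_elA : continuous elA.
Proof. exact: continuous_affine2. Qed.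

Lemma continuous_elJ : continuous elJ.
Proof.
exact: (contD (contM (@continuous_quadx _ _) (@continuous_quady _ _))
  (contN (contM (@continuous_quady _ _) (@continuous_quadx _ _)))).
Qed.

Lemma measurable_elJ : measurable_fun (setT : set T2) (elJ : T2 -> R).
Proof. by apply: continuous_measurable2; exact: continuous_elJ. Qed.

Definition elAinv (y : R2) : R2 :=
  affine2 (ed E / elD) (- eb E / elD) (- ec E / elD) (ea E / elD)
    ((eb E * eg E - ed E * ee E) / elD) ((ec E * ee E - ea E * eg E) / elD) y.

Lemma elAinvK y : elD != 0 -> elA (elAinv y) = y.
Proof.
rewrite /elA /elAinv /elD /affine2 => D0; apply: eq_pair2 => /=; field; exact: D0.
Qed.

Lemma elAK p : elD != 0 -> elAinv (elA p) = p.
Proof.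
rewrite /elA /elAinv /elD /affine2 => D0; apply: eq_pair2 => /=; field; exact: D0.
Qed.

Hypothesis reg : el_regular.

Let D0 : 0 < elD. Proof. by case: reg. Qed.
Let Dn0 : elD != 0. Proof. by rewrite gt_eqF. Qed.

Lemma elK_gt0 p : That p -> 0 < elK p.
Proof. by move=> /(proj2 reg); rewrite elJE pmulr_rgt0. Qed.

Lemma cov_elA : cov That elA (cst elD).
Proof.
apply: (cov_ext _ _ (cov_affine2 (ee E) (eg E) Dn0 compact_That)) => // p _ /=.
by rewrite gtr0_norm.
Qed.

Lemma cov_elF : cov That elF elJ.
Proof.
have h := cov_quad_shift compact_That convex2_That elK_gt0.
have cH : continuous elH.
  have cq := @continuous_quad R elq; have cc r := @continuous_cst2 R r.
  exact: (continuous_pair (contD (@continuous_fst2 R) (contM cq (cc _)))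
    (contD (@continuous_snd2 R) (contM cq (cc _)))).
have cHT : compact (elH @` That) by apply: continuous_image_compact => //; exact: compact_That.
have h2 := cov_affine2 (ee E) (eg E) Dn0 cHT.
apply: (cov_ext _ _ (cov_comp h h2 _ _ _)) => //.
- by move=> p _; rewrite elFE.
- by move=> p _; rewrite elJE /= gtr0_norm.
- exact: measurable_affine2.
Qed.

(** By the midpoint formula, F p - F q = DF(w) (p - q) with one point [w] of the convex triangle.
    The adjugate of DF(w) inverts this up to the determinant, which is bounded below by compactness.
    Injectivity on the whole triangle follows too. *)
Lemma elF_lip_inv : exists2 K : R, 0 <= K &
  forall p q, That p -> That q -> dist1 p q <= K * dist1 (elF p) (elF q).
Proof.
have [m m0 hm] : exists2 m : R, 0 < m & forall p, That p -> m <= elJ p.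
  have T0 : That !=set0 by exists (0, 0); apply/ThatE => /=; split; lra.
  have [q /set_mem Tq hq] := compact_EVT_min T0 compact_That
    (continuous_subspaceT continuous_elJ).
  by exists (elJ q); [exact: (proj2 reg)|move=> p Tp; apply: hq; rewrite inE].
have [B1 B10 h1] := continuous_bounded2 compact_That (@continuous_quadx _ elx).
have [B2 B20 h2] := continuous_bounded2 compact_That (@continuous_quady _ elx).
have [B3 B30 h3] := continuous_bounded2 compact_That (@continuous_quadx _ ely).
have [B4 B40 h4] := continuous_bounded2 compact_That (@continuous_quady _ ely).
pose B := B1 + B2 + B3 + B4.
have B0 : 0 <= B by rewrite /B; lra.
exists (2 * B / m); first by rewrite divr_ge0// ?mulr_ge0// ltW.
move=> p q Tp Tq; set w := 2^-1 *: (p + q).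
have Tw : That w.
  have -> : w = (1 - 2^-1) *: p + 2^-1 *: q.
    by rewrite /w; apply: eq_pair2; rewrite /= /GRing.scale /=; field.
  by apply: convex2_That => //; apply/andP; split; lra.
have x1 := quad_increment elx p q; have x2 := quad_increment ely p q.
rewrite -/w in x1 x2.
have Jw := hm w Tw.
have J0 : 0 < elJ w by lra.
have {}h1 := h1 w Tw; have {}h2 := h2 w Tw; have {}h3 := h3 w Tw; have {}h4 := h4 w Tw.
set u := quad elx p - quad elx q in x1; set v := quad ely p - quad ely q in x2.
have e1' : elJ w * (p.1 - q.1) = quady ely w * u - quady elx w * v.
  by rewrite x1 x2 /elJ; ring.
have e2' : elJ w * (p.2 - q.2) = quadx elx w * v - quadx ely w * u.
  by rewrite x1 x2 /elJ; ring.
have b1 : elJ w * `|p.1 - q.1| <= B * (`|u| + `|v|).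
  rewrite -{1}(gtr0_norm J0) -normrM e1' (le_trans (ler_normB _ _))// !normrM.
  have := normr_ge0 u; have := normr_ge0 v; rewrite /B.
  have := normr_ge0 (quady ely w); have := normr_ge0 (quady elx w); nra.
have b2 : elJ w * `|p.2 - q.2| <= B * (`|u| + `|v|).
  rewrite -{1}(gtr0_norm J0) -normrM e2' (le_trans (ler_normB _ _))// !normrM.
  have := normr_ge0 u; have := normr_ge0 v; rewrite /B.
  have := normr_ge0 (quadx elx w); have := normr_ge0 (quadx ely w); nra.
rewrite mulrAC ler_pdivlMr// mulrC.
apply: (@le_trans _ _ (elJ w * dist1 p q)); first by rewrite ler_wpM2r// dist1_ge0.
by rewrite /dist1 /= mulrDr -/u -/v; lra.
Qed.

Lemma elF_inj p q : That p -> That q -> elF p = elF q -> p = q.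
Proof.
move=> Tp Tq pq; have [K _ h] := elF_lip_inv.
by apply: dist1_0_eq; have := h p q Tp Tq; rewrite pq dist1xx mulr0.
Qed.

Lemma elA_inj p q : elA p = elA q -> p = q.
Proof. by move=> h; rewrite -(elAK p Dn0) h elAK. Qed.

(** A substitute for the inverse function theorem: a preimage of z has the form z - t d with t = q
    (z - t d), so it is enough to find a zero in t of the scalar function [f]. *)
Lemma elH_open p0 : 0 < elK p0 -> forall eps : R, 0 < eps ->
  exists2 r : R, 0 < r & forall z, dist1 (elH p0) z < r ->
    exists2 p, dist1 p0 p < eps & elH p = z.
Proof.
move=> m0 eps eps0; set m := elK p0 in m0.
pose d : R2 := (e1 E, e2 E).
pose Q := k3 elq * d.1 ^+ 2 + k4 elq * (d.1 * d.2) + k5 elq * d.2 ^+ 2.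
pose dl := `|d.1| + `|d.2|.
have dl0 : 0 <= dl by rewrite addr_ge0.
pose eta := Num.min (m / (2 * (`|Q| + 1))) (eps / (2 * (dl + 1))).
have Q1 : 0 < 2 * (`|Q| + 1) by have := normr_ge0 Q; lra.
have dl1 : 0 < 2 * (dl + 1) by lra.
have eta0 : 0 < eta by rewrite lt_min !divr_gt0.
have etaQ : eta * `|Q| <= m / 2.
  have : eta <= m / (2 * (`|Q| + 1)) by rewrite ge_min lexx.
  rewrite ler_pdivlMr//; have := normr_ge0 Q; lra.
have etad : eta * dl < eps / 2.
  have : eta <= eps / (2 * (dl + 1)) by rewrite ge_min lexx orbT.
  by rewrite ler_pdivlMr//; lra.
have QN := ler_norm Q; have QN' := ler_norm (- Q); rewrite normrN in QN'.
(* Hence for z = elH p0 the function [f] below satisfies f (t0 + s) = s m - s^2 Q, of the sign of s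
   when |s| = eta; the radii [r1] and [r2] keep these signs for nearby z. *)
have qE (t : R) : quad elq (p0.1 - t * d.1, p0.2 - t * d.2) =
    quad elq p0 - t * (m - 1) + t ^+ 2 * Q.
  by rewrite /m /elK /Q /quad /quadx /quady /d /=; ring.
have em0 : 0 < eta * m / 2 by rewrite divr_gt0// mulr_gt0.
have [r1 r10 h1] := sdiff_cont (sdiff_quad elq (p0.1 - eta * d.1, p0.2 - eta * d.2)) em0.
have [r2 r20 h2] := sdiff_cont (sdiff_quad elq (p0.1 - (- eta) * d.1, p0.2 - (- eta) * d.2)) em0.
exists (Num.min (Num.min r1 r2) (eps / 2)); first by rewrite !lt_min r10 r20 divr_gt0.
move=> z; rewrite !lt_min => /andP[/andP[z1 z2] z3].
pose t0 := quad elq p0.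
pose f (t : R) := t - quad elq (z.1 - t * d.1, z.2 - t * d.2).
have cf : continuous f.
  have c1 : continuous (fun t : R => (z.1 - t * d.1, z.2 - t * d.2)).
    apply: continuous_pair; apply: contD; try exact: cst_continuous;
    apply: contN; apply: contM; try exact: cst_continuous; by move=> x; exact: cvg_id.
  apply: contD; first by move=> x; exact: cvg_id.
  apply: contN => t; apply: continuous_comp; first exact: c1.
  exact: continuous_quad.
have shift (s : R) : dist1 (p0.1 - s * d.1, p0.2 - s * d.2)
     (z.1 - (t0 + s) * d.1, z.2 - (t0 + s) * d.2) = dist1 (elH p0) z.
  have aux (a b c e : R) : a = c -> b = e -> `|a| + `|b| = `|c| + `|e| by move=> -> ->.
  by apply: aux; rewrite /elH /d /t0 /=; ring.
have fm : f (t0 - eta) <= 0.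
  have := h2 (z.1 - (t0 + - eta) * d.1, z.2 - (t0 + - eta) * d.2).
  rewrite shift => /(_ z2); rewrite qE -/t0 ler_norml => /andP[h _].
  rewrite /f; move: h; have : 0 <= eta * (m / 2 - eta * `|Q|).
    by apply: mulr_ge0; [exact: ltW|rewrite subr_ge0].
  have : eta ^+ 2 * - Q <= eta ^+ 2 * `|Q| by rewrite ler_wpM2l// sqr_ge0.
  by rewrite sqrrN; clear; lra.
have fp : 0 <= f (t0 + eta).
  have := h1 (z.1 - (t0 + eta) * d.1, z.2 - (t0 + eta) * d.2).
  rewrite shift => /(_ z1); rewrite qE -/t0 ler_norml => /andP[_ h].
  rewrite /f; move: h; have : 0 <= eta * (m / 2 - eta * `|Q|).
    by apply: mulr_ge0; [exact: ltW|rewrite subr_ge0].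
  have : eta ^+ 2 * Q <= eta ^+ 2 * `|Q| by rewrite ler_wpM2l// sqr_ge0.
  by clear; lra.
have le_t : t0 - eta <= t0 + eta by move: eta0; clear; lra.
have [|t] := IVT le_t (continuous_subspaceT cf) (v := 0).
  by rewrite ge_min le_max fm fp orbT.
rewrite in_itv/= => /andP[ta tb] ft0.
have qt : quad elq (z.1 - t * d.1, z.2 - t * d.2) = t by move: ft0; rewrite /f; clear; lra.
exists (z.1 - t * d.1, z.2 - t * d.2).
  have te : `|t0 - t| <= eta by rewrite ler_norml; move: ta tb; clear; lra.
  have e (a b c x : R) : `|a - (b - t * c)| <= `|a + t0 * c - b| + `|t0 - t| * `|c|.
    rewrite -normrM; have -> : a - (b - t * c) = (a + t0 * c - b) - (t0 - t) * c by ring.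
    exact: ler_normB.
  have := e p0.1 z.1 d.1 0; have := e p0.2 z.2 d.2 0; move: z3.
  rewrite /elH /dist1 /= -/t0 /= => z3 a1 a2.
  have : `|t0 - t| * dl <= eta * dl by rewrite ler_wpM2r.
  by rewrite /dl in etad *; move: z3 a1 a2 etad; rewrite /d /=; clear; lra.
by apply: eq_pair2; rewrite /elH /= qt /d /=; ring.
Qed.

Lemma elF_open p0 : 0 < elK p0 -> forall eps : R, 0 < eps ->
  exists2 r : R, 0 < r & forall y, dist1 (elF p0) y < r ->
    exists2 p, dist1 p0 p < eps & elF p = y.
Proof.
move=> m0 eps eps0; have [r r0 h] := elH_open m0 eps0.
have ci : {for elF p0, continuous elAinv} by exact: continuous_affine2.
have [r' r'0 h'] : exists2 r' : R, 0 < r' & forall y, dist1 (elF p0) y < r' ->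
    dist1 (elH p0) (elAinv y) < r.
  apply/(nbhs_dist1P _ (fun y => dist1 (elH p0) (elAinv y) < r)).
  apply: (ci [set w | dist1 (elH p0) w < r]); apply/nbhs_dist1P; exists r => // y.
  by rewrite elFE elAK.
exists r' => // y /h'/h[p pp Hp]; exists p => //.
by rewrite elFE Hp elAinvK.
Qed.

Lemma elF_interior p : That° p -> (elF @` That)° (elF p).
Proof.
move=> pT; have /nbhs_dist1P[e e0 he] := pT.
have Tp : That p by exact: interior_subset.
have [r r0 h] := elF_open (elK_gt0 Tp) e0.
by apply/nbhs_dist1P; exists r => // y /h[q /he Tq <-]; exists q.
Qed.

Lemma elA_interior p : That° p -> (elA @` That)° (elA p).
Proof.
move=> /nbhs_dist1P[e e0 he].
have ci : {for elA p, continuous elAinv} by exact: continuous_affine2.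
rewrite /interior /=; near=> y; exists (elAinv y); last by rewrite elAinvK.
near: y; apply: ci; rewrite elAK//; apply/nbhs_dist1P; exists e => //.
Unshelve. all: by end_near.
Qed.

Lemma elF_elA p : quad elq p = 0 -> elF p = elA p.
Proof. by move=> h; rewrite elFE /elH h !mul0r !addr0; case: p {h}. Qed.

End Elements.

(** * From the mesh to elements with at most one curved edge *)

Section MeshGeometry.
Variable R : realType.
Local Notation R2 := (R * R)%type.
Local Notation That := (@That R).

Lemma det2 (M : 'M[R]_2) : \det M = M 0 0 * M 1 1 - M 0 1 * M 1 0.
Proof.
rewrite (expand_det_row _ 0) !big_ord_recl big_ord0 addr0 /cofactor !det_mx11 !mxE.
rewrite /= !expr0 !mul1r expr1 mulN1r mulrN.
by congr (M _ _ * M _ _ - M _ _ * M _ _); exact/val_inj.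
Qed.

Lemma partial_quad (c : quadc R) p j : partial j (quad c) p = cmp j (quadx c p, quady c p).
Proof. exact: (sdiff_partial j (sdiff_quad c p)). Qed.

Lemma jac_elF (E : elem R) p i j : jac (elF E) p i j =
  cmp j (if i == 0 then (quadx (elx E) p, quady (elx E) p)
         else (quadx (ely E) p, quady (ely E) p)).
Proof.
rewrite /jac mxE; have [->|/ord2P ->] := eqVneq i 0.
  by rewrite -partial_quad.
by rewrite /= -partial_quad.
Qed.

Lemma det_jac_elF (E : elem R) p : \det (jac (elF E) p) = elJ E p.
Proof. by rewrite det2 !jac_elF /= /elJ. Qed.

Lemma polydeg1P (f : R2 -> R) : polydeg_le 1 f -> exists a b c : R,
  forall x, f x = a * x.1 + b * x.2 + c.
Proof.
move=> [c hc]; exists (c 1%N 0%N), (c 0%N 1%N), (c 0%N 0%N) => x; rewrite hc.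
under eq_bigr do rewrite big_mkcond !big_ord_recl big_ord0 /=.
rewrite !big_ord_recl big_ord0 /bump /=; ring.
Qed.

Lemma polydeg2P (f : R2 -> R) : polydeg_le 2 f -> exists c : quadc R, f =1 quad c.
Proof.
move=> [c hc]; exists (Quadc (c 0%N 0%N) (c 1%N 0%N) (c 0%N 1%N) (c 2%N 0%N)
  (c 1%N 1%N) (c 0%N 2%N)) => x; rewrite hc.
under eq_bigr do rewrite big_mkcond !big_ord_recl big_ord0 /=.
rewrite !big_ord_recl big_ord0 /bump /quad /=; ring.
Qed.

Definition opp (n : 'I_3) : 'I_3 * 'I_3 :=
  if n == 0 then (1, 2) else if n == 1 then (0, 2) else (0, 1).

Lemma sum_pairs (V : nmodType) (f : 'I_3 -> 'I_3 -> V) :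
  \sum_(k < 3) \sum_(m < 3 | (k < m)%N) f k m =
  \sum_(n < 3) f (opp n).1 (opp n).2.
Proof.
under eq_bigr do rewrite big_mkcond sum3.
rewrite !sum3 !ltnn.
have -> : (0 < (2%R : 'I_3))%N by [].
have -> : ((1%R : 'I_3) < (2%R : 'I_3))%N by [].
have -> : ((2%R : 'I_3) < 0)%N = false by [].
have -> : ((2%R : 'I_3) < (1%R : 'I_3))%N = false by [].
by rewrite /opp /= !(addr0, add0r) addrC [f 0 1 + _]addrC addrA.
Qed.

Lemma FtilE0 (I : finType) (vtx : I -> 'I_3 -> R2) i p : Ftil vtx i p =
  affine2 ((vtx i 0).1 - (vtx i 2).1) ((vtx i 1).1 - (vtx i 2).1)
          ((vtx i 0).2 - (vtx i 2).2) ((vtx i 1).2 - (vtx i 2).2)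
          (vtx i 2).1 (vtx i 2).2 p.
Proof.
rewrite /Ftil sum3 lam0 lam1 lam2 /affine2.
by apply: eq_pair2; rewrite /= /GRing.scale /=; ring.
Qed.

(** The last two components are, by Cramer's rule, the preimage of the displacement [d] under the
    linear part, since the shift is applied before the affine map. *)
Definition elem_of (v : 'I_3 -> R2) (n : 'I_3) (d : R2) : elem R :=
  let a := (v 0).1 - (v 2).1 in let b := (v 1).1 - (v 2).1 in
  let c := (v 0).2 - (v 2).2 in let e := (v 1).2 - (v 2).2 in
  Elem a b c e (v 2).1 (v 2).2 n
    ((e * d.1 - b * d.2) / (a * e - b * c)) ((a * d.2 - c * d.1) / (a * e - b * c)).

Section OneMesh.
Variables (I : finType) (vtx : I -> 'I_3 -> R2) (G : R2 -> R2).

Lemma FtilE i n d p : Ftil vtx i p = elA (elem_of (vtx i) n d) p.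
Proof. exact: FtilE0. Qed.

Lemma FtilF i n p : Ftil vtx i p = elF (elem_of (vtx i) n (0, 0)) p.
Proof.
rewrite elFE -(FtilE i n) /elH /elem_of /= !mulr0 !subr0 !mul0r !mulr0 !addr0.
by case: p.
Qed.

Lemma det_Ftil i n d p : \det (jac (Ftil vtx i) p) = elD (elem_of (vtx i) n d).
Proof.
have -> : Ftil vtx i = elF (elem_of (vtx i) n (0, 0)) by apply/funext => q; exact: FtilF.
rewrite det_jac_elF elJE /elK /elem_of /= !mulr0 !subr0 !mul0r !mulr0 !addr0 mulr1.
by [].
Qed.

Lemma TtilE i : Ttil vtx i = Ftil vtx i @` That.
Proof.
apply/seteqP; split => [x /simplexP[p [p0 _ ->]]|_ [p /ThatP p0 <-]].
  by exists p => //; exact/ThatP.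
by apply/simplexP; exists p; split => // k; rewrite inE.
Qed.

Lemma edgeP (v : 'I_3 -> R2) k x : edge v k x <->
  exists p, [/\ That p, lam p k = 0 & x = \sum_m lam p m *: v m].
Proof.
split=> [/simplexP[p [p0 pk ->]]|[p [/ThatP p0 pk ->]]].
  by exists p; split; [exact/ThatP|apply: pk; rewrite !inE eqxx|].
apply/simplexP; exists p; split => // m; rewrite !inE negbK => /eqP -> //.
Qed.

Lemma edge_zhatP k x : edge (@zhat R) k x <-> That x /\ lam x k = 0.
Proof.
have zE (q : R2) : q = \sum_k lam q k *: zhat R k.
  rewrite sum3 lam0 lam1 lam2 /zhat /=.
  by apply: eq_pair2; rewrite /= /GRing.scale /=; ring.
split=> [/edgeP[p [Tp pk]]|[Tx xk]]; first by rewrite -zE => ->.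
by apply/edgeP; exists x; split.
Qed.

Lemma edge_segment (v : 'I_3 -> R2) (a b k : 'I_3) : a != b -> a != k -> b != k ->
  edge v k = segment (v a) (v b).
Proof.
move=> ab ak bk; apply/seteqP; split => x.
  move=> /edgeP[p [/ThatP Tp pk ->]]; exists (lam p b).
  have sl : lam p 0 + lam p 1 + lam p 2 = 1 by rewrite lam0 lam1 lam2; ring.
  have := Tp 0; have := Tp 1; have := Tp 2.
  move: ab ak bk pk sl; rewrite sum3.
  case: (ord3P a) => ->; case: (ord3P b) => ->; case: (ord3P k) => -> //= _ _ _ -> sl *;
  (split; first by apply/andP; split; lra); apply: eq_pair2; rewrite /= /GRing.scale /=;
  by rewrite -sl; ring.
move=> [t [/andP[t0 t1] ->]]; apply/edgeP.
pose l m := if m == a then 1 - t else if m == b then t else 0.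
have lE m : lam (l 0, l 1) m = l m.
  move: ab ak bk; rewrite /l.
  case: (ord3P a) => ->; case: (ord3P b) => ->; case: (ord3P k) => -> //= _ _ _;
  by case: (ord3P m) => ->; rewrite ?lam0 ?lam1 ?lam2 /=; ring.
exists (l 0, l 1); split.
- apply/ThatP => m; rewrite lE /l; case: ifP => _; first by rewrite subr_ge0.
  by case: ifP.
- by rewrite lE /l eq_sym (negbTE ak) eq_sym (negbTE bk).
- rewrite sum3 !lE /l; move: ab ak bk.
  case: (ord3P a) => ->; case: (ord3P b) => ->; case: (ord3P k) => -> //= _ _ _;
  by rewrite scale0r ?addr0 ?add0r// addrC.
Qed.

Lemma oppP k : [/\ (opp k).1 != (opp k).2, (opp k).1 != k & (opp k).2 != k].
Proof. by case: (ord3P k) => ->. Qed.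

Definition disp i (n : 'I_3) : R2 :=
  let m := 2^-1 *: (vtx i (opp n).1 + vtx i (opp n).2) in G m - m.

Hypothesis nondeg : forall i, \det (jac (Ftil vtx i) 0) != 0.
Hypothesis Gv : forall i k, G (vtx i k) = vtx i k.

Lemma elD_neq0 i n d : elD (elem_of (vtx i) n d) != 0.
Proof. by rewrite -(det_Ftil i n d 0) nondeg. Qed.

Lemma Ftil_inj i p q : Ftil vtx i p = Ftil vtx i q -> p = q.
Proof.
rewrite !(FtilE i 0 0) => h.
by rewrite -(elAK p (elD_neq0 i 0 0)) h elAK// elD_neq0.
Qed.

Lemma Ftil_invK i p : Ftil_inv vtx i (Ftil vtx i p) = p.
Proof. by apply: pinvKV; rewrite ?inE// => x y _ _; exact: Ftil_inj. Qed.

(** The Lagrange interpolant in hierarchical form. [G] fixes the vertices, so its linear interpolant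
    is the affine map, and each edge bubble, equal to 1 at the midpoint of its edge, carries the
    displacement of that midpoint. *)
Lemma FTE i p : FT vtx G i p = Ftil vtx i p + \sum_n quad (qbub R n) p *: disp i n.
Proof.
rewrite /FT /Gh /comp Ftil_invK /= sum_pairs /Ftil !sum3 !Gv /disp /opp /=.
rewrite lam0 lam1 lam2 /qbub /=.
move: (G _) (G _) (G _) => m0 m1 m2.
by apply: eq_pair2; rewrite /quad /= /GRing.scale /=; field.
Qed.

Lemma FT_elF i n p : (forall k, k != n -> disp i k = 0) ->
  FT vtx G i p = elF (elem_of (vtx i) n (disp i n)) p.
Proof.
move=> h; rewrite FTE (bigD1 n)//= big1 ?addr0; last by move=> k kn; rewrite h// scaler0.
have := elD_neq0 i n (disp i n); rewrite elFE (FtilE i n (disp i n)).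
rewrite /elA /elH /elD /elq /elem_of /affine2 /= => D0.
by apply: eq_pair2; rewrite /= /GRing.scale /=; field.
Qed.

Lemma Ttil_closed i : closed (Ttil vtx i).
Proof.
apply: compact_closed2; rewrite TtilE; apply: continuous_image_compact.
  exact: compact_That.
have -> : Ftil vtx i = elA (elem_of (vtx i) 0 0) by apply/funext => p; exact: FtilE.
exact: continuous_elA.
Qed.

Lemma Ftil_cont i : continuous (Ftil vtx i).
Proof.
have -> : Ftil vtx i = elA (elem_of (vtx i) 0 0) by apply/funext => p; exact: FtilE.
exact: continuous_elA.
Qed.

Lemma Ftil_interior i p : That° p -> (Ttil vtx i)° (Ftil vtx i p).
Proof.
move=> h; rewrite TtilE.
have -> : Ftil vtx i = elA (elem_of (vtx i) 0 0) by apply/funext => q; exact: FtilE.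
have D0 := elD_neq0 i 0 0; set E := elem_of _ _ _ in D0 *.
have /nbhs_dist1P[e e0 he] := h.
have ci : {for elA E p, continuous (elAinv E)} by exact: continuous_affine2.
have hT : nbhs (elAinv E (elA E p)) That by rewrite elAK.
have /nbhs_dist1P[r r0 hr] := ci _ hT; apply/nbhs_dist1P; exists r => // y /hr Ty.
by exists (elAinv E y) => //; rewrite elAinvK.
Qed.

Lemma Omega_til_open : open (Omega_til vtx).
Proof. exact: open_interior. Qed.

Lemma Omega_til_Ttil i p : That° p -> Omega_til vtx (Ftil vtx i p).
Proof.
move=> h; apply: filterS (Ftil_interior i h) => x Tx.
by exists i.
Qed.

Lemma lam_mix (p q : R2) t k :
  lam ((1 - t) *: p + t *: q) k = (1 - t) * lam p k + t * lam q k.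
Proof.
by case: (ord3P k) => ->; rewrite ?lam0 ?lam1 ?lam2 /= /GRing.scale /=; ring.
Qed.

Lemma mix_near (p q : R2) (U : set R2) : That p -> That q -> nbhs p U ->
  exists t : R, 0 < t <= 1 /\ U ((1 - t) *: p + t *: q).
Proof.
move=> /That_square[p1 p2] /That_square[q1 q2] /nbhs_dist1P[r r0 h].
pose t := Num.min 1 (r / 5).
have t0 : 0 < t by rewrite lt_min ltr01 divr_gt0.
have t5 : t * 5 <= r by rewrite -ler_pdivlMr// ge_min lexx orbT.
exists t; split; first by rewrite t0 ge_min lexx.
apply: h; rewrite /dist1 /= /GRing.scale /=.
have e (a b : R) : a - ((1 - t) * a + t * b) = t * (a - b) by ring.
rewrite !e !normrM (gtr0_norm t0).
have := ler_normB p.1 q.1; have := ler_normB p.2 q.2 => h1 h2.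
have : t * (`|p.1 - q.1| + `|p.2 - q.2|) <= t * 4 by apply: ler_wpM2l; [exact: ltW|lra].
by rewrite mulrDr; lra.
Qed.

Lemma Ttil_closure i p : That p -> closure (Omega_til vtx) (Ftil vtx i p).
Proof.
move=> Tp U Up; pose b : R2 := (3^-1, 3^-1).
have Tb : That b by apply/ThatE; rewrite /b/=; split; lra.
have [t [/andP[t0 t1] Ut]] := mix_near Tp Tb (Ftil_cont Up).
exists (Ftil vtx i ((1 - t) *: p + t *: b)); split => //.
apply: Omega_til_Ttil; apply/interior_That => k; rewrite lam_mix.
have : 0 < lam b k by case: (ord3P k) => ->; rewrite ?lam0 ?lam1 ?lam2 /b /=; lra.
by move=> bk; have /ThatP/(_ k) pk := Tp; have := mulr_gt0 t0 bk; nra.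
Qed.

Hypothesis conf : forall i j, i != j ->
    Ttil vtx i `&` Ttil vtx j = simplex (vtx i) (shared vtx i j) /\
    shared vtx i j != [set: 'I_3]%SET.

Lemma Ttil_meet i j p : i != j -> That p -> Ttil vtx j (Ftil vtx i p) ->
  exists k, lam p k = 0 /\ forall m, lam p m != 0 -> m \in shared vtx i j.
Proof.
move=> ij Tp jp; have [e sT] := conf ij.
have : simplex (vtx i) (shared vtx i j) (Ftil vtx i p).
  by rewrite -e; split => //; rewrite TtilE; exists p.
move=> /simplexP[q [q0 qS]] /Ftil_inj pq; rewrite -pq in q0 qS.
have [k kS] : exists k, k \notin shared vtx i j.
  apply/existsP; move: sT; apply: contra_neqT => /existsPn h.
  by apply/setP => k; rewrite [RHS]inE; apply/negPn/h.
exists k; split; first exact: qS.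
by move=> m; apply: contra_neqT => /qS.
Qed.

Lemma overlap_null i j p q : i != j -> That p -> That q -> Ftil vtx i p = Ftil vtx j q ->
  ~ That° p.
Proof.
move=> ij Tp Tq pq /interior_That h.
have [|k [k0 _]] := Ttil_meet ij Tp; first by rewrite TtilE; exists q.
by have := h k; rewrite k0 ltxx.
Qed.

(** By conformity, another triangle through a relatively interior point of the edge has both end
    points as vertices and so shares the edge. If there is none, a neighbourhood of the point inside
    the union of the triangles would lie in triangle [i] alone, on whose boundary the point is. *)
Lemma noninterior_out_rel i k p : ~ interior_edge vtx i k -> That p -> lam p k = 0 ->
  (forall m, m != k -> 0 < lam p m) -> ~ Omega_til vtx (Ftil vtx i p).
Proof.
move=> ni Tp pk pm Op.
have nj j : i != j -> ~ Ttil vtx j (Ftil vtx i p).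
  move=> ij Tj; have [m [m0 mS]] := Ttil_meet ij Tp Tj.
  have sh m' : m' != k -> exists m, vtx j m = vtx i m'.
    move=> /pm m'0; have := mS m'; rewrite gt_eqF// => /(_ isT).
    by rewrite inE => /existsP[m'' /eqP <-]; exists m''.
  have [ab ak bk] := oppP k; move: ab ak bk; set a := (opp k).1; set b := (opp k).2.
  move=> ab ak bk.
  have [a' ha] := sh a ak; have [b' hb] := sh b bk.
  have ab' : a' != b'.
    apply/eqP => a'b'; have vab : vtx i a = vtx i b by rewrite -ha -hb a'b'.
    have zab : zhat R a = zhat R b.
      apply: (@Ftil_inj i).
      have zE m' : Ftil vtx i (zhat R m') = vtx i m'.
        rewrite /Ftil sum3; case: (ord3P m') => ->;
        rewrite lam0 lam1 lam2 /zhat /= ?subr0 ?subrr ?sub0r ?addNr ?scale0r ?scale1r;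
        by rewrite ?(add0r, addr0).
      by rewrite !zE.
    move: ab zab; rewrite /a /b /opp; case: (ord3P k) => -> /= _ [] /eqP;
    by rewrite ?oner_eq0 // eq_sym oner_eq0.
  have [c [ac bc]] : exists c, a' != c /\ b' != c.
    by move: ab'; case: (ord3P a') => ->; case: (ord3P b') => -> //= _;
      [exists 2|exists 1|exists 2|exists 0|exists 1|exists 0].
  apply: ni; exists j, c; split; first by move=> ji; rewrite ji eqxx in ij.
  by rewrite (edge_segment _ ab' ac bc) (edge_segment _ ab ak bk) ha hb.
have : That° p.
  pose B := \bigcup_(j in [set j | i != j]) Ttil vtx j.
  have oB : open (~` B).
    apply: closed_openC; apply: closed_bigcup; first exact: finite_finset.
    by move=> j _; exact: Ttil_closed.
  have [r r0 hr] := (open_dist1P _).1 oB (Ftil vtx i p) (fun '(ex_intro2 j ij Tj) => nj j ij Tj).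
  have [s s0 hs] := (open_dist1P _).1 Omega_til_open _ Op.
  have hU : nbhs (Ftil vtx i p) [set y | dist1 (Ftil vtx i p) y < Num.min r s].
    by apply/nbhs_dist1P; exists (Num.min r s); rewrite ?lt_min ?r0.
  have /nbhs_dist1P[t t0 ht] := Ftil_cont hU.
  apply/nbhs_dist1P; exists t => // q /ht /=; rewrite lt_min => /andP[/hr nB /hs/interior_subset].
  move=> [j _ jq]; have [ij|ij] := eqVneq i j; last by exfalso; apply: nB; exists j.
  by move: jq; rewrite -ij TtilE => -[q' Tq' /Ftil_inj <-].
by move=> /interior_That/(_ k); rewrite pk ltxx.
Qed.

Lemma noninterior_out i k p : ~ interior_edge vtx i k -> That p -> lam p k = 0 ->
  ~ Omega_til vtx (Ftil vtx i p).
Proof.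
move=> ni Tp pk Op.
(* The midpoint of the edge. If an end point were in the open set [Omega_til], so would be a point
   slightly moved towards [b], which is relatively interior to the edge. *)
pose b : R2 := (if k == 0 then 0 else 2^-1, if k == 1 then 0 else 2^-1).
have bE m : lam b m = if m == k then 0 else 2^-1.
  rewrite /b /lam; case: (ord3P m) => ->; case: (ord3P k) => -> /=; by [|field|lra].
have Tb : That b by apply/ThatP => m; rewrite bE; case: ifP => _//; rewrite invr_ge0.
have Op' : nbhs (Ftil vtx i p) (Omega_til vtx).
  by apply: open_nbhs_nbhs; split => //; exact: Omega_til_open.
have [t [/andP[t0 t1] Ot]] := mix_near Tp Tb (Ftil_cont Op').
apply: noninterior_out_rel ni _ _ _ Ot.
- by apply: convex2_That => //; rewrite ltW.
- by rewrite lam_mix pk bE eqxx !mulr0 addr0.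
- move=> m mk; rewrite lam_mix bE (negbTE mk).
  have /ThatP/(_ m) pm := Tp.
  have : 0 <= (1 - t) * lam p m by rewrite mulr_ge0// subr_ge0.
  by lra.
Qed.

Lemma zhat_That k : That (zhat R k).
Proof.
by apply/ThatE; case: (ord3P k) => ->; rewrite /zhat /=; split; lra.
Qed.

Lemma lam_zhat k m : lam (zhat R k) m = (k == m)%:R.
Proof.
by case: (ord3P k) => ->; case: (ord3P m) => ->;
  rewrite ?lam0 ?lam1 ?lam2 /zhat /= ?(subr0, subrr, sub0r, addNr).
Qed.

Lemma Ftil_zhat i k : Ftil vtx i (zhat R k) = vtx i k.
Proof.
rewrite /Ftil (bigD1 k)//= lam_zhat eqxx scale1r big1 ?addr0// => m mk.
by rewrite lam_zhat eq_sym (negbTE mk) scale0r.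
Qed.

(** An edge at vertex [n] that is not interior keeps the vertex out of [Omega_til], but the vertex
    is in the closure, so it would be a boundary vertex. As each triangle has an interior vertex,
    only the edge opposite to it can be curved. *)
Lemma interior_edge_at i n k : ~ boundary_vertex vtx i n -> k != n -> interior_edge vtx i k.
Proof.
move=> nb kn; apply: contrapT => ni; apply: nb; split.
  by rewrite -(Ftil_zhat i n); apply: Ttil_closure; exact: zhat_That.
rewrite -(Ftil_zhat i n) => /interior_subset; apply: (noninterior_out ni).
  exact: zhat_That.
by rewrite lam_zhat eq_sym (negbTE kn).
Qed.

Hypothesis int_edge : forall i k, interior_edge vtx i k ->
    FT vtx G i @` edge (@zhat R) k = edge (vtx i) k.
Hypothesis str_edge : forall i k, straight (FT vtx G i @` edge (@zhat R) k) ->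
    affine_on (edge (@zhat R) k) (FT vtx G i).

Lemma qbub_zhat n k : quad (qbub R n) (zhat R k) = 0.
Proof.
by case: (ord3P n) => ->; case: (ord3P k) => ->; rewrite /quad /qbub /zhat /=; ring.
Qed.

Lemma FT_zhat i k : FT vtx G i (zhat R k) = vtx i k.
Proof.
rewrite FTE Ftil_zhat big1 ?addr0// => n _; by rewrite qbub_zhat scale0r.
Qed.

(** On an interior edge F is affine and fixes the end points in the sense of [FT_zhat], so the
    midpoint goes to the midpoint; on the other hand it is displaced by exactly [disp], since only
    the bubble of this edge is nonzero there. *)
Lemma interior_disp i k : interior_edge vtx i k -> disp i k = 0.
Proof.
move=> ik; have [ab ak bk] := oppP k.
have [|p [pa hp]] := @str_edge i k.
  by rewrite int_edge// (edge_segment _ ab ak bk); eexists; eexists.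
have hz m : m != k -> edge (@zhat R) k (zhat R m).
  by move=> mk; apply/edge_zhatP; rewrite lam_zhat (negbTE mk); split => //; exact: zhat_That.
pose m : R2 := 2^-1 *: (zhat R (opp k).1 + zhat R (opp k).2).
have hm : edge (@zhat R) k m.
  rewrite (edge_segment _ ab ak bk); exists 2^-1; split; first by apply/andP; split; lra.
  by rewrite /m scalerDr; congr (_ *: _ + _); field.
have pm : p m = 2^-1 *: (p (zhat R (opp k).1) + p (zhat R (opp k).2)).
  have mid j : cmp j (p m) = 2^-1 * (cmp j (p (zhat R (opp k).1)) + cmp j (p (zhat R (opp k).2))).
    have [a [b [c h]]] := polydeg1P (pa j).
    have := h m; have := h (zhat R (opp k).1); have := h (zhat R (opp k).2).
    by rewrite /comp => -> -> ->; rewrite /m /= /GRing.scale /=; field.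
  by apply: eq_pair2; [exact: (mid 0)|exact: (mid 1)].
move: pm; rewrite -!hp//; try exact: hz.
rewrite !FT_zhat FTE.
have -> : Ftil vtx i m = 2^-1 *: (vtx i (opp k).1 + vtx i (opp k).2).
  rewrite /Ftil sum3 /m /opp /zhat; case: (ord3P k) => ->;
  by rewrite lam0 lam1 lam2; apply: eq_pair2; rewrite /= /GRing.scale /=; field.
rewrite (bigD1 k)//= big1 ?addr0; last first.
  move=> n nk; suff -> : quad (qbub R n) m = 0 by rewrite scale0r.
  move: nk; rewrite /m /opp /qbub /zhat; case: (ord3P k) => ->; case: (ord3P n) => -> //= _;
  by rewrite /quad /= /GRing.scale /=; field.
have -> : quad (qbub R k) m = 1.
  rewrite /m /opp /qbub /zhat; case: (ord3P k) => ->;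
  by rewrite /quad /= /GRing.scale /=; field.
by rewrite scale1r => /(canRL (addKr _)); rewrite addNr.
Qed.

End OneMesh.

Lemma mesh_elem (I : finType) (vtx : I -> 'I_3 -> R2) (G : R2 -> R2) (Om : set R2)
    (C sigma c1 c2 : R) : 0 < c1 -> isoparametric_mesh vtx G Om C sigma c1 c2 ->
  forall i, exists E : elem R,
    [/\ el_regular E, FT vtx G i = elF E, Ftil vtx i = elA E &
      (e1 E = 0 /\ e2 E = 0) \/
      forall p, That p -> lam p (en E) = 0 -> ~ Omega_til vtx (Ftil vtx i p)].
Proof.
move=> c10 hm i; have nd := mesh_nondegenerate hm; have cf := mesh_conforming hm.
have Gv := mesh_G_vertex hm; have ie := mesh_interior_edge hm; have se := mesh_straight_edge hm.
have [n nb] := mesh_two_boundary_vertices hm i.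
have dk k : k != n -> disp vtx G i k = 0.
  by move=> kn; apply: interior_disp => //; exact: interior_edge_at nb kn.
pose E := elem_of (vtx i) n (disp vtx G i n).
have FE : FT vtx G i = elF E by apply/funext => p; exact: FT_elF.
have AE : Ftil vtx i = elA E by apply/funext => p; exact: FtilE.
exists E; split => //; last first.
  have [int|nint] := pselect (interior_edge vtx i n).
    left; rewrite /E (interior_disp nd Gv ie se int) /elem_of /=.
    by rewrite !mulr0 !subrr !mul0r.
  by right => p Tp pn; exact: noninterior_out nint Tp pn.
have hd p : That p -> c1 * hT vtx i ^+ 2 <= elJ E p <= c2 * hT vtx i ^+ 2.
  by move=> Tp; have := mesh_FT_det hm i Tp; rewrite FE det_jac_elF.
(* Both factors of the bubble vanish at vertex [n], and with them its gradient. The lower bound on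
   the Jacobian at this vertex thus fixes the sign of the affine determinant. *)
have JD : elJ E (zhat R n) = elD E.
  rewrite elJE /elK /elq /E /elem_of /=.
  suff [-> ->] : quadx (qbub R n) (zhat R n) = 0 /\ quady (qbub R n) (zhat R n) = 0.
    by rewrite !mul0r !addr0 mulr1.
  by case: (ord3P n) => ->; rewrite /qbub /zhat /quadx /quady /=; split; ring.
have /andP[l1 l2] := hd _ (zhat_That n); rewrite JD in l1 l2.
have D0 : elD E != 0 by exact: elD_neq0.
have h0 : 0 <= hT vtx i ^+ 2 by rewrite sqr_ge0.
have D0' : 0 < elD E by rewrite lt_neqAle eq_sym D0 (le_trans _ l1)// mulr_ge0// ltW.
have hh : 0 < hT vtx i ^+ 2.
  rewrite lt_neqAle h0 andbT; apply/eqP => e; rewrite -e mulr0 in l2; lra.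
split => // p Tp; have /andP[h _] := hd _ Tp.
by rewrite (lt_le_trans _ h)// mulr_gt0.
Qed.

End MeshGeometry.

(** * Integration over a mesh *)

Section Charts.
Variable R : realType.
Local Notation R2 := (R * R)%type.
Local Notation T2 := (measurableTypeR R * measurableTypeR R)%type.
Local Notation mu := (mu2 R).
Local Notation That := (@That R).
Local Open Scope ereal_scope.

Lemma mu_zero_integral (N : set T2) (a : R) : (0 < a)%R -> measurable N ->
  \int[mu]_p ((\1_N p)%:E * a%:E) = 0 -> mu N = 0.
Proof.
move=> a0 mN h.
have m1 : measurable_fun setT (fun p : T2 => (\1_N p)%:E : \bar R).
  by apply/measurable_EFinP; exact: measurable_indic.
have p1 (p : T2) : setT p -> 0 <= (\1_N p)%:E :> \bar R by rewrite lee_fin indicE.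
have := h; rewrite (ge0_integralZr mu measurableT m1 p1 (ltW _ : 0 <= a%:E))//.
rewrite integral_indic// setIT => /eqP.
by rewrite mule_eq0 => /orP[/eqP//|]; rewrite eqe gt_eqF.
Qed.

(** Completing (a, b) to an invertible matrix gives an affine map under which the line is the
    preimage of the vertical axis, a null rectangle. *)
Lemma mu_line (a b c : R) : (a != 0)%R || (b != 0)%R ->
  mu [set p : T2 | (a * p.1 + b * p.2 + c = 0)%R] = 0.
Proof.
pose f : T2 -> \bar R := fun p => (\1_([set 0%R] `*` [set: R]) p)%:E.
have mZ : measurable ([set 0%R] `*` [set: R] : set T2) by exact: measurableX.
have mf : measurable_fun setT f by apply/measurable_EFinP; exact: measurable_indic.
have f0 : forall p, 0 <= f p by move=> p; rewrite lee_fin indicE.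
have If : \int[mu]_p f p = 0.
  rewrite /f integral_indic// setIT.
  rewrite [LHS](@product_measure1E _ _ _ _ _ lebesgue_measure lebesgue_measure)//.
  by rewrite [X in X * _](@lebesgue_measure_set1 R 0%R) mul0e.
set N := [set p | _].
have mN : measurable (N : set T2).
  have -> : N = [set p : R2 | (a * p.1 + b * p.2 + c <= 0)%R] `&`
      [set p : R2 | (0 <= a * p.1 + b * p.2 + c)%R].
    apply/seteqP; split => p; rewrite /N /=; first by move=> ->.
    by move=> [h1 h2]; apply/eqP; rewrite eq_le h1 h2.
  have ca : continuous (fun p : R2 => (a * p.1 + b * p.2 + c)%R).
    have cc r := @continuous_cst2 R r.
    exact: (contD (contD (contM (cc _) (@continuous_fst2 R)) (contM (cc _) (@continuous_snd2 R))) (cc _)).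
  apply: closed_measurable2; apply: closedI; first exact: closed_le2.
  exact: closed_ge2.
have key (a' b' c' d' : R) : (a * d' - b * c' != 0)%R -> mu N = 0.
  move=> D0.
  have := ge0_integral_affine2 c 0%R D0 mf f0; rewrite If => h.
  apply: (@mu_zero_integral N `|a * d' - b * c'|%R) => //.
    by rewrite normr_gt0.
  rewrite -h; apply: eq_integral => p _; congr (_ * _).
  rewrite /f !indicE.
  suff -> : (p \in N) = (affine2 a b c' d' c 0%R p \in [set 0%R] `*` [set: R]) by [].
  apply/idP/idP; rewrite !inE /N /affine2 /=.
    by move=> ->.
  by move=> [->].
move=> /orP[a0|b0].
  by apply: (key 0%R 0%R 0%R 1%R); rewrite mulr1 mulr0 subr0.
by apply: (key 0%R 0%R 1%R 0%R); rewrite mulr1 mulr0 sub0r oppr_eq0.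
Qed.

Lemma ae_line (a b c : R) : (a != 0)%R || (b != 0)%R ->
  {ae mu, forall p : T2, (a * p.1 + b * p.2 + c != 0)%R}.
Proof.
move=> ab; exists [set p : T2 | (a * p.1 + b * p.2 + c = 0)%R]; split => //.
- have ca : continuous (fun p : R2 => (a * p.1 + b * p.2 + c)%R).
    have cc r := @continuous_cst2 R r.
    exact: (contD (contD (contM (cc _) (@continuous_fst2 R)) (contM (cc _) (@continuous_snd2 R))) (cc _)).
  have := @continuous_measurable2 _ _ ca measurableT [set 0%R].
  by rewrite setTI; apply; exact: measurable_set1.
- exact: mu_line.
- by move=> p /= /negP; rewrite negbK => /eqP.
Qed.

Lemma ae_forall (I : finType) (P : I -> R2 -> Prop) :
  (forall i, {ae mu, forall x : T2, P i x}) -> {ae mu, forall x : T2, forall i, P i x}.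
Proof.
move=> h; have : {ae mu, forall x : T2, forall i, i \in index_enum I -> P i x}.
  elim: (index_enum I) => [|i s IH]; first exact: aeW.
  move: IH (h i); apply: filterS2 => x IH hi j; rewrite inE => /orP[/eqP ->//|]; exact: IH.
by apply: filterS => x hx i; apply: hx; rewrite mem_index_enum.
Qed.

Lemma ae_lam k (c : R) : {ae mu, forall p : T2, (lam p k != c)%R}.
Proof.
have e (x : R) : (x - c != 0)%R = (x != c)%R by rewrite subr_eq0.
case: (ord3P k) => ->.
- have := @ae_line 1%R 0%R (- c) (introT orP (or_introl (oner_neq0 R))).
  by apply: filterS => p; rewrite lam0 mul1r mul0r addr0 e.
- have := @ae_line 0%R 1%R (- c) (introT orP (or_intror (oner_neq0 R))).
  by apply: filterS => p; rewrite lam1 mul1r mul0r add0r e.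
- have h : ((1%R : R) != 0)%R || ((1%R : R) != 0)%R by rewrite oner_neq0.
  have := @ae_line 1%R 1%R (c - 1) h.
  apply: filterS => p; rewrite lam2 !mul1r; apply: contra => /eqP <-.
  by apply/eqP; ring.
Qed.

Lemma ae_That_interior : {ae mu, forall p : T2, That p -> That° p}.
Proof.
have := ae_lam 0%R 0%R; have := ae_lam 1%R 0%R; have := ae_lam 2%R 0%R.
apply: filterS3 => p h2 h1 h0 /ThatP Tp.
by apply/interior_That => k; rewrite lt_neqAle Tp andbT eq_sym; case: (ord3P k) => ->.
Qed.

Definition bThat : set R2 := That `\` That°.

Lemma compact_bThat : compact bThat.
Proof.
apply: (@subclosed_compact _ _ That); last by move=> p [].
  rewrite /bThat setDE; apply: closedI; first by apply: compact_closed2; exact: compact_That.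
  by apply: open_closedC; exact: open_interior.
exact: compact_That.
Qed.

Lemma mu_bThat : mu bThat = 0.
Proof.
have mb : measurable (bThat : set T2) by exact: (compact_measurable2 compact_bThat).
have [N [mN N0 h]] := ae_That_interior.
apply/eqP; rewrite -measure_le0 -N0; apply: le_measure; rewrite ?inE//.
by move=> p [Tp nTp]; apply: h => /= h; apply: nTp; exact: h.
Qed.

Lemma mu_That_fin : mu That < +oo.
Proof.
apply: (@le_lt_trans _ _ (mu (box (0, 0)%R 1%R : set T2))).
  apply: le_measure; rewrite ?inE.
  - exact: measurable_That.
  - exact: (compact_measurable2 (@compact_box _ _ _)).
  - by move=> p /That_square; rewrite !ler_norml => -[h1 h2]; split; rewrite /= in_itv/= sub0r add0r.
rewrite /box product_measure1E//; try exact: measurable_itv.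
rewrite [X in X * _](lebesgue_measure_itv `[_, _]) [X in _ * X](lebesgue_measure_itv `[_, _]) /=.
by rewrite -EFinD; case: ifP => _; rewrite ?mul0e -?EFinM ?ltry.
Qed.

Section Family.
Variables (I : finType) (U : set R2) (F : I -> R2 -> R2) (J : I -> R2 -> R).

(** Everything that integration over a mesh asks of the element maps. The affine and the curved mesh
    both satisfy it, so each lemma on integrals serves the two of them. *)
Record charts : Prop := Charts {
  ch_open : open U;
  ch_cont : forall i, continuous (F i);
  ch_mJ : forall i, measurable_fun (setT : set T2) (J i : T2 -> R);
  ch_J0 : forall i p, That p -> (0 < J i p)%R;
  ch_cov : forall i, cov That (F i) (J i);
  ch_inj : forall i p q, That p -> That q -> F i p = F i q -> p = q;
  ch_disj : forall i j p q, i != j -> That° p -> That q -> F i p <> F j q;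
  ch_in : forall i p, That° p -> U (F i p);
  ch_cover : forall x, U x -> exists i p, That p /\ F i p = x }.

Hypothesis ch : charts.

Let mF i : measurable_fun (setT : set T2) (F i : T2 -> T2).
Proof.
apply/measurable_fun_pairP; split; apply: continuous_measurable2 => x.
  apply: (@continuous_comp _ _ _ (F i) fst); first exact: (ch_cont ch).
  exact: continuous_fst2.
apply: (@continuous_comp _ _ _ (F i) snd); first exact: (ch_cont ch).
exact: continuous_snd2.
Qed.

Let cFT i (C : set R2) : compact C -> measurable (F i @` C : set T2).
Proof.
by move=> cC; apply: compact_measurable2; apply: continuous_image_compact => //; exact: (ch_cont ch).
Qed.

Let mU : measurable (U : set T2).
Proof. by apply: open_measurable2; exact: ch_open ch. Qed.

Lemma chart_null i (N M : set T2) : measurable N -> mu N = 0 -> measurable M ->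
  (forall p, That p -> M (F i p) -> N p) -> mu (M `&` F i @` That) = 0.
Proof.
move=> mN N0 mM h.
have mFT : measurable (F i @` That : set T2) by apply: cFT; exact: compact_That.
rewrite -integral_indic// -(ch_cov ch i); last 2 first.
- by apply/measurable_EFinP; exact: measurable_indic.
- by move=> p; rewrite lee_fin indicE.
rewrite (@integral_eq_off_null _ _ _ mu _ N _ (cst 0))//; first exact: integral0.
by move=> p Tp nN; rewrite indicE memNset ?mul0e// => /(h _ Tp).
Qed.

Let Fb0 i : mu (F i @` bThat) = 0.
Proof.
have mb : measurable (bThat : set T2) by exact: (compact_measurable2 compact_bThat).
rewrite (_ : F i @` bThat = F i @` bThat `&` F i @` That); last first.
  by apply/seteqP; split => [x [p bp <-]|x []//]; split; exists p => //; case: bp.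
apply: (@chart_null i bThat) => //; first exact: mu_bThat.
  by apply: cFT; exact: compact_bThat.
by move=> p Tp [q [Tq nq] /(ch_inj ch Tq Tp) <-].
Qed.

Let FoE i : F i @` That° = F i @` That `\` F i @` bThat.
Proof.
apply/seteqP; split => x.
  move=> [p op <-]; have Tp := interior_subset op; split; first by exists p.
  by move=> [q [Tq nq] /(ch_inj ch Tq Tp) qp]; apply: nq; rewrite qp.
move=> [[p Tp <-] nb]; exists p => //; apply: contrapT => np.
by apply: nb; exists p.
Qed.

Let mFo i : measurable (F i @` That° : set T2).
Proof.
rewrite FoE; apply: measurableD; apply: cFT; first exact: compact_That.
exact: compact_bThat.
Qed.

Let Fb_ae : {ae mu, forall x : T2, forall i, ~ (F i @` bThat) x}.
Proof.
apply: (@ae_forall I (fun i x => ~ (F i @` bThat) x)) => i.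
exists (F i @` bThat); split; [apply: cFT; exact: compact_bThat|exact: Fb0|].
by move=> x /= /contrapT.
Qed.

(** The images of the open reference triangle are disjoint, and they exhaust [U] up to the images of
    its boundary, which are null. *)
Lemma charts_ge0 (f : T2 -> \bar R) : measurable_fun setT f -> (forall p, 0 <= f p) ->
  \int[mu]_(x in U) f x = \sum_i \int[mu]_(p in That) (f (F i p) * (J i p)%:E).
Proof.
move=> mf f0.
pose W := \big[setU/set0]_(i <- index_enum I) F i @` That°.
have WE x : W x <-> exists i, (F i @` That°) x.
  rewrite /W -bigcup_seq; split => [[i _ h]|[i h]]; first by exists i.
  by exists i => //=; rewrite mem_index_enum.
have -> : \int[mu]_(x in U) f x = \int[mu]_(x in W) f x.
  rewrite integral_mkcond [RHS]integral_mkcond; apply: integral_eq_ae.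
  apply: filterS Fb_ae => x nb _; rewrite !patchE.
  suff -> : (x \in U) = (x \in W) by [].
  apply/idP/idP; rewrite !inE.
    move=> /(ch_cover ch)[i [p [Tp Fp]]]; apply/WE; exists i; rewrite FoE; split => //.
    by exists p.
  by move=> /WE[i [p op <-]]; exact: (ch_in ch).
rewrite ge0_integral_bigsetU//; first last.
- by apply: measurable_funTS.
- move=> i j _ _ [x [[p op <-] [q oq qp]]]; apply/eqP; apply: contraT => ij.
  by exfalso; apply: (ch_disj ch ij op (interior_subset oq)); rewrite qp.
- exact: index_enum_uniq.
apply: eq_bigr => i _; rewrite (ch_cov ch i)//.
rewrite integral_mkcond [RHS]integral_mkcond; apply: integral_eq_ae.
apply: filterS Fb_ae => x nb _; rewrite !patchE.
suff -> : (x \in F i @` That°) = (x \in F i @` That) by [].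
apply/idP/idP; rewrite !inE FoE; first by case.
by move=> h; split => //; exact: nb.
Qed.

Definition chinv i (x : R2) : R2 := xget (0, 0)%R [set p | That p /\ F i p = x].

Lemma chinvK i p : That p -> chinv i (F i p) = p.
Proof.
move=> Tp; apply: xget_unique => // q [Tq qp].
exact: (ch_inj ch Tq Tp qp).
Qed.

Lemma measurable_chinv i : measurable_fun (setT : set T2) (chinv i : T2 -> T2).
Proof.
have key (f : R2 -> R) : continuous f -> f (0, 0)%R = 0%R ->
    measurable_fun (setT : set T2) (fun x : T2 => f (chinv i x)).
  move=> cf f0; apply: (measurability _ (measurable_realfun.RGenCInfty.measurableE R)).
  move=> _ [_ [c ->] <-]; rewrite setTI.
  (* The image of a compact set is compact, hence measurable. Off the image of [F i] the inverse has
     the default value (0, 0), where f is 0, so that the complement belongs to the preimage exactly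
     when c <= 0. *)
  have -> : (fun x => f (chinv i x)) @^-1` `[c, +oo[%classic =
    F i @` (That `&` [set p | (c <= f p)%R]) `|`
    (if (c <= 0)%R then ~` (F i @` That) else set0).
    apply/seteqP; split => x; rewrite /= in_itv/= andbT.
      have [[p Tp <-]|nx] := pselect ((F i @` That) x).
        by rewrite chinvK// => cp; left; exists p.
      rewrite /chinv xgetPN; last by move=> p [Tp Fp]; apply: nx; exists p.
      by rewrite f0 => ->; right.
    move=> [[p [Tp cp] <-]|]; first by rewrite chinvK.
    case: ifP => // c0 nx; rewrite /chinv xgetPN ?f0//.
    by move=> p [Tp Fp]; apply: nx; exists p.
  apply: measurableU.
    apply: cFT; apply: (@subclosed_compact _ _ That) => //; last exact: compact_That.
    apply: closedI; first by apply: compact_closed2; exact: compact_That.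
    exact: closed_ge2.
  by case: ifP => _ //; apply: measurableC; apply: cFT; exact: compact_That.
by apply/measurable_fun_pairP; split; apply: key => //; [exact: continuous_fst2|exact: continuous_snd2].
Qed.

(** Null sets pass in both directions: from [U] to the triangle because the Jacobian is positive in
    the change of variables, and back through the measurable inverse of the chart. *)
Lemma charts_ae (P : R2 -> Prop) :
  ae_on U P <-> forall i, ae_on That (fun p => P (F i p)).
Proof.
split.
  move=> [N [mN N0 h]] i.
  have m1 : measurable_fun setT (fun p : T2 => (\1_N (F i p))%:E * (J i p)%:E).
    apply: emeasurable_funM; last by apply/measurable_EFinP; exact: ch_mJ.
    apply/measurable_EFinP; apply: (measurableT_comp (f := \1_N : T2 -> R)) => //.
  have z : \int[mu]_(p in That) ((\1_N (F i p))%:E * (J i p)%:E) = 0.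
    have m2 : measurable_fun setT (fun p : T2 => (\1_N p)%:E : \bar R).
      by apply/measurable_EFinP; exact: measurable_indic.
    have p2 : forall p : T2, 0 <= (\1_N p)%:E :> \bar R by move=> p; rewrite lee_fin indicE.
    have := charts_ge0 m2 p2.
    have -> : \int[mu]_(x in U) (\1_N x)%:E = 0.
      rewrite integral_indic//; apply/eqP; rewrite -measure_le0 -N0.
      by apply: le_measure; rewrite ?inE//; exact: measurableI.
    move=> /esym/eqP; rewrite seq_psume_eq0; last first.
      move=> j _; apply: integral_ge0 => p Tp; rewrite mule_ge0// lee_fin ltW//.
      exact: (ch_J0 ch j Tp).
    by move=> /allP/(_ i); rewrite mem_index_enum => /(_ isT)/eqP.
  have hz : ae_eq mu That (fun p : T2 => (\1_N (F i p))%:E * (J i p)%:E) (cst 0).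
    apply/ae_eq_integral_abs; [exact: measurable_That|exact: measurable_funTS|].
    rewrite -[RHS]z; apply: eq_integral => p /set_mem Tp; rewrite gee0_abs//.
    by rewrite mule_ge0// lee_fin ?indicE// ltW//; exact: (ch_J0 ch i Tp).
  have := ae_That_interior; move: hz; apply: filterS2 => p hz oT Tp.
  have := hz Tp; rewrite /= indicE => /eqP; rewrite mule_eq0 !eqe.
  have := ch_J0 ch i Tp => Jp; rewrite (gt_eqF Jp) orbF pnatr_eq0 eqb0 => /negP nN.
  apply: contrapT => nP; apply: nN; rewrite inE; apply: h => /= hP; apply: nP.
  by apply: hP; apply: (ch_in ch); exact: oT.
move=> h.
have hi i : {ae mu, forall x : T2, (F i @` That) x -> P x}.
  have [N [mN N0 hN]] := h i.
  pose M := (chinv i @^-1` N) : set T2.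
  have mM : measurable M by rewrite -[M]setTI; exact: measurable_chinv.
  have mFT : measurable (F i @` That : set T2) by apply: cFT; exact: compact_That.
  exists (M `&` F i @` That); split.
  - exact: measurableI.
  - apply: (@chart_null i N) => // p Tp; by rewrite /M /= chinvK.
  - move=> x /= nx; have Fx : (F i @` That) x by apply: contrapT => nF; apply: nx.
    split => //; have [p Tp pE] := Fx; rewrite /M /= -pE chinvK//; apply: hN => /= hP.
    by apply: nx => _; rewrite -pE; exact: hP.
have : {ae mu, forall x : T2, forall i, (F i @` That) x -> P x}.
  exact: (@ae_forall I (fun i x => (F i @` That) x -> P x)).
apply: filterS => x hx /(ch_cover ch)[i [p [Tp pE]]].
by apply: (hx i); exists p.
Qed.

Lemma charts_glue (f : I -> R2 -> R) :
  (forall i, measurable_fun (setT : set T2) (f i : T2 -> R)) ->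
  exists2 g : R2 -> R, measurable_fun (setT : set T2) (g : T2 -> R) &
    forall i p, That° p -> g (F i p) = f i p.
Proof.
move=> mf; exists (fun x => \sum_i \1_(F i @` That°) x * f i (chinv i x))%R.
  apply: measurable_sum => i; apply: measurable_funM; first exact: measurable_indic.
  exact: (measurableT_comp (mf i) (measurable_chinv i)).
move=> i p op; have Tp := interior_subset op.
rewrite (bigD1 i)//= big1 ?addr0.
  by rewrite indicE mem_set ?mul1r ?chinvK//; exists p.
move=> j ji; rewrite indicE memNset ?mul0r// => -[q oq qp].
by apply: (ch_disj ch ji oq Tp).
Qed.

Lemma charts_integrable (f : R2 -> R) : measurable_fun (setT : set T2) (f : T2 -> R) ->
  (forall i, mu.-integrable That (fun p => (f (F i p) * J i p)%:E)) ->
  mu.-integrable U (EFin \o f).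
Proof.
move=> mf hf; apply/integrableP; split.
  by apply/measurable_EFinP; exact: measurable_funTS.
have m1 : measurable_fun setT (fun x : T2 => `|(f x)%:E|).
  by apply: measurableT_comp => //; apply/measurable_EFinP.
rewrite (charts_ge0 m1)//.
apply: lte_sum_pinfty => i _; have /integrableP[_] := hf i.
apply: le_lt_trans; rewrite le_eqVlt; apply/orP; left; apply/eqP.
apply: eq_integral => p /set_mem Tp.
by rewrite !abse_EFin normrM (gtr0_norm (ch_J0 ch i Tp)) EFinM.
Qed.

Lemma charts_Rintegral_ge0 (f : R2 -> R) : measurable_fun (setT : set T2) (f : T2 -> R) ->
  (forall x, (0 <= f x)%R) ->
  (forall i, mu.-integrable That (fun p => (f (F i p) * J i p)%:E)) ->
  (\int[mu]_(x in U) f x)%R = (\sum_i \int[mu]_(p in That) (f (F i p) * J i p))%R.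
Proof.
move=> mf f0 hf; rewrite /Rintegral.
rewrite sum_fine; last first.
  by move=> i _; apply: integrable_fin_num; [exact: measurable_That|exact: hf].
congr fine.
have m1 : measurable_fun setT (fun x : T2 => (f x)%:E) by apply/measurable_EFinP.
have p1 (x : T2) : 0 <= (f x)%:E by rewrite lee_fin.
rewrite (charts_ge0 m1 p1); apply: eq_bigr => i _.
by apply: eq_integral => p _; rewrite EFinM.
Qed.

Lemma charts_Rintegral (f : R2 -> R) : measurable_fun (setT : set T2) (f : T2 -> R) ->
  (forall i, mu.-integrable That (fun p => (f (F i p) * J i p)%:E)) ->
  (\int[mu]_(x in U) f x)%R = (\sum_i \int[mu]_(p in That) (f (F i p) * J i p))%R.
Proof.
move=> mf hf.
have mA : measurable_fun (setT : set T2) (fun x : T2 => `|f x|%R : R).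
  by apply: measurableT_comp => //; exact: normr_measurable.
have hA i : mu.-integrable That (fun p => (`|f (F i p)| * J i p)%:E).
  apply: (@eq_integrable _ _ _ mu That (@measurable_That R) _ _ _ (integrable_abse (hf i))).
  by move=> p /set_mem Tp; rewrite /= normrM (gtr0_norm (ch_J0 ch i Tp)).
have mP : measurable_fun (setT : set T2) (fun x : T2 => f x + `|f x| : R)%R.
  exact: measurable_funD.
have hP i : mu.-integrable That (fun p => ((f (F i p) + `|f (F i p)|) * J i p)%:E).
  apply: (@eq_integrable _ _ _ mu That (@measurable_That R) _ _ _
    (integrableD (@measurable_That R) (hf i) (hA i))).
  by move=> p _; rewrite /= -EFinD mulrDl.
(* A difference of two nonnegative integrable functions, each covered by [charts_Rintegral_ge0]. *)
have fE x : f x = ((f x + `|f x|) - `|f x|)%R by rewrite addrK.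
rewrite (@eq_Rintegral _ _ _ mu U _ _ (fun x _ => fE x)).
rewrite RintegralB//; first last.
- exact: (charts_integrable mA).
- exact: (charts_integrable mP).
rewrite (charts_Rintegral_ge0 mP)//; last first.
  by move=> x; have := ler_norm (- f x); rewrite normrN; lra.
rewrite (charts_Rintegral_ge0 mA)// -sumrB; apply: eq_bigr => i _.
rewrite -(RintegralB (@measurable_That R) (hP i) (hA i)).
by apply: eq_Rintegral => p _; rewrite -mulrBl addrK.
Qed.

End Family.

End Charts.

(** * The curved mesh and functions glued from its elements *)

Section CurvedMesh.
Variable R : realType.
Local Notation R2 := (R * R)%type.
Local Notation T2 := (measurableTypeR R * measurableTypeR R)%type.
Local Notation That := (@That R).
Variables (I : finType) (E : I -> elem R).

Definition Otil : set R2 := (\bigcup_i elA (E i) @` That)°.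
Definition Ocur : set R2 := (\bigcup_i elF (E i) @` That)°.

(** The properties of the mesh that the analysis uses, freed from vertices and from [G]. [cm_ginj]
    makes A o F^-1, the inverse of G_h, well defined across elements, which is the direction that
    transports test functions to Omega_h. *)
Record cmesh : Prop := CMesh {
  cm_reg : forall i, el_regular (E i);
  cm_ovl : forall i j p q, i != j -> That p -> That q ->
    elA (E i) p = elA (E j) q -> ~ That° p;
  cm_ginj : forall i j p q, That p -> That q ->
    elF (E i) p = elF (E j) q -> elA (E i) p = elA (E j) q;
  cm_out : forall i, (e1 (E i) = 0 /\ e2 (E i) = 0) \/
    forall p, That p -> lam p (en (E i)) = 0 -> ~ Otil (elA (E i) p) }.

Hypothesis cm : cmesh.

Lemma charts_til : charts Otil (fun i => elA (E i)) (fun i => cst (elD (E i))).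
Proof.
split.
- exact: open_interior.
- by move=> i; exact: continuous_elA.
- by move=> i; exact: measurable_cst.
- by move=> i p _; case: (cm_reg cm i).
- by move=> i; apply: cov_elA; exact: (cm_reg cm).
- by move=> i p q _ _; apply: elA_inj; exact: (cm_reg cm).
- by move=> i j p q ij op Tq pq; apply: (cm_ovl cm ij (interior_subset op) Tq pq).
- move=> i p op; have /nbhs_dist1P[r r0 h] := elA_interior (cm_reg cm i) op.
  by apply/nbhs_dist1P; exists r => // y /h Fy; exists i.
- by move=> x /interior_subset[i _ [p Tp <-]]; exists i, p.
Qed.

Lemma charts_cur : charts Ocur (fun i => elF (E i)) (fun i => elJ (E i)).
Proof.
split.
- exact: open_interior.
- by move=> i; exact: continuous_elF.
- by move=> i; exact: measurable_elJ.
- by move=> i p Tp; case: (cm_reg cm i) => _; exact.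
- by move=> i; apply: cov_elF; exact: (cm_reg cm).
- by move=> i p q; apply: elF_inj; exact: (cm_reg cm).
- move=> i j p q ij op Tq pq; have Tp := interior_subset op.
  by apply: (cm_ovl cm ij Tp Tq (cm_ginj cm Tp Tq pq)).
- move=> i p op; have /nbhs_dist1P[r r0 h] := elF_interior (cm_reg cm i) op.
  by apply/nbhs_dist1P; exists r => // y /h Fy; exists i.
- by move=> x /interior_subset[i _ [p Tp <-]]; exists i, p.
Qed.

Lemma dist1_forall (A : finType) (P : A -> R2 -> Prop) x :
  (forall a, exists2 r : R, 0 < r & forall y, dist1 x y < r -> P a y) ->
  exists2 r : R, 0 < r & forall y, dist1 x y < r -> forall a, P a y.
Proof.
move=> h; have [r r0 hr] : exists2 r : R, 0 < r & forall y, dist1 x y < r ->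
    forall a, a \in index_enum A -> P a y.
  elim: (index_enum A) => [|a s [r r0 hr]]; first by exists 1.
  have [t t0 ht] := h a; exists (Num.min r t); first by rewrite lt_min r0.
  move=> y; rewrite lt_min => /andP[yr yt] b; rewrite inE => /orP[/eqP ->|]; first exact: ht.
  exact: hr.
by exists r => // y /hr hy a; apply: hy; rewrite mem_index_enum.
Qed.

Lemma near_gt0 (f : R2 -> R) x : continuous f -> 0 < f x ->
  exists2 r : R, 0 < r & forall y, dist1 x y < r -> 0 < f y.
Proof.
move=> cf fx; apply/(nbhs_dist1P x (fun y => 0 < f y)).
by apply: (cf x [set t | 0 < t]); exact: lt_nbhsr.
Qed.

(** The derivative of [lam k] in the direction [d]; on the edge opposite to vertex k it is a fixed
    multiple of the normal component of [d]. *)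
Definition lamd (d : R2) (k : 'I_3) : R :=
  if k == 0 then d.1 else if k == 1 then d.2 else - d.1 - d.2.

Lemma bub_factor (n k : 'I_3) : k != n -> exists b : 'I_3, forall p d : R2,
  quad (qbub R n) p = 4 * lam p b * lam p k /\
  quadx (qbub R n) p * d.1 + quady (qbub R n) p * d.2 =
    4 * (lam p b * lamd d k + lam p k * lamd d b).
Proof.
(* The third index: in Z/3 the three indices sum to zero. *)
pose b : 'I_3 := - (n + k).
move=> kn; exists b => p d; move: kn; rewrite /b.
case: (ord3P n) => ->; case: (ord3P k) => -> //= _;
  rewrite /lam /lamd /qbub /quad /quadx /quady /=; split; ring.
Qed.

Lemma continuous_lam k : continuous (fun p : R2 => lam p k).
Proof.
case: (ord3P k) => ->; first exact: continuous_fst2; first exact: continuous_snd2.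
exact: (contD (contD (@continuous_cst2 R 1) (contN (@continuous_fst2 R))) (contN (@continuous_snd2 R))).
Qed.

Lemma lam_elH (F : elem R) p k :
  lam (elH F p) k = lam p k + quad (elq F) p * lamd (e1 F, e2 F) k.
Proof.
by case: (ord3P k) => ->; rewrite ?lam0 ?lam1 ?lam2 /lamd /elH /=; ring.
Qed.

(* Near a point of the boundary which both maps leave in place, the curved
   element covers the straight one. *)
Lemma elA_sub_elF i q : That q -> elF (E i) q = elA (E i) q -> Otil (elA (E i) q) ->
  exists2 r : R, 0 < r & forall y, dist1 (elA (E i) q) y < r ->
    (elA (E i) @` That) y -> (elF (E i) @` That) y.
Proof.
move=> Tq Fq Oq; have reg := cm_reg cm i.
have [[e10 e20]|hout] := cm_out cm i.
  exists 1 => // y _ [p Tp <-]; exists p => //.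
  by rewrite elFE /elH e10 e20 !mulr0 !addr0; case: p {Tp}.
(* A coordinate that is positive at [q] stays so. A coordinate k that vanishes at [q] is a factor of
   the bubble, because k differs from [en]; so the shift multiplies it by a factor close to [elK] at
   [q], which is positive. Hence p is in the triangle as soon as its shifted point is. *)
have [eps eps0 heps] : exists2 r : R, 0 < r & forall p, dist1 q p < r -> forall k,
    (0 < lam q k -> 0 < lam p k) /\
    (lam q k = 0 -> exists2 c : R, 0 < c & lam (elH (E i) p) k = lam p k * c).
  apply: (@dist1_forall _ (fun k p => (0 < lam q k -> 0 < lam p k) /\
    (lam q k = 0 -> exists2 c : R, 0 < c & lam (elH (E i) p) k = lam p k * c))) => k.
  have /ThatP/(_ k) := Tq; rewrite le_eqVlt => /predU1P[qk|qk]; last first.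
    have [r r0 hr] := near_gt0 (@continuous_lam k) qk.
    by exists r => // y /hr; split => // e; rewrite e ltxx in qk.
  have kn : k != en (E i) by apply/eqP => kn; apply: (hout q) => //; rewrite -kn.
  have [b hb] := bub_factor kn; pose d := (e1 (E i), e2 (E i)).
  pose f p := 1 + 4 * lam p b * lamd d k.
  have cf : continuous f.
    exact: (contD (@continuous_cst2 R 1) (contM (contM (@continuous_cst2 R 4)
      (@continuous_lam b)) (@continuous_cst2 R _))).
  have fq : 0 < f q.
    have := elK_gt0 reg Tq; rewrite /elK /elq -addrA.
    have [_] := hb q d; rewrite /d /= => ->.
    by rewrite -qk mul0r addr0 /f mulrA.
  have [r r0 hr] := near_gt0 cf fq.
  exists r => // y /hr fy; split; first by rewrite -qk ltxx.
  move=> _; exists (f y) => //; rewrite lam_elH /elq (hb y d).1 /f; ring.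
have [r r0 hr] := elF_open reg (elK_gt0 reg Tq) eps0.
exists r => // y; rewrite -Fq => /hr[p /heps hp Fp] [q' Tq' Aq'].
have {}Aq' : elH (E i) p = q'.
  by apply: (elA_inj reg); rewrite -elFE Fp.
exists p => //; apply/ThatP => k; have [h1 h2] := hp k.
have /ThatP/(_ k) := Tq; rewrite le_eqVlt => /predU1P[/esym/h2[c c0]|/h1/ltW//].
have /ThatP/(_ k) := Tq'; rewrite -Aq' => + e.
by rewrite e pmulr_lge0.
Qed.

Lemma elA_closed i : closed (elA (E i) @` That).
Proof.
apply: compact_closed2; apply: continuous_image_compact; first exact: compact_That.
exact: continuous_elA.
Qed.

Lemma elF_closed i : closed (elF (E i) @` That).
Proof.
apply: compact_closed2; apply: continuous_image_compact; first exact: compact_That.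
exact: continuous_elF.
Qed.

Lemma boundary_fixed i q : That q -> ~ That° q -> Otil (elA (E i) q) ->
  elF (E i) q = elA (E i) q.
Proof.
move=> Tq nq Oq; have [[e10 e20]|hout] := cm_out cm i.
  by rewrite elFE /elH e10 e20 !mulr0 !addr0; case: q {Tq nq Oq}.
apply: elF_elA.
have [k qk] : exists k, lam q k = 0.
  apply: contrapT => h; apply: nq; apply/interior_That => k.
  rewrite lt_neqAle eq_sym; apply/andP; split; last by move/ThatP: Tq.
  by apply/eqP => qk; apply: h; exists k.
have kn : k != en (E i) by apply/eqP => kn; apply: (hout q) => //; rewrite -kn.
have [b hb] := bub_factor kn.
by rewrite /elq (hb q 0).1 qk mulr0.
Qed.

(** G_h maps Omega_til into Omega_h. A point of Omega_til on the boundary of an element stays in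
    place, and near it each curved element covers the straight one; so a neighbourhood covered by
    straight elements is covered by the curved ones. *)
Lemma Otil_Ocur i p : That p -> Otil (elA (E i) p) -> Ocur (elF (E i) p).
Proof.
move=> Tp Op; have [op|np] := pselect (That° p); first exact: (ch_in charts_cur).
rewrite (boundary_fixed Tp np Op); set x := elA (E i) p in Op *.
have [r r0 hr] : exists2 r : R, 0 < r & forall y, dist1 x y < r -> forall j,
    (elA (E j) @` That) y -> (elF (E j) @` That) y.
  apply: (@dist1_forall _ (fun j y => (elA (E j) @` That) y -> (elF (E j) @` That) y)) => j.
  have [[q Tq qx]|nx] := pselect ((elA (E j) @` That) x); last first.
    have [r r0 hr] := (open_dist1P _).1 (closed_openC (@elA_closed j)) x nx.
    by exists r => // y /hr.
  have nq : ~ That° q.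
    move=> oq; have [ij|ij] := eqVneq i j.
      by apply: np; rewrite (elA_inj (cm_reg cm i) (_ : elA (E i) p = elA (E i) q))// {2}ij qx.
    by apply: (cm_ovl cm _ Tq Tp qx oq); rewrite eq_sym.
  rewrite -qx; apply: elA_sub_elF => //; last by rewrite qx.
  by apply: boundary_fixed => //; rewrite qx.
have [s s0 hs] := (open_dist1P _).1 (ch_open charts_til) x Op.
apply/nbhs_dist1P; exists (Num.min r s); first by rewrite lt_min r0.
move=> y; rewrite lt_min => /andP[/hr yr /hs/interior_subset[j _ /yr]].
by exists j.
Qed.

Definition glued (U : I -> R2 -> R) (x : R2) : R :=
  xget 0 [set v | exists i p, [/\ That p, elF (E i) p = x & U i p = v]].

Section Glued.
Variable U : I -> R2 -> R.
Hypothesis compat : forall i j p q, That p -> That q ->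
  elF (E i) p = elF (E j) q -> U i p = U j q.

Lemma gluedE i p : That p -> glued U (elF (E i) p) = U i p.
Proof.
move=> Tp; apply: xget_unique; first by exists i, p.
by move=> v [j [q [Tq Fq <-]]]; exact: compat.
Qed.

Lemma glued_out x : (forall i p, That p -> elF (E i) p = x -> U i p = 0) -> glued U x = 0.
Proof.
move=> h; have [[i [p [Tp Fp]]]|nx] := pselect (exists i p, That p /\ elF (E i) p = x).
  by rewrite -Fp gluedE// (h i p).
by rewrite /glued xgetPN// => v [i [p [Tp Fp _]]]; apply: nx; exists i, p.
Qed.

Hypothesis lipU : forall i, LipB That (U i).
Hypothesis U0 : forall i p, That p -> ~ Ocur (elF (E i) p) -> U i p = 0.

(** The plane is covered by the curved elements, on each of which the inverse of F is Lipschitz, and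
    by the closed complement of Omega_h, on which the glued function is zero; these closed sets feed
    [Lip_cover]. *)
Lemma glued_lip : exists2 L : R, 0 <= L & Lip L setT (glued U).
Proof.
have /choice[L hL] : forall i, exists L : R, 0 <= L /\ Lip L (elF (E i) @` That) (glued U).
  move=> i; have [L [M [L0 M0 lU bU]]] := lipU i.
  have [K K0 hK] := elF_lip_inv (cm_reg cm i).
  exists (L * K); split; first exact: mulr_ge0.
  move=> _ _ [p Tp <-] [q Tq <-]; rewrite !gluedE//.
  by rewrite (le_trans (lU _ _ Tp Tq))// -mulrA ler_wpM2l// hK.
pose S := \sum_i L i; have S0 : 0 <= S by rewrite sumr_ge0// => i _; case: (hL i).
exists S => //; pose C (o : option I) := if o is Some i then elF (E i) @` That else ~` Ocur.
apply: (@Lip_cover _ _ C).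
- by move=> p q t.
- case=> [i|]; first exact: elF_closed.
  by apply: open_closedC; exact: (ch_open charts_cur).
- move=> y _; have [/(ch_cover charts_cur)[i [p [Tp <-]]]|ny] := pselect (Ocur y).
    by exists (Some i), p.
  by exists None.
- case=> [i|] y z [Cy _] [Cz _].
    have [L0 lL] := hL i; apply: (le_trans (lL _ _ Cy Cz)).
    rewrite ler_wpM2r ?dist1_ge0// /S (bigD1 i)//= lerDl sumr_ge0// => j _.
    by case: (hL j).
  have z0 x : (~` Ocur) x -> glued U x = 0.
    by move=> nx; apply: glued_out => i p Tp Fp; apply: U0 => //; rewrite Fp.
  by rewrite !z0// subrr normr0 mulr_ge0// dist1_ge0.
Qed.

End Glued.

(* The columns of the adjugate of DF. *)
Definition elN (F : elem R) (j : 'I_2) (p : R2) : R2 :=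
  if j == 0 then (quady (ely F) p, - quadx (ely F) p)
  else (- quady (elx F) p, quadx (elx F) p).

Lemma glued_sdiff (U : I -> R2 -> R) i p a :
  (forall i j p q, That p -> That q -> elF (E i) p = elF (E j) q -> U i p = U j q) ->
  That° p -> sdiff (U i) p a ->
  sdiff (glued U) (elF (E i) p)
    (dot a (elN (E i) 0 p) / elJ (E i) p, dot a (elN (E i) 1 p) / elJ (E i) p).
Proof.
move=> compat op da; have Tp := interior_subset op; have reg := cm_reg cm i.
have /nbhs_dist1P[e e0 he] := op.
have [r r0 hr] := elF_open reg (elK_gt0 reg Tp) e0.
have [K K0 hK] := elF_lip_inv reg.
have J0 : elJ (E i) p != 0 by rewrite gt_eqF//; case: reg => _; exact.
pose G := chinv (fun i => elF (E i)) i.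
have GK q : That q -> G (elF (E i) q) = q by exact: (chinvK charts_cur).
have inT y : dist1 (elF (E i) p) y < r -> exists2 q, That q & elF (E i) q = y.
  by move=> /hr[q /he Tq Fq]; exists q.
apply: (@sdiff_inv _ (glued U) (U i) (quad (elx (E i))) (quad (ely (E i))) G p a
  (quadx (elx (E i)) p, quady (elx (E i)) p) (quadx (ely (E i)) p, quady (ely (E i)) p)
  _ r K r0) => //.
- exact: GK.
- move=> y /inT[q Tq Fq]; rewrite -Fq GK//; split; first by [].
  by rewrite gluedE.
- move=> y z /inT[q Tq <-] /inT[q' Tq' <-]; rewrite !GK//; exact: hK.
- move: J0; rewrite /elJ /elN /dot /= => J0.
  by apply: eq_pair2; rewrite /= /GRing.scale /=; field.
- exact: sdiff_quad.
- exact: sdiff_quad.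
Qed.

End CurvedMesh.

(** * Almost everywhere statements and integrals on the reference triangle *)

Section AeOn.
Variable R : realType.
Local Notation R2 := (R * R)%type.

Lemma ae_onE (U : set R2) (P : R2 -> Prop) : ae_on U P =
  {ae mu2 R, forall x : (measurableTypeR R * measurableTypeR R)%type, U x -> P x}.
Proof. by []. Qed.

Lemma ae_onW (U : set R2) (P : R2 -> Prop) : (forall x, U x -> P x) -> ae_on U P.
Proof. by move=> h; apply: aeW => x; exact: h. Qed.

Lemma ae_onS (U : set R2) (P Q : R2 -> Prop) : (forall x, U x -> P x -> Q x) ->
  ae_on U P -> ae_on U Q.
Proof. by rewrite !ae_onE => h; apply: filterS => x hP Ux; apply: h => //; exact: hP. Qed.

Lemma ae_onI (U : set R2) (P Q : R2 -> Prop) :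
  ae_on U P -> ae_on U Q -> ae_on U (fun x => P x /\ Q x).
Proof. by rewrite !ae_onE; apply: filterS2 => x hP hQ Ux; split; [exact: hP|exact: hQ]. Qed.

Lemma ae_on_sub (U V : set R2) (P : R2 -> Prop) : V `<=` U -> ae_on U P -> ae_on V P.
Proof. by rewrite !ae_onE => VU; apply: filterS => x hP /VU. Qed.

Lemma Rint_ae (U : set R2) (f g : R2 -> R) : ae_on U (fun x => f x = g x) ->
  (\int[mu2 R]_(x in U) f x)%R = (\int[mu2 R]_(x in U) g x)%R.
Proof.
move=> fg; congr fine; apply: integral_eq_ae; move: fg; rewrite ae_onE.
by apply: filterS => x + Ux => /(_ Ux) ->.
Qed.

End AeOn.

Section ThatIntegrals.
Variable R : realType.
Local Notation R2 := (R * R)%type.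
Local Notation T2 := (measurableTypeR R * measurableTypeR R)%type.
Local Notation mu := (mu2 R).
Local Notation That := (@That R).

Let mT := @measurable_That R.

(** The limit [f] is arbitrary on the exceptional null set. Multiplying by the indicator [h] of the
    complement of that set makes the convergence pointwise on the whole triangle and the limit
    measurable, without changing any integral. *)
Lemma dom_conv (f_ : nat -> R2 -> R) (f g : R2 -> R) :
  (forall n, measurable_fun (That : set T2) (f_ n : T2 -> R)) ->
  ae_on That (fun p => f_ n p @[n --> \oo] --> f p) ->
  mu.-integrable That (EFin \o g) ->
  (forall n p, That p -> `|f_ n p| <= g p) ->
  (\int[mu]_(p in That) f_ n p)%R @[n --> \oo] --> (\int[mu]_(p in That) f p)%R.
Proof.
move=> mf [N [mN N0 hN]] ig fg.
have g0 p : That p -> 0 <= g p by move=> Tp; exact: le_trans (fg 0%N p Tp).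
pose h p := (\1_(~` N) p : R).
have mh : measurable_fun (That : set T2) (h : T2 -> R).
  by apply: measurable_funTS; apply: measurable_indic; exact: measurableC.
have h01 p : h p = 0 \/ h p = 1.
  by rewrite /h indicE; case: (_ \in _); [right|left].
pose f' p := f p * h p.
have cv p : That p -> (f_ n p * h p) @[n --> \oo] --> f' p.
  move=> Tp; rewrite /f' /h indicE in_setC.
  case: (boolP (p \in N)) => pN /=.
    by rewrite mulr0; under eq_fun do rewrite mulr0; exact: cvg_cst.
  rewrite mulr1; under eq_fun do rewrite mulr1.
  by apply: contrapT => nc; move: pN => /negP; apply; rewrite inE; apply: hN => /= hp; apply: nc; exact: hp.
have -> : (\int[mu]_(p in That) f p)%R = (\int[mu]_(p in That) f' p)%R.
  congr fine; apply: (integral_eq_off_null mN N0) => p Tp pN.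
  by rewrite /f' /h indicE in_setC memNset//= mulr1.
have -> : (fun n => (\int[mu]_(p in That) f_ n p)%R) =
    fun n => (\int[mu]_(p in That) (f_ n p * h p))%R.
  apply/funext => n; congr fine; apply: (integral_eq_off_null mN N0) => p Tp pN.
  by rewrite /h indicE in_setC memNset//= mulr1.
have b n p : That p -> `|f_ n p * h p| <= g p.
  move=> Tp; have [->|->] := h01 p; first by rewrite mulr0 normr0 g0.
  by rewrite mulr1 fg.
have mfn n : measurable_fun (That : set T2) (fun p : T2 => f_ n p * h p).
  exact: measurable_funM.
have mf' : measurable_fun (That : set T2) (f' : T2 -> R).
  exact: (@measurable_fun_cvg _ _ _ _ (fun n p => f_ n p * h p)).
have bf' p : That p -> `|f' p| <= g p.
  move=> Tp; apply: (ler_cvg_to (cvg_norm (cv p Tp)) (cvg_cst (g p))).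
  by apply: nearW => n; exact: b.
have if' : mu.-integrable That (EFin \o f').
  apply: (@le_integrable _ _ _ mu That mT _ (EFin \o g)) => //.
    exact/measurable_EFinP.
  by move=> p Tp; rewrite /= lee_fin (ger0_norm (g0 _ Tp)) bf'.
apply: fine_cvg; rewrite fineK; last exact: integrable_fin_num.
apply: (@dominated_cvg _ _ _ mu That mT _ _ (EFin \o g)) => //.
- by move=> n; exact/measurable_EFinP.
- by move=> p Tp; apply: cvg_EFin; [exact: nearW|exact: cv].
Qed.

Lemma dom_conv0 (I : finType) (f_ : I -> nat -> R2 -> R) (f g : I -> R2 -> R) :
  (forall i n, measurable_fun (That : set T2) (f_ i n : T2 -> R)) ->
  (forall i, ae_on That (fun p => f_ i n p @[n --> \oo] --> f i p)) ->
  (forall i, mu.-integrable That (EFin \o g i)) ->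
  (forall i n p, That p -> `|f_ i n p| <= g i p) ->
  (forall n, \sum_i (\int[mu]_(p in That) f_ i n p)%R = 0) ->
  \sum_i (\int[mu]_(p in That) f i p)%R = 0.
Proof.
move=> mf cv ig b h0.
have : (fun n => \sum_i (\int[mu]_(p in That) f_ i n p)%R) @ \oo -->
    \sum_i (\int[mu]_(p in That) f i p)%R.
  have cvi i := dom_conv (mf i) (cv i) (ig i) (b i).
  elim: (index_enum I) => [|i s IH].
    by rewrite big_nil; under eq_fun do rewrite big_nil; exact: cvg_cst.
  by rewrite big_cons; under eq_fun do rewrite big_cons; apply: cvgD.
under eq_fun do rewrite h0.
by move=> h; apply/esym; apply: (cvg_unique _ (cvg_cst 0) h).
Qed.

Definition sqint (f : R2 -> R) : Prop :=
  measurable_fun (That : set T2) (f : T2 -> R) /\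
  (\int[mu]_(p in That) (f p ^+ 2)%:E < +oo)%E.

Lemma That_cst_int (c : R) : mu.-integrable That (EFin \o cst c).
Proof.
apply: measurable_bounded_integrable => //; first exact: mu_That_fin.
exists `|c|; split; first exact: num_real.
by move=> M cM p _ /=; exact: ltW.
Qed.

Lemma sqint_sq f : sqint f -> mu.-integrable That (fun p => (f p ^+ 2)%:E).
Proof.
move=> [mf hf]; apply/integrableP; split.
  by apply/measurable_EFinP; exact: measurable_funX.
by under eq_integral do rewrite gee0_abs ?lee_fin ?sqr_ge0//.
Qed.

Lemma le_int (f g : R2 -> R) : measurable_fun (That : set T2) (f : T2 -> R) ->
  (forall p, That p -> `|f p| <= g p) -> mu.-integrable That (EFin \o g) ->
  mu.-integrable That (EFin \o f).
Proof.
move=> mf fg; apply: le_integrable => //; first exact/measurable_EFinP.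
move=> p Tp; rewrite /= lee_fin (le_trans (fg _ Tp))// ler_norm//.
Qed.

Lemma int_add (f g : R2 -> R) : mu.-integrable That (EFin \o f) ->
  mu.-integrable That (EFin \o g) -> mu.-integrable That (fun p => (f p + g p)%:E).
Proof. by move=> hf hg; exact: (integrableD mT hf hg). Qed.

Lemma int_scale (c : R) (f : R2 -> R) : mu.-integrable That (EFin \o f) ->
  mu.-integrable That (fun p => (c * f p)%:E).
Proof. by move=> hf; exact: (integrableZl mT c hf). Qed.

Lemma int_sum (A : finType) (f : A -> R2 -> R) : (forall a, mu.-integrable That (EFin \o f a)) ->
  mu.-integrable That (fun p => (\sum_a f a p)%:E).
Proof.
move=> hf; have := integrable_sum mT (index_enum A) (fun i (_ : true) => hf i).
by apply: eq_integrable => // p _; rewrite sumEFin.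
Qed.

Lemma int_abs (f : R2 -> R) : mu.-integrable That (EFin \o f) ->
  mu.-integrable That (fun p => `|f p|%:E).
Proof. by move=> hf; exact: (integrable_abse hf). Qed.

Lemma int_meas (f : R2 -> R) : mu.-integrable That (EFin \o f) ->
  measurable_fun (That : set T2) (f : T2 -> R).
Proof. by move=> /integrableP[/measurable_EFinP]. Qed.

Lemma int_bd (f h : R2 -> R) (M : R) : mu.-integrable That (EFin \o f) ->
  measurable_fun (That : set T2) (h : T2 -> R) -> (forall p, That p -> `|h p| <= M) ->
  mu.-integrable That (fun p => (f p * h p)%:E).
Proof.
move=> hf mh hM; apply: (@le_int _ (fun p => M * `|f p|)).
- by apply: measurable_funM => //; exact: int_meas.
- by move=> p Tp; rewrite normrM mulrC ler_wpM2r// hM.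
- by apply: int_scale; exact: int_abs.
Qed.

Lemma sqint_mul (f g : R2 -> R) : sqint f -> sqint g -> mu.-integrable That (fun p => (f p * g p)%:E).
Proof.
move=> sf sg; apply: (@le_int _ (fun p => f p ^+ 2 + g p ^+ 2)).
- by apply: measurable_funM; [case: sf|case: sg].
- move=> p _; rewrite normrM -(real_normK (num_real (f p))) -(real_normK (num_real (g p))).
  have := sqr_ge0 (`|f p| - `|g p|); have := mulr_ge0 (normr_ge0 (f p)) (normr_ge0 (g p)).
  by rewrite sqrrB; lra.
- by apply: int_add; exact: sqint_sq.
Qed.

Lemma sqint_int f : sqint f -> mu.-integrable That (EFin \o f).
Proof.
move=> sf; apply: (@le_int _ (fun p => 1 + f p ^+ 2)); first by case: sf.
  move=> p _; rewrite -(real_normK (num_real (f p))).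
  by have := sqr_ge0 (`|f p| - 1); have := normr_ge0 (f p); rewrite sqrrB; lra.
apply: (@int_add (cst 1)); first exact: That_cst_int.
exact: sqint_sq.
Qed.

Lemma int_bm (h : R2 -> R) (M : R) :
  measurable_fun (That : set T2) (h : T2 -> R) -> (forall p, That p -> `|h p| <= M) ->
  mu.-integrable That (EFin \o h).
Proof.
by move=> mh hM; apply: (@le_int _ (cst M)) => //; exact: That_cst_int.
Qed.

End ThatIntegrals.

(** * Pullback of square-integrable functions and of weak gradients *)

Section Pull.
Variable R : realType.
Local Notation R2 := (R * R)%type.
Local Notation T2 := (measurableTypeR R * measurableTypeR R)%type.
Local Notation mu := (mu2 R).
Local Notation That := (@That R).
Variables (I : finType) (U : set R2) (F : I -> R2 -> R2) (J : I -> R2 -> R).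
Hypothesis ch : charts U F J.
Hypothesis Jb : forall i, exists m M : R, 0 < m /\ forall p, That p -> m <= J i p <= M.

Let mT := @measurable_That R.

Lemma measurable_chart i : measurable_fun (setT : set T2) (F i : T2 -> T2).
Proof.
apply/measurable_fun_pairP; split; apply: continuous_measurable2 => x.
  apply: (@continuous_comp _ _ _ (F i) fst); first exact: (ch_cont ch).
  exact: continuous_fst2.
apply: (@continuous_comp _ _ _ (F i) snd); first exact: (ch_cont ch).
exact: continuous_snd2.
Qed.

Lemma measurable_pull i (f : R2 -> R) : measurable_fun (setT : set T2) (f : T2 -> R) ->
  measurable_fun (That : set T2) (fun p : T2 => f (F i p)).
Proof.
by move=> mf; apply: measurable_funTS; exact: (measurableT_comp mf (measurable_chart i)).
Qed.

Lemma sqint_pull (f : R2 -> R) : measurable_fun (setT : set T2) (f : T2 -> R) ->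
  (\int[mu]_(x in U) (f x ^+ 2)%:E < +oo)%E <-> forall i, sqint (f \o F i).
Proof.
move=> mf.
have m1 : measurable_fun setT (fun x : T2 => (f x ^+ 2)%:E).
  by apply/measurable_EFinP; exact: measurable_funX.
have p1 (x : T2) : (0 <= (f x ^+ 2)%:E)%E by rewrite lee_fin sqr_ge0.
rewrite (charts_ge0 ch m1 p1).
have m2 i : measurable_fun (That : set T2) (fun p : T2 => (f (F i p) ^+ 2)%:E).
  by apply/measurable_EFinP; apply: measurable_funX; exact: measurable_pull.
have m3 i : measurable_fun (That : set T2) (fun p : T2 => ((f (F i p) ^+ 2)%:E * (J i p)%:E)%E).
  apply: emeasurable_funM => //; apply/measurable_EFinP; apply: measurable_funTS.
  exact: (ch_mJ ch).
split=> [h i|h].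
  split; first exact: measurable_pull.
  have [m [M [m0 hJ]]] := Jb i.
  have hi : (\int[mu]_(p in That) ((f (F i p) ^+ 2)%:E * (J i p)%:E) < +oo)%E.
    apply: le_lt_trans h; rewrite (bigD1 i)//= leeDl// sume_ge0// => j _.
    apply: integral_ge0 => p Tp; rewrite mule_ge0// ?lee_fin ?sqr_ge0// ltW//.
    exact: (ch_J0 ch).
  apply: (@le_lt_trans _ _ (m^-1%:E * \int[mu]_(p in That) ((f (F i p) ^+ 2)%:E * (J i p)%:E)))%E.
    rewrite -ge0_integralZl//; last 2 first.
    - by move=> p Tp; rewrite mule_ge0// ?lee_fin ?sqr_ge0// ltW//; exact: (ch_J0 ch).
    - by rewrite lee_fin invr_ge0 ltW.
    apply: ge0_le_integral => //.
    - by move=> p Tp; rewrite lee_fin sqr_ge0.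
    - exact: m2.
    - by apply: measurable_funeM.
    - move=> p Tp; rewrite -!EFinM lee_fin mulrCA.
      rewrite -{1}[_ ^+ 2]mulr1 ler_wpM2l ?sqr_ge0// mulrC ler_pdivlMr// mul1r.
      by have /andP[] := hJ p Tp.
  by rewrite lte_mul_pinfty// ?lee_fin ?invr_ge0 ?ltW//.
apply: lte_sum_pinfty => i _; have [m [M [m0 hJ]]] := Jb i.
have [_ hi] := h i.
apply: (@le_lt_trans _ _ (`|M|%:E * \int[mu]_(p in That) ((f (F i p) ^+ 2)%:E)))%E.
  rewrite -ge0_integralZl//.
  apply: ge0_le_integral => //.
  - by move=> p Tp; rewrite mule_ge0// ?lee_fin ?sqr_ge0// ltW//; exact: (ch_J0 ch).
  - by apply: measurable_funeM.
  - move=> p Tp; rewrite -!EFinM lee_fin mulrC ler_wpM2r ?sqr_ge0//.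
    by have /andP[_ h2] := hJ p Tp; exact: le_trans (ler_norm _).
by rewrite lte_mul_pinfty// lee_fin.
Qed.

Lemma int_pull (f : R2 -> R) i : mu.-integrable That (EFin \o (f \o F i)) ->
  mu.-integrable That (fun p => (f (F i p) * J i p)%:E).
Proof.
have [m [M [m0 hJ]]] := Jb i => hf.
apply: (@int_bd _ (f \o F i) (J i) M) => //.
  by apply: measurable_funTS; exact: (ch_mJ ch).
by move=> p Tp; have /andP[h1 h2] := hJ p Tp; rewrite ger0_norm//; lra.
Qed.

(** Composition with a chart keeps measurability for Borel functions only; extension by zero makes
    the representative Borel on the whole plane. *)
Lemma borel_rep (f : R2 -> R) : ae_measurable U f -> exists2 f0 : R2 -> R,
  measurable_fun (setT : set T2) (f0 : T2 -> R) & ae_on U (fun x => f x = f0 x).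
Proof.
move=> [g mg fg]; exists (g \_ U).
  have mU : measurable (U : set T2) by apply: open_measurable2; exact: (ch_open ch).
  by apply/(measurable_restrictT _ mU).
by apply: ae_onS fg => x Ux ->; rewrite patchE mem_set.
Qed.

Lemma L2_rep (f : R2 -> R) : L2 U f -> exists f0 : R2 -> R,
  [/\ measurable_fun (setT : set T2) (f0 : T2 -> R), ae_on U (fun x => f x = f0 x) &
      forall i, sqint (f0 \o F i)].
Proof.
move=> [/borel_rep[f0 mf0 ff0] h]; exists f0; split => //.
apply/(sqint_pull mf0); apply: le_lt_trans h; rewrite le_eqVlt; apply/orP; left; apply/eqP.
by apply: integral_eq_ae; move: ff0; rewrite ae_onE; apply: filterS => x + Ux => /(_ Ux) ->.
Qed.

End Pull.

Section WeakPull.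
Variable R : realType.
Local Notation R2 := (R * R)%type.
Local Notation T2 := (measurableTypeR R * measurableTypeR R)%type.
Local Notation mu := (mu2 R).
Local Notation That := (@That R).

Lemma test_partial0 (U : set R2) (K : set R2) (f : R2 -> R) j x : closed K ->
  (forall x, ~ K x -> f x = 0) -> ~ K x -> partial j f x = 0.
Proof.
move=> cK f0 nK; rewrite (sdiff_partial j (sdiff_zero_off cK f0 nK)).
by rewrite /cmp; case: eqP.
Qed.

Lemma test_bounded (U : set R2) (f : R2 -> R) : test_fun U f ->
  exists2 M : R, 0 <= M & forall x, `|f x| <= M /\ forall j, `|partial j f x| <= M.
Proof.
move=> [sf [K [cK KU f0]]].
have [B B0 hB] := continuous_bounded2 cK (sf [::]).1.
have [B1 B10 hB1] := continuous_bounded2 cK (sf [:: 0]).1.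
have [B2 B20 hB2] := continuous_bounded2 cK (sf [:: 1]).1.
exists (B + B1 + B2); first by lra.
move=> x; have [Kx|nK] := pselect (K x).
  split; first by have := hB x Kx; rewrite /=; lra.
  move=> j; have [->|/ord2P ->] := eqVneq j 0.
    by have := hB1 x Kx; rewrite /=; lra.
  by have := hB2 x Kx; rewrite /=; lra.
rewrite f0// normr0; split; first by lra.
move=> j; rewrite (@test_partial0 U K)//; last exact: compact_closed2.
by rewrite normr0; lra.
Qed.

Variables (I : finType) (U : set R2) (F : I -> R2 -> R2) (J : I -> R2 -> R).
Hypothesis ch : charts U F J.
Hypothesis Jb : forall i, exists m M : R, 0 < m /\ forall p, That p -> m <= J i p <= M.

Let mU : measurable (U : set T2).
Proof. by apply: open_measurable2; exact: (ch_open ch). Qed.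

(** The identities for the two weak derivatives are added, one test function [theta j] for each.
    Later integrations by parts know psi through this single identity and through square
    integrability. *)
Lemma weak_pull (psi : R2 -> R) (g : 'I_2 -> R2 -> R) : H1_with_grad U psi g ->
  exists (psi0 : R2 -> R) (g0 : 'I_2 -> R2 -> R),
  [/\ measurable_fun (setT : set T2) (psi0 : T2 -> R) /\
      forall j, measurable_fun (setT : set T2) (g0 j : T2 -> R),
      ae_on U (fun x => psi x = psi0 x) /\ forall j, ae_on U (fun x => g j x = g0 j x),
      forall i, sqint (psi0 \o F i), forall i j, sqint (g0 j \o F i) &
      forall theta : 'I_2 -> R2 -> R, (forall j, test_fun U (theta j)) ->
        \sum_i (\int[mu]_(p in That) ((\sum_j (psi0 (F i p) * partial j (theta j) (F i p) +
           g0 j (F i p) * theta j (F i p))) * J i p))%R = 0].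
Proof.
move=> [Lpsi Lg wg].
have [psi0 [mpsi epsi spsi]] := L2_rep ch Jb Lpsi.
have /choice[g0 hg0] := fun j => L2_rep ch Jb (Lg j).
exists psi0, g0; split => //.
- by split => // j; case: (hg0 j).
- by split => // j; case: (hg0 j).
- by move=> i j; case: (hg0 j).
move=> theta ht.
pose f1 j x := psi0 x * partial j (theta j) x.
pose f2 j x := g0 j x * theta j x.
have mt j : measurable_fun (setT : set T2) (theta j : T2 -> R).
  by apply: continuous_measurable2; case: (ht j) => s _; exact: (s [::]).1.
have mpt j : measurable_fun (setT : set T2) (partial j (theta j) : T2 -> R).
  by apply: continuous_measurable2; case: (ht j) => s _; exact: (s [:: j]).1.
have mg j : measurable_fun (setT : set T2) (g0 j : T2 -> R) by case: (hg0 j).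
have mf1 j : measurable_fun (setT : set T2) (f1 j : T2 -> R) by exact: measurable_funM.
have mf2 j : measurable_fun (setT : set T2) (f2 j : T2 -> R) by exact: measurable_funM.
have if1 i j : mu.-integrable That (EFin \o (f1 j \o F i)).
  have [M M0 hM] := test_bounded (ht j).
  apply: (@int_bd _ (psi0 \o F i) (fun p => partial j (theta j) (F i p)) M).
  - exact: sqint_int.
  - exact: (measurable_pull ch i (mpt j)).
  - by move=> p _; exact: (hM _).2.
have if2 i j : mu.-integrable That (EFin \o (f2 j \o F i)).
  have [M M0 hM] := test_bounded (ht j).
  apply: (@int_bd _ (g0 j \o F i) (fun p => theta j (F i p)) M).
  - by apply: sqint_int; case: (hg0 j).
  - exact: (measurable_pull ch i (mt j)).
  - by move=> p _; exact: (hM _).1.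
have z j : (\int[mu]_(x in U) f1 j x)%R + (\int[mu]_(x in U) f2 j x)%R = 0.
  have [_ _ /(_ (theta j) (ht j))] := wg j; rewrite /= expr1 mulN1r => h.
  have -> : (\int[mu]_(x in U) f1 j x)%R = (\int[mu]_(x in U) (psi x * partial j (theta j) x))%R.
    by apply: Rint_ae; apply: ae_onS epsi => x Ux ->.
  rewrite h; have -> : (\int[mu]_(x in U) f2 j x)%R = (\int[mu]_(x in U) (g j x * theta j x))%R.
    have [_ e _] := hg0 j.
    by apply: Rint_ae; apply: ae_onS e => x Ux ->.
  by rewrite addNr.
have e j : \sum_i (\int[mu]_(p in That) ((f1 j (F i p) + f2 j (F i p)) * J i p))%R = 0.
  rewrite -[RHS](z j) (charts_Rintegral ch (mf1 j)) ?(charts_Rintegral ch (mf2 j)).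
  - rewrite -big_split; apply: eq_bigr => i _ /=.
    rewrite -(RintegralD (@measurable_That R) (int_pull ch Jb (if1 i j)) (int_pull ch Jb (if2 i j))).
    by apply: eq_Rintegral => p _; rewrite mulrDl.
  - by move=> i; exact: (int_pull ch Jb (if2 i j)).
  - by move=> i; exact: (int_pull ch Jb (if1 i j)).
have : \sum_j \sum_i (\int[mu]_(p in That) ((f1 j (F i p) + f2 j (F i p)) * J i p))%R = 0.
  by rewrite big1.
rewrite exchange_big /= => h0; rewrite -[RHS]h0; apply: eq_bigr => i _.
have iF j : mu.-integrable That (EFin \o (fun p => (f1 j (F i p) + f2 j (F i p)) * J i p)).
  apply: (@int_pull _ _ _ _ _ ch Jb (fun x => f1 j x + f2 j x)).
  by apply: int_add; [exact: if1|exact: if2].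
rewrite !big_ord_recl big_ord0 addr0 -(RintegralD (@measurable_That R) (iF _) (iF _)).
by apply: eq_Rintegral => p _; rewrite !big_ord_recl big_ord0 addr0 mulrDl.
Qed.

End WeakPull.

(** * Integration by parts on the reference triangle *)

Section RefParts.
Variable R : realType.
Local Notation R2 := (R * R)%type.
Local Notation T2 := (measurableTypeR R * measurableTypeR R)%type.
Local Notation mu := (mu2 R).
Local Notation That := (@That R).
Variables (I : finType) (E : I -> elem R).
Hypothesis cm : cmesh E.
Local Notation F i := (elF (E i)).
Local Notation J i := (elJ (E i)).
Local Notation Ocur := (Ocur E).
Local Notation Otil := (Otil E).

Lemma Jb_cur i : exists m M : R, 0 < m /\ forall p, That p -> m <= J i p <= M.
Proof.
have T0 : That !=set0 by exists (0, 0); apply/ThatE => /=; split; lra.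
have [q /set_mem Tq hq] := compact_EVT_min T0 (@compact_That R)
    (continuous_subspaceT (@continuous_elJ R (E i))).
have [B B0 hB] := continuous_bounded2 (@compact_That R) (@continuous_elJ R (E i)).
exists (J i q), B; split; first by case: (cm_reg cm i) => _; exact.
move=> p Tp; rewrite hq ?inE//= (le_trans (ler_norm _))//; exact: hB.
Qed.

Lemma Jb_til i : exists m M : R, 0 < m /\
  forall p, That p -> m <= cst (elD (E i)) p <= M.
Proof.
exists (elD (E i)), (elD (E i)); split; first by case: (cm_reg cm i).
by move=> p _; rewrite /= lexx.
Qed.

Lemma compact_bigsetU (K : I -> set R2) : (forall i, compact (K i)) ->
  compact (\bigcup_i K i).
Proof.
move=> cK; have -> : \bigcup_i K i = \big[setU/set0]_(i <- index_enum I) K i.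
  by rewrite -bigcup_seq; apply: eq_bigcupl; split => i _ //=; exact: mem_index_enum.
by apply: bigsetU_compact => i _; exact: cK.
Qed.

Section Identity.
Variables (psi : R2 -> R) (g : 'I_2 -> R2 -> R).
Hypothesis mpsi : measurable_fun (setT : set T2) (psi : T2 -> R).
Hypothesis mg : forall j, measurable_fun (setT : set T2) (g j : T2 -> R).
Hypothesis spsi : forall i, sqint (psi \o F i).
Hypothesis sg : forall i j, sqint (g j \o F i).
Hypothesis weak : forall theta : 'I_2 -> R2 -> R, (forall j, test_fun Ocur (theta j)) ->
  \sum_i (\int[mu]_(p in That) ((\sum_j (psi (F i p) * partial j (theta j) (F i p) +
     g j (F i p) * theta j (F i p))) * J i p))%R = 0.

(* Integration by parts against Lipschitz functions given on the elements: the
   gradient [a] on the reference element becomes [a . adj DF / det DF]. *)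
Lemma ref_parts (U : 'I_2 -> I -> R2 -> R) (K : I -> set R2) (a : 'I_2 -> I -> R2 -> R2) :
  (forall k i j p q, That p -> That q -> F i p = F j q -> U k i p = U k j q) ->
  (forall k i, LipB That (U k i)) ->
  (forall i, compact (K i)) ->
  (forall i p, K i p -> That p /\ Ocur (F i p)) ->
  (forall k i p, That p -> ~ K i p -> U k i p = 0) ->
  (forall k i, ae_on That (fun p => sdiff (U k i) p (a k i p))) ->
  \sum_i (\int[mu]_(p in That) (\sum_j (psi (F i p) * dot (a j i p) (elN (E i) j p) +
     g j (F i p) * U j i p * J i p)))%R = 0.
Proof.
move=> compat lipU cK KO U0 da.
pose KK := \bigcup_i F i @` K i.
have cKK : compact KK.
  apply: compact_bigsetU => i; apply: continuous_image_compact => //.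
  exact: continuous_elF.
have KKO : KK `<=` Ocur by move=> _ [i _ [p Kp <-]]; case: (KO i p Kp).
have u0 k x : ~ KK x -> glued E (U k) x = 0.
  move=> nx; apply: glued_out => // i p Tp Fp.
    by move=> *; exact: compat.
  by apply: U0 => // Kp; apply: nx; exists i => //; exists p.
have /choice[th hth] : forall k, exists th : (nat -> R2 -> R), exists C : R, [/\ 0 <= C,
    forall n, test_fun Ocur (th n),
    forall n x, `|th n x| <= C /\ forall j, `|partial j (th n) x| <= C,
    forall x, th n x @[n --> \oo] --> glued E (U k) x &
    forall x c, sdiff (glued E (U k)) x c -> forall j, partial j (th n) x @[n --> \oo] --> cmp j c].
  move=> k; have [L L0 lL] : exists2 L : R, 0 <= L & Lip L setT (glued E (U k)).
    apply: glued_lip => //; first by move=> *; exact: compat.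
    by move=> i p Tp nO; apply: U0 => // Kp; apply: nO; case: (KO i p Kp).
  exact: (lip_approx (ch_open (charts_cur cm)) cKK KKO L0 lL (u0 k)).
have {hth}/choice[C hC] := hth.
have /choice[M hM] : forall i, exists M : R, forall p, That p -> 0 <= J i p <= M.
  move=> i; have [m [M [m0 h]]] := Jb_cur i; exists M => p Tp.
  by have /andP[h1 ->] := h p Tp; rewrite andbT; lra.
apply: (@dom_conv0 R I (fun i n p => (\sum_j (psi (F i p) * partial j (th j n) (F i p) +
     g j (F i p) * th j n (F i p))) * J i p) _
  (fun i p => M i * (\sum_j (C j * `|psi (F i p)| + C j * `|g j (F i p)|)))).
- move=> i n; apply: measurable_funM; last first.
    by apply: measurable_funTS; exact: measurable_elJ.
  apply: measurable_sum => j; have [C0 /(_ n)[sth _] _ _ _] := hC j.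
  apply: measurable_funD; apply: measurable_funM.
  + exact: (measurable_pull (charts_cur cm) i mpsi).
  + apply: (measurable_pull (charts_cur cm) i); apply: continuous_measurable2.
    exact: (sth [:: j]).1.
  + exact: (measurable_pull (charts_cur cm) i (mg j)).
  + apply: (measurable_pull (charts_cur cm) i); apply: continuous_measurable2.
    exact: (sth [::]).1.
(* At an interior point of the element the glued function is strictly differentiable, so the
   derivatives of the approximants converge there; the factor 1 / J of its gradient cancels with the
   weight [J]. *)
- move=> i; have := ae_onI (da 0 i) (da 1 i); have := @ae_That_interior R.
  rewrite -[X in X -> _]/(ae_on That That°) => oT dd.
  apply: ae_onS (ae_onI oT dd) => p Tp [op [d0 d1]].
  have J0 : J i p != 0 by rewrite gt_eqF//; case: (cm_reg cm i) => _; exact.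
  have cvj j : (psi (F i p) * partial j (th j n) (F i p) + g j (F i p) * th j n (F i p))
      @[n --> \oo] --> psi (F i p) * (dot (a j i p) (elN (E i) j p) / J i p) +
        g j (F i p) * U j i p.
    have [C0 _ _ cv cd] := hC j.
    have dj : sdiff (U j i) p (a j i p) by have [->|/ord2P ->] := eqVneq j 0.
    have compj i' j' p' q' : That p' -> That q' -> F i' p' = F j' q' -> U j i' p' = U j j' q'.
      exact: compat.
    have := cd _ _ (glued_sdiff cm compj op dj) j.
    rewrite (_ : cmp j _ = dot (a j i p) (elN (E i) j p) / J i p); last first.
      by rewrite /cmp; have [->|/ord2P ->] := eqVneq j 0.
    have := cv (F i p); rewrite (gluedE compj)// => h1 h2.
    by apply: cvgD; apply: cvgM => //; exact: cvg_cst.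
  rewrite (_ : \sum_j _ = (\sum_j (psi (F i p) * (dot (a j i p) (elN (E i) j p) / J i p) +
        g j (F i p) * U j i p)) * J i p); last first.
    by rewrite mulr_suml; apply: eq_bigr => j _; field.
  apply: cvgM; last exact: cvg_cst.
  rewrite !big_ord_recl big_ord0 addr0; under eq_fun do rewrite !big_ord_recl big_ord0 addr0.
  by apply: cvgD.
- move=> i; have i1 := int_abs (sqint_int (spsi i)).
  have i2 j := int_abs (sqint_int (sg i j)).
  exact: (int_scale (M i) (int_sum (fun j => int_add (int_scale (C j) i1) (int_scale (C j) (i2 j))))).
- move=> i n p Tp; have /andP[J0 JM] := hM i p Tp.
  rewrite normrM (ger0_norm J0) mulrC; apply: ler_pM => //.
  rewrite (le_trans (ler_norm_sum _ _ _))//; apply: ler_sum => j _.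
  have [C0 _ hb _ _] := hC j; have [b1 b2] := hb n (F i p).
  rewrite (le_trans (ler_normD _ _))// !normrM; apply: lerD.
    by rewrite mulrC ler_wpM2r// b2.
  by rewrite mulrC ler_wpM2r.
- by move=> n; apply: weak => j; have [_ h _ _ _] := hC j.
Qed.

End Identity.
End RefParts.

Lemma sum2 (V : nmodType) (f : 'I_2 -> V) : \sum_j f j = f 0 + f 1.
Proof.
by rewrite !big_ord_recl big_ord0 addr0; congr (f _ + f _); exact/val_inj.
Qed.

(** * Cutoff functions on the reference triangle *)

Section Cutoff.
Variable R : realType.
Local Notation R2 := (R * R)%type.
Local Notation T2 := (measurableTypeR R * measurableTypeR R)%type.
Local Notation mu := (mu2 R).
Local Notation That := (@That R).

Definition gradlam (k : 'I_3) : R2 :=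
  if k == 0 then (1, 0) else if k == 1 then (0, 1) else (-1, -1).

Lemma dot_gradlam k d : dot (gradlam k) d = lamd d k.
Proof. by case: (ord3P k) => ->; rewrite /dot /gradlam /lamd /=; ring. Qed.

Definition lamq (k : 'I_3) : quadc R :=
  if k == 0 then Quadc 0 1 0 0 0 0 else if k == 1 then Quadc 0 0 1 0 0 0
  else Quadc 1 (-1) (-1) 0 0 0.

Lemma lamqE k p : quad (lamq k) p = lam p k.
Proof. by case: (ord3P k) => ->; rewrite ?lam0 ?lam1 ?lam2 /quad /lamq /=; ring. Qed.

Lemma LipB_That_quad (c : quadc R) : LipB That (quad c).
Proof. by apply: (@LipB_quad _ _ _ 1) => p; exact: That_square. Qed.

Lemma LipB_quadx (c : quadc R) : LipB That (quadx c).
Proof.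
by apply: LipB_ext (LipB_That_quad (Quadc (k1 c) (2 * k3 c) (k4 c) 0 0 0)) => p _;
  rewrite /quad /quadx /=; ring.
Qed.

Lemma LipB_quady (c : quadc R) : LipB That (quady c).
Proof.
by apply: LipB_ext (LipB_That_quad (Quadc (k2 c) (k4 c) (2 * k5 c) 0 0 0)) => p _;
  rewrite /quad /quady /=; ring.
Qed.

Lemma LipB_That_lam k : LipB That (fun p => lam p k).
Proof. by apply: LipB_ext (LipB_That_quad (lamq k)) => p _; exact: lamqE. Qed.

Lemma sdiff_lam k p : sdiff (fun p => lam p k) p (gradlam k).
Proof.
rewrite (_ : (fun p => lam p k) = quad (lamq k)); last by apply/funext => q; rewrite lamqE.
have := sdiff_quad (lamq k) p; rewrite (_ : (_, _) = gradlam k)//.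
by case: (ord3P k) => ->; rewrite /gradlam /lamq /quadx /quady /=; apply: eq_pair2 => /=; ring.
Qed.

Lemma edge_proj k p : That p -> exists q, [/\ That q, lam q k = 0 & dist1 p q <= lam p k].
Proof.
move=> Tp; have /ThatE[p1 p2 p3] := Tp; case: (ord3P k) => ->.
- exists (0, p.2); split => //; first by apply/ThatE => /=; split; lra.
  by rewrite /dist1 /= subrr normr0 subr0 addr0 ger0_norm// lam0.
- exists (p.1, 0); split => //; first by apply/ThatE => /=; split; lra.
  by rewrite /dist1 /= subrr normr0 subr0 add0r ger0_norm// lam1.
- exists (1 - p.2, p.2); split => //; first by apply/ThatE => /=; split; lra.
    by rewrite lam2 /=; ring.
  by rewrite /dist1 /= subrr normr0 addr0 lam2 distrC ger0_norm; lra.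
Qed.

(** Projecting parallel to an axis onto the edge stays in the triangle and moves a point by at most
    [lam p k]. *)
Lemma LipB_edge0 (f : R2 -> R) k : LipB That f -> (forall p, That p -> lam p k = 0 -> f p = 0) ->
  exists2 L : R, 0 <= L & forall p, That p -> `|f p| <= L * lam p k.
Proof.
move=> [L [M [L0 M0 lf bf]]] f0; exists L => // p Tp.
have [q [Tq qk pq]] := edge_proj k Tp.
have := lf p q Tp Tq; rewrite (f0 q Tq qk) subr0 => h.
by rewrite (le_trans h)// ler_wpM2l.
Qed.

(** Rises from 0 to 1 across the strip where [lam k] is between 1 / n and 2 / n. Starting at 1 / n
    instead of 0 leaves a compact support inside the open triangle; [dcut] is the slope, valid off
    the two lines with a kink. *)
Definition cut (n : nat) (k : 'I_3) (p : R2) : R := clamp01 (n%:R * lam p k - 1).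

Definition dcut (n : nat) (k : 'I_3) (p : R2) : R :=
  n%:R * \1_[set p : R2 | 1 < n%:R * lam p k < 2] p.

Lemma clamp01_0 (t : R) : t <= 0 -> clamp01 t = 0.
Proof. by move=> t0; rewrite /clamp01 maxEle minEle; case: ifP; case: ifP; lra. Qed.

Lemma clamp01_1 (t : R) : 1 <= t -> clamp01 t = 1.
Proof. by move=> t0; rewrite /clamp01 maxEle minEle; case: ifP; case: ifP; lra. Qed.

Lemma clamp01_id (t : R) : 0 <= t <= 1 -> clamp01 t = t.
Proof. by move=> /andP[t0 t1]; rewrite /clamp01 maxEle minEle; case: ifP; case: ifP; lra. Qed.

Lemma sdiff_cut n k p : n%:R * lam p k != 1 -> n%:R * lam p k != 2 ->
  sdiff (cut n k) p (dcut n k p *: gradlam k).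
Proof.
move=> n1 n2; have c1 : continuous (fun p : R2 => n%:R * lam p k - 1).
  exact: (contD (contM (@continuous_cst2 R _) (@continuous_lam R k)) (@continuous_cst2 R _)).
have c1' : continuous (fun p : R2 => 1 - n%:R * lam p k).
  exact: (contD (@continuous_cst2 R _) (contN (contM (@continuous_cst2 R _) (@continuous_lam R k)))).
have c2 : continuous (fun p : R2 => n%:R * lam p k - 2).
  exact: (contD (contM (@continuous_cst2 R _) (@continuous_lam R k)) (@continuous_cst2 R _)).
have c2' : continuous (fun p : R2 => 2 - n%:R * lam p k).
  exact: (contD (@continuous_cst2 R _) (contN (contM (@continuous_cst2 R _) (@continuous_lam R k)))).
have E0 : 0 *: gradlam k = (0, 0) by rewrite scale0r.
have [h1|h1|e] := ltgtP (n%:R * lam p k) 1; last by rewrite e eqxx in n1.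
  rewrite /dcut indicE memNset ?mulr0 ?E0; last by move=> /andP[]; lra.
  have p0 : 0 < 1 - n%:R * lam p k by lra.
  have [r r0 hr] := near_gt0 c1' p0.
  apply: (sdiff_loc r0 _ (sdiff_cst 0 p)) => y /hr hy.
  by rewrite /cut clamp01_0//; lra.
have [h2|h2|e] := ltgtP (n%:R * lam p k) 2; last by rewrite e eqxx in n2.
  rewrite /dcut indicE mem_set ?mulr1; last by apply/andP.
  have p0 : 0 < n%:R * lam p k - 1 by lra.
  have p1 : 0 < 2 - n%:R * lam p k by lra.
  have [r r0 hr] := near_gt0 c1 p0; have [s s0 hs] := near_gt0 c2' p1.
  have m0 : 0 < Num.min r s by rewrite lt_min r0.
  have hd := sdiffD (sdiffM (sdiff_cst n%:R p) (sdiff_lam k p)) (sdiff_cst (-1) p).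
  move: hd; rewrite (_ : _ + (0, 0) = n%:R *: gradlam k); last first.
    by apply: eq_pair2; rewrite /= /GRing.scale /= mulr0 !addr0.
  apply: (sdiff_loc m0) => y; rewrite lt_min => /andP[/hr y1 /hs y2].
  by rewrite /cut clamp01_id//; apply/andP; split; lra.
rewrite /dcut indicE memNset ?mulr0 ?E0; last by move=> /andP[]; lra.
have p0 : 0 < n%:R * lam p k - 2 by lra.
have [r r0 hr] := near_gt0 c2 p0.
apply: (sdiff_loc r0 _ (sdiff_cst 1 p)) => y /hr hy.
by rewrite /cut clamp01_1//; lra.
Qed.

Definition chi n p := cut n 0 p * cut n 1 p * cut n 2 p.

Definition cutx n (k : 'I_3) p :=
  if k == 0 then cut n 1 p * cut n 2 p
  else if k == 1 then cut n 0 p * cut n 2 p else cut n 0 p * cut n 1 p.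

Lemma sdiff_chi n p : (forall k, n%:R * lam p k != 1 /\ n%:R * lam p k != 2) ->
  sdiff (chi n) p (\sum_k (dcut n k p * cutx n k p) *: gradlam k).
Proof.
move=> h; have d k := sdiff_cut (h k).1 (h k).2.
have := sdiffM (sdiffM (d 0) (d 1)) (d 2).
set a := (X in sdiff _ _ X); set b := (X in _ -> sdiff _ _ X); suff -> : a = b by [].
by rewrite /a /b sum3 /cutx /=; apply: eq_pair2; rewrite /= /GRing.scale /=; ring.
Qed.

Lemma cut01 n k p : 0 <= cut n k p <= 1.
Proof. by rewrite clamp01_ge0 clamp01_le1. Qed.

Lemma cutx01 n k p : 0 <= cutx n k p <= 1.
Proof.
have [/andP[a0 a1] /andP[b0 b1] /andP[c0 c1]] := And3 (cut01 n 0 p) (cut01 n 1 p) (cut01 n 2 p).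
by rewrite /cutx; case: ifP => _; [|case: ifP => _]; rewrite mulr_ge0//= mulr_ile1.
Qed.

Lemma chi01 n p : 0 <= chi n p <= 1.
Proof.
have [/andP[a0 a1] /andP[b0 b1] /andP[c0 c1]] := And3 (cut01 n 0 p) (cut01 n 1 p) (cut01 n 2 p).
by rewrite /chi !mulr_ge0//= !mulr_ile1// mulr_ge0.
Qed.

Lemma chi_out n p k : n%:R * lam p k <= 1 -> chi n p = 0.
Proof.
move=> h; have : cut n k p = 0 by rewrite /cut clamp01_0// subr_le0.
by rewrite /chi; case: (ord3P k) => -> ->; rewrite ?mulr0 ?mul0r.
Qed.

Lemma LipB_cut n k : LipB That (cut n k).
Proof.
apply: (@LipB_clamp _ _ (fun p => n%:R * lam p k - 1)).
exact: (LipBD (LipBM (LipB_cst _ _) (LipB_That_lam k)) (LipB_cst _ _)).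
Qed.

Lemma LipB_chi n : LipB That (chi n).
Proof. by apply: LipBM (LipB_cut _ _); exact: LipBM (LipB_cut _ _) (LipB_cut _ _). Qed.

Lemma LipB_within (f : R2 -> R) : LipB That f -> {within That, continuous f}.
Proof.
move=> [L [M [L0 M0 lf _]]]; apply/subspace_continuousP => x Tx.
apply/cvgrPdist_lt => e e0; rewrite near_withinE; apply/nbhs_dist1P.
have L1 : 0 < L + 1 by lra.
exists (e / (L + 1)); first by rewrite divr_gt0.
move=> y; rewrite ltr_pdivlMr// => xy Ty; apply: le_lt_trans (lf x y Tx Ty) _.
by have := dist1_ge0 x y; lra.
Qed.

Lemma LipB_measurable (f : R2 -> R) : LipB That f -> measurable_fun (That : set T2) (f : T2 -> R).
Proof.
move=> /LipB_within; apply: within_continuous_measurable2.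
by apply: compact_closed2; exact: compact_That.
Qed.

Lemma measurable_lam k : measurable_fun (setT : set T2) (fun p : T2 => lam p k).
Proof. by apply: continuous_measurable2; exact: continuous_lam. Qed.

Lemma measurable_clamp : measurable_fun (setT : set (measurableTypeR R)) (@clamp01 R).
Proof.
by apply: measurable_maxr => //; apply: measurable_minr.
Qed.

Lemma measurable_cut n k : measurable_fun (setT : set T2) (cut n k : T2 -> R).
Proof.
apply: (measurableT_comp measurable_clamp); apply: measurable_funB => //.
by apply: measurable_funM => //; exact: measurable_lam.
Qed.

Lemma measurable_dcut n k : measurable_fun (setT : set T2) (dcut n k : T2 -> R).
Proof.
apply: measurable_funM => //; apply: measurable_indic.
have mf : measurable_fun (setT : set T2) (fun p : T2 => n%:R * lam p k).
  by apply: measurable_funM => //; exact: measurable_lam.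
have := mf measurableT `]1, 2[%classic (measurable_itv _).
by rewrite setTI; congr measurable; apply/seteqP; split => p /=; rewrite in_itv.
Qed.

Lemma measurable_cutx n k : measurable_fun (setT : set T2) (cutx n k : T2 -> R).
Proof.
have m := measurable_cut n.
by case: (ord3P k) => ->; apply: measurable_funM; exact: m.
Qed.

Lemma measurable_chi n : measurable_fun (setT : set T2) (chi n : T2 -> R).
Proof.
have m := measurable_cut n.
by apply: measurable_funM; [apply: measurable_funM|]; exact: m.
Qed.

(** On the strip that carries the slope n one has n lam < 2, so a factor of size L lam compensates
    the growth uniformly in n. *)
Lemma dcut_bound n k p (L m : R) : 0 <= lam p k -> `|m| <= L * lam p k -> 0 <= L ->
  `|dcut n k p * m| <= 2 * L.
Proof.
move=> l0 mL L0; rewrite /dcut indicE; case: (boolP (_ \in _)) => [|_]; last first.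
  by rewrite mulr0 mul0r normr0 mulr_ge0.
rewrite inE /= => /andP[_ h]; rewrite mulr1 normrM ger0_norm//.
have n0 : 0 <= (n%:R : R) by [].
have := ler_wpM2l n0 mL; have := ler_wpM2l L0 (ltW h); lra.
Qed.

End Cutoff.

Section CutoffIdentity.
Variable R : realType.
Local Notation R2 := (R * R)%type.
Local Notation T2 := (measurableTypeR R * measurableTypeR R)%type.
Local Notation mu := (mu2 R).
Local Notation That := (@That R).
Variables (I : finType) (E : I -> elem R).
Hypothesis cm : cmesh E.
Local Notation F i := (elF (E i)).
Local Notation J i := (elJ (E i)).
Local Notation Ocur := (Ocur E).
Variables (psi : R2 -> R) (g : 'I_2 -> R2 -> R).
Hypothesis mpsi : measurable_fun (setT : set T2) (psi : T2 -> R).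
Hypothesis mg : forall j, measurable_fun (setT : set T2) (g j : T2 -> R).
Hypothesis spsi : forall i, sqint (psi \o F i).
Hypothesis sg : forall i j, sqint (g j \o F i).
Hypothesis weak : forall theta : 'I_2 -> R2 -> R, (forall j, test_fun Ocur (theta j)) ->
  \sum_i (\int[mu]_(p in That) ((\sum_j (psi (F i p) * partial j (theta j) (F i p) +
     g j (F i p) * theta j (F i p))) * J i p))%R = 0.

Lemma LipB_elN (e : elem R) j c : LipB That (fun p => lamd (elN e j p) c).
Proof.
have [h1 h2] : LipB That (fun p => (elN e j p).1) /\ LipB That (fun p => (elN e j p).2).
  rewrite /elN; case: (j == 0); split => /=; try exact: LipB_quadx;
  try exact: LipB_quady; apply: LipBN; [exact: LipB_quadx|exact: LipB_quady].
by case: (ord3P c) => ->; [exact: h1|exact: h2|exact: (LipBD (LipBN h1) (LipBN h2))].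
Qed.

(* The cutoff [chi n] vanishes near the boundary of the element and its
   gradient, of size n, is bounded when multiplied by adj DF W, whose normal
   component vanishes on each edge. *)
Lemma cut_identity (i0 : I) (W : 'I_2 -> R2 -> R) (w : 'I_2 -> R2 -> R2) (D : R2 -> R) (B : R) :
  (forall j, LipB That (W j)) -> (forall j, ae_on That (fun p => sdiff (W j) p (w j p))) ->
  measurable_fun (That : set T2) (D : T2 -> R) -> (forall p, That p -> `|D p| <= B) ->
  ae_on That (fun p => \sum_j dot (w j p) (elN (E i0) j p) = D p) ->
  (forall k p, That p -> lam p k = 0 -> \sum_j W j p * lamd (elN (E i0) j p) k = 0) ->
  (\int[mu]_(p in That) (psi (F i0 p) * D p + \sum_j g j (F i0 p) * W j p * J i0 p))%R = 0.
Proof.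
move=> lW dW mD bD DE me; pose F0 := elF (E i0); pose J0 := elJ (E i0).
pose m k p := \sum_j W j p * lamd (elN (E i0) j p) k.
have lm k : LipB That (m k).
  have h := LipBD (LipBM (lW 0) (LipB_elN (E i0) 0 k)) (LipBM (lW 1) (LipB_elN (E i0) 1 k)).
  apply: LipB_ext h => p _; by rewrite /m sum2.
have /choice[L hL] : forall k, exists L : R, 0 <= L /\ forall p, That p -> `|m k p| <= L * lam p k.
  by move=> k; have [L L0 h] := LipB_edge0 (lm k) (me k); exists L.
have /choice[MW hMW] : forall j, exists M : R, 0 <= M /\ forall p, That p -> `|W j p| <= M.
  by move=> j; have [L' [M [L'0 M0 _ h]]] := lW j; exists M.
have [mj [MJ [mj0 hMJ]]] := Jb_cur cm i0.
have mm k : measurable_fun (That : set T2) (m k : T2 -> R) by exact: LipB_measurable.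
have mW j : measurable_fun (That : set T2) (W j : T2 -> R) by exact: LipB_measurable.
have mpF : measurable_fun (That : set T2) (fun p : T2 => psi (F0 p)).
  exact: (measurable_pull (charts_cur cm) i0 mpsi).
have mgF j : measurable_fun (That : set T2) (fun p : T2 => g j (F0 p)).
  exact: (measurable_pull (charts_cur cm) i0 (mg j)).
have mJ0 : measurable_fun (That : set T2) (J0 : T2 -> R).
  by apply: measurable_funTS; exact: measurable_elJ.
(* The integrand that [ref_parts] yields for [chi n] times W, with the terms sorted into derivatives
   of the cutoff, multiplied by the normal components [m k], and the divergence [D] of W. *)
pose h n p := psi (F0 p) * (\sum_k (dcut n k p * m k p * cutx n k p) + chi n p * D p) +
  \sum_j g j (F0 p) * (chi n p * W j p) * J0 p.
have cv : (\int[mu]_(p in That) h n p)%R @[n --> \oo] -->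
    (\int[mu]_(p in That) (psi (F0 p) * D p + \sum_j g j (F0 p) * W j p * J0 p))%R.
  pose G p := (\sum_k 2 * L k + B) * `|psi (F0 p)| + \sum_j (MW j * MJ) * `|g j (F0 p)|.
  apply: (@dom_conv _ _ _ G).
  - move=> n; apply: measurable_funD.
      apply: measurable_funM => //; apply: measurable_funD.
        apply: measurable_sum => k; apply: measurable_funM.
          by apply: measurable_funM => //; apply: measurable_funTS; exact: measurable_dcut.
        by apply: measurable_funTS; exact: measurable_cutx.
      by apply: measurable_funM => //; apply: measurable_funTS; exact: measurable_chi.
    apply: measurable_sum => j; apply: measurable_funM => //; apply: measurable_funM => //.
    by apply: measurable_funM => //; apply: measurable_funTS; exact: measurable_chi.
  (* At a fixed interior point all cutoffs are 1 and all slopes 0 for large n, so the sequence is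
     eventually constant. *)
  - apply: ae_onS (ae_That_interior R : ae_on That That°) => p Tp /interior_That op.
    apply: cvg_near_cst.
    have hk k : \forall n \near \oo, 2 < n%:R * lam p k.
      near=> n; rewrite -ltr_pdivrMr//; near: n.
      exact: nbhs_infty_gtr.
    near=> n; have [h0 h1 h2] : [/\ 2 < n%:R * lam p 0, 2 < n%:R * lam p 1 & 2 < n%:R * lam p 2].
      by split; near: n; exact: hk.
    have hn k : 2 < n%:R * lam p k by case: (ord3P k) => ->.
    have d0 k : dcut n k p = 0.
      by rewrite /dcut indicE memNset ?mulr0// => /andP[_]; have := hn k; lra.
    have c1 k : cut n k p = 1 by rewrite /cut clamp01_1//; have := hn k; lra.
    have x1 : chi n p = 1 by rewrite /chi !c1 !mulr1.
    rewrite /h x1 mul1r big1 ?add0r; last by move=> k _; rewrite d0 !mul0r.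
    by congr (_ + _); apply: eq_bigr => j _; rewrite mul1r.
  - apply: int_add; first exact: (int_scale _ (int_abs (sqint_int (spsi i0)))).
    exact: (int_sum (fun j => int_scale _ (int_abs (sqint_int (sg i0 j))))).
  - move=> n p Tp; have /andP[c0 c1] := chi01 n p.
    rewrite (le_trans (ler_normD _ _))//; apply: lerD.
      rewrite normrM mulrC ler_wpM2r// (le_trans (ler_normD _ _))//; apply: lerD.
        rewrite (le_trans (ler_norm_sum _ _ _))//; apply: ler_sum => k _.
        have /andP[x0 x1] := cutx01 n k p; have [Lk hk] := hL k.
        rewrite normrM (ger0_norm x0) -[leRHS]mulr1; apply: ler_pM => //.
        by apply: dcut_bound => //; [move/ThatP: Tp|exact: hk].
      rewrite normrM (ger0_norm c0) -[leRHS]mul1r; apply: ler_pM => //; exact: bD.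
    rewrite (le_trans (ler_norm_sum _ _ _))//; apply: ler_sum => j _.
    have [M0 hW] := hMW j; have /andP[J1 J2] := hMJ p Tp.
    have J3 : 0 <= J0 p by rewrite /J0; lra.
    rewrite -mulrA normrM mulrC ler_wpM2r// normrM (ger0_norm J3) ler_pM//.
    rewrite normrM (ger0_norm c0) -[leRHS]mul1r; apply: ler_pM => //; exact: hW.
have z n : (\int[mu]_(p in That) h n p)%R = 0.
  (* Extension by zero to the other elements; it is compatible across edges because [chi n] vanishes
     on the boundary of the triangle, and [K] contains its support. *)
  pose U j i p : R := if i == i0 then chi n p * W j p else 0.
  pose K i : set R2 := if i == i0 then That `&` [set p | forall k, 1 <= n%:R * lam p k] else set0.
  pose a j i p : R2 := if i == i0 then
     chi n p *: w j p + W j p *: (\sum_k (dcut n k p * cutx n k p) *: gradlam R k) else (0, 0).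
  have Ubd j i p : That p -> ~ That° p -> U j i p = 0.
    move=> Tp np; rewrite /U; case: ifP => // _.
    have [k pk] : exists k, lam p k = 0.
      apply: contrapT => nk; apply: np; apply/interior_That => k.
      rewrite lt_neqAle eq_sym; apply/andP; split; last by move/ThatP: Tp.
      by apply/eqP => pk; apply: nk; exists k.
    by rewrite (@chi_out _ n p k) ?mul0r// pk mulr0.
  have : \sum_i (\int[mu]_(p in That) (\sum_j (psi (F i p) * dot (a j i p) (elN (E i) j p) +
     g j (F i p) * U j i p * J i p)))%R = 0.
    apply: (@ref_parts _ _ _ cm psi g mpsi mg spsi sg weak U K a).
    - move=> k i j p q Tp Tq pq; have [ij|ij] := eqVneq i j.
        by rewrite -ij in pq *; rewrite (elF_inj (cm_reg cm i) Tp Tq pq).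
      have np := cm_ovl cm ij Tp Tq (cm_ginj cm Tp Tq pq).
      have nq : ~ That° q.
        by rewrite eq_sym in ij; apply: (cm_ovl cm ij Tq Tp); exact/esym/(cm_ginj cm Tp Tq pq).
      by rewrite !Ubd.
    - move=> k i; rewrite /U; case: eqP => _; last exact: LipB_cst.
      exact: LipBM (LipB_chi _ n) (lW k).
    - move=> i; rewrite /K; case: eqP => _; last exact: compact0.
      apply: (@subclosed_compact _ _ That) => //; last exact: compact_That.
      apply: closedI; first by apply: compact_closed2; exact: compact_That.
      rewrite (_ : [set p | _] = \bigcap_k [set p : R2 | 1 <= n%:R * lam p k]); last first.
        by apply/seteqP; split => p h' k; [move=> _|]; exact: h'.
      apply: closed_bigI => k _; apply: closed_ge2.
      exact: (contM (@continuous_cst2 R _) (@continuous_lam R k)).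
    - move=> i p; rewrite /K; case: eqP => [ii0|//] [Tp hp]; split => //.
      apply: (ch_in (charts_cur cm)); apply/interior_That => k.
      have := hp k; move/ThatP: Tp => /(_ k); rewrite le_eqVlt => /predU1P[<-|//].
      by rewrite mulr0; lra.
    - move=> k i p Tp; rewrite /K /U; case: eqP => // ii0 nK.
      have [c hc] : exists c, n%:R * lam p c < 1.
        apply: contrapT => nc; apply: nK; split => // c; rewrite leNgt; apply/negP => h'.
        by apply: nc; exists c.
      by rewrite (@chi_out _ n p c) ?mul0r// ltW.
    - move=> k i; rewrite /U /a; case: eqP => ii0; last first.
        by apply: ae_onW => p _; exact: sdiff_cst.
      have ae1 c : ae_on That (fun p => n%:R * lam p c != 1 /\ n%:R * lam p c != 2).
        have [->|n0] := eqVneq n 0%N.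
          by apply: ae_onW => p _; rewrite mul0r; split; rewrite lt_eqF//.
        have nn : (n%:R : R) != 0 by rewrite pnatr_eq0.
        have hv (v : R) : ae_on That (fun p => n%:R * lam p c != v).
          rewrite ae_onE; apply: filterS (ae_lam c (v / n%:R)) => p hp _.
          by apply: contra hp => /eqP <-; rewrite mulrC mulKf.
        exact: ae_onI (hv 1) (hv 2).
      have := ae_onI (ae_onI (ae1 0) (ae_onI (ae1 1) (ae1 2))) (dW k).
      apply: ae_onS => p Tp [[h0 [h1 h2]] dWp].
      have := sdiffM (sdiff_chi (n := n) (p := p) _) dWp; apply => c.
      by case: (ord3P c) => ->.
  rewrite (bigD1 i0)//= big1 ?addr0; last first.
    move=> i ii0; rewrite (@eq_Rintegral _ _ _ mu That (cst 0)) ?Rintegral_cst ?mul0r//.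
      exact: measurable_That.
    move=> p _; rewrite sum2 /U /a (negbTE ii0) /dot !mul0r !addr0 !mulr0 !mul0r !addr0.
    by [].
  move=> h0; rewrite -[RHS]h0; apply: Rint_ae.
  apply: ae_onS DE => p Tp DEp; rewrite /h /U /a eqxx big_split /= -mulr_sumr.
  congr (_ * _ + _).
  have e j : dot (chi n p *: w j p + W j p *: (\sum_k (dcut n k p * cutx n k p) *: gradlam R k))
      (elN (E i0) j p) = chi n p * dot (w j p) (elN (E i0) j p) +
      \sum_k dcut n k p * cutx n k p * (W j p * lamd (elN (E i0) j p) k).
    rewrite !sum3 -!dot_gradlam /dot /= /GRing.scale /=; ring.
  rewrite (eq_bigr _ (fun j _ => e j)) big_split /= -mulr_sumr DEp addrC; congr (_ + _).
  rewrite exchange_big /=; apply: eq_bigr => k _.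
  by rewrite -mulr_sumr /m mulrAC.
have c0 : (\int[mu]_(p in That) h n p)%R @[n --> \oo] --> (0 : R).
  by under eq_fun do rewrite z; exact: cvg_cst.
by apply/esym; apply: (cvg_unique _ c0 cv).
Unshelve. all: by end_near.
Qed.

End CutoffIdentity.

Lemma fin_min (R : realType) (A : finType) (d : A -> R) : (forall a, 0 < d a) ->
  exists2 m : R, 0 < m & forall a, m <= d a.
Proof.
move=> d0; have [m m0 hm] : exists2 m : R, 0 < m & forall a, a \in index_enum A -> m <= d a.
  elim: (index_enum A) => [|a s [m m0 hm]]; first by exists 1.
  exists (Num.min (d a) m); first by rewrite lt_min d0.
  by move=> b; rewrite inE ge_min => /orP[/eqP ->|/hm ->]; rewrite ?lexx ?orbT.
by exists m => // a; apply: hm; rewrite mem_index_enum.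
Qed.

(** * Pullback of functions in H^1_0 with their approximations *)

Section Approximation.
Variable R : realType.
Local Notation R2 := (R * R)%type.
Local Notation T2 := (measurableTypeR R * measurableTypeR R)%type.
Local Notation mu := (mu2 R).
Local Notation That := (@That R).

Let mT := @measurable_That R.

Lemma sqint_of_int (f : R2 -> R) : measurable_fun (That : set T2) (f : T2 -> R) ->
  mu.-integrable That (fun p => (f p ^+ 2)%:E) -> sqint f.
Proof.
move=> mf /integrableP[_ h]; split => //; apply: le_lt_trans h.
by apply: ge0_le_integral => //; do ?[by move=> p _; rewrite lee_fin sqr_ge0];
  [apply/measurable_EFinP; exact: measurable_funX
  |apply: measurableT_comp => //; apply/measurable_EFinP; exact: measurable_funX
  |move=> p _; rewrite gee0_abs// lee_fin sqr_ge0].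
Qed.

Lemma sqint_bd (f : R2 -> R) (M : R) : measurable_fun (That : set T2) (f : T2 -> R) ->
  (forall p, That p -> `|f p| <= M) -> sqint f.
Proof.
move=> mf hM; apply: sqint_of_int => //; apply: (@int_bm _ _ (M ^+ 2)).
  exact: measurable_funX.
move=> p Tp; rewrite normrX ler_pXn2r// ?nnegrE//; first exact: hM.
exact: le_trans (hM p Tp).
Qed.

Lemma sqintM (f h : R2 -> R) (M : R) : sqint f -> measurable_fun (That : set T2) (h : T2 -> R) ->
  (forall p, That p -> `|h p| <= M) -> sqint (fun p => f p * h p).
Proof.
move=> sf mh hM; have mf := sf.1; apply: sqint_of_int; first exact: measurable_funM.
have := @int_bd _ (fun p => f p ^+ 2) (fun p => h p ^+ 2) (M ^+ 2) (sqint_sq sf).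
under [X in _ -> _ -> integrable _ _ X]eq_fun do rewrite -exprMn.
apply; first exact: measurable_funX.
move=> p Tp; rewrite normrX ler_pXn2r// ?nnegrE//; first exact: hM.
exact: le_trans (hM p Tp).
Qed.

Lemma sqintB (f h : R2 -> R) : sqint f -> sqint h -> sqint (fun p => f p - h p).
Proof.
move=> sf sh; have mf := sf.1; have mh := sh.1.
apply: sqint_of_int; first exact: measurable_funB.
apply: (@le_int _ _ (fun p => 2 * f p ^+ 2 + 2 * h p ^+ 2)).
- by apply: measurable_funX; exact: measurable_funB.
- move=> p _; rewrite ger0_norm ?sqr_ge0// sqrrB.
  by have := sqr_ge0 (f p + h p); rewrite sqrrD; lra.
- exact: (int_add (int_scale 2 (sqint_sq sf)) (int_scale 2 (sqint_sq sh))).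
Qed.

(** Young's inequality |x e| <= eta x^2 + e^2 / eta: [eta] makes the first integral at most eps / 2,
    and then [del] does the same for the second. *)
Lemma pair_small (x : R2 -> R) (eps : R) : sqint x -> 0 < eps ->
  exists2 del : R, 0 < del & forall e, sqint e ->
    (\int[mu]_(p in That) (e p ^+ 2)%:E < del%:E)%E ->
    `|(\int[mu]_(p in That) (x p * e p))%R| <= eps.
Proof.
move=> sx eps0; pose S := (\int[mu]_(p in That) (x p ^+ 2))%R.
have S0 : 0 <= S by apply: Rintegral_ge0 => p _; exact: sqr_ge0.
pose eta := eps / (2 * (S + 1)).
have eta0 : 0 < eta by rewrite divr_gt0// mulr_gt0//; lra.
exists (eps * eta / 2); first by rewrite divr_gt0// mulr_gt0.
move=> e se he.
have ie := sqint_sq se; have ix := sqint_sq sx.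
have he' : (\int[mu]_(p in That) (e p ^+ 2))%R <= eps * eta / 2.
  by rewrite -lee_fin /Rintegral fineK ?ltW//; exact: integrable_fin_num.
have ixe := sqint_mul sx se.
apply: (le_trans (le_normr_Rintegral mT ixe)).
have ib : mu.-integrable That (fun p => (eta * x p ^+ 2 + eta^-1 * e p ^+ 2)%:E).
  exact: (int_add (int_scale eta ix) (int_scale eta^-1 ie)).
apply: (@le_trans _ _ (\int[mu]_(p in That) (eta * x p ^+ 2 + eta^-1 * e p ^+ 2))%R).
  apply: le_Rintegral => //; first exact: (int_abs ixe).
  move=> p _; rewrite normrM -(real_normK (num_real (x p))) -(real_normK (num_real (e p))).
  set a := `|x p|; set b := `|e p|.
  have a0 : 0 <= a by exact: normr_ge0.
  have b0 : 0 <= b by exact: normr_ge0.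
  have : 0 <= (eta * a - b) ^+ 2 / eta by rewrite divr_ge0 ?sqr_ge0// ltW.
  rewrite (_ : (eta * a - b) ^+ 2 / eta = eta * a ^+ 2 + eta^-1 * b ^+ 2 - 2 * (a * b)).
    by have := mulr_ge0 a0 b0; lra.
  by field; rewrite gt_eqF.
rewrite (RintegralD mT (int_scale eta ix) (int_scale eta^-1 ie)).
rewrite !(RintegralZl _ mT)// -/S.
have h1 : eta * S <= eps / 2.
  rewrite /eta mulrAC ler_pdivrMr; last by rewrite mulr_gt0//; lra.
  by have := mulr_ge0 (ltW eps0) S0; lra.
have h2 : eta^-1 * (\int[mu]_(p in That) (e p ^+ 2))%R <= eps / 2.
  by rewrite mulrC ler_pdivrMr// mulrAC.
lra.
Qed.

Lemma Rint_sum (A : finType) (f : A -> R2 -> R) : (forall a, mu.-integrable That (EFin \o f a)) ->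
  (\int[mu]_(p in That) (\sum_a f a p))%R = \sum_a (\int[mu]_(p in That) f a p)%R.
Proof.
move=> hf; have is_ s : mu.-integrable That (fun p => (\sum_(a <- s) f a p)%:E).
  have := integrable_sum mT s (fun i (_ : true) => hf i).
  by apply: eq_integrable => // p _; rewrite sumEFin.
elim: (index_enum A) => [|a s IH].
  rewrite big_nil (@eq_Rintegral _ _ _ mu That (cst 0)) ?Rintegral_cst ?mul0r//.
  by move=> p _; rewrite big_nil.
rewrite big_cons -IH -(RintegralD mT (hf a) (is_ s)).
by apply: eq_Rintegral => p _; rewrite big_cons.
Qed.

Variables (I : finType) (E : I -> elem R).
Hypothesis cm : cmesh E.
Local Notation F i := (elF (E i)).
Local Notation A i := (elA (E i)).
Local Notation J i := (elJ (E i)).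
Local Notation Ocur := (Ocur E).
Local Notation Otil := (Otil E).

Lemma H10_pull (f : R2 -> R) : H10 Otil f ->
  exists (f0 : R2 -> R) (g0 : 'I_2 -> R2 -> R),
  [/\ ae_on Otil (fun x => f x = f0 x),
      forall i, sqint (f0 \o A i), forall i k, sqint (g0 k \o A i) &
      forall del : R, 0 < del -> exists2 phi, test_fun Otil phi & forall i,
        (\int[mu]_(p in That) ((f0 (A i p) - phi (A i p)) ^+ 2)%:E < del%:E)%E /\
        forall k, (\int[mu]_(p in That) ((g0 k (A i p) - partial k phi (A i p)) ^+ 2)%:E < del%:E)%E].
Proof.
move=> [g [Lf Lg wg] happ]; have ct := charts_til cm; have Jb := Jb_til cm.
have [f0 [mf0 ef0 sf0]] := L2_rep ct Jb Lf.
have /choice[g0 hg0] := fun k => L2_rep ct Jb (Lg k).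
exists f0, g0; split => //; first by move=> i k; case: (hg0 k).
move=> del del0.
(* The smallest Jacobian of the affine charts: an integral over one reference triangle is at most 1
   / m times the integral over Omega_til, hence the tolerance del m. *)
have [m m0 hm] := @fin_min R I (fun i => elD (E i)) (fun i => proj1 (cm_reg cm i)).
have eps0 : 0 < del * m by rewrite mulr_gt0.
have [phi tphi hphi] := happ _ eps0; exists phi => //.
have key (h : R2 -> R) i : measurable_fun (setT : set T2) (h : T2 -> R) ->
    (\int[mu]_(x in Otil) (h x ^+ 2)%:E < (del * m)%:E)%E ->
    (\int[mu]_(p in That) (h (A i p) ^+ 2)%:E < del%:E)%E.
  move=> mh hh; have D0 := proj1 (cm_reg cm i).
  have m1 : measurable_fun setT (fun x : T2 => (h x ^+ 2)%:E).
    by apply/measurable_EFinP; exact: measurable_funX.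
  have p1 (x : T2) : (0 <= (h x ^+ 2)%:E)%E by rewrite lee_fin sqr_ge0.
  have m2 : measurable_fun (That : set T2) (fun p : T2 => (h (A i p) ^+ 2)%:E).
    by apply/measurable_EFinP; apply: measurable_funX; exact: (measurable_pull ct i).
  have h1 : (m%:E * \int[mu]_(p in That) (h (A i p) ^+ 2)%:E <=
      \int[mu]_(x in Otil) (h x ^+ 2)%:E)%E.
    rewrite (charts_ge0 ct m1 p1) (bigD1 i)//=.
    apply: (@le_trans _ _ (\int[mu]_(p in That) ((h (A i p) ^+ 2)%:E * (elD (E i))%:E))%E).
      have pos (p : T2) : That p -> (0 <= (h (A i p) ^+ 2)%:E)%E by rewrite lee_fin sqr_ge0.
      have d0 : (0 <= (elD (E i))%:E)%E by rewrite lee_fin ltW.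
      rewrite (@ge0_integralZr _ _ _ mu That mT _ m2 _ pos d0).
      rewrite muleC; apply: lee_wpmul2l; last by rewrite lee_fin hm.
      by apply: integral_ge0 => p _; rewrite lee_fin sqr_ge0.
    rewrite leeDl// sume_ge0// => j _; apply: integral_ge0 => p _.
    by rewrite mule_ge0// ?lee_fin ?sqr_ge0// ltW//; case: (cm_reg cm j).
  have := le_lt_trans h1 hh; rewrite mulrC EFinM.
  by rewrite lte_pmul2l//.
have mphi : measurable_fun (setT : set T2) (phi : T2 -> R).
  by apply: continuous_measurable2; case: tphi => s _; exact: (s [::]).1.
have mdphi k : measurable_fun (setT : set T2) (partial k phi : T2 -> R).
  by apply: continuous_measurable2; case: tphi => s _; exact: (s [:: k]).1.
have nn (h : R2 -> R) : (0 <= \int[mu]_(x in Otil) (h x ^+ 2)%:E)%E.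
  by apply: integral_ge0 => x _; rewrite lee_fin sqr_ge0.
have ef : (\int[mu]_(x in Otil) ((f x - phi x) ^+ 2)%:E =
    \int[mu]_(x in Otil) ((f0 x - phi x) ^+ 2)%:E)%E.
  apply: integral_eq_ae; move: ef0; rewrite ae_onE; apply: filterS => x + Ux.
  by move=> /(_ Ux) ->.
have eg k : (\int[mu]_(x in Otil) ((g k x - partial k phi x) ^+ 2)%:E =
    \int[mu]_(x in Otil) ((g0 k x - partial k phi x) ^+ 2)%:E)%E.
  apply: integral_eq_ae; have [_ + _] := hg0 k; rewrite ae_onE; apply: filterS => x + Ux.
  by move=> /(_ Ux) ->.
rewrite ef in hphi; split.
  apply: (key (fun x => f0 x - phi x)); first exact: measurable_funB.
  by apply: le_lt_trans hphi; rewrite leeDl// sume_ge0.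
move=> k; have [_ _ _] := hg0 k; have mgk : measurable_fun (setT : set T2) (g0 k : T2 -> R).
  by case: (hg0 k).
apply: (key (fun x => g0 k x - partial k phi x)); first exact: measurable_funB.
apply: le_lt_trans hphi; rewrite -eg (bigD1 k)//= addeCA; apply: leeDl; apply: adde_ge0.
  by apply: integral_ge0 => p _; rewrite lee_fin sqr_ge0.
by apply: sume_ge0 => l _; apply: integral_ge0 => p _; rewrite lee_fin sqr_ge0.
Qed.

(** The transpose of the linear part, which pulls gradients back to the reference triangle. *)
Definition elAT (e : elem R) (g : R2) : R2 :=
  (ea e * g.1 + ec e * g.2, eb e * g.1 + ed e * g.2).

Lemma sdiff_elA (e : elem R) (f : R2 -> R) p c : sdiff f (elA e p) c ->
  sdiff (f \o elA e) p (elAT e c).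
Proof.
move=> df; pose q1 := Quadc (ee e) (ea e) (eb e) 0 0 0.
pose q2 := Quadc (eg e) (ec e) (ed e) 0 0 0.
have E1 q : elA e q = (quad q1 q, quad q2 q).
  by rewrite /elA /affine2 /quad /=; apply: eq_pair2 => /=; ring.
rewrite E1 in df; have h := sdiff_comp df (sdiff_quad q1 p) (sdiff_quad q2 p).
rewrite (_ : f \o elA e = fun y => f (quad q1 y, quad q2 y)); last first.
  by apply/funext => y; rewrite /= E1.
move: h; set u := (X in sdiff _ _ X); set v := (X in _ -> sdiff _ _ X); suff -> : u = v by [].
by rewrite /u /v /elAT /quadx /quady /=; apply: eq_pair2; rewrite /= /GRing.scale /=; ring.
Qed.

Lemma elA_lip (e : elem R) : exists2 L : R, 0 <= L &
  forall p q, dist1 (elA e p) (elA e q) <= L * dist1 p q.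
Proof.
pose L := `|ea e| + `|eb e| + `|ec e| + `|ed e|.
exists L; first by rewrite !addr_ge0.
move=> p q; rewrite /dist1 /elA /affine2 /=.
have e1 : ea e * p.1 + eb e * p.2 + ee e - (ea e * q.1 + eb e * q.2 + ee e) =
  ea e * (p.1 - q.1) + eb e * (p.2 - q.2) by ring.
have e2 : ec e * p.1 + ed e * p.2 + eg e - (ec e * q.1 + ed e * q.2 + eg e) =
  ec e * (p.1 - q.1) + ed e * (p.2 - q.2) by ring.
rewrite e1 e2; have h1 := ler_normD (ea e * (p.1 - q.1)) (eb e * (p.2 - q.2)).
have h2 := ler_normD (ec e * (p.1 - q.1)) (ed e * (p.2 - q.2)).
rewrite !normrM in h1 h2; rewrite /L.
have := normr_ge0 (ea e); have := normr_ge0 (eb e); have := normr_ge0 (ec e).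
have := normr_ge0 (ed e); have := normr_ge0 (p.1 - q.1); have := normr_ge0 (p.2 - q.2).
move: h1 h2; move: `|_ + _| `|_ + _| => s1 s2; move: `|_| `|_| `|_| `|_| `|_| `|_|.
move=> *; nra.
Qed.

End Approximation.

(** * Green's formula for functions of H^1_0 transported by G_h *)

Section H10Identity.
Variable R : realType.
Local Notation R2 := (R * R)%type.
Local Notation T2 := (measurableTypeR R * measurableTypeR R)%type.
Local Notation mu := (mu2 R).
Local Notation That := (@That R).
Variables (I : finType) (E : I -> elem R).
Hypothesis cm : cmesh E.
Local Notation F i := (elF (E i)).
Local Notation A i := (elA (E i)).
Local Notation J i := (elJ (E i)).
Local Notation Ocur := (Ocur E).
Local Notation Otil := (Otil E).

Let mT := @measurable_That R.

Lemma LipB_smooth_elA (phi : R2 -> R) i : smooth phi -> LipB That (phi \o A i).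
Proof.
move=> sphi; have cA : compact (A i @` That).
  by apply: continuous_image_compact; [exact: compact_That|exact: continuous_elA].
have [M M0 hM] := compact_in_square cA.
have [L L0 [lL bL]] := smooth_LipB M sphi.
have [L' L'0 hL'] := elA_lip (E i).
have bx p : That p -> box (0, 0) M (A i p).
  move=> Tp; have [h1 h2] := hM (A i p) (imageP _ Tp).
  by split; rewrite /= in_itv/= sub0r add0r -ler_norml.
exists (L * L'), L; split => //; first exact: mulr_ge0.
  move=> p q Tp Tq; rewrite /= (le_trans (lL _ _ (bx _ Tp) (bx _ Tq)))//.
  by rewrite -mulrA ler_wpM2l.
by move=> p /bx/bL[].
Qed.

Variables (psi : R2 -> R) (g : 'I_2 -> R2 -> R).
Hypothesis mpsi : measurable_fun (setT : set T2) (psi : T2 -> R).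
Hypothesis mg : forall j, measurable_fun (setT : set T2) (g j : T2 -> R).
Hypothesis spsi : forall i, sqint (psi \o F i).
Hypothesis sg : forall i j, sqint (g j \o F i).
Hypothesis weak : forall theta : 'I_2 -> R2 -> R, (forall j, test_fun Ocur (theta j)) ->
  \sum_i (\int[mu]_(p in That) ((\sum_j (psi (F i p) * partial j (theta j) (F i p) +
     g j (F i p) * theta j (F i p))) * J i p))%R = 0.

(** [ref_parts] applied to phi o A, which represents phi o G_h^-1 on Omega_h. The support stays
    compact in Omega_h by [Otil_Ocur]. *)
Lemma test_identity (phi : 'I_2 -> R2 -> R) : (forall j, test_fun Otil (phi j)) ->
  \sum_i (\int[mu]_(p in That) (\sum_j (psi (F i p) *
     dot (elAT (E i) (partial 0 (phi j) (A i p), partial 1 (phi j) (A i p))) (elN (E i) j p) +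
     g j (F i p) * phi j (A i p) * J i p)))%R = 0.
Proof.
move=> ht.
have /choice[S hS] : forall j, exists S, [/\ compact S, S `<=` Otil & forall x, ~ S x -> phi j x = 0].
  by move=> j; case: (ht j).
pose K i := That `&` [set p | S 0 (A i p) \/ S 1 (A i p)].
apply: (@ref_parts _ _ _ cm psi g mpsi mg spsi sg weak (fun j i => phi j \o A i) K
  (fun j i p => elAT (E i) (partial 0 (phi j) (A i p), partial 1 (phi j) (A i p)))).
- by move=> k i j p q Tp Tq pq; rewrite /= (cm_ginj cm Tp Tq pq).
- by move=> k i; apply: LipB_smooth_elA; case: (ht k).
- move=> i; apply: (@subclosed_compact _ _ That); [|exact: compact_That|by move=> p []].
  apply: closedI; first by apply: compact_closed2; exact: compact_That.
  apply: (@preimage_closed _ _ (A i) (S 0 `|` S 1)).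
    by move=> x _; exact: continuous_elA.
  by apply: closedU; apply: compact_closed2; case: (hS 0) => //; case: (hS 1).
- move=> i p [Tp Sp]; split => //; apply: (Otil_Ocur cm) => //.
  by case: Sp; [case: (hS 0) => _ h _; exact: h|case: (hS 1) => _ h _; exact: h].
- move=> k i p Tp nK /=; case: (hS k) => _ _; apply => Sp; apply: nK; split => //.
  by have [k0|/ord2P k1] := eqVneq k 0; [left; rewrite -k0|right; rewrite -k1].
- move=> k i; apply: ae_onW => p _; apply: sdiff_elA; apply: smooth_sdiff.
  by case: (ht k).
Qed.

Lemma bounded_elN (e : elem R) j v : exists2 M : R, 0 <= M &
  forall p, That p -> `|dot v (elN e j p)| <= M.
Proof.
have h (a : R2 -> R) : continuous a -> exists2 B : R, 0 <= B & forall x, That x -> `|a x| <= B.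
  exact: continuous_bounded2 (@compact_That R).
have [|M M0 hM] := h (fun p => dot v (elN e j p)); last by exists M.
rewrite /dot /elN; case: (j == 0) => /=.
  exact: (contD (contM (@continuous_cst2 R _) (@continuous_quady R _))
    (contM (@continuous_cst2 R _) (contN (@continuous_quadx R _)))).
exact: (contD (contM (@continuous_cst2 R _) (contN (@continuous_quady R _)))
    (contM (@continuous_cst2 R _) (@continuous_quadx R _))).
Qed.

Lemma measurable_elN (e : elem R) j v :
  measurable_fun (setT : set T2) (fun p : T2 => dot v (elN e j p)).
Proof.
apply: continuous_measurable2; rewrite /dot /elN; case: (j == 0) => /=.
  exact: (contD (contM (@continuous_cst2 R _) (@continuous_quady R _))
    (contM (@continuous_cst2 R _) (contN (@continuous_quadx R _)))).
exact: (contD (contM (@continuous_cst2 R _) (contN (@continuous_quady R _)))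
    (contM (@continuous_cst2 R _) (@continuous_quadx R _))).
Qed.

(** The left side is linear in the values and derivatives of f0, with square-integrable
    coefficients, and vanishes for test functions; the approximation passes to the limit term by
    term. *)
Lemma h10_identity (f0 : 'I_2 -> R2 -> R) (g0 : 'I_2 -> 'I_2 -> R2 -> R) :
  (forall j i, sqint (f0 j \o A i)) -> (forall j i k, sqint (g0 j k \o A i)) ->
  (forall j (del : R), 0 < del -> exists2 phi, test_fun Otil phi & forall i,
     (\int[mu]_(p in That) ((f0 j (A i p) - phi (A i p)) ^+ 2)%:E < del%:E)%E /\
     forall k, (\int[mu]_(p in That) ((g0 j k (A i p) - partial k phi (A i p)) ^+ 2)%:E < del%:E)%E) ->
  \sum_i (\int[mu]_(p in That) (\sum_j (psi (F i p) *
     dot (elAT (E i) (g0 j 0 (A i p), g0 j 1 (A i p))) (elN (E i) j p) +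
     g j (F i p) * f0 j (A i p) * J i p)))%R = 0.
Proof.
move=> sf0 sg0 happ.
(* The integrand as a sum of products [X] times [Y], indexed by a component and by 0, 1 for its two
   partial derivatives or 2 for its value. *)
pose X i (a : 'I_2 * 'I_3) p := if a.2 == 0 then psi (F i p) * dot (elAT (E i) (1, 0)) (elN (E i) a.1 p)
  else if a.2 == 1 then psi (F i p) * dot (elAT (E i) (0, 1)) (elN (E i) a.1 p)
  else g a.1 (F i p) * J i p.
pose Y (u : 'I_2 -> R2 -> R) (v : 'I_2 -> 'I_2 -> R2 -> R) i (a : 'I_2 * 'I_3) p :=
  if a.2 == 0 then v a.1 0 (A i p) else if a.2 == 1 then v a.1 1 (A i p) else u a.1 (A i p).
have XYE u v i p : \sum_j (psi (F i p) * dot (elAT (E i) (v j 0 (A i p), v j 1 (A i p))) (elN (E i) j p) +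
     g j (F i p) * u j (A i p) * J i p) = \sum_a X i a p * Y u v i a p.
  rewrite (eq_bigr (fun j => \sum_l X i (j, l) p * Y u v i (j, l) p)).
    by rewrite pair_bigA /=; apply: eq_bigr => -[].
  by move=> j _; rewrite sum3 /X /Y /= /dot /elAT /=; ring.
have sX i a : sqint (X i a).
  rewrite /X; case: (a.2 == 0).
    have [M M0 hM] := bounded_elN (E i) a.1 (elAT (E i) (1, 0)).
    apply: (@sqintM _ _ _ M (spsi i)) => //; apply: measurable_funTS; exact: measurable_elN.
  case: (a.2 == 1).
    have [M M0 hM] := bounded_elN (E i) a.1 (elAT (E i) (0, 1)).
    apply: (@sqintM _ _ _ M (spsi i)) => //; apply: measurable_funTS; exact: measurable_elN.
  have [B B0 hB] := continuous_bounded2 (@compact_That R) (@continuous_elJ R (E i)).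
  apply: (@sqintM _ _ _ B (sg i a.1)) => //; apply: measurable_funTS; exact: measurable_elJ.
have sY i a : sqint (Y f0 g0 i a).
  by rewrite /Y; case: (a.2 == 0); [exact: sg0|case: (a.2 == 1); [exact: sg0|exact: sf0]].
set T := (X in X = 0); apply/eqP; rewrite -normr_le0; apply/ler_addgt0Pr => eps eps0.
rewrite add0r.
pose N : R := (\sum_(i : I) \sum_(a : 'I_2 * 'I_3) 1) + 1.
have N0 : 0 < N by rewrite ltr_wpDl// sumr_ge0// => i _; rewrite sumr_ge0.
have e0 : 0 < eps / N by rewrite divr_gt0.
have /choice[d hd] : forall ia : I * ('I_2 * 'I_3), exists d : R, 0 < d /\ forall e, sqint e ->
    (\int[mu]_(p in That) (e p ^+ 2)%:E < d%:E)%E ->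
    `|(\int[mu]_(p in That) (X ia.1 ia.2 p * e p))%R| <= eps / N.
  by move=> ia; have [d d0 h] := pair_small (sX ia.1 ia.2) e0; exists d.
have [del del0 hdel] := fin_min (fun ia => (hd ia).1).
have /choice[phi hphi] : forall j, exists phi, test_fun Otil phi /\ forall i,
     (\int[mu]_(p in That) ((f0 j (A i p) - phi (A i p)) ^+ 2)%:E < del%:E)%E /\
     forall k, (\int[mu]_(p in That) ((g0 j k (A i p) - partial k phi (A i p)) ^+ 2)%:E < del%:E)%E.
  by move=> j; have [phi t h] := happ j del del0; exists phi.
pose Z := Y phi (fun j k => partial k (phi j)).
have ct := charts_til cm.
have sZ i a : sqint (Z i a).
  have sm (h : R2 -> R) : continuous h -> sqint (h \o A i).
    move=> ch; have cA : compact (A i @` That).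
      by apply: continuous_image_compact; [exact: compact_That|exact: continuous_elA].
    have [B B0 hB] := continuous_bounded2 cA ch.
    apply: (@sqint_bd _ _ B).
      by apply: (measurable_pull ct i); exact: continuous_measurable2.
    by move=> p Tp; apply: hB; exists p.
  have s j : smooth (phi j) by case: (hphi j) => -[].
  rewrite /Z /Y; case: (a.2 == 0); last case: (a.2 == 1).
  - exact: (sm _ (s a.1 [:: 0]).1).
  - exact: (sm _ (s a.1 [:: 1]).1).
  - exact: (sm _ (s a.1 [::]).1).
have TE : T = \sum_i \sum_a (\int[mu]_(p in That) (X i a p * (Y f0 g0 i a p - Z i a p)))%R.
  have := test_identity (fun j => (hphi j).1) => T0.
  rewrite -[LHS]subr0 -[X in _ - X]T0 /T -sumrB; apply: eq_bigr => i _.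
  have iXY a : mu.-integrable That (EFin \o (fun p => X i a p * Y f0 g0 i a p)).
    exact: sqint_mul (sX i a) (sY i a).
  have iXZ a : mu.-integrable That (EFin \o (fun p => X i a p * Z i a p)).
    exact: sqint_mul (sX i a) (sZ i a).
  rewrite (@eq_Rintegral _ _ _ mu That (fun p => \sum_a X i a p * Y f0 g0 i a p)); last first.
    by move=> p _; exact: XYE.
  rewrite [X in _ - X](@eq_Rintegral _ _ _ mu That (fun p => \sum_a X i a p * Z i a p)); last first.
    by move=> p _; exact: (XYE phi (fun j k => partial k (phi j))).
  rewrite (Rint_sum iXY) (Rint_sum iXZ) -sumrB; apply: eq_bigr => a _.
  rewrite -(RintegralB mT (iXY a) (iXZ a)); apply: eq_Rintegral => p _.
  by rewrite mulrBr.
rewrite TE (le_trans (ler_norm_sum _ _ _))//.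
apply: (@le_trans _ _ (\sum_(i : I) \sum_(a : 'I_2 * 'I_3) 1 * (eps / N))); last first.
  under eq_bigr do rewrite -mulr_suml.
  rewrite -mulr_suml mulrCA ger_pMr// ler_pdivrMr// mul1r /N lerDl//.
apply: ler_sum => i _; rewrite (le_trans (ler_norm_sum _ _ _))//; apply: ler_sum => a _.
rewrite mul1r; apply: (hd (i, a)).2; first exact: sqintB.
have dd : (del%:E <= (d (i, a))%:E)%E by rewrite lee_fin.
apply: lt_le_trans dd; have [_ /(_ i)[h1 h2]] := hphi a.1.
rewrite /Z /Y; case: (a.2 == 0); last case: (a.2 == 1).
- exact: h2.
- exact: h2.
- exact: h1.
Qed.

End H10Identity.

(** * Traces of functions in H^1_0 *)

Section PartialIntegral.
Variable R : realType.
Local Notation R2 := (R * R)%type.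
Local Notation T2 := (measurableTypeR R * measurableTypeR R)%type.
Local Notation mu := (mu2 R).
Local Notation lam1 := (@lebesgue_measure R).

Lemma slice_integral0 (f df : R -> R) (M : R) : continuous df ->
  (forall t, is_derive (t : R) (1 : R) f (df t)) ->
  (forall t, M < `|t| -> f t = 0 /\ df t = 0) ->
  (\int[lam1]_t (df t)%:E = 0)%E.
Proof.
move=> cdf dff f0; pose N := `|M| + 1.
have N0 : 0 < N by rewrite /N; have := normr_ge0 M; lra.
have NM : M < N by rewrite /N; have := ler_norm M; lra.
have le : - N <= N by lra.
have := continuous_FTC2_le le cdf dff.
have [-> _] : f N = 0 /\ df N = 0 by apply: f0; rewrite gtr0_norm.
have [-> _] : f (- N) = 0 /\ df (- N) = 0 by apply: f0; rewrite normrN gtr0_norm.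
rewrite subrr => E; rewrite -[RHS]E [RHS]integral_mkcond; apply: eq_integral => t _.
rewrite patchE; case: ifPn => // tN; have [|_ ->//] := f0 t.
rewrite (lt_le_trans NM)// leNgt; apply: contra tN => tN; rewrite inE /= in_itv/=.
by rewrite -ler_norml ltW.
Qed.

(** With the product rule, this makes a test function together with its classical gradient an
    instance of the pulled back weak identity. *)
Lemma int_partial_test (U : set R2) (h : R2 -> R) j : test_fun U h ->
  (\int[mu]_(x in U) partial j h x)%R = 0.
Proof.
move=> [sh [K [cK KU h0]]]; have clK := compact_closed2 cK.
have [M M0 hM] := compact_in_square cK.
have dh0 i x : ~ K x -> partial i h x = 0 by exact: (@test_partial0 R U K).
have out x : M < `|x.1| \/ M < `|x.2| -> ~ K x.
  by move=> + /hM[x1 x2]; rewrite !ltNge x1 x2 => -[].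
suff e : (\int[mu]_x (partial j h x)%:E = 0)%E.
  rewrite /Rintegral integral_mkcond (_ : (\int[mu]_x _)%E = 0%E)// -[RHS]e.
  apply: eq_integral => x _; rewrite patchE; case: ifPn => // /negP nU.
  by rewrite dh0// => /KU Ux; apply: nU; rewrite inE.
have cp i : continuous (partial i h) by exact: (sh [:: i]).1.
have iK i : mu.-integrable (K : set T2) (EFin \o partial i h).
  apply: measurable_bounded_integrable.
  - exact: compact_measurable2.
  - apply: (@le_lt_trans _ _ (mu (box (0, 0) M : set T2))).
      apply: le_measure; rewrite ?inE; first exact: compact_measurable2.
        by apply: compact_measurable2; exact: compact_box.
      by move=> x /hM[x1 x2]; split; rewrite /= in_itv/= sub0r add0r -ler_norml.
    rewrite /box product_measure1E//; try exact: measurable_itv.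
    rewrite [X in (X * _)%E](lebesgue_measure_itv `[_, _]) [X in (_ * X)%E](lebesgue_measure_itv `[_, _]) /=.
    by rewrite -EFinD; case: ifP => _; rewrite ?mul0e -?EFinM ?ltry.
  - by apply: measurable_funTS; exact: continuous_measurable2.
  - have [B B0 hB] := continuous_bounded2 cK (cp i).
    exists B; split; first exact: num_real.
    by move=> B' BB' x Kx; exact: le_trans (hB x Kx) (ltW BB').
have iT i : mu.-integrable (setT : set T2) (EFin \o partial i h).
  have /integrable_mkcond := iK i => /(_ (compact_measurable2 cK)).
  congr integrable; apply/funext => x; rewrite patchE; case: ifPn => // /negP nK.
  by rewrite /= dh0// => Kx; apply: nK; rewrite inE.
have [->|/ord2P ->] := eqVneq j 0.
  rewrite -(integral21_prod_meas1 (iT 0)); apply: integral0_eq => y _; rewrite /fubini_G /=.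
  apply: (@slice_integral0 (fun t => h (t, y)) (fun t => partial 0 h (t, y)) M).
  - by move=> t; apply: (@continuous_comp _ _ _ (fun t => (t, y))); [exact: continuous_pairr|exact: cp].
  - by move=> t; exact: smooth_slice1.
  - by move=> t tM; split; [apply: h0|apply: dh0]; apply: out; left.
rewrite -(integral12_prod_meas1 (iT 1)); apply: integral0_eq => y _; rewrite /fubini_F /=.
apply: (@slice_integral0 (fun t => h (y, t)) (fun t => partial 1 h (y, t)) M).
- by move=> t; apply: (@continuous_comp _ _ _ (fun t => (y, t))); [exact: continuous_pairl|exact: cp].
- by move=> t; exact: smooth_slice2.
- by move=> t tM; split; [apply: h0|apply: dh0]; apply: out; right.
Qed.

Lemma test_funM (U : set R2) (f h : R2 -> R) : test_fun U f -> test_fun U h ->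
  test_fun U (fun x => f x * h x).
Proof.
move=> [sf [K [cK KU f0]]] [sh _]; split; first exact: smoothM.
by exists K; split => // x /f0 ->; rewrite mul0r.
Qed.

End PartialIntegral.

Section Strip.
Variable R : realType.
Local Notation R2 := (R * R)%type.
Local Notation T2 := (measurableTypeR R * measurableTypeR R)%type.
Local Notation mu := (mu2 R).
Local Notation lam1 := (@lebesgue_measure R).
Local Notation That := (@That R).

Let mT := @measurable_That R.

Definition rect (d a b : R) : set R2 := `[0, d]%classic `*` `[a, b]%classic.

Lemma measurable_rect d a b : measurable (rect d a b : set T2).
Proof. by apply: measurableX; exact: measurable_itv. Qed.

(** On each line, |phi (t, s)| is at most the integral of |dphi (., s)| over [0, d], as phi vanishes
    at t = 0; integrating in t costs the factor d. *)
Lemma strip_poincare (phi dphi : R2 -> R) (d a b : R) : 0 < d ->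
  continuous phi -> continuous dphi ->
  (forall t s, is_derive (t : R) (1 : R) (fun t => phi (t, s)) (dphi (t, s))) ->
  (forall s, a <= s <= b -> phi (0, s) = 0) ->
  (\int[mu]_(p in rect d a b) `|phi p|%:E <=
   d%:E * \int[mu]_(p in rect d a b) `|dphi p|%:E)%E.
Proof.
move=> d0 cphi cdphi dphiE phi0.
have mabs (f : R2 -> R) : continuous f -> measurable_fun (setT : set T2) (fun p : T2 => `|f p|%:E).
  move=> cf; apply/measurable_EFinP; apply: measurableT_comp; first exact: normr_measurable.
  exact: continuous_measurable2.
pose f1 := (fun p : T2 => `|phi p|%:E) \_ (rect d a b).
pose f2 := (fun p : T2 => `|dphi p|%:E) \_ (rect d a b).
have mf1 : measurable_fun setT f1.
  by apply/(measurable_restrictT _ (measurable_rect d a b)); apply: measurable_funTS; exact: mabs.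
have mf2 : measurable_fun setT f2.
  by apply/(measurable_restrictT _ (measurable_rect d a b)); apply: measurable_funTS; exact: mabs.
have f10 p : (0 <= f1 p)%E by rewrite /f1 patchE; case: ifP.
have f20 p : (0 <= f2 p)%E by rewrite /f2 patchE; case: ifP.
have -> : (\int[mu]_(p in rect d a b) `|phi p|%:E = \int[lam1]_s fubini_G lam1 f1 s)%E.
  by rewrite integral_mkcond; exact: (@fubini_tonelli2 _ _ _ _ _ lam1 lam1 f1 mf1 f10).
have -> : (\int[mu]_(p in rect d a b) `|dphi p|%:E = \int[lam1]_s fubini_G lam1 f2 s)%E.
  by rewrite integral_mkcond; exact: (@fubini_tonelli2 _ _ _ _ _ lam1 lam1 f2 mf2 f20).
have mG2 : measurable_fun setT (fubini_G lam1 f2) by exact: measurable_fun_fubini_tonelli_G.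
have mG1 : measurable_fun setT (fubini_G lam1 f1) by exact: measurable_fun_fubini_tonelli_G.
have G20 s : (0 <= fubini_G lam1 f2 s)%E by apply: integral_ge0.
have G10 s : (0 <= fubini_G lam1 f1 s)%E by apply: integral_ge0.
rewrite -ge0_integralZl//; last by rewrite lee_fin ltW.
apply: ge0_le_integral => //; first by apply: measurable_funeM.
move=> s _; have [sab|nsab] := boolP (a <= s <= b); last first.
  have -> : fubini_G lam1 f1 s = 0%E; last first.
    by apply: mule_ge0 (G20 s); rewrite lee_fin ltW.
  rewrite /fubini_G; apply: integral0_eq => t _; rewrite /f1 patchE memNset// => -[_] /=.
  by rewrite in_itv/=; exact/negP.
have inR t : ((t, s) \in rect d a b) = (t \in `[0, d]%classic).
  apply/idP/idP; rewrite !inE /rect /=; first by case.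
  by move=> h; split => //=; rewrite in_itv.
have cs (f : R2 -> R) : continuous f -> continuous (fun t => f (t, s)).
  by move=> cf t; apply: (@continuous_comp _ _ _ (fun t => (t, s))); [exact: continuous_pairr|exact: cf].
have msl (f : R2 -> R) (D : set (measurableTypeR R)) : continuous f ->
    measurable_fun D (fun t : measurableTypeR R => `|f (t, s)|%:E).
  move=> cf; apply: measurable_funTS; apply/measurable_EFinP.
  apply: measurableT_comp; first exact: normr_measurable.
  by apply: continuous_measurable_fun; exact: cs.
have E1 : fubini_G lam1 f1 s = (\int[lam1]_(t in `[0%R, d]) `|phi (t, s)|%:E)%E.
  rewrite /fubini_G [RHS]integral_mkcond; apply: eq_integral => t _.
  by rewrite /f1 !patchE inR.
have E2 : fubini_G lam1 f2 s = (\int[lam1]_(t in `[0%R, d]) `|dphi (t, s)|%:E)%E.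
  rewrite /fubini_G [RHS]integral_mkcond; apply: eq_integral => t _.
  by rewrite /f2 !patchE inR.
rewrite E1 E2; set k := (X in (_ <= _ * X)%E).
have k0 : (0 <= k)%E by apply: integral_ge0.
have -> : (d%:E * k = \int[lam1]_(t in `[0%R, d]) cst k t)%E.
  rewrite integral_cst//.
  rewrite [X in (_ = _ * X)%E](lebesgue_measure_itv `[0%R, d]) /= lte_fin d0.
  by rewrite oppr0 adde0 muleC.
apply: ge0_le_integral => //.
- exact: msl.
- move=> t; rewrite /= in_itv/= => /andP[t0 td].
  have := continuous_FTC2_le t0 (cs _ cdphi) (dphiE ^~ s).
  rewrite phi0// subr0 => e.
  rewrite -abse_EFin -e (le_trans (le_abse_integral _ _ _))//.
    apply: measurable_funTS; apply/measurable_EFinP.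
    by apply: continuous_measurable_fun; exact: cs.
  apply: ge0_subset_integral => //; first exact: msl.
  by move=> u; rewrite /= !in_itv/= => /andP[-> ut]; exact: le_trans td.
Qed.

Lemma within_bounded (h : R2 -> R) : {within That, continuous h} ->
  exists2 B : R, 0 <= B & forall p, That p -> `|h p| <= B.
Proof.
move=> ch; have ck : compact (h @` That).
  by apply: continuous_compact => //; exact: compact_That.
have [M [Mr hM]] := compact_bounded ck.
exists (`|M| + 1); first by rewrite addr_ge0.
move=> x Kx; apply: (hM (`|M| + 1)); last by exists x.
by rewrite (le_lt_trans (ler_norm _))// ltrDl.
Qed.

Lemma within_measurable (h : R2 -> R) : {within That, continuous h} ->
  measurable_fun (That : set T2) (h : T2 -> R).
Proof.
by apply: within_continuous_measurable2; apply: compact_closed2; exact: compact_That.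
Qed.

(** If h were c > 0 at (0, s0), it would exceed c / 2 on a thin box of width d at the edge, so its
    integral there would be of order d. The Poincare inequality bounds it by d times the integral of
    |G| over the box, up to small errors, and that integral tends to 0 with d. *)
Lemma strip_le0 (h G : R2 -> R) : {within That, continuous h} -> sqint G ->
  (forall del : R, 0 < del -> exists (phi dphi : R2 -> R),
    [/\ continuous phi, continuous dphi,
      (forall t s, is_derive (t : R) (1 : R) (fun t => phi (t, s)) (dphi (t, s))),
      (forall s, 0 <= s <= 1 -> phi (0, s) = 0) &
      (\int[mu]_(p in That) ((h p - phi p) ^+ 2)%:E < del%:E)%E /\
      (\int[mu]_(p in That) ((G p - dphi p) ^+ 2)%:E < del%:E)%E]) ->
  forall s : R, 0 < s < 1 -> h (0, s) <= 0.
Proof.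
move=> ch sG happ s0 /andP[s00 s01]; rewrite leNgt; apply/negP => c0.
set c := h (0, s0) in c0.
have [Bh Bh0 hBh] := within_bounded ch; have mh := within_measurable ch.
have sh : sqint h by exact: (sqint_bd mh hBh).
have Ts : That (0, s0) by apply/ThatE => /=; split; lra.
have c20 : 0 < c / 2 by rewrite divr_gt0.
have [r r0 hr] : exists2 r : R, 0 < r & forall y, dist1 (0, s0) y < r -> That y -> c / 2 <= h y.
  have /subspace_continuousP/(_ _ Ts)/cvgrPdist_lt/(_ _ c20) := ch.
  rewrite near_withinE => /nbhs_dist1P[r r0 hr]; exists r => // y /hr hy /hy.
  change (`|c - h y| < c / 2 -> c / 2 <= h y).
  by rewrite ltr_norml => /andP[_]; lra.
(* With a width d <= rho, the box of height 2 rho around s0 lies in the triangle and in the ball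
   where h >= c / 2. *)
pose rho := Num.min (r / 4) (Num.min (s0 / 2) ((1 - s0) / 4)).
have rho0 : 0 < rho by rewrite !lt_min !divr_gt0// subr_gt0.
have [rho1 rho2 rho3] : [/\ rho <= r / 4, rho <= s0 / 2 & rho <= (1 - s0) / 4].
  by rewrite /rho; split; rewrite !ge_min lexx ?orbT.
have crho : 0 < c * rho / 4 by rewrite divr_gt0// mulr_gt0.
have sA : sqint (fun p => `|G p|).
  have [mG hG] := sG; split.
    by apply: measurableT_comp => //; exact: normr_measurable.
  by under eq_integral do rewrite real_normK ?num_real//.
have [d0 d00 hd0] := pair_small sA crho.
(* The area 2 rho d of the box is below [d0], so the indicator of the box is small in L2 and
   [pair_small] bounds the integral of |G| over it by c rho / 4. *)
pose d := Num.min rho (d0 / (4 * rho)).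
have d_gt0 : 0 < d by rewrite lt_min rho0 divr_gt0// mulr_gt0.
have drho : d <= rho by rewrite ge_min lexx.
have dd0 : d * (2 * rho) < d0.
  have : d <= d0 / (4 * rho) by rewrite ge_min lexx orbT.
  rewrite ler_pdivlMr ?mulr_gt0// => h1.
  have := mulr_gt0 d_gt0 rho0; lra.
pose Q := rect d (s0 - rho) (s0 + rho).
have QT : Q `<=` That.
  move=> p [/=]; rewrite !in_itv/= => /andP[p1 p2] /andP[p3 p4].
  apply/ThatE; move: p1 p2 p3 p4 drho rho2 rho3 s00 s01; clear; split; lra.
have Qr p : Q p -> dist1 (0, s0) p < r.
  move=> [/=]; rewrite !in_itv/= => /andP[p1 p2] /andP[p3 p4].
  rewrite /dist1 /= sub0r normrN (ger0_norm p1).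
  have : `|s0 - p.2| <= rho by rewrite ler_norml; move: p3 p4; clear; lra.
  by move: p1 p2 drho rho1 rho0 r0; clear; lra.
have mQ : measurable (Q : set T2) by exact: measurable_rect.
have muQ : mu Q = (d * (2 * rho))%:E.
  rewrite /Q /rect product_measure1E//; try exact: measurable_itv.
  rewrite [X in (X * _)%E](lebesgue_measure_itv `[_, _]) [X in (_ * X)%E](lebesgue_measure_itv `[_, _]) /=.
  rewrite lte_fin d_gt0 lte_fin (_ : s0 - rho < s0 + rho); last by lra.
  by rewrite -!EFinD -EFinM; congr (_%:E); lra.
pose q p := (\1_Q p : R).
have mq : measurable_fun (That : set T2) (q : T2 -> R).
  by apply: measurable_funTS; exact: measurable_indic.
have q01 p : 0 <= q p <= 1 by rewrite /q indicE; case: (_ \in _); rewrite lexx ler01.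
have bq p : That p -> `|q p| <= 1 by move=> _; have /andP[q0 q1] := q01 p; rewrite ger0_norm.
have sq : sqint q by exact: (sqint_bd mq bq).
have Iq : (\int[mu]_(p in That) q p)%R = d * (2 * rho).
  rewrite /Rintegral /q integral_indic// (_ : Q `&` That = Q); last by apply/setIidl.
  by rewrite [X in fine X]muQ.
have hGq : (\int[mu]_(p in That) (`|G p| * q p))%R <= c * rho / 4.
  apply: le_trans (ler_norm _) _; apply: hd0 => //.
  have -> : (\int[mu]_(p in That) (q p ^+ 2)%:E = (d * (2 * rho))%:E)%E.
    rewrite -muQ -(_ : Q `&` That = Q); last by apply/setIidl.
    rewrite -integral_indic//; apply: eq_integral => p _.
    by rewrite /q indicE; case: (_ \in _); rewrite ?expr1n ?expr0n.
  by rewrite lte_fin.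
have s1 : sqint (cst 1 : R2 -> R).
  by apply: (@sqint_bd _ _ 1) => // p _; rewrite normr1.
have crd : 0 < c * rho * d / 4 by rewrite divr_gt0// !mulr_gt0.
have [e1 e10 he1] := pair_small s1 crd.
have [e2 e20 he2] := pair_small s1 crho.
have e0 : 0 < Num.min e1 e2 by rewrite lt_min e10.
have [phi [dphi [cphi cdphi dphiE phi0 [hphi hdphi]]]] := happ _ e0.
have scont (f : R2 -> R) : continuous f -> sqint f.
  move=> cf; have [B B0 hB] := continuous_bounded2 (@compact_That R) cf.
  by apply: (@sqint_bd _ _ B) => //; apply: measurable_funTS; exact: continuous_measurable2.
have sabs (f : R2 -> R) : sqint f -> sqint (fun p => `|f p|).
  move=> [mf hf]; split.
    by apply: measurableT_comp => //; exact: normr_measurable.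
  by under eq_integral do rewrite real_normK ?num_real//.
have sm (f : R2 -> R) (e e' : R) : sqint f -> e <= e' ->
    (\int[mu]_(p in That) (f p ^+ 2)%:E < e%:E)%E -> (\int[mu]_(p in That) (`|f p| ^+ 2)%:E < e'%:E)%E.
  move=> _ ee; under [X in _ -> (X < _)%E]eq_integral do rewrite real_normK ?num_real//.
  by move=> /lt_le_trans; apply; rewrite lee_fin.
have shp : sqint (fun p => h p - phi p) by apply: sqintB => //; exact: scont.
have sGp : sqint (fun p => G p - dphi p) by apply: sqintB => //; exact: scont.
have h1 : (\int[mu]_(p in That) `|h p - phi p|)%R <= c * rho * d / 4.
  have := he1 _ (sabs _ shp) (sm _ _ _ shp (_ : _ <= e1) hphi).
  rewrite ge_min lexx => /(_ isT); apply: le_trans.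
  by rewrite (le_trans _ (ler_norm _))//; under [leRHS]eq_Rintegral do rewrite mul1r.
have h2 : (\int[mu]_(p in That) `|G p - dphi p|)%R <= c * rho / 4.
  have := he2 _ (sabs _ sGp) (sm _ _ _ sGp (_ : _ <= e2) hdphi).
  rewrite ge_min lexx orbT => /(_ isT); apply: le_trans.
  by rewrite (le_trans _ (ler_norm _))//; under [leRHS]eq_Rintegral do rewrite mul1r.
have iq : mu.-integrable That (EFin \o q) by exact: sqint_int.
have ihp : mu.-integrable That (fun p => `|h p - phi p|%:E) by exact: int_abs (sqint_int shp).
have iGp : mu.-integrable That (fun p => `|G p - dphi p|%:E) by exact: int_abs (sqint_int sGp).
have iGq : mu.-integrable That (fun p => (`|G p| * q p)%:E) by exact: sqint_mul.
have ipq : mu.-integrable That (fun p => (`|phi p| * q p)%:E).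
  by apply: sqint_mul => //; apply: sabs; exact: scont.
have idq : mu.-integrable That (fun p => (`|dphi p| * q p)%:E).
  by apply: sqint_mul => //; apply: sabs; exact: scont.
have strip : (\int[mu]_(p in That) (`|phi p| * q p))%R <= d * (\int[mu]_(p in That) (`|dphi p| * q p))%R.
  have tr (f : R2 -> R) : (\int[mu]_(p in That) (`|f p| * q p)%:E = \int[mu]_(p in Q) `|f p|%:E)%E.
    rewrite integral_mkcond [RHS]integral_mkcond; apply: eq_integral => p _.
    rewrite !patchE /q indicE; case: (boolP (p \in Q)) => pQ.
      by rewrite mulr1 mem_set//; apply: QT; move: pQ; rewrite inE.
    by rewrite mulr0; case: ifP.
  have phi0' s : s0 - rho <= s <= s0 + rho -> phi (0, s) = 0.
    move=> /andP[a1 a2]; apply: phi0; move: a1 a2 rho2 rho3 s00 s01; clear => *.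
    by apply/andP; split; lra.
  have := strip_poincare d_gt0 cphi cdphi dphiE phi0'; rewrite -/Q -!tr.
  rewrite -(fineK (integrable_fin_num mT ipq)) -(fineK (integrable_fin_num mT idq)).
  by rewrite -EFinM lee_fin.
have low : c / 2 * (d * (2 * rho)) <= (\int[mu]_(p in That) `|h p - phi p|)%R +
    (\int[mu]_(p in That) (`|phi p| * q p))%R.
  rewrite -Iq -(RintegralZl _ mT iq) -(RintegralD mT ihp ipq).
  apply: le_Rintegral => //; first exact: (int_scale _ iq).
    exact: (int_add ihp ipq).
  move=> p Tp; rewrite /q indicE; case: (boolP (p \in Q)) => pQ; last first.
    by rewrite !mulr0 addr0.
  rewrite !mulr1; have Qp : Q p by move: pQ; rewrite inE.
  have := hr p (Qr p Qp) Tp; have := ler_norm (h p - phi p); have := ler_norm (phi p).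
  by clear; lra.
have up : (\int[mu]_(p in That) (`|dphi p| * q p))%R <=
    (\int[mu]_(p in That) `|G p - dphi p|)%R + (\int[mu]_(p in That) (`|G p| * q p))%R.
  rewrite -(RintegralD mT iGp iGq); apply: le_Rintegral => //; first exact: (int_add iGp iGq).
  move=> p Tp; have /andP[q0 q1] := q01 p.
  have := ler_normB (G p) (G p - dphi p); rewrite opprB addrCA subrr addr0 => tri.
  apply: (le_trans (ler_wpM2r q0 tri)).
  by rewrite mulrDl addrC lerD2r ler_piMr.
(* The estimates add up to c rho d <= c rho d / 4 + d (c rho / 4 + c rho / 4), a contradiction. *)
have := ler_wpM2l (ltW d_gt0) (le_trans up (lerD h2 hGq)).
have : 0 < c * rho * d by rewrite !mulr_gt0.
by move: strip low h1; clear; lra.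
Qed.

Lemma strip_zero (h G : R2 -> R) : {within That, continuous h} -> sqint G ->
  (forall del : R, 0 < del -> exists (phi dphi : R2 -> R),
    [/\ continuous phi, continuous dphi,
      (forall t s, is_derive (t : R) (1 : R) (fun t => phi (t, s)) (dphi (t, s))),
      (forall s, 0 <= s <= 1 -> phi (0, s) = 0) &
      (\int[mu]_(p in That) ((h p - phi p) ^+ 2)%:E < del%:E)%E /\
      (\int[mu]_(p in That) ((G p - dphi p) ^+ 2)%:E < del%:E)%E]) ->
  forall s : R, 0 < s < 1 -> h (0, s) = 0.
Proof.
move=> ch sG happ s hs; apply/eqP; rewrite eq_le (strip_le0 ch sG happ hs) /=.
rewrite -oppr_le0; apply: (@strip_le0 (fun p => - h p) (fun p => - G p)) hs.
- by move=> x; apply: cvgN; exact: ch.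
- have [mG hG] := sG; split; first by apply: measurable_oppr_comp || apply: measurable_funN.
  by under eq_integral do rewrite sqrrN.
- move=> del /happ[phi [dphi [c1 c2 d12 p0 [h1 h2]]]].
  exists (fun p => - phi p), (fun p => - dphi p); split.
  + exact: contN.
  + exact: contN.
  + by move=> t u; apply: is_deriveN.
  + by move=> u hu; rewrite p0// oppr0.
  + have e (a b : R) : (- a - - b) ^+ 2 = (a - b) ^+ 2 by rewrite -opprD sqrrN.
    by split; under eq_integral do rewrite e.
Qed.

End Strip.

(** * Piecewise quadratic functions and the Piola transform *)

Section PiecewiseQuadratic.
Variable R : realType.
Local Notation R2 := (R * R)%type.
Local Notation T2 := (measurableTypeR R * measurableTypeR R)%type.
Local Notation mu := (mu2 R).
Local Notation That := (@That R).

Lemma ae_box (S : set R2) (P : R2 -> Prop) (c : R2) (r : R) : 0 < r ->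
  box c r `<=` S -> ae_on S P -> exists2 y, box c r y & P y.
Proof.
move=> r0 bS [N [mN N0 hN]]; apply: contrapT => nex.
have mb : measurable (box c r : set T2) by apply: compact_measurable2; exact: compact_box.
have : (mu (box c r) <= mu N)%E.
  apply: le_measure; rewrite ?inE// => y by_; apply: hN => /= h; apply: nex.
  by exists y => //; apply: h; exact: bS.
rewrite N0 /box product_measure1E//; try exact: measurable_itv.
rewrite [X in (X * _)%E](lebesgue_measure_itv `[_, _]) [X in (_ * X)%E](lebesgue_measure_itv `[_, _]) /=.
rewrite !lte_fin (_ : c.1 - r < c.1 + r); last by lra.
rewrite (_ : c.2 - r < c.2 + r); last by lra.
rewrite -!EFinD -EFinM lee_fin leNgt => /negP; apply.
by rewrite mulr_gt0//; lra.
Qed.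

Definition cont_in (S : set R2) (f : R2 -> R) := forall p, S p -> forall e : R, 0 < e ->
  exists2 r : R, 0 < r & forall y, S y -> dist1 p y < r -> `|f p - f y| < e.

Lemma within_cont_in (f : R2 -> R) : {within That, continuous f} -> cont_in That f.
Proof.
move=> cf p Tp e e0.
have /subspace_continuousP/(_ _ Tp)/cvgrPdist_lt/(_ _ e0) := cf.
rewrite near_withinE => /nbhs_dist1P[r r0 hr]; exists r => // y Ty py; exact: hr.
Qed.

Lemma cont_inS (S T : set R2) f : S `<=` T -> cont_in T f -> cont_in S f.
Proof.
by move=> ST cf p /ST Tp e /(cf p Tp)[r r0 hr]; exists r => // y /ST Ty; exact: hr.
Qed.

Lemma quad_cont_in (S : set R2) c : cont_in S (quad c).
Proof.
move=> p _ e e0; have e20 : 0 < e / 2 by rewrite divr_gt0.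
have [r r0 hr] := sdiff_cont (sdiff_quad c p) e20; exists r => // y _ /hr h.
by rewrite distrC; lra.
Qed.

(** A homothety with centre p and small ratio t carries the given box into S, by convexity, and as
    close to p as desired. Its image has positive measure, so f and g agree somewhere in it, and
    continuity at p excludes f p <> g p. *)
Lemma cont_ae_eq (S : set R2) (f g : R2 -> R) (b : R2) (s : R) :
  convex2 S -> 0 < s -> box b s `<=` S -> cont_in S f -> cont_in S g ->
  ae_on S (fun p => f p = g p) -> forall p, S p -> f p = g p.
Proof.
move=> xS s0 bS cf cg fg p Sp; apply: contrapT => /eqP np.
pose eta := `|f p - g p| / 2.
have eta0 : 0 < eta by rewrite divr_gt0// normr_gt0 subr_eq0.
have [r r0 hr] := cf p Sp _ eta0; have [r' r'0 hr'] := cg p Sp _ eta0.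
pose m := Num.min r r'; have m0 : 0 < m by rewrite lt_min r0.
pose K := dist1 p b + 2 * s + 1.
have K0 : 0 < K by rewrite /K; have := dist1_ge0 p b; lra.
pose t := Num.min 1 (m / (2 * K)).
have t0 : 0 < t by rewrite lt_min ltr01 divr_gt0// mulr_gt0.
have t1 : t <= 1 by rewrite ge_min lexx.
have tK : t * K < m.
  have : t <= m / (2 * K) by rewrite ge_min lexx orbT.
  by rewrite ler_pdivlMr ?mulr_gt0//; have := mulr_gt0 t0 K0; lra.
pose c := (1 - t) *: p + t *: b.
have key y : box c (t * s) y -> S y /\ dist1 p y < m.
  move=> [/=]; rewrite !in_itv/= => /andP[y1 y2] /andP[y3 y4].
  rewrite /c /= /GRing.scale /= in y1 y2 y3 y4.
  pose z : R2 := ((y.1 - (1 - t) * p.1) / t, (y.2 - (1 - t) * p.2) / t).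
  have tn0 : t != 0 by rewrite gt_eqF.
  have yz : y = (1 - t) *: p + t *: z.
    by apply: eq_pair2; rewrite /z /= /GRing.scale /=; field.
  have bz : box b s z.
    split; rewrite /z /= in_itv/=; apply/andP; split.
    - by rewrite ler_pdivlMr//; lra.
    - by rewrite ler_pdivrMr//; lra.
    - by rewrite ler_pdivlMr//; lra.
    - by rewrite ler_pdivrMr//; lra.
  clearbody z; split; first by rewrite yz; apply: xS => //; [exact: bS|rewrite ltW].
  have zb : dist1 b z <= 2 * s.
    move: bz => [/=]; rewrite !in_itv/= => /andP[z1 z2] /andP[z3 z4].
    have hb1 : `|b.1 - z.1| <= s by rewrite ler_norml; move: z1 z2; clear; lra.
    have hb2 : `|b.2 - z.2| <= s by rewrite ler_norml; move: z3 z4; clear; lra.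
    by rewrite /dist1; move: hb1 hb2; clear; lra.
  have -> : dist1 p y = t * dist1 p z.
    rewrite yz /dist1 /= /GRing.scale /=.
    have e u v : u - ((1 - t) * u + t * v) = t * (u - v) by ring.
    by rewrite !e !normrM (gtr0_norm t0) mulrDr.
  have := dist1_tri b p z => h; apply: le_lt_trans tK; rewrite ler_wpM2l ?ltW//.
  by rewrite /K; lra.
have [|y by_ fgy] := @ae_box S (fun p => f p = g p) c (t * s) (mulr_gt0 t0 s0) _ fg.
  by move=> y /key[].
have [Sy] := key y by_; rewrite lt_min => /andP[yr yr'].
have := hr y Sy yr; have := hr' y Sy yr'; rewrite fgy => h1 h2.
have := ler_distD (g y) (f p) (g p); rewrite (distrC (g y) (g p)) /eta in h1 h2 *.
by have := normr_gt0 (f p - g p); rewrite subr_eq0 np; lra.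
Qed.

(** A weight on the barycenter contributes one third of itself to every barycentric coordinate.
    Without vertex k nothing else contributes to [lam k], which is therefore the smallest
    coordinate; conversely the weight is 3 lam k. *)
Lemma ctKP k p : ctK k p <-> 0 <= @lam R p k /\ forall m, lam p k <= lam p m.
Proof.
rewrite /ctK /triangle; split => [/simplexP[q [q0 _ ->]]|[h0 hm]].
  have e m : lam (\sum_l lam q l *: (if l == k then bary R else zhat R l)) m =
      lam q k / 3 + (if m == k then 0 else lam q m).
    rewrite sum3 /bary sum3 /zhat; case: (ord3P k) => ->; case: (ord3P m) => ->;
    rewrite ?lam0 ?lam1 ?lam2 /= /GRing.scale /=; by field.
  have := q0 k; rewrite e eqxx addr0 => qk; split; first by rewrite divr_ge0.
  by move=> m; rewrite e; case: ifP => _; rewrite ?addr0// lerDl.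
pose q : R2 := (if k == 0 then 3 * lam p k else p.1 - lam p k,
                if k == 1 then 3 * lam p k else p.2 - lam p k).
have qE m : lam q m = if m == k then 3 * lam p k else lam p m - lam p k.
  by rewrite /q; case: (ord3P k) => ->; case: (ord3P m) => ->;
    rewrite ?lam0 ?lam1 ?lam2 /=; ring.
apply/simplexP; exists q; split.
- move=> m; rewrite qE; case: ifP => _; first by rewrite mulr_ge0.
  by rewrite subr_ge0.
- by move=> m; rewrite inE.
- rewrite sum3 !qE /bary sum3 /zhat; case: (ord3P k) => ->;
  rewrite ?lam0 ?lam1 ?lam2 /=; by apply: eq_pair2; rewrite /= /GRing.scale /=; field.
Qed.

Lemma ctK_That k p : ctK k p -> That p.
Proof. by move=> /ctKP[h0 h]; apply/ThatP => m; exact: le_trans (h m). Qed.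

Lemma convex2_ctK k : convex2 (@ctK R k).
Proof.
move=> p q t /ctKP[p0 pm] /ctKP[q0 qm] /andP[t0 t1]; have s0 : 0 <= 1 - t by rewrite subr_ge0.
apply/ctKP; split=> [|m]; rewrite !lam_mix; first by rewrite addr_ge0// mulr_ge0.
by apply: lerD; apply: ler_wpM2l.
Qed.

Lemma closed_ctK k : closed (@ctK R k).
Proof.
have -> : @ctK R k = [set p | 0 <= lam p k] `&`
    \bigcap_m [set p : R2 | 0 <= lam p m - lam p k].
  apply/seteqP; split => p; first by move=> /ctKP[h0 h]; split => // m _ /=; rewrite subr_ge0.
  by move=> [h0 h]; apply/ctKP; split => // m; have := h m I; rewrite /= subr_ge0.
apply: closedI; first by apply: closed_ge2; exact: continuous_lam.
apply: closed_bigI => m _; apply: closed_ge2.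
exact: (contD (@continuous_lam R m) (contN (@continuous_lam R k))).
Qed.

Lemma ctK_box k : exists b : R2, exists2 s : R, 0 < s & box b s `<=` @ctK R k.
Proof.
(* The centroid of the subtriangle, with coordinate 1/9 at index k and 4/9 at the two others. *)
exists (if k == 0 then (9^-1, 4 / 9) else if k == 1 then (4 / 9, 9^-1) else (4 / 9, 4 / 9)).
exists (18^-1) => // p [/=]; rewrite !in_itv/= => /andP[h1 h2] /andP[h3 h4].
apply/ctKP; split; first by move: h1 h2 h3 h4; case: (ord3P k) => -> /=; rewrite ?lam0 ?lam1 ?lam2; lra.
by move=> m; move: h1 h2 h3 h4; case: (ord3P k) => ->; case: (ord3P m) => -> /=;
  rewrite ?lam0 ?lam1 ?lam2; lra.
Qed.

Lemma That_ctK p : That p -> exists k, ctK k p.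
Proof.
move=> /ThatP Tp; have [k _ hk] := @arg_minP _ R 'I_3 ord0 xpredT (fun k => lam p k) isT.
by exists k; apply/ctKP; split => // m; exact: hk.
Qed.

Lemma edge_ctK k p : That p -> lam p k = 0 -> ctK k p.
Proof. by move=> /ThatP Tp pk; apply/ctKP; rewrite pk. Qed.

Lemma ctK_near k p : 0 < lam p k -> (forall m, m != k -> lam p k < lam p m) ->
  exists2 r : R, 0 < r & forall y, dist1 p y < r -> ctK k y.
Proof.
move=> p0 pm.
have [r r0 hr] := near_gt0 (@continuous_lam R k) p0.
have [s s0 hs] : exists2 s : R, 0 < s & forall y, dist1 p y < s -> forall m, lam y k <= lam y m.
  apply: (@dist1_forall R _ (fun m y => lam y k <= lam y m)) => m.
  have [->|mk] := eqVneq m k; first by exists 1.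
  have q0 : 0 < lam p m - lam p k by rewrite subr_gt0 pm.
  have cl : continuous (fun y : R2 => lam y m - lam y k).
    exact: (contD (@continuous_lam R m) (contN (@continuous_lam R k))).
  have [t t0 ht] := near_gt0 cl q0; exists t => // y /ht.
  by rewrite subr_gt0 => /ltW.
exists (Num.min r s); first by rewrite lt_min r0.
by move=> y; rewrite lt_min => /andP[/hr y1 /hs y2]; apply/ctKP; split => //; exact: ltW.
Qed.

Lemma ae_ctK : ae_on That (fun p => exists k, 0 < lam p k /\ forall m, m != k -> lam p k < lam p m).
Proof.
have d (k m : 'I_3) : k != m -> ae_on That (fun p => lam p k != lam p m).
  move=> km.
  have h (a b c : R) : (a != 0) || (b != 0) ->
      (forall p : R2, a * p.1 + b * p.2 + c = lam p k - lam p m) ->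
      ae_on That (fun p => lam p k != lam p m).
    move=> ab e; rewrite ae_onE; apply: filterS (ae_line c ab) => p hp _.
    by rewrite -subr_eq0 -e.
  move: km h; case: (ord3P k) => ->; case: (ord3P m) => -> //= _ h.
  - by apply: (h 1 (-1) 0) => [|p]; rewrite ?oner_neq0// lam0 lam1; ring.
  - by apply: (h 2 1 (-1)) => [|p]; rewrite ?oner_neq0 ?orbT// lam0 lam2; ring.
  - by apply: (h (-1) 1 0) => [|p]; rewrite ?oner_neq0 ?orbT// lam0 lam1; ring.
  - by apply: (h 1 2 (-1)) => [|p]; rewrite ?oner_neq0// lam1 lam2; ring.
  - by apply: (h (-2) (-1) 1) => [|p]; rewrite ?oppr_eq0 ?oner_neq0 ?orbT// lam0 lam2; ring.
  - by apply: (h (-1) (-2) 1) => [|p]; rewrite ?oppr_eq0 ?oner_neq0// lam1 lam2; ring.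
have oT : ae_on That That° := @ae_That_interior R.
have := ae_onI oT (ae_onI (d 0 1 isT) (ae_onI (d 0 2 isT) (d 1 2 isT))).
apply: ae_onS => p Tp [/interior_That op [h01 [h02 h12]]].
have [k /ctKP[_ hk]] := That_ctK Tp; exists k; split => // m mk.
rewrite lt_neqAle hk andbT; move: mk h01 h02 h12.
by case: (ord3P k) => ->; case: (ord3P m) => -> //= _; rewrite ?[lam p 1 == _]eq_sym ?[lam p 2 == _]eq_sym.
Qed.

Definition pwq (f : R2 -> R) (c : 'I_3 -> quadc R) := forall k p, ctK k p -> f p = quad (c k) p.

Lemma pwq_of_ae (f : R2 -> R) (c : 'I_3 -> quadc R) : {within That, continuous f} ->
  (forall k, ae_on (@ctK R k) (fun p => f p = quad (c k) p)) -> pwq f c.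
Proof.
move=> cf h k p kp; have [b [s s0 bs]] := ctK_box k.
apply: (@cont_ae_eq (@ctK R k) f (quad (c k)) b s) => //.
- exact: convex2_ctK.
- by apply: cont_inS (within_cont_in cf); exact: ctK_That.
- exact: quad_cont_in.
Qed.

Lemma That_ae_eq (f g : R2 -> R) : {within That, continuous f} -> {within That, continuous g} ->
  ae_on That (fun p => f p = g p) -> forall p, That p -> f p = g p.
Proof.
move=> cf cg; have [b [s s0 bs]] := ctK_box 0.
apply: (@cont_ae_eq _ _ _ b s) => //; try exact: within_cont_in.
- exact: convex2_That.
- by apply: subset_trans bs _ => p; exact: ctK_That.
Qed.

Lemma LipB_pwq (f : R2 -> R) c : pwq f c -> LipB That f.
Proof.
move=> fc; have /choice[L hL] : forall k, exists L : R, 0 <= L /\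
    (Lip L That (quad (c k)) /\ forall p, That p -> `|quad (c k) p| <= L).
  move=> k; have [L [M [L0 M0 lq bq]]] := LipB_That_quad (c k); exists (L + M).
  split; first exact: addr_ge0.
  split=> [y z Ty Tz|p Tp].
    by apply: (le_trans (lq y z Ty Tz)); rewrite ler_wpM2r ?dist1_ge0// lerDl.
  by apply: (le_trans (bq p Tp)); rewrite lerDr.
pose S := \sum_k L k.
have LS k : L k <= S.
  by rewrite /S (bigD1 k)//= lerDl sumr_ge0// => m _; case: (hL m).
have S0 : 0 <= S by rewrite sumr_ge0// => m _; case: (hL m).
exists S, S; split => //.
  apply: (@Lip_cover _ _ (@ctK R)); first exact: convex2_That.
  - exact: closed_ctK.
  - by move=> y; exact: That_ctK.
  - move=> k y z [ky Ty] [kz Tz]; rewrite (fc k y ky) (fc k z kz).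
    have [_ [lq _]] := hL k; apply: (le_trans (lq y z Ty Tz)).
    by rewrite ler_wpM2r ?dist1_ge0.
move=> p Tp; have [k kp] := That_ctK Tp; rewrite (fc k p kp).
by have [_ [_ bq]] := hL k; exact: le_trans (bq p Tp) (LS k).
Qed.

(** On the line lam k = 0 the polynomial is a quadratic in one variable with three zeros, so its
    three coefficients there vanish. *)
Lemma quad_edge0 (c : quadc R) k : (forall a, a != k -> quad c (zhat R a) = 0) ->
  quad c (2^-1 *: (zhat R (opp k).1 + zhat R (opp k).2)) = 0 ->
  forall p, lam p k = 0 -> quad c p = 0.
Proof.
move=> hz hm p; move: hz hm; case: (ord3P k) => ->.
- rewrite /opp /= => hz; have := hz 1 isT; have := hz 2 isT.
  rewrite lam0 /quad /zhat /= /GRing.scale /= => h1 h2 h3 p0; rewrite p0.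
  have z0 : k0 c = 0 by lra. have z2 : k2 c = 0 by lra. have z5 : k5 c = 0 by lra.
  by rewrite z0 z2 z5; ring.
- rewrite /opp /= => hz; have := hz 0 isT; have := hz 2 isT.
  rewrite lam1 /quad /zhat /= /GRing.scale /= => h1 h2 h3 p0; rewrite p0.
  have z0 : k0 c = 0 by lra. have z2 : k1 c = 0 by lra. have z5 : k3 c = 0 by lra.
  by rewrite z0 z2 z5; ring.
- rewrite /opp /= => hz; have := hz 0 isT; have := hz 1 isT.
  rewrite lam2 /quad /zhat /= /GRing.scale /= => h1 h2 h3 p0.
  have -> : p.2 = 1 - p.1 by lra.
  have e1 : k0 c + k2 c + k5 c = 0 by lra.
  have e2 : k1 c - k2 c + k4 c - 2 * k5 c = 0 by lra.
  have e3 : k3 c - k4 c + k5 c = 0 by lra.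
  transitivity ((k0 c + k2 c + k5 c) + (k1 c - k2 c + k4 c - 2 * k5 c) * p.1 +
    (k3 c - k4 c + k5 c) * p.1 ^+ 2); first by ring.
  by rewrite e1 e2 e3 !mul0r !addr0.
Qed.

End PiecewiseQuadratic.

(** * Vanishing on the edges outside of the affine domain *)

Section EdgeTrace.
Variable R : realType.
Local Notation R2 := (R * R)%type.
Local Notation T2 := (measurableTypeR R * measurableTypeR R)%type.
Local Notation mu := (mu2 R).
Local Notation That := (@That R).

Let mT := @measurable_That R.

(* Maps the edge p.1 = 0 onto the edge opposite to n. *)
Definition flip (n : 'I_3) (p : R2) : R2 :=
  if n == 0 then affine2 1 0 0 1 0 0 p else if n == 1 then affine2 0 1 1 0 0 0 p
  else affine2 0 1 (-1) (-1) 0 1 p.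

Definition flop (n : 'I_3) (p : R2) : R2 :=
  if n == 0 then p else if n == 1 then (p.2, p.1) else (1 - p.1 - p.2, p.1).

Lemma flopK n p : flip n (flop n p) = p.
Proof.
by case: (ord3P n) => ->; rewrite /flop /flip /affine2 /=; apply: eq_pair2 => /=; ring.
Qed.

Lemma flip_That n p : That (flip n p) <-> That p.
Proof.
split=> /ThatE; case: (ord3P n) => ->; rewrite /flip /affine2 /= => -[h1 h2 h3];
  apply/ThatE => /=; split; lra.
Qed.

Lemma flip_image n : flip n @` That = That.
Proof.
apply/seteqP; split => [_ [p Tp <-]|p Tp]; first exact/flip_That.
by exists (flop n p); rewrite ?flopK//; apply/(flip_That n); rewrite flopK.
Qed.

Lemma flip_edge n s : 0 <= s <= 1 -> That (flip n (0, s)) /\ lam (flip n (0, s)) n = 0.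
Proof.
move=> /andP[s0 s1]; split; first by apply/flip_That/ThatE => /=; split; lra.
by case: (ord3P n) => ->; rewrite ?lam0 ?lam1 ?lam2 /flip /affine2 /=; ring.
Qed.

Lemma edge_flip n p : That p -> lam p n = 0 -> exists2 s, 0 <= s <= 1 & p = flip n (0, s).
Proof.
move=> Tp pn; have := flopK n p; have : That (flop n p) by apply/(flip_That n); rewrite flopK.
have : (flop n p).1 = 0.
  by move: pn; case: (ord3P n) => ->; rewrite ?lam0 ?lam1 ?lam2 /flop.
case: (flop n p) => x s /= -> /ThatE[/= _ s0 s1] <-; exists s => //.
by apply/andP; split; lra.
Qed.

Lemma cov_flip n : cov That (flip n) (cst 1).
Proof.
have h (a b c d e g : R) : `|a * d - b * c| = 1 -> cov That (affine2 a b c d e g) (cst 1).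
  move=> det1 f mf f0.
  rewrite -(cov_affine2 e g (_ : a * d - b * c != 0) (@compact_That R) mf f0) ?det1//.
  by rewrite -normr_eq0 det1 oner_neq0.
case: (ord3P n) => ->; apply: h.
- by rewrite mulr1 mulr0 subr0 normr1.
- by rewrite mulr1 mulr0 sub0r normrN1.
- by rewrite mul1r mul0r sub0r opprK normr1.
Qed.

Lemma continuous_flip n : continuous (flip n).
Proof. by case: (ord3P n) => ->; exact: continuous_affine2. Qed.

Lemma measurable_flip n : measurable_fun (setT : set T2) (flip n : T2 -> T2).
Proof. by case: (ord3P n) => ->; exact: measurable_affine2. Qed.

Lemma int_flip n (f : R2 -> R) : measurable_fun (That : set T2) (f : T2 -> R) ->
  (\int[mu]_(p in That) (f (flip n p) ^+ 2)%:E = \int[mu]_(p in That) (f p ^+ 2)%:E)%E.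
Proof.
move=> mf; pose F : T2 -> \bar R := (fun p : T2 => (f p ^+ 2)%:E) \_ That.
have mF : measurable_fun setT F.
  apply/(measurable_restrictT _ mT); apply/measurable_EFinP; exact: measurable_funX.
have F0 p : (0 <= F p)%E by rewrite /F patchE; case: ifP => _; rewrite ?lee_fin ?sqr_ge0.
have := cov_flip n mF F0; rewrite flip_image => h.
transitivity (\int[mu]_(p in That) (F (flip n p) * (cst 1 p)%:E))%E.
  apply: eq_integral => p; rewrite inE => /(flip_That n) Tp.
  by rewrite /F patchE mem_set// mule1.
by rewrite h; apply: eq_integral => p; rewrite inE => Tp; rewrite /F patchE mem_set.
Qed.

Lemma sqint_flip n (f : R2 -> R) : sqint f -> sqint (f \o flip n).
Proof.
move=> [mf hf]; split; last by rewrite int_flip.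
have mF : measurable_fun (setT : set T2) ((f : T2 -> R) \_ That).
  exact/(measurable_restrictT _ mT).
have : measurable_fun (That : set T2) (((f : T2 -> R) \_ That) \o flip n).
  by apply: measurable_funTS; exact: (measurableT_comp mF (measurable_flip n)).
apply: eq_measurable_fun => p; rewrite inE => /(flip_That n) Tp.
by rewrite /= patchE mem_set.
Qed.

Lemma sqint_lin (a c del : R) (f h : R2 -> R) : 0 < del -> sqint f -> sqint h ->
  (\int[mu]_(p in That) (f p ^+ 2)%:E < del%:E)%E ->
  (\int[mu]_(p in That) (h p ^+ 2)%:E < del%:E)%E ->
  sqint (fun p => a * f p + c * h p) /\
  (\int[mu]_(p in That) ((a * f p + c * h p) ^+ 2)%:E <
    ((2 * a ^+ 2 + 2 * c ^+ 2 + 1) * del)%:E)%E.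
Proof.
move=> del0 sf sh; have if_ := sqint_sq sf; have ih := sqint_sq sh.
rewrite -(fineK (integrable_fin_num mT if_)) -(fineK (integrable_fin_num mT ih)) !lte_fin => f1 h1.
have mS : measurable_fun (That : set T2) (fun p : T2 => a * f p + c * h p).
  by case: sf => mf _; case: sh => mh _; apply: measurable_funD; apply: measurable_funM.
have bd p : That p -> `|(a * f p + c * h p) ^+ 2| <= 2 * a ^+ 2 * f p ^+ 2 + 2 * c ^+ 2 * h p ^+ 2.
  move=> _; rewrite ger0_norm ?sqr_ge0//; have := sqr_ge0 (a * f p - c * h p).
  by rewrite sqrrB sqrrD !exprMn; lra.
have iR := int_add (int_scale (2 * a ^+ 2) if_) (int_scale (2 * c ^+ 2) ih).
have iS : mu.-integrable That (fun p => ((a * f p + c * h p) ^+ 2)%:E).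
  by apply: le_int bd iR; exact: measurable_funX.
have sS : sqint (fun p => a * f p + c * h p) by exact: sqint_of_int.
split => //; rewrite -(fineK (integrable_fin_num mT iS)) lte_fin.
apply: (@le_lt_trans _ _ (2 * a ^+ 2 * (\int[mu]_(p in That) (f p ^+ 2))%R +
   2 * c ^+ 2 * (\int[mu]_(p in That) (h p ^+ 2))%R)).
  rewrite -(RintegralZl _ mT if_) -(RintegralZl _ mT ih).
  rewrite -(RintegralD mT (int_scale (2 * a ^+ 2) if_) (int_scale (2 * c ^+ 2) ih)).
  by apply: le_Rintegral => // p Tp; exact: le_trans (ler_norm _) (bd p Tp).
have a0 : 0 <= 2 * a ^+ 2 by rewrite mulr_ge0// sqr_ge0.
have c0 : 0 <= 2 * c ^+ 2 by rewrite mulr_ge0// sqr_ge0.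
have := ler_wpM2l a0 (ltW f1); have := ler_wpM2l c0 (ltW h1).
by rewrite !mulrDl mul1r; move: del0; clear; lra.
Qed.

Lemma compose_elA (e : elem R) n : exists e' : elem R, forall p, elA e' p = elA e (flip n p).
Proof.
have h (a b c d u v : R) : exists e' : elem R, forall p, elA e' p = elA e (affine2 a b c d u v p).
  exists (Elem (ea e * a + eb e * c) (ea e * b + eb e * d) (ec e * a + ed e * c)
    (ec e * b + ed e * d) (ea e * u + eb e * v + ee e) (ec e * u + ed e * v + eg e) 0 0 0) => p.
  by rewrite /elA /affine2 /=; apply: eq_pair2 => /=; ring.
by case: (ord3P n) => ->; exact: h.
Qed.

Lemma continuous_compT (f : R2 -> R) (F : R2 -> R2) : continuous f -> continuous F ->
  continuous (f \o F).
Proof. by move=> cf cF x; apply: continuous_comp; [exact: cF|exact: cf]. Qed.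

Lemma sdiff_slice1 (f : R2 -> R) (t s : R) a : sdiff f (t, s) a ->
  is_derive (t : R) (1 : R) (fun t => f (t, s)) a.1.
Proof.
rewrite -[a.1]/(cmp 0 a) => /(sdiff_is_derive 0)[df <-].
have E : (fun h : R => h^-1 *: (((fun t => f (t, s)) \o shift t) (h *: 1) - f (t, s))) =
         (fun h : R => h^-1 *: ((f \o shift (t, s)) (h *: basis2 R 0) - f (t, s))).
  apply/funext => h; rewrite /= /basis2 /=; congr (_ *: (f _ - _)).
  by apply: eq_pair2 => //=; rewrite /GRing.scale /= mulr0 add0r.
split; first by rewrite /derivable E.
by rewrite /derive E.
Qed.

(* After [flip n], [strip_zero] applies to the first variable. *)
Lemma edge_trace (e : elem R) (n : 'I_3) (U : set R2) (f0 : R2 -> R) (g0 : 'I_2 -> R2 -> R)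
    (h : R2 -> R) :
  {within That, continuous h} -> ae_on That (fun p => f0 (elA e p) = h p) ->
  sqint (f0 \o elA e) -> (forall k, sqint (g0 k \o elA e)) ->
  (forall del : R, 0 < del -> exists2 phi, test_fun U phi &
     (\int[mu]_(p in That) ((f0 (elA e p) - phi (elA e p)) ^+ 2)%:E < del%:E)%E /\
     forall k, (\int[mu]_(p in That) ((g0 k (elA e p) - partial k phi (elA e p)) ^+ 2)%:E < del%:E)%E) ->
  (forall p, That p -> lam p n = 0 -> ~ U (elA e p)) ->
  forall p, That p -> lam p n = 0 -> h p = 0.
Proof.
move=> ch f0h sf0 sg0 happ out; have [e' he'] := compose_elA e n.
pose G p := ea e' * g0 0 (elA e (flip n p)) + ec e' * g0 1 (elA e (flip n p)).
have chf : {within That, continuous (h \o flip n)}.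
  apply/subspace_continuousP => x Tx; apply/cvgrPdist_lt => eps eps0.
  have Tfx : That (flip n x) by apply/flip_That.
  have /subspace_continuousP/(_ _ Tfx)/cvgrPdist_lt/(_ _ eps0) := ch.
  rewrite !near_withinE => H; have {}H := @continuous_flip n x _ H.
  apply/nbhs_dist1P; have /nbhs_dist1P[r r0 hr] := H; exists r => // y /hr hy Ty.
  by apply: hy; exact/flip_That.
have scont (f : R2 -> R) : continuous f -> sqint f.
  move=> cf; have [B B0 hB] := continuous_bounded2 (@compact_That R) cf.
  by apply: (@sqint_bd _ _ B) => //; apply: measurable_funTS; exact: continuous_measurable2.
have sG : sqint G.
  have [mG _] : sqint (g0 0 \o elA e \o flip n) by exact: sqint_flip.
  have s0 := sqint_flip n (sg0 0); have s1 := sqint_flip n (sg0 1).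
  have M u : measurable_fun (That : set T2) (cst u : T2 -> R) by [].
  have t0 := @sqintM _ _ (cst (ea e')) `|ea e'| s0 (M _) (fun _ _ => lexx _).
  have t1 := @sqintM _ _ (cst (- ec e')) `|- ec e'| s1 (M _) (fun _ _ => lexx _).
  have := sqintB t0 t1; congr sqint; apply/funext => p; rewrite /G /=; ring.
have key : forall s : R, 0 < s < 1 -> (h \o flip n) (0, s) = 0.
  apply: (@strip_zero R (h \o flip n) G) => // del del0.
  (* The factor that [sqint_lin] loses when the two partial derivatives are combined into the one
     along the first variable; hence the tolerance del / K. *)
  pose K := 2 * ea e' ^+ 2 + 2 * ec e' ^+ 2 + 1.
  have K0 : 0 < K by rewrite /K; have := sqr_ge0 (ea e'); have := sqr_ge0 (ec e'); lra.
  have d0 : 0 < Num.min del (del / K) by rewrite lt_min del0 divr_gt0.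
  have [phi tphi [h1 h2]] := happ _ d0; have [sphi [S [cS SU phi0]]] := tphi.
  have cA : continuous (elA e \o flip n).
    by move=> x; apply: continuous_comp; [exact: continuous_flip|exact: continuous_elA].
  have cp k : continuous (partial k phi) by exact: (sphi [:: k]).1.
  exists (phi \o elA e'), (fun p => (elAT e' (partial 0 phi (elA e' p), partial 1 phi (elA e' p))).1).
  split.
  - by apply: continuous_compT (@continuous_elA _ e'); exact: (sphi [::]).1.
  - exact: (contD (contM (@continuous_cst2 R _) (continuous_compT (cp 0) (@continuous_elA _ e')))
      (contM (@continuous_cst2 R _) (continuous_compT (cp 1) (@continuous_elA _ e')))).
  - move=> t s; apply: sdiff_slice1; apply: sdiff_elA; exact: smooth_sdiff.
  - move=> s /(flip_edge n)[T0 l0]; rewrite /= he' phi0// => /SU; exact: out.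
  - split.
      have me : measurable_fun (That : set T2) (fun p : T2 => h p - phi (elA e p)).
        apply: measurable_funB; first exact: within_measurable.
        apply: measurable_funTS; apply: continuous_measurable2.
        by apply: continuous_compT (@continuous_elA _ e); exact: (sphi [::]).1.
      under eq_integral do rewrite /= he'.
      rewrite (int_flip n me); apply: (@lt_le_trans _ _ (Num.min del (del / K))%:E).
        rewrite (_ : (\int[mu]_(p in That) _)%E =
          (\int[mu]_(p in That) ((f0 (elA e p) - phi (elA e p)) ^+ 2)%:E)%E) //.
        apply: integral_eq_ae; move: f0h; rewrite ae_onE; apply: filterS.
        by move=> p hp Tp; rewrite hp.
      by rewrite lee_fin ge_min lexx.
    have sd k : sqint (fun p => g0 k (elA e p) - partial k phi (elA e p)).
      by apply: (sqintB (sg0 k)); apply: scont; exact: continuous_compT (cp k) (@continuous_elA _ e).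
    have sdf k := sqint_flip n (sd k).
    have [||_] := sqint_lin (ea e') (ec e') d0 (sdf 0) (sdf 1).
    - by have := h2 0; rewrite -(int_flip n (sd 0).1).
    - by have := h2 1; rewrite -(int_flip n (sd 1).1).
    rewrite -/K => H; have KE : (K * Num.min del (del / K) <= del)%R.
      by rewrite -ler_pdivlMl// mulrC ge_min lexx orbT.
    apply: le_lt_trans (lt_le_trans H _); last by rewrite lee_fin.
    rewrite le_eqVlt; apply/orP; left; apply/eqP; apply: eq_integral => p _.
    by congr ((_ ^+ 2)%:E); rewrite /G /elAT /= !he'; ring.
move=> p Tp pn; have [s s01 ->] := edge_flip Tp pn.
apply/eqP; rewrite -normr_le0; apply/ler_addgt0Pr => eps eps0; rewrite add0r.
have Ts : That (0, s) by apply/(flip_That n); case: (flip_edge n s01).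
have [r r0 hr] := within_cont_in chf Ts eps0.
pose t := Num.min 1 r; have t0 : 0 < t by rewrite lt_min ltr01.
have [t1 tr] : t <= 1 /\ t <= r by rewrite /t !ge_min !lexx orbT.
(* End points of the edge are reached by continuity, from a point moved slightly towards the
   midpoint of the edge. *)
pose s' := (1 - t) * s + t / 2; have /andP[s0 s1] := s01.
have [s'0 s'1] : 0 < s' /\ s' < 1.
  have := mulr_ge0 (_ : 0 <= 1 - t) s0; have := mulr_ge0 (_ : 0 <= 1 - t) (_ : 0 <= 1 - s).
  by rewrite !subr_ge0 => /(_ t1 s1) ? /(_ t1) ?; rewrite /s'; split; lra.
have Ts' : That (0, s') by apply/ThatE => /=; move: s'0 s'1; clearbody s'; clear; split; lra.
have := hr (0, s') Ts'; rewrite (key s') ?s'0// subr0 => H; apply/ltW/H.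
rewrite /dist1 /= subrr normr0 add0r.
have -> : s - s' = t * (s - 2^-1) by rewrite /s'; ring.
rewrite normrM (gtr0_norm t0); apply: (@le_lt_trans _ _ (t * 2^-1)).
  by apply: ler_wpM2l; [exact: ltW|rewrite ler_norml; move: s0 s1; clear; lra].
by lra.
Qed.

End EdgeTrace.

(** * The Piola transform on one element *)

Section Piola.
Variable R : realType.
Local Notation R2 := (R * R)%type.
Local Notation T2 := (measurableTypeR R * measurableTypeR R)%type.
Local Notation mu := (mu2 R).
Local Notation That := (@That R).

Variable e : elem R.

Definition piola (V : 'I_2 -> R2 -> R) (j : 'I_2) (p : R2) : R :=
  (if j == 0 then quadx (elx e) p * V 0 p + quady (elx e) p * V 1 p
   else quadx (ely e) p * V 0 p + quady (ely e) p * V 1 p) * (elJ e p)^-1.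

(** The sum of [piola V j] times column j of adj(DF) is adj(DF) DF V / det DF = V, so the normal
    component on the reference triangle is that of V. *)
Lemma piola_elN V p k : elJ e p != 0 ->
  \sum_j piola V j p * lamd (elN e j p) k = lamd (V 0 p, V 1 p) k.
Proof.
rewrite sum2 /piola /elN /elJ /= => J0.
by case: (ord3P k) => ->; rewrite /lamd /=; field.
Qed.

Lemma sdiff_ext (f g : R2 -> R) p a : f =1 g -> sdiff f p a -> sdiff g p a.
Proof. by move=> /funext ->. Qed.

Lemma sdiff_quadx (c : quadc R) p : sdiff (quadx c) p (2 * k3 c, k4 c).
Proof.
have h := sdiff_quad (Quadc (k1 c) (2 * k3 c) (k4 c) 0 0 0) p.
have -> : (2 * k3 c, k4 c) = (quadx (Quadc (k1 c) (2 * k3 c) (k4 c) 0 0 0) p,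
    quady (Quadc (k1 c) (2 * k3 c) (k4 c) 0 0 0) p).
  by rewrite /quadx /quady /=; apply: eq_pair2 => /=; ring.
by apply: (sdiff_loc ltr01) h => y _; rewrite /quad /quadx /=; ring.
Qed.

Lemma sdiff_quady (c : quadc R) p : sdiff (quady c) p (k4 c, 2 * k5 c).
Proof.
have h := sdiff_quad (Quadc (k2 c) (k4 c) (2 * k5 c) 0 0 0) p.
have -> : (k4 c, 2 * k5 c) = (quadx (Quadc (k2 c) (k4 c) (2 * k5 c) 0 0 0) p,
    quady (Quadc (k2 c) (k4 c) (2 * k5 c) 0 0 0) p).
  by rewrite /quadx /quady /=; apply: eq_pair2 => /=; ring.
by apply: (sdiff_loc ltr01) h => y _; rewrite /quad /quady /=; ring.
Qed.

(* The columns of adj DF are divergence free. *)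
Lemma piola_sdiff V p a b : sdiff (V 0) p a -> sdiff (V 1) p b -> elJ e p != 0 ->
  exists w : 'I_2 -> R2, (forall j, sdiff (piola V j) p (w j)) /\
    \sum_j dot (w j) (elN e j p) = a.1 + b.2.
Proof.
move=> da db J0.
have x1 := sdiff_quadx (elx e) p; have y1 := sdiff_quady (elx e) p.
have x2 := sdiff_quadx (ely e) p; have y2 := sdiff_quady (ely e) p.
have dJ := sdiffD (sdiffM x1 y2) (sdiffM (sdiff_cst (-1) p) (sdiffM y1 x2)).
have eJ y : quadx (elx e) y * quady (ely e) y + -1 * (quady (elx e) y * quadx (ely e) y) = elJ e y.
  by rewrite /elJ; ring.
have {}dJ := sdiff_ext eJ dJ.
have dV := sdiffV J0 dJ.
have d0 := sdiffM (sdiffD (sdiffM x1 da) (sdiffM y1 db)) dV.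
have d1 := sdiffM (sdiffD (sdiffM x2 da) (sdiffM y2 db)) dV.
eexists (fun j : 'I_2 => if j == 0 then _ else _); split.
  move=> j; have [->|/ord2P ->] := eqVneq j 0; [exact: d0|exact: d1].
rewrite sum2 /dot /elN /= /GRing.scale /= /GRing.scale /=.
move: J0; rewrite /elJ => J0; field; exact: J0.
Qed.

Hypothesis reg : el_regular e.

Let Jn0 p : That p -> elJ e p != 0.
Proof. by move=> /(proj2 reg) /lt0r_neq0. Qed.

Lemma LipB_elJV : LipB That (fun p => (elJ e p)^-1).
Proof.
have [m m0 hm] : exists2 m : R, 0 < m & forall p, That p -> m <= elJ e p.
  have T0 : That !=set0 by exists (0, 0); apply/ThatE => /=; split; lra.
  have [q /set_mem Tq hq] := compact_EVT_min T0 (@compact_That R)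
    (continuous_subspaceT (@continuous_elJ R e)).
  by exists (elJ e q); [case: reg => _; exact|move=> p Tp; apply: hq; rewrite inE].
apply: (LipBV m0 hm).
exact: (LipBD (LipBM (LipB_quadx _) (LipB_quady _)) (LipBN (LipBM (LipB_quady _) (LipB_quadx _)))).
Qed.

Lemma LipB_piola V j : (forall l, LipB That (V l)) -> LipB That (piola V j).
Proof.
move=> lV; apply: LipBM LipB_elJV; case: (j == 0).
  exact: (LipBD (LipBM (LipB_quadx _) (lV 0)) (LipBM (LipB_quady _) (lV 1))).
exact: (LipBD (LipBM (LipB_quadx _) (lV 0)) (LipBM (LipB_quady _) (lV 1))).
Qed.

(* Only the bubble, which vanishes on the two other edges, makes the tangential
   derivatives of F non-constant. *)
Lemma elN_edge k : k != en e \/ (e1 e = 0 /\ e2 e = 0) -> exists c : 'I_2 -> R,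
  forall j p, lam p k = 0 -> lamd (elN e j p) k = c j.
Proof.
move=> H; exists (fun j => lamd (if j == 0 then (ed e, - ec e) else (- eb e, ea e)) k) => j p pk.
have q0 : k != en e -> lamd (quady (elq e) p, - quadx (elq e) p) k = 0.
  move: pk; rewrite /elq; case: (ord3P k) => ->; case: (ord3P (en e)) => -> //=;
  rewrite ?lam0 ?lam1 ?lam2 /lamd /qbub /quadx /quady /= => pk _; lra.
have H0 (s : R) : (e1 e = 0 /\ e2 e = 0 -> s = 0) -> s * lamd (quady (elq e) p, - quadx (elq e) p) k = 0.
  by move=> s0; case: H => [/q0 ->|/s0 ->]; rewrite ?mulr0 ?mul0r.
have s0 a b : e1 e = 0 /\ e2 e = 0 -> a * e1 e + b * e2 e = 0 by move=> [-> ->]; rewrite !mulr0 addr0.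
rewrite /elN !qcombxE !qcombyE; case: (j == 0).
  rewrite -[RHS]addr0 -(H0 (ec e * e1 e + ed e * e2 e)); last exact: s0.
  by case: (ord3P k) => ->; rewrite /lamd /=; ring.
rewrite -[RHS]subr0 -(H0 (ea e * e1 e + eb e * e2 e)); last exact: s0.
by case: (ord3P k) => ->; rewrite /lamd /=; ring.
Qed.

Section Gap.
Variables (V g : 'I_2 -> R2 -> R) (cV cg : 'I_2 -> 'I_3 -> quadc R).
Hypothesis VP : forall j, pwq (V j) (cV j).
Hypothesis gP : forall j, pwq (g j) (cg j).

(** The pullback of v - w to one element. *)
Definition gap j p := piola V j p - g j p.

Lemma LipB_gap j : LipB That (gap j).
Proof.
by apply: LipBD; [apply: LipB_piola => l|apply: LipBN]; exact: LipB_pwq.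
Qed.

Lemma gap_edge : (forall j a, g j (zhat R a) = piola V j (zhat R a)) ->
  (forall j k, let m := 2^-1 *: (zhat R (opp k).1 + zhat R (opp k).2) in g j m = piola V j m) ->
  (e1 e = 0 /\ e2 e = 0) \/ (forall j p, That p -> lam p (en e) = 0 -> g j p = 0) ->
  forall k p, That p -> lam p k = 0 -> \sum_j gap j p * lamd (elN e j p) k = 0.
Proof.
move=> gz gm tr k.
have [c hc] : exists c : 'I_2 -> R, forall j p, That p -> lam p k = 0 ->
    g j p * lamd (elN e j p) k = g j p * c j.
  have [kn|kn] := boolP (k != en e).
    by have [c hc] := @elN_edge k (or_introl kn); exists c => j p _ /hc ->.
  case: tr => [e0|g0].
    by have [c hc] := @elN_edge k (or_intror e0); exists c => j p _ /hc ->.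
  (* On the curved edge g vanishes, so whatever the normal factor is, it may be replaced by the
     constant 0. *)
  exists (fun=> 0) => j p Tp pk; rewrite g0 ?mul0r//.
  by move: kn; rewrite negbK => /eqP <-.
(* The edge lies in the subtriangle [ctK k], so V and g are given by their polynomials of index k
   there; [L] forms the normal component coefficient by coefficient. *)
pose L (f : quadc R -> R) := lamd (f (cV 0 k), f (cV 1 k)) k - (f (cg 0 k) * c 0 + f (cg 1 k) * c 1).
pose Q := Quadc (L (@k0 R)) (L (@k1 R)) (L (@k2 R)) (L (@k3 R)) (L (@k4 R)) (L (@k5 R)).
have QE p : That p -> lam p k = 0 -> \sum_j gap j p * lamd (elN e j p) k = quad Q p.
  move=> Tp pk; have kp := edge_ctK Tp pk.
  have -> : \sum_j gap j p * lamd (elN e j p) k =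
      \sum_j piola V j p * lamd (elN e j p) k - \sum_j g j p * lamd (elN e j p) k.
    by rewrite -sumrB; apply: eq_bigr => j _; rewrite /gap mulrBl.
  rewrite (piola_elN V k (Jn0 Tp)) sum2 !hc// !(VP _ kp) !(gP _ kp).
  by rewrite /Q /L; case: (ord3P k) => ->; rewrite /lamd /quad /=; ring.
have z p : That p -> lam p k = 0 -> (forall j, g j p = piola V j p) -> quad Q p = 0.
  by move=> Tp pk gE; rewrite -QE// big1// => j _; rewrite /gap gE subrr mul0r.
move=> p Tp pk; rewrite QE//; apply: (quad_edge0 _ _ pk).
  move=> a ak; apply: z => //; first exact: zhat_That.
  by move: ak; case: (ord3P a) => ->; case: (ord3P k) => -> // _;
    rewrite ?lam0 ?lam1 ?lam2 /zhat /=; ring.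
apply: z; last by move=> j; exact: gm.
  by case: (ord3P k) => ->; rewrite /opp /zhat /=; apply/ThatE; rewrite /= /GRing.scale /=; split; lra.
by case: (ord3P k) => ->; rewrite /opp /zhat /= ?lam0 ?lam1 ?lam2 /= /GRing.scale /=; field.
Qed.

(** The divergence of adj(DF) applied to the gap, on the subtriangle k: div V minus the gradients of
    g against the columns of adj(DF), which have no divergence of their own. *)
Definition gapD k p : R := quadx (cV 0 k) p + quady (cV 1 k) p -
  \sum_j dot (quadx (cg j k) p, quady (cg j k) p) (elN e j p).

Lemma gap_sdiff : exists (w : 'I_2 -> R2 -> R2) (D : R2 -> R) (B : R),
  [/\ forall j, ae_on That (fun p => sdiff (gap j) p (w j p)),
      measurable_fun (That : set T2) (D : T2 -> R),
      forall p, That p -> `|D p| <= B &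
      ae_on That (fun p => \sum_j dot (w j p) (elN e j p) = D p)].
Proof.
pose good k (p : R2) := 0 < lam p k /\ forall m : 'I_3, m != k -> lam p k < lam p m.
have /choice[w hw] : forall p, exists w : 'I_2 -> R2, forall k, That p -> good k p ->
    (forall j, sdiff (gap j) p (w j)) /\ \sum_j dot (w j) (elN e j p) = gapD k p.
  move=> p; have [[k [Tp gk]]|ng] := pselect (exists k, That p /\ good k p); last first.
    by exists (fun=> 0) => k Tp gk; exfalso; apply: ng; exists k.
  have [r r0 hr] := ctK_near gk.1 gk.2.
  have qs f c : pwq f c -> sdiff f p (quadx (c k) p, quady (c k) p).
    by move=> fc; apply: (sdiff_loc r0) (sdiff_quad (c k) p) => y /hr/fc.
  have [u [du hu]] := piola_sdiff (qs _ _ (VP 0)) (qs _ _ (VP 1)) (Jn0 Tp).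
  exists (fun j => u j + (-1) *: (quadx (cg j k) p, quady (cg j k) p)) => k' _ gk'.
  (* A coordinate can be strictly smaller than all others for one index only, so the choice of [w p]
     is consistent. *)
  have -> : k' = k.
    apply/eqP/negPn/negP => kk; have := gk.2 _ kk.
    by rewrite eq_sym in kk; have := gk'.2 _ kk; lra.
  split=> [j|].
    have := sdiffD (du j) (sdiffM (sdiff_cst (-1) p) (qs _ _ (gP j))).
    rewrite scaler0 addr0; apply: sdiff_ext => y; by rewrite /gap mulN1r.
  rewrite /gapD -[X in X - _]hu -sumrB; apply: eq_bigr => j _.
  by rewrite /dot /= /GRing.scale /=; ring.
have cD k : continuous (gapD k).
  have cN j v : continuous (fun p : R2 => dot (quadx (cg j v) p, quady (cg j v) p) (elN e j p)).
    rewrite /dot /elN; case: (j == 0) => /=.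
      exact: (contD (contM (@continuous_quadx R _) (@continuous_quady R _))
        (contM (@continuous_quady R _) (contN (@continuous_quadx R _)))).
    exact: (contD (contM (@continuous_quadx R _) (contN (@continuous_quady R _)))
      (contM (@continuous_quady R _) (@continuous_quadx R _))).
  rewrite /gapD; under eq_fun do rewrite sum2.
  exact: (contD (contD (@continuous_quadx R _) (@continuous_quady R _)) (contN (contD (cN 0 k) (cN 1 k)))).
have /choice[B hB] : forall k, exists B : R, 0 <= B /\ forall p, That p -> `|gapD k p| <= B.
  by move=> k; have [B B0 h] := continuous_bounded2 (@compact_That R) (cD k); exists B.
(* Off the lines where two coordinates agree exactly one term of the sum is present; on these lines
   several may be, whence the bound by the sum of all [B k]. *)
exists (fun j p => w p j), (fun p => \sum_k \1_(@ctK R k) p * gapD k p), (\sum_k B k); split.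
- by move=> j; apply: ae_onS (@ae_ctK R) => p Tp [k gk]; case: (hw p k Tp gk).
- apply: measurable_funTS; apply: measurable_sum => k; apply: measurable_funM.
    apply: measurable_indic; apply: compact_measurable2.
    apply: (@subclosed_compact _ _ That); [exact: closed_ctK|exact: compact_That|].
    by move=> y; exact: ctK_That.
  exact: continuous_measurable2.
- move=> p Tp; apply: (le_trans (ler_norm_sum _ _ _)); apply: ler_sum => k _.
  have [B0 h] := hB k; rewrite indicE; case: (p \in _); rewrite ?mul1r ?mul0r ?normr0//.
  exact: h.
- apply: ae_onS (@ae_ctK R) => p Tp [k gk]; have [_ ->] := hw p k Tp gk.
  rewrite (bigD1 k)//= indicE mem_set ?mul1r; last first.
    apply/ctKP; split; first exact: ltW gk.1.
    by move=> m; have [->//|/gk.2/ltW] := eqVneq m k.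
  rewrite big1 ?addr0// => m mk; rewrite indicE memNset ?mul0r// => /ctKP[_ /(_ k)].
  by rewrite leNgt (gk.2 m mk).
Qed.

End Gap.
End Piola.

Section ElementRep.
Variable R : realType.
Local Notation R2 := (R * R)%type.
Local Notation T2 := (measurableTypeR R * measurableTypeR R)%type.
Local Notation mu := (mu2 R).
Local Notation That := (@That R).

Lemma continuous_cmp j : continuous (@cmp R j).
Proof.
have [->|/ord2P ->] := eqVneq j 0; rewrite /cmp /=; [exact: continuous_fst2|exact: continuous_snd2].
Qed.

Lemma within_cmp (g : R2 -> R2) j : {within That, continuous g} ->
  {within That, continuous (cmp j \o g)}.
Proof. by move=> cg x; apply: (@continuous_comp _ _ _ (from_subspace That g)); [exact: cg|exact: continuous_cmp]. Qed.

Lemma Vhat_quad (vh : R2 -> R2) : Vhat vh -> exists c : 'I_2 -> 'I_3 -> quadc R,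
  forall j k, ae_on (@ctK R k) (fun x => cmp j (vh x) = quad (c j k) x).
Proof.
move=> [_ hv]; have /choice[c hc] : forall jk : 'I_2 * 'I_3, exists c : quadc R,
    ae_on (@ctK R jk.2) (fun x => cmp jk.1 (vh x) = quad c x).
  move=> [j k] /=; have [p /(_ j)/polydeg2P[c hc] hp] := hv k; exists c.
  by apply: ae_onS hp => x _ ->; exact: hc.
by exists (fun j k => c (j, k)) => j k; exact: (hc (j, k)).
Qed.

Lemma within_sumM (a b f g : R2 -> R) : continuous a -> continuous b ->
  {within That, continuous f} -> {within That, continuous g} ->
  {within That, continuous (fun p => a p * f p + b p * g p)}.
Proof.
move=> ca cb cf cg x; have wa := continuous_subspaceT ca (A := That).
have wb := continuous_subspaceT cb (A := That).
by apply: cvgD; apply: cvgM; [exact: wa|exact: cf|exact: wb|exact: cg].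
Qed.

Lemma Nhat_That a : @Nhat R a -> That a.
Proof.
move=> [p [q [hp hq ->]]].
have h r : @ct_vertex R r -> That r.
  move=> [->|[k ->]]; last exact: zhat_That.
  by rewrite /bary sum3 /zhat; apply/ThatE; rewrite /= /GRing.scale /=; split; lra.
have -> : 2^-1 *: (p + q) = (1 - 2^-1) *: p + 2^-1 *: q.
  by apply: eq_pair2; rewrite /= /GRing.scale /=; field.
by apply: convex2_That; [exact: h|exact: h|rewrite invr_ge0 ler0n invf_le1// ler1n].
Qed.

Variable e : elem R.
Hypothesis reg : el_regular e.

(** V is recovered as adj(DF) applied to the continuous representative of v o F. It is therefore
    continuous and equal almost everywhere to the function of [Vhat] behind v, which makes it
    quadratic on each subtriangle at every point. *)
Lemma element_rep (vt v : R2 -> R2) :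
  (exists2 vh, Vhat vh & ae_on That (fun x => vt (elA e x) = vh x)) ->
  (exists2 vh, Vhat vh & ae_on That (fun x =>
     v (elF e x) = mulmv ((\det (jac (elF e) x))^-1 *: jac (elF e) x) (vh x))) ->
  (forall a, Nhat a -> exists2 y, value_at (vt \o elA e) a y & value_at (v \o elF e) a y) ->
  exists (g V : 'I_2 -> R2 -> R) (cg cV : 'I_2 -> 'I_3 -> quadc R),
  [/\ forall j, pwq (g j) (cg j), forall j, pwq (V j) (cV j),
      forall j, ae_on That (fun p => cmp j (vt (elA e p)) = g j p),
      forall j, ae_on That (fun p => cmp j (v (elF e p)) = piola e V j p) &
      forall j a, Nhat a -> g j a = piola e V j a].
Proof.
move=> [vh1 /Vhat_quad[cg hcg] e1] [vh2 /Vhat_quad[cV hcV] e2] node.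
(* [value_at] supplies continuous representatives together with a node; the barycenter is taken as
   the node that fixes them. *)
have n0 : @Nhat R (2^-1 *: (bary R + bary R)).
  by exists (bary R), (bary R); split => //; left.
have [y0 [g1 [cg1 eg1 _]] [g2 [cg2 eg2 _]]] := node _ n0.
pose g j := cmp j \o g1.
pose V (j : 'I_2) p := if j == 0 then
    quady (ely e) p * (g2 p).1 + - quady (elx e) p * (g2 p).2
  else - quadx (ely e) p * (g2 p).1 + quadx (elx e) p * (g2 p).2.
have sub k : @ctK R k `<=` That by move=> p; exact: ctK_That.
have J0 p : That p -> elJ e p != 0 by move=> /(proj2 reg) /lt0r_neq0.
have cV' j : {within That, continuous (V j)}.
  have [h1 h2] := (@within_cmp g2 0 cg2, @within_cmp g2 1 cg2).
  rewrite /V; case: (j == 0).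
    exact: within_sumM (@continuous_quady R _) (contN (@continuous_quady R _)) h1 h2.
  exact: within_sumM (contN (@continuous_quadx R _)) (@continuous_quadx R _) h1 h2.
have VE j : ae_on That (fun p => V j p = cmp j (vh2 p)).
  apply: ae_onS (ae_onI e2 eg2) => p Tp [E2 Eg2].
  rewrite /V -Eg2 /= E2; have := J0 p Tp.
  have M i l : ((\det (jac (elF e) p))^-1 *: jac (elF e) p) i l = (elJ e p)^-1 *
      cmp l (if i == 0 then (quadx (elx e) p, quady (elx e) p) else (quadx (ely e) p, quady (ely e) p)).
    by rewrite -jac_elF -det_jac_elF [LHS]mxE.
  rewrite /mulmv !sum2 !M /elJ /cmp /= => Jp.
  by case: (j == 0); field.
have PE p j : That p -> piola e V j p = cmp j (g2 p).
  move=> Tp; have := J0 p Tp; rewrite /piola /V /cmp /elJ /= => Jp.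
  by case: (j == 0); field.
exists g, V, cg, cV; split.
- move=> j; apply: pwq_of_ae; first exact: within_cmp.
  move=> k; apply: ae_onS (ae_onI (hcg j k) (ae_on_sub (sub k) (ae_onI e1 eg1))) => p _ [h [h1 h2]].
  by rewrite -h -h1 /g /= -h2.
- move=> j; apply: pwq_of_ae => // k.
  by apply: ae_onS (ae_onI (hcV j k) (ae_on_sub (sub k) (VE j))) => p _ [<- <-].
- by move=> j; apply: ae_onS eg1 => p _ /= ->.
- by move=> j; apply: ae_onS eg2 => p Tp /= ->; rewrite PE.
(* The representatives supplied at another node agree with the chosen ones on the whole triangle,
   being continuous and almost everywhere equal. *)
move=> j a Na; have Ta := Nhat_That Na.
have [y [h1 [ch1 eh1 h1a]] [h2 [ch2 eh2 h2a]]] := node a Na.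
rewrite PE// /g /=.
have -> : cmp j (g1 a) = cmp j (h1 a).
  apply: (That_ae_eq (@within_cmp g1 j cg1) (@within_cmp h1 j ch1)) => //.
  by apply: ae_onS (ae_onI eg1 eh1) => p _ /= [<- <-].
have -> : cmp j (g2 a) = cmp j (h2 a).
  apply: (That_ae_eq (@within_cmp g2 j cg2) (@within_cmp h2 j ch2)) => //.
  by apply: ae_onS (ae_onI eg2 eh2) => p _ /= [<- <-].
by rewrite h1a h2a.
Qed.

End ElementRep.

(** * The inclusion in H_0(div) *)

Section Hdiv.
Variable R : realType.
Local Notation R2 := (R * R)%type.
Local Notation T2 := (measurableTypeR R * measurableTypeR R)%type.
Local Notation mu := (mu2 R).
Local Notation That := (@That R).

Let mT := @measurable_That R.

Lemma sqintD (f h : R2 -> R) : sqint f -> sqint h -> sqint (fun p => f p + h p).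
Proof.
move=> sf sh; have s0 : sqint (cst 0 : R2 -> R).
  by apply: (@sqint_bd _ _ 0) => // p _; rewrite normr0.
have := sqintB sf (sqintB s0 sh); congr sqint; apply/funext => p /=; ring.
Qed.

Lemma sqint_ae (f h : R2 -> R) : measurable_fun (That : set T2) (f : T2 -> R) ->
  ae_on That (fun p => f p = h p) -> sqint h -> sqint f.
Proof.
move=> mf fh [_ hh]; split => //; apply: le_lt_trans hh; rewrite le_eqVlt.
apply/orP; left; apply/eqP; apply: integral_eq_ae; move: fh; rewrite ae_onE.
by apply: filterS => p hp Tp; rewrite hp.
Qed.

Lemma L2_of_pull (I : finType) (U : set R2) F J (f f0 : R2 -> R) :
  charts U F J -> (forall i : I, exists m M : R, 0 < m /\ forall p, That p -> m <= J i p <= M) ->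
  measurable_fun (setT : set T2) (f0 : T2 -> R) -> ae_on U (fun x => f x = f0 x) ->
  (forall i, sqint (f0 \o F i)) -> L2 U f.
Proof.
move=> ch Jb mf0 ff0 sf; split; first by exists f0 => //; exact: measurable_funTS.
have := sqint_pull ch Jb mf0 => -[_ /(_ sf)]; apply: le_lt_trans; rewrite le_eqVlt.
apply/orP; left; apply/eqP; apply: integral_eq_ae; move: ff0; rewrite ae_onE.
by apply: filterS => p hp Tp; rewrite hp.
Qed.

Lemma charts_patch (I : finType) (U : set R2) F J (f : I -> R2 -> R) :
  charts U F J -> (forall i, measurable_fun (That : set T2) (f i : T2 -> R)) ->
  exists2 g : R2 -> R, measurable_fun (setT : set T2) (g : T2 -> R) &
    forall i, ae_on That (fun p => g (F i p) = f i p).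
Proof.
move=> ch mf; have mf' i : measurable_fun (setT : set T2) ((f i : T2 -> R) \_ That).
  exact/(measurable_restrictT _ mT).
have [g mg hg] := charts_glue ch mf'; exists g => // i.
apply: ae_onS (@ae_That_interior R : ae_on That That°) => p Tp /hg ->.
by rewrite patchE mem_set.
Qed.

Variables (I : finType) (E : I -> elem R).
Hypothesis cm : cmesh E.
Local Notation F i := (elF (E i)).
Local Notation A i := (elA (E i)).
Local Notation J i := (elJ (E i)).
Local Notation Ocur := (Ocur E).
Local Notation Otil := (Otil E).

Let ct := charts_til cm.
Let cc := charts_cur cm.
Let Jb := Jb_cur cm.

Variables (vt v : R2 -> R2) (g V : I -> 'I_2 -> R2 -> R) (cg cV : I -> 'I_2 -> 'I_3 -> quadc R).
Hypothesis vt0 : forall j, H10 Otil (cmp j \o vt).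
Hypothesis gP : forall i j, pwq (g i j) (cg i j).
Hypothesis VP : forall i j, pwq (V i j) (cV i j).
Hypothesis vtE : forall i j, ae_on That (fun p => cmp j (vt (A i p)) = g i j p).
Hypothesis vE : forall i j, ae_on That (fun p => cmp j (v (F i p)) = piola (E i) (V i) j p).
Hypothesis nodes : forall i j a, @Nhat R a -> g i j a = piola (E i) (V i) j a.

Local Notation weak_pulled psi ga := (forall theta : 'I_2 -> R2 -> R,
  (forall j, test_fun Ocur (theta j)) ->
  \sum_i (\int[mu]_(p in That) ((\sum_j (psi (F i p) * partial j (theta j) (F i p) +
     ga j (F i p) * theta j (F i p))) * J i p))%R = 0).

Lemma LipB_sqint (f : R2 -> R) : LipB That f -> sqint f /\ exists M, forall p, That p -> `|f p| <= M.
Proof.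
move=> lf; have mf := LipB_measurable lf; have [L [M [_ _ _ hM]]] := lf.
by split; [exact: (sqint_bd mf hM)|exists M].
Qed.

(* The divergence of v, pulled back and multiplied by det DF. *)
Lemma pulled_divergence : exists dd : I -> R2 -> R, (forall i, sqint (dd i)) /\
  forall (psi : R2 -> R) (ga : 'I_2 -> R2 -> R),
    measurable_fun (setT : set T2) (psi : T2 -> R) ->
    (forall j, measurable_fun (setT : set T2) (ga j : T2 -> R)) ->
    (forall i, sqint (psi \o F i)) -> (forall i j, sqint (ga j \o F i)) ->
    weak_pulled psi ga ->
    \sum_i (\int[mu]_(p in That) (psi (F i p) * dd i p +
      \sum_j ga j (F i p) * piola (E i) (V i) j p * J i p))%R = 0.
Proof.
have /choice[f0 /choice[g0 hfg]] := fun j => H10_pull cm (vt0 j).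
have fE i j : ae_on That (fun p => f0 j (A i p) = g i j p).
  have [ef _ _ _] := hfg j; have := (charts_ae ct _).1 ef i => e.
  by apply: ae_onS (ae_onI e (vtE i j)) => p _ [<- <-].
have tr i : (e1 (E i) = 0 /\ e2 (E i) = 0) \/
    (forall j p, That p -> lam p (en (E i)) = 0 -> g i j p = 0).
  case: (cm_out cm i) => [|out]; [by left|right => j].
  have [_ sf sg happ] := hfg j.
  apply: (@edge_trace R (E i) (en (E i)) Otil (f0 j) (g0 j)) => //.
  - exact: LipB_within (LipB_pwq (gP i j)).
  - by move=> del /happ[phi tphi h]; exists phi.
have /choice[w /choice[D /choice[B hD]]] := fun i => gap_sdiff (cm_reg cm i) (VP i) (gP i).
(* The contribution of w to the divergence, written with the weak gradient [g0] of vt; [D] is the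
   contribution of v - w. *)
pose X i p := \sum_j dot (elAT (E i) (g0 j 0 (A i p), g0 j 1 (A i p))) (elN (E i) j p).
have sX i : sqint (X i).
  have s j k c : sqint (fun p => g0 j k (A i p) * dot c (elN (E i) j p)).
    have [_ _ sg _] := hfg j; have [M M0 hM] := bounded_elN (E i) j c.
    apply: (@sqintM _ _ _ M (sg i k)) => //.
    by apply: measurable_funTS; exact: measurable_elN.
  have := sqintD (sqintD (s 0 0 (elAT (E i) (1, 0))) (s 0 1 (elAT (E i) (0, 1))))
    (sqintD (s 1 0 (elAT (E i) (1, 0))) (s 1 1 (elAT (E i) (0, 1)))).
  congr sqint; apply/funext => p; rewrite /X sum2 /dot /elAT /=; ring.
have sD i : sqint (D i) by case: (hD i) => _ mD bD _; exact: (sqint_bd mD bD).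
exists (fun i p => D i p + X i p); split; first by move=> i; exact: sqintD.
move=> psi ga mpsi mga spsi sga weak.
have c1 i : (\int[mu]_(p in That) (psi (F i p) * D i p +
    \sum_j ga j (F i p) * gap (E i) (V i) (g i) j p * J i p))%R = 0.
  have [dw mD bD DE] := hD i.
  apply: (cut_identity cm mpsi mga spsi sga weak (w := w i) (B := B i)) => //.
    by move=> j; exact: (LipB_gap (cm_reg cm i) (VP i) (gP i)).
  apply: (gap_edge (cm_reg cm i) (VP i) (gP i)) => //.
    move=> j a; apply: nodes; exists (zhat R a), (zhat R a).
    split; try by right; exists a.
    by apply: eq_pair2; rewrite /= /GRing.scale /=; field.
  move=> j k; apply: nodes; exists (zhat R (opp k).1), (zhat R (opp k).2).
  by split => //; right; [exists (opp k).1|exists (opp k).2].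
have c2 := h10_identity cm mpsi mga spsi sga weak
  (fun j i => let: And4 _ h _ _ := hfg j in h i) (fun j i k => let: And4 _ _ h _ := hfg j in h i k)
  (fun j => let: And4 _ _ _ h := hfg j in h).
have sJ i : sqint (J i).
  have [m [M [m0 hJ]]] := Jb i; apply: (@sqint_bd _ _ M).
    by apply: measurable_funTS; exact: measurable_elJ.
  by move=> p Tp; have /andP[h1 h2] := hJ p Tp; rewrite ger0_norm//; lra.
have i1 i : mu.-integrable That (fun p => (psi (F i p) * D i p +
    \sum_j ga j (F i p) * gap (E i) (V i) (g i) j p * J i p)%:E).
  apply: int_add; first exact: sqint_mul (spsi i) (sD i).
  apply: int_sum => j; have lg := LipB_gap (cm_reg cm i) (VP i) (gP i) j.
  have [M hM] := (LipB_sqint lg).2.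
  exact: (sqint_mul (sqintM (sga i j) (LipB_measurable lg) hM) (sJ i)).
have i2 i : mu.-integrable That (fun p => (\sum_j (psi (F i p) *
     dot (elAT (E i) (g0 j 0 (A i p), g0 j 1 (A i p))) (elN (E i) j p) +
     ga j (F i p) * f0 j (A i p) * J i p))%:E).
  have i3 : mu.-integrable That (fun p => (psi (F i p) * X i p)%:E) by exact: sqint_mul (spsi i) (sX i).
  have i4 : mu.-integrable That (fun p => (\sum_j ga j (F i p) * f0 j (A i p) * J i p)%:E).
    apply: int_sum => j; have [_ sf _ _] := hfg j; have [m [M [m0 hJ]]] := Jb i.
    apply: (int_bd (M := M) (sqint_mul (sga i j) (sf i))); first by case: (sJ i).
    by move=> p Tp; have /andP[h1 h2] := hJ p Tp; rewrite ger0_norm//; lra.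
  have := int_add i3 i4; congr integrable; apply/funext => p; congr (_%:E).
  by rewrite big_split /= -mulr_sumr.
rewrite -[RHS]c2; apply: eq_bigr => i _.
apply: (etrans _ (etrans (congr1 (fun z => z + _) (c1 i)) (add0r _))).
rewrite -(RintegralD mT (i1 i) (i2 i)).
apply: Rint_ae; apply: ae_onS (ae_onI (fE i 0) (fE i 1)) => p Tp [E0 E1].
by rewrite /X /gap !sum2 E0 E1; ring.
Qed.

(** The identity [green] holds for every psi with a pulled back weak gradient. For a test function
    and its classical gradient it is the definition of the weak divergence, and for a general H^1
    function it is the vanishing of the normal trace. *)
Lemma Hdiv_inclusion : H0div Ocur v.
Proof.
have [dd [sdd identity]] := pulled_divergence.
have lP i j : LipB That (piola (E i) (V i) j).
  by apply: LipB_piola => [|l]; [exact: (cm_reg cm)|exact: LipB_pwq (VP i l)].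
have /choice[v0 hv0] : forall j, exists v0 : R2 -> R,
    measurable_fun (setT : set T2) (v0 : T2 -> R) /\
    forall i, ae_on That (fun p => v0 (F i p) = piola (E i) (V i) j p).
  move=> j; have [v0 h1 h2] := charts_patch cc (fun i => LipB_measurable (lP i j)).
  by exists v0.
have mJ i : measurable_fun (That : set T2) (J i : T2 -> R).
  by apply: measurable_funTS; exact: measurable_elJ.
have J0 i p : That p -> 0 < J i p by move=> Tp; exact: (ch_J0 cc i Tp).
have sdJ i : sqint (fun p => dd i p * (J i p)^-1).
  have lV := LipB_elJV (cm_reg cm i); have [M hM] := (LipB_sqint lV).2.
  exact: sqintM (sdd i) (LipB_measurable lV) hM.
have [d0 md0 hd0] := charts_patch cc (fun i => (sdJ i).1).
have sv0 i j : sqint (v0 j \o F i).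
  have [mv hv] := hv0 j; apply: (sqint_ae (measurable_pull cc i mv) (hv i)).
  exact: (LipB_sqint (lP i j)).1.
have sd0 i : sqint (d0 \o F i) by exact: sqint_ae (measurable_pull cc i md0) (hd0 i) (sdJ i).
have vv0 j : ae_on Ocur (fun x => cmp j (v x) = v0 j x).
  apply/(charts_ae cc) => i; have [_ hv] := hv0 j.
  by apply: ae_onS (ae_onI (hv i) (vE i j)) => p _ [-> ->].
have green psi ga : measurable_fun (setT : set T2) (psi : T2 -> R) ->
    (forall j, measurable_fun (setT : set T2) (ga j : T2 -> R)) ->
    (forall i, sqint (psi \o F i)) -> (forall i j, sqint (ga j \o F i)) ->
    weak_pulled psi ga ->
    (\int[mu]_(x in Ocur) (\sum_j cmp j (v x) * ga j x))%R +
    (\int[mu]_(x in Ocur) (d0 x * psi x))%R = 0.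
  move=> mpsi mga spsi sga weak; rewrite -[RHS](identity psi ga mpsi mga spsi sga weak).
  have -> : (\int[mu]_(x in Ocur) (\sum_j cmp j (v x) * ga j x))%R =
      (\int[mu]_(x in Ocur) (\sum_j v0 j x * ga j x))%R.
    apply: Rint_ae; apply: ae_onS (ae_onI (vv0 0) (vv0 1)) => x _ [e0 e1].
    by rewrite !sum2 e0 e1.
  have mvg : measurable_fun (setT : set T2) ((fun x : T2 => \sum_j v0 j x * ga j x) : T2 -> R).
    by apply: measurable_sum => j; apply: measurable_funM => //; case: (hv0 j).
  have mdp : measurable_fun (setT : set T2) ((fun x : T2 => d0 x * psi x) : T2 -> R).
    exact: measurable_funM.
  have i1 i : mu.-integrable That (fun p => ((\sum_j v0 j (F i p) * ga j (F i p)) * J i p)%:E).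
    apply: (int_pull cc Jb (f := fun x => \sum_j v0 j x * ga j x)).
    exact: (int_sum (fun j => sqint_mul (sv0 i j) (sga i j))).
  have i2 i : mu.-integrable That (fun p => (d0 (F i p) * psi (F i p) * J i p)%:E).
    apply: (int_pull cc Jb (f := fun x => d0 x * psi x)).
    exact: sqint_mul (sd0 i) (spsi i).
  rewrite (charts_Rintegral cc mvg i1) (charts_Rintegral cc mdp i2) -big_split /=.
  apply: eq_bigr => i _; rewrite -(RintegralD mT (i1 i) (i2 i)); apply: Rint_ae.
  have [_ h0] := hv0 0; have [_ h1] := hv0 1.
  apply: ae_onS (ae_onI (hd0 i) (ae_onI (h0 i) (h1 i))) => p Tp [E1 [E2 E3]].
  by rewrite !sum2 E1 E2 E3; field; rewrite gt_eqF// J0.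
split.
  move=> j; exact: (L2_of_pull cc Jb (hv0 j).1 (vv0 j) (fun i => sv0 i j)).
exists d0; split.
- by apply: (L2_of_pull cc Jb (f0 := d0)) => //; exact: ae_onW.
- move=> phi tphi; have [sphi _] := tphi; apply/eqP; rewrite -addr_eq0; apply/eqP.
  have [M M0 hM] := test_bounded tphi.
  have cp : continuous phi by exact: (sphi [::]).1.
  have cdp j : continuous (partial j phi) by exact: (sphi [:: j]).1.
  have mp := continuous_measurable2 cp.
  have mdp j := continuous_measurable2 (cdp j).
  apply: green => //.
  + by move=> i; apply: (sqint_bd (measurable_pull cc i mp)) => p _; exact: (hM _).1.
  + by move=> i j; apply: (sqint_bd (measurable_pull cc i (mdp j))) => p _; exact: (hM _).2.
  (* For smooth phi the weak identity is the integral of the divergence of phi theta, whose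
     components are test functions, so it vanishes. *)
  move=> theta ttheta.
  have th j : test_fun Ocur (fun x => phi x * theta j x) by exact: test_funM.
  have pE j x : partial j (fun x => phi x * theta j x) x =
      phi x * partial j (theta j) x + partial j phi x * theta j x.
    rewrite partialM; first by rewrite [partial j phi x * _]mulrC.
      exact: (sphi [::]).2.
    by have [st _] := ttheta j; exact: (st [::]).2.
  have cq j : continuous (partial j (fun x => phi x * theta j x)).
    by have [st _] := th j; exact: (st [:: j]).1.
  have iq i j : mu.-integrable That (fun p => (partial j (fun x => phi x * theta j x) (F i p) * J i p)%:E).
    apply: (int_pull cc Jb (f := partial j (fun x => phi x * theta j x))).
    have [M' M'0 hM'] := test_bounded (th j).
    apply: (int_bm (M := M')).
      exact: (measurable_pull cc i (continuous_measurable2 (cq j))).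
    by move=> p _; exact: (hM' _).2.
  transitivity (\sum_i \sum_j (\int[mu]_(p in That) (partial j (fun x => phi x * theta j x) (F i p) * J i p))%R).
    apply: eq_bigr => i _; rewrite -(Rint_sum (iq i)); apply: eq_Rintegral => p _.
    by rewrite mulr_suml; apply: eq_bigr => j _; rewrite pE.
  rewrite exchange_big big1// => j _.
  have := charts_Rintegral cc (continuous_measurable2 (cq j)) (iq ^~ j).
  by rewrite (int_partial_test j (th j)) => <-.
- move=> psi gpsi H.
  have [psi0 [g0 [[mpsi mg0] [epsi eg] spsi sg0 weak]]] := weak_pull cc Jb H.
  rewrite /normal_trace -[RHS](green psi0 g0 mpsi mg0 spsi sg0 weak); congr (_ + _).
    apply: Rint_ae; apply: ae_onS (ae_onI (eg 0) (eg 1)) => x _ [e0 e1].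
    by rewrite !sum2 e0 e1.
  by apply: Rint_ae; apply: ae_onS epsi => x _ ->.
Qed.

End Hdiv.

(** * The pressure space *)

Section PressureMean.
Variable R : realType.
Local Notation R2 := (R * R)%type.
Local Notation T2 := (measurableTypeR R * measurableTypeR R)%type.
Local Notation mu := (mu2 R).
Local Notation That := (@That R).

Let mT := @measurable_That R.

(** Positive and negative parts are transported separately, so the identity holds for extended
    integrals without integrability of h. *)
Lemma cov_integral (D : set R2) (F : R2 -> R2) (J : R2 -> R) (h : R2 -> R) : cov D F J ->
  (forall p, D p -> 0 < J p) -> measurable_fun (setT : set T2) (h : T2 -> R) ->
  (\int[mu]_(x in F @` D) (h x)%:E = \int[mu]_(p in D) (h (F p) * J p)%:E)%E.
Proof.
move=> cF J0 mh; rewrite integralE [RHS]integralE.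
have mhE : measurable_fun (setT : set T2) (fun x : T2 => (h x)%:E) by apply/measurable_EFinP.
congr (_ - _)%E.
  rewrite -cF; last by move=> p; exact: funepos_ge0.
    apply: eq_integral => p /set_mem Dp; rewrite !funeposE -!EFin_max -EFinM.
    by rewrite maxr_pMl ?ltW ?J0// mul0r.
  exact: measurable_funepos.
rewrite -cF; last by move=> p; exact: funeneg_ge0.
  apply: eq_integral => p /set_mem Dp; rewrite !funenegE -!EFinN -!EFin_max -EFinM.
  by rewrite maxr_pMl ?ltW ?J0// mul0r mulNr.
exact: measurable_funeneg.
Qed.

Lemma image_ae (I : finType) (U : set R2) F J (ch : charts U F J) (i : I) (P : R2 -> Prop) :
  ae_on That (fun p => P (F i p)) -> ae_on (F i @` That) P.
Proof.
move=> [N [mN N0 h]]; pose M := (chinv F i) @^-1` N.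
have mM : measurable (M : set T2).
  by rewrite -[M]setTI; apply: (measurable_chinv ch i).
have mF : measurable (F i @` That : set T2).
  apply: compact_measurable2; apply: continuous_image_compact; [exact: compact_That|exact: (ch_cont ch)].
exists (M `&` F i @` That); split.
- exact: measurableI.
- apply: (chart_null ch mN N0 mM) => p Tp; by rewrite /M /= (chinvK ch).
- move=> x /= nP; have [Fx|nF] := pselect ((F i @` That) x); last by exfalso; apply: nP.
  split => //; case: Fx => p Tp px; rewrite /M /= -px (chinvK ch i Tp); apply: h => /= hp.
  by apply: nP => _; rewrite -px; exact: hp.
Qed.

Lemma That_measure : (0 < fine (mu That) :> R).
Proof.
rewrite fine_gt0// (mu_That_fin R) andbT lt0e measure_ge0 andbT; apply/eqP => T0.
have [b [s s0 bs]] := @ctK_box R 0.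
have [|y _ []] := @ae_box R That (fun=> False) b s s0 (subset_trans bs (@ctK_That R 0)).
by exists That; split => // p /= /not_implyP[].
Qed.

Variables (I : finType) (E : I -> elem R).
Hypothesis cm : cmesh E.
Local Notation F i := (elF (E i)).
Local Notation A i := (elA (E i)).
Local Notation J i := (elJ (E i)).
Local Notation Otil := (Otil E).

Let ct := charts_til cm.
Let cc := charts_cur cm.
Let Jt := Jb_til cm.

Lemma measure_til i : fine (mu (A i @` That)) = elD (E i) * fine (mu That).
Proof.
have reg := cm_reg cm i; have D0 : 0 < elD (E i) by case: reg.
have m1 : measurable_fun (setT : set T2) (cst 1 : T2 -> R) by [].
have cE (D : set T2) (c : R) : measurable D -> (\int[mu]_(x in D) c%:E = c%:E * mu D)%E.
  by move=> mD; exact: (integral_cst mu mD c%:E).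
have := @cov_integral That (A i) _ (cst 1) (cov_elA reg) (fun _ _ => D0) m1.
rewrite /= cE; last first.
  apply: compact_measurable2; apply: continuous_image_compact; [exact: compact_That|exact: continuous_elA].
rewrite mul1e mul1r cE// => ->; rewrite fineM//.
by apply/fin_numPlt; rewrite (mu_That_fin R) andbT (lt_le_trans _ (measure_ge0 _ _))// ltNyr.
Qed.

Lemma ae_measurable_rep (f : R2 -> R) : L2 That f -> exists r : R2 -> R,
  [/\ measurable_fun (That : set T2) (r : T2 -> R), ae_on That (fun p => f p = r p) & sqint r].
Proof.
move=> [[r mr fr] hf]; exists r; split => //; split => //.
apply: le_lt_trans hf; rewrite le_eqVlt; apply/orP; left; apply/eqP.
by apply: integral_eq_ae; move: fr; rewrite ae_onE; apply: filterS => p hp Tp; rewrite hp.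
Qed.

Lemma integral_cur (q : R2 -> R) i : L2 That (q \o F i) ->
  (\int[mu]_(x in F i @` That) (q x / \det (jac (F i) (pinv That (F i) x))))%R =
  (\int[mu]_(p in That) q (F i p))%R.
Proof.
move=> /ae_measurable_rep[r [mr qr sr]]; have reg := cm_reg cm i.
have J0 p : That p -> 0 < J i p by case: reg => _; exact.
have lV := LipB_elJV reg.
have mf (j : I) : measurable_fun (That : set T2) (fun p : T2 => r p * (J i p)^-1).
  by apply: measurable_funM => //; exact: LipB_measurable.
(* A Borel function on the plane that represents q / det DF on the image of element [i]. Gluing
   takes data on every element; the same [r] is given to all of them, since only element [i] is
   evaluated. *)
have [h0 mh0 h0E] := charts_patch cc mf.
have hE : ae_on (F i @` That) (fun x => q x / \det (jac (F i) (pinv That (F i) x)) = h0 x).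
  apply: (image_ae cc); apply: ae_onS (ae_onI qr (h0E i)) => p Tp [/= -> ->].
  rewrite pinvKV ?inE//; last by move=> x y /set_mem Tx /set_mem Ty; exact: elF_inj.
  by rewrite det_jac_elF.
rewrite (Rint_ae hE) /Rintegral (cov_integral (cov_elF reg) J0 mh0) -/(Rintegral _ _ _).
apply: Rint_ae; apply: ae_onS (ae_onI qr (h0E i)) => p Tp [/= -> ->].
by rewrite divfK// gt_eqF// J0.
Qed.

(** The weight 2 |Ttil| is the affine determinant times the constant 2 |That|. This constant is
    positive, so the weighted sum vanishes together with the mean over the affine domain. *)
Lemma mean_cur (q : R2 -> R) : (forall i, L2 That (q \o F i)) ->
  \sum_i 2 * fine (mu (A i @` That)) *
    (\int[mu]_(x in F i @` That) (q x / \det (jac (F i) (pinv That (F i) x))))%R =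
  2 * fine (mu That) * \sum_i elD (E i) * (\int[mu]_(p in That) q (F i p))%R.
Proof.
move=> Lq; rewrite mulr_sumr; apply: eq_bigr => i _.
by rewrite measure_til integral_cur//; ring.
Qed.

Lemma mean_til (q qt : R2 -> R) : L2 Otil qt ->
  (forall i, ae_on That (fun p => q (F i p) = qt (A i p))) ->
  (\int[mu]_(x in Otil) qt x)%R = \sum_i elD (E i) * (\int[mu]_(p in That) q (F i p))%R.
Proof.
move=> /(L2_rep ct Jt)[qt0 [mq eq sq]] hq; rewrite (Rint_ae eq).
have iq i := int_pull ct Jt (sqint_int (sq i)).
rewrite (charts_Rintegral ct mq iq); apply: eq_bigr => i _.
have e := (charts_ae ct _).1 eq i.
have -> : (\int[mu]_(p in That) q (F i p))%R = (\int[mu]_(p in That) (qt0 \o A i) p)%R.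
  by apply: Rint_ae; apply: ae_onS (ae_onI e (hq i)) => p _ [h1 ->]; exact: h1.
rewrite -(RintegralZl _ mT (sqint_int (sq i))); apply: eq_Rintegral => p _ /=.
by rewrite mulrC.
Qed.

Lemma Qhat_ae (f h : R2 -> R) : ae_on That (fun p => f p = h p) -> Qhat h -> Qhat f.
Proof.
move=> fh [Lh hq]; split.
  have [r [mr hr sr]] := ae_measurable_rep Lh; split.
    by exists r => //; apply: ae_onS (ae_onI fh hr) => p _ [-> ->].
  case: Lh => _; apply: le_lt_trans; rewrite le_eqVlt; apply/orP; left; apply/eqP.
  by apply: integral_eq_ae; move: fh; rewrite ae_onE; apply: filterS => p hp Tp; rewrite hp.
move=> k; have [p pd hp] := hq k; exists p => //.
have sub : @ctK R k `<=` That by move=> y; exact: ctK_That.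
by apply: ae_onS (ae_onI hp (ae_on_sub sub fh)) => y _ [<- ->].
Qed.

Lemma pressure_space (q : R2 -> R) :
  (exists2 qt, L20 Otil qt /\ (forall i, exists2 qh, Qhat qh & ae_on That (fun x => qt (A i x) = qh x)) &
     forall i, ae_on That (fun x => q (F i x) = qt (A i x))) <->
  (forall i, Qhat (q \o F i)) /\
  \sum_i 2 * fine (mu (A i @` That)) *
    (\int[mu]_(x in F i @` That) (q x / \det (jac (F i) (pinv That (F i) x))))%R = 0.
Proof.
split.
  move=> [qt [[Lq mq] hq] uq]; have Qq i : Qhat (q \o F i).
    have [qh Qh hqh] := hq i; apply: Qhat_ae Qh.
    by apply: ae_onS (ae_onI (uq i) hqh) => p _ /= [-> ->].
  split => //; rewrite mean_cur; last by move=> i; case: (Qq i).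
  by rewrite -(mean_til Lq uq) mq mulr0.
move=> [Qq]; have Lq i : L2 That (q \o F i) by case: (Qq i).
rewrite mean_cur// => /eqP; rewrite !mulf_eq0 pnatr_eq0 /= gt_eqF ?That_measure//= => /eqP m0.
(* The preimage under Upsilon is glued along the affine charts from Borel representatives of the
   pullbacks of q. *)
have /choice[r hr] := fun i => ae_measurable_rep (Lq i).
have [qt mqt qtE] := charts_patch ct (fun i => let: And3 h _ _ := hr i in h).
have uq i : ae_on That (fun x => q (F i x) = qt (A i x)).
  by have [_ h _] := hr i; apply: ae_onS (ae_onI h (qtE i)) => p _ /= [-> ->].
have Lqt : L2 Otil qt.
  apply: (L2_of_pull ct Jt mqt); first exact: ae_onW.
  by move=> i; have [_ _ s] := hr i; exact: sqint_ae (measurable_pull ct i mqt) (qtE i) s.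
exists qt => //; split; first by split => //; rewrite (mean_til Lqt uq).
by move=> i; exists (q \o F i) => //; apply: ae_onS (uq i) => p _ /= ->.
Qed.

End PressureMean.

(** * The isoparametric mesh as a curved mesh *)

Section MeshInstance.
Variable R : realType.
Local Notation R2 := (R * R)%type.
Local Notation That := (@That R).

Lemma mesh_cmesh (I : finType) (vtx : I -> 'I_3 -> R2) (G : R2 -> R2) (Om : set R2)
    (C sigma c1 c2 : R) : 0 < c1 -> isoparametric_mesh vtx G Om C sigma c1 c2 ->
  exists E : I -> elem R, [/\ cmesh E, forall i, FT vtx G i = elF (E i),
    forall i, Ftil vtx i = elA (E i), Omega_til vtx = Otil E & Omega_h vtx G = Ocur E].
Proof.
move=> c10 hm; have nd := mesh_nondegenerate hm; have cf := mesh_conforming hm.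
have /choice[E hE] := mesh_elem c10 hm.
have FE i : FT vtx G i = elF (E i) by case: (hE i).
have AE i : Ftil vtx i = elA (E i) by case: (hE i).
have TE i : Ttil vtx i = elA (E i) @` That by rewrite TtilE AE.
have OE : Omega_til vtx = Otil E.
  by rewrite /Omega_til /Otil; congr interior; apply: eq_bigcupr => i _; exact: TE.
exists E; split => //.
- split.
  + by move=> i; case: (hE i).
  + move=> i j p q ij Tp Tq pq; apply: (overlap_null nd cf ij Tp Tq).
    by rewrite !AE.
  + move=> i j p q Tp Tq; rewrite -!FE -!AE /FT /=; apply: (mesh_Gh_inj hm).
      by rewrite TtilE; exists p.
    by rewrite TtilE; exists q.
  + by move=> i; have [_ _ e h] := hE i; rewrite -OE -e.
- rewrite /Omega_h /Ocur; congr interior; apply: eq_bigcupr => i _.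
  by rewrite /Tcur TtilE -FE /FT image_comp.
Qed.

End MeshInstance.

Theorem theorem4p2 (R : realType) (Om : set (R * R)) (hOm : smooth_domain Om)
    (C sigma c1 c2 : R) (hc1 : 0 < c1) :
  exists2 h0 : R, 0 < h0 &
    forall (I : finType) (vtx : I -> 'I_3 -> R * R) (G : R * R -> R * R),
      isoparametric_mesh vtx G Om C sigma c1 c2 ->
      mesh_size vtx <= h0 ->
      (Vh vtx G `<=` H0div (Omega_h vtx G)) /\
      (forall q : R * R -> R,
         Qh vtx G q <->
         (forall i : I, @Qhat R (q \o FT vtx G i)) /\
         \sum_(i : I) 2 * fine (mu2 R (Ttil vtx i)) *
           (\int[mu2 R]_(x in Tcur vtx G i)
              (q x / \det (jac (FT vtx G i) (FT_inv vtx G i x))))%R = 0).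
Proof.
exists 1 => // I vtx G hm _; have [E [cm FE AE OE OcE]] := mesh_cmesh hc1 hm.
have TE i : Ttil vtx i = elA (E i) @` @That R by rewrite TtilE AE.
have CE i : Tcur vtx G i = elF (E i) @` @That R by rewrite /Tcur TtilE -FE /FT image_comp.
split.
  move=> v [vt [vt0 vtV] rel]; rewrite OcE.
  have /choice[g /choice[V /choice[cg /choice[cV H]]]] : forall i, exists g V cg cV,
      [/\ forall j : 'I_2, pwq (g j) (cg j), forall j : 'I_2, pwq (V j) (cV j),
      forall j, ae_on (@That R) (fun p => cmp j (vt (elA (E i) p)) = g j p),
      forall j, ae_on (@That R) (fun p => cmp j (v (elF (E i) p)) = piola (E i) V j p) &
      forall j a, @Nhat R a -> g j a = piola (E i) V j a].
    move=> i; have [vV nodes] := rel i.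
    apply: element_rep; first exact: (cm_reg cm i).
    - by have [vh hv h] := vtV i; exists vh => //; move: h; rewrite AE.
    - by have [vh hv h] := vV; exists vh => //; move: h; rewrite /AT FE.
    - by move=> a /nodes[y]; rewrite AE FE; exists y.
  apply: (Hdiv_inclusion cm (vt := vt) (g := g) (V := V) (cg := cg) (cV := cV)).
  - by move=> j; rewrite -OE.
  - by move=> i; case: (H i).
  - by move=> i; case: (H i).
  - by move=> i; case: (H i).
  - by move=> i; case: (H i).
  - by move=> i; case: (H i).
move=> q; apply: iff_trans (iff_trans (pressure_space cm q) _).
  rewrite /Qh /Qh_til /Q_til /Upsilon_rel /= OE.
  by split=> -[qt [Lq hq] uq]; exists qt => [|i]; [split => // i; have := hq i; rewrite AE|have := uq i; rewrite FE AE
    |split => // i; have := hq i; rewrite AE|have := uq i; rewrite FE AE].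
have e i : 2 * fine (mu2 R (Ttil vtx i)) * (\int[mu2 R]_(x in Tcur vtx G i)
              (q x / \det (jac (FT vtx G i) (FT_inv vtx G i x))))%R =
   2 * fine (mu2 R (elA (E i) @` @That R)) * (\int[mu2 R]_(x in elF (E i) @` @That R)
     (q x / \det (jac (elF (E i)) (pinv (@That R) (elF (E i)) x))))%R.
  by rewrite /FT_inv TE CE FE.
by split=> -[h1 h2]; (split=> [i|]; [have := h1 i; rewrite FE|
  rewrite -[RHS]h2; apply: eq_bigr => i _; rewrite e]).
Qed.
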